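(* Let $\mu=\int_0^\infty\mu_m\,d\rho(m)$ be a Lorentz invariant Radon measure on the closed forward light cone $\overline{V_+}\subseteq\mathbb{R}^d$ with $\mu(\{0\})=0$, and let $\mathcal{E}=L^2(X,\zeta)$, the representation $\pi$ of $\mathbb{R}^d$ on $\mathcal{E}$, the involution $\theta$, and the projected measure $\nu$ on $\mathbb{R}^d$ be as defined in the context. If $\nu$ is tempered, then the constant function $1\in\mathcal{E}^{-\infty}$ is a reflection positive distribution vector for the action $\pi$ of $\mathbb{R}^d$. Accordingly, one obtains a reflection positive representation of $\mathbb{R}^d$ on the closed subspace $\mathcal{F}\subseteq\mathcal{E}$ generated by $\pi^{-\infty}(C_c^\infty(\mathbb{R}^d))1$. The corresponding reflection positive distribution $\widehat\nu$ on $\mathbb{R}^d$ is rotation invariant, so that $\mathcal{F}$ carries a reflection positive representation of the euclidean motion group $\mathrm{Mot}(\mathbb{R}^d)=\mathbb{R}^d\rtimes \mathrm{O}_d(\mathbb{R})$ for which $\mathcal{F}_0$ and $\mathcal{F}_+$ are invariant under $H:=\mathbb{R}^{d-1}\rtimes\mathrm{O}_{d-1}(\mathbb{R})\subseteq\mathrm{Mot}(\mathbb{R}^d)^\tau$. Moreover, $\widehat{\mathcal{F}}\cong L^2(\overline{V_+},\mu)$ by a unitary isomorphism for which $q:\mathcal{F}_+\to\widehat{\mathcal{F}}$ is $H$-equivariant (where $H$ acts on $L^2(\overline{V_+},\mu)$ by restriction of $\pi^c$) and, for $t>0$, $\widehat{\pi(t,0)}$ is the operator $(C_tf)(p)=e^{-tp_0}f(p)$,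 i.e., the analytic continuation of the time translations $\pi^c((t,\mathbf{0}),\mathbf{1})$ in the natural representation $\pi^c$ of the Poincaré group $\mathbb{R}^d\rtimes L^\uparrow$ on $\widehat{\mathcal{F}}\cong L^2(\overline{V_+},\mu)$.
   Context: Write $p=(p_0,\mathbf{p})\in\mathbb{R}\times\mathbb{R}^{d-1}$, $xp=x_0p_0+\mathbf{x}\mathbf{p}$ (euclidean scalar product), $p^2=xp|_{x=p}$, $\mathbb{R}^d_+=\{x:x_0>0\}$, $\overline{V_+}=\{p:p_0\ge0,\ p_0^2-\mathbf{p}^2\ge0\}$, and $L^\uparrow=\{g\in\mathrm{O}_{1,d-1}(\mathbb{R}):g_{00}>0\}$. For $m\ge0$ ($m>0$ if $d=1$), $\mu_m$ is the measure on $\{p:p_0^2-\mathbf{p}^2=m^2,\ p_0>0\}$ with $\int f\,d\mu_m=\int_{\mathbb{R}^{d-1}}f(\sqrt{m^2+\mathbf{p}^2},\mathbf{p})\frac{d\mathbf{p}}{\sqrt{m^2+\mathbf{p}^2}}$ (for $d=1$, $\mu_m=\frac1m\delta_m$). $\rho$ is a Borel measure on $[0,\infty[$ (with $\rho(\{0\})=0$ for $d=1$). The natural representation $\pi^c$ of the Poincaré group on $L^2(\overline{V_+},\mu)$ is $(\pi^c(x,g)f)(p)=e^{-ixp}f(g^{-1}p)$ (with $g\in L^\uparrow$ acting on the translation part $\mathbb{R}^d$ by the contragredient action with respect to the pairing $xp$). Let $X=\mathbb{R}\times\overline{V_+}$, $d\zeta(x,p)=\frac1\pi\frac{p_0}{p_0^2+x^2}\,dx\,d\mu(p)$,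 $\mathcal{E}=L^2(X,\zeta)$, $(\theta f)(t,p)=f(-t,p)$, and let $\pi$ be the unitary representation of $\mathbb{R}^d$ on $\mathcal{E}$ given by $(\pi(x_0,\mathbf{x})f)(t,p_0,\mathbf{p})=e^{-i(x_0t+\mathbf{x}\mathbf{p})}f(t,p_0,\mathbf{p})$. Let $\nu$ be the image of $\zeta$ under $(t,p_0,\mathbf{p})\mapsto(t,\mathbf{p})$; it has density $\Theta(p)=\frac1\pi\int_0^\infty\frac{1}{m^2+p^2}\,d\rho(m)$ on $\mathbb{R}^d$. A measure on $\mathbb{R}^d$ is tempered if $(1+\|x\|^2)^{-N}$ is integrable for some $N\in\mathbb{N}$. $\widehat\nu$ denotes the Fourier transform of $\nu$ as a tempered distribution. $\mathcal{E}^{-\infty}$ is the space of distribution vectors, i.e. continuous antilinear functionals on the Fréchet space $\mathcal{E}^\infty$ of smooth vectors for $\pi$; a measurable function $h$ on $X$ defines one by $f\mapsto\int h\overline f\,d\zeta$ when this is defined and continuous on $\mathcal{E}^\infty$. For $\phi\in C_c^\infty(\mathbb{R}^d)$, $\pi^{-\infty}(\phi)1=\int\phi(x)\pi^{-\infty}(x)1\,dx$, which is the function $(t,p_0,\mathbf{p})\mapsto\int\phi(x)e^{-i(x_0t+\mathbf{x}\mathbf{p})}dx$. $\mathcal{F}_+$ is the closed subspace generated by $\pi^{-\infty}(C_c^\infty(\mathbb{R}^d_+))1$, and $\mathcal{F}_0=\{v\in\mathcal{F}_+:\theta v=v\}$. That $1$ is a reflection positive distribution vector means that it is a $\theta$-invariant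 distribution vector and $\langle\theta v,v\rangle\ge0$ for $v\in\mathcal{F}_+$; correspondingly $\widehat\nu$ is reflection positive: it is positive definite, invariant under $(x_0,\mathbf{x})\mapsto(-x_0,\mathbf{x})$, and its twist by this reflection is positive on $C_c^\infty(\mathbb{R}_+^d)$. $\mathcal{F}$ is identified with $L^2(\mathbb{R}^d,\nu)$ (functions independent of $p_0$), on which $\mathrm{Mot}(\mathbb{R}^d)$ acts by $(\pi(x,g)f)(p)=e^{-ixp}f(g^{-1}p)$. $\tau$ is the involution of $\mathrm{Mot}(\mathbb{R}^d)$ induced by conjugation with the reflection $(x_0,\mathbf{x})\mapsto(-x_0,\mathbf{x})$; $\mathfrak{q}$ is the $-1$-eigenspace of $\tau$ in the Lie algebra. A unitary representation $\pi$ of a Lie group $G$ with involution $\tau$ and open subgroup $H\subseteq G^\tau$ is reflection positive on $(\mathcal{F},\mathcal{F}_+,\theta)$ (with $\mathcal{F}_+$ closed and $\langle\theta v,v\rangle\ge0$ on $\mathcal{F}_+$) if $\pi(\tau(g))=\theta\pi(g)\theta$ for $g\in G$, $\pi(h)\mathcal{F}_+=\mathcal{F}_+$ for $h\in H$, and there is a subspace $\mathcal{D}$ of smooth vectors in $\mathcal{F}_+$, dense in $\mathcal{F}_+$, with $\mathtt{d}\pi(x)\mathcal{D}\subseteq\mathcal{D}$ for $x\in\mathfrak{q}$. For $\mathbb{R}^d$ one takes $H=\{0\}\times\mathbb{R}^{d-1}$. $\widehat{\mathcal{F}}$ is the Hilbert completion of $\mathcal{F}_+/\{v\in\mathcal{F}_+:\langle\theta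 v,v\rangle=0\}$ with respect to $\sqrt{\langle\theta v,v\rangle}$, $q:\mathcal{F}_+\to\widehat{\mathcal{F}}$, $v\mapsto\widehat v$, the canonical map, and $\widehat T\widehat v=\widehat{Tv}$ for operators $T$ on $\mathcal{F}_+$ that pass to $\widehat{\mathcal{F}}$. *)

(* Defs.v *)
From HB Require Import structures.
From mathcomp Require Import all_boot all_order all_algebra complex.
From mathcomp Require Import all_classical all_reals all_analysis.
From mathcomp Require Import measurable_realfun.

Set Implicit Arguments.
Unset Strict Implicit.
Unset Printing Implicit Defensive.

Import Order.TTheory GRing.Theory Num.Theory numFieldNormedType.Exports.

Local Open Scope classical_set_scope.
Local Open Scope complex_scope.
Local Open Scope ring_scope.

Definition cV_display : measure_display. Proof. exact. Qed.

(* The Borel sigma-algebra of 'cV[R]_d is generated by the coordinates. *)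
Section measurable_cV.
Variables (R : realType) (d : nat).

Definition cV_measurable : set (set 'cV[R]_d) :=
  g_sigma_preimage (fun (i : 'I_d) (x : 'cV[R]_d) => x i 0).

Let cV_set0 : cV_measurable set0.
Proof. exact: sigma_algebra0. Qed.

Let cV_setC A : cV_measurable A -> cV_measurable (~` A).
Proof. exact: sigma_algebraC. Qed.

Let cV_bigcup (F : (set 'cV[R]_d)^nat) :
  (forall i, cV_measurable (F i)) -> cV_measurable (\bigcup_i (F i)).
Proof. exact: sigma_algebra_bigcup. Qed.

HB.instance Definition _ := @isMeasurable.Build cV_display
  'cV[R]_d cV_measurable cV_set0 cV_setC cV_bigcup.

End measurable_cV.

Lemma measurable_coord (R : realType) d (i : 'I_d) :
  measurable_fun [set: 'cV[R]_d] (fun x => x i 0).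
Proof.
move=> _ Y mY; rewrite setTI; apply: sub_sigma_algebra => /=.
rewrite -bigcup_seq/=; exists i => /=; first by rewrite mem_index_enum.
by exists Y => //; rewrite setTI.
Qed.

Lemma measurable_cVP (R : realType) d dT (T : measurableType dT)
    (f : T -> 'cV[R]_d) :
  (forall i, measurable_fun [set: T] (fun t => f t i 0)) ->
  measurable_fun [set: T] f.
Proof.
move=> mf _ A mA; rewrite setTI; move: A mA.
suff : (cV_measurable (R := R) (d := d)) `<=`
    [set A | measurable (f @^-1` A)] by exact.
apply: smallest_sub.
  split => [|A mA|F mF] /=.
  - by rewrite preimage_set0.
  - by rewrite setTD; exact: measurableC mA.
  - by rewrite preimage_bigcup; apply: bigcup_measurable => i _; exact: mF.
rewrite -bigcup_seq/= => A [i _ [B mB <-]] /=.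
by rewrite setTI -[X in measurable X]setTI; exact: mf.
Qed.

(* The point (x0, x) of R x R^n, as a vector of R^{1+n}. *)
Definition pt (R : realType) n (x0 : R) (x : 'cV[R]_n) : 'cV[R]_n.+1 :=
  col_mx (x0%:M : 'cV[R]_1) x.

Definition vecpart (R : realType) n (p : 'cV[R]_n.+1) : 'cV[R]_n :=
  @dsubmx _ 1 n 1 p.

Lemma pt_time (R : realType) n (x0 : R) (x : 'cV[R]_n) (j : 'I_1) :
  pt x0 x (lshift n j) 0 = x0.
Proof.
by apply: etrans (col_mxEu (x0%:M : 'cV[R]_1) x j 0) _; rewrite mxE !ord1 eqxx.
Qed.

Lemma pt_space (R : realType) n (x0 : R) (x : 'cV[R]_n) (j : 'I_n) :
  pt x0 x (rshift 1 j) 0 = x j 0.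
Proof. exact: (col_mxEd (x0%:M : 'cV[R]_1) x j 0). Qed.

Lemma measurable_pt (R : realType) n d (T : measurableType d)
    (f : T -> R) (g : T -> 'cV[R]_n) :
  measurable_fun [set: T] f -> measurable_fun [set: T] g ->
  measurable_fun [set: T] (fun t => pt (f t) (g t)).
Proof.
move=> mf mg; apply: measurable_cVP => i.
have [j ->|j ->] := split_ordP (i : 'I_(1 + n)).
  rewrite [X in measurable_fun _ X](_ : _ = f) //.
  by apply/funext => t; exact: pt_time.
rewrite [X in measurable_fun _ X](_ : _ = (fun x => x j 0) \o g).
  exact: measurableT_comp (measurable_coord j) mg.
by apply/funext => t; exact: pt_space.
Qed.

Lemma measurable_vecpart (R : realType) n :
  measurable_fun [set: 'cV[R]_n.+1] (@vecpart R n).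
Proof.
apply: measurable_cVP => i.
rewrite [X in measurable_fun _ X](_ : _ = fun p : 'cV[R]_n.+1 => p (rshift 1 i) 0).
  exact: (measurable_coord (rshift 1 i : 'I_n.+1)).
by apply/funext => p; rewrite mxE.
Qed.

Section lebesgue_cV.
Variable R : realType.

Section cons.
Variables (n : nat) (m : {sigma_finite_measure set 'cV[R]_n -> \bar R}).

Definition leb_cons : set 'cV[R]_n.+1 -> \bar R :=
  pushforward (@lebesgue_measure R \x m)%E (fun x => pt x.1 x.2).

Let mpt : measurable_fun [set: (measurableTypeR R * 'cV[R]_n)] (fun x => pt x.1 x.2).
Proof. exact: measurable_pt. Qed.

Let leb_cons0 : leb_cons set0 = 0%E.
Proof. exact: measure0. Qed.

Let leb_cons_ge0 A : (0 <= leb_cons A)%E.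
Proof. exact: measure_ge0. Qed.

Let leb_cons_sigma_additive : semi_sigma_additive leb_cons.
Proof. exact: measure_semi_sigma_additive. Qed.

HB.instance Definition _ := isMeasure.Build _ _ _ leb_cons
  leb_cons0 leb_cons_ge0 leb_cons_sigma_additive.

Let leb_cons_sigma_finite : sigma_finite setT leb_cons.
Proof.
pose s (p : 'cV[R]_n.+1) : R * 'cV[R]_n := (p ord0 0, vecpart p).
have ms : measurable_fun setT s.
  apply/measurable_fun_pair; first exact: measurable_coord.
  exact: measurable_vecpart.
have sK x : s (pt x.1 x.2) = x.
  case: x => a v; rewrite /s; congr pair; last exact: col_mxKd.
  by rewrite (_ : ord0 = lshift n (ord0 : 'I_1)) ?pt_time //; exact/val_inj.
have /sigma_finiteP[F [TF ndF Foo]] := sigma_finiteT (@lebesgue_measure R).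
have /sigma_finiteP[G [TG ndG Goo]] := sigma_finiteT m.
exists (fun k => s @^-1` (F k `*` G k)).
  rewrite -preimage_bigcup [X in s @^-1` X](_ : _ = setT) ?preimage_setT //.
  apply/seteqP; split => // -[a v] _.
  have [i _ Fa] : (\bigcup_i F i) a by rewrite -TF.
  have [j _ Gv] : (\bigcup_i G i) v by rewrite -TG.
  exists (maxn i j) => //; split => /=.
    by move: a Fa; exact/subsetPset/ndF/leq_maxl.
  by move: v Gv; exact/subsetPset/ndG/leq_maxr.
move=> k; have [mFk Fk] := Foo k; have [mGk Gk] := Goo k.
have mFG : measurable (F k `*` G k) by exact: measurableX.
split; first by rewrite -[X in measurable X]setTI; exact: ms.
rewrite /leb_cons /pushforward -comp_preimage.
rewrite (_ : s \o _ = id) ?preimage_id; last by apply/funext => x; exact: sK.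
by rewrite product_measure1E// lte_mul_pinfty// ge0_fin_numE.
Qed.

HB.instance Definition _ :=
  Measure_isSigmaFinite.Build _ _ _ leb_cons leb_cons_sigma_finite.

Definition leb_consM : {sigma_finite_measure set 'cV[R]_n.+1 -> \bar R} :=
  leb_cons.

End cons.

Fixpoint leb (d : nat) : {sigma_finite_measure set 'cV[R]_d -> \bar R} :=
  match d with
  | 0 => (\d_ (0 : 'cV[R]_0) : {finite_measure set 'cV[R]_0 -> \bar R})
  | d'.+1 => leb_consM (leb d')
  end.

End lebesgue_cV.

Section mixture.
Local Open Scope ereal_scope.
Context d1 d2 d3 (T1 : measurableType d1) (T2 : measurableType d2)
  (T3 : measurableType d3) (R : realType).
Variables (m1 : {measure set T1 -> \bar R})
  (m2 : {sigma_finite_measure set T2 -> \bar R}) (D : set T1)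
  (w : T1 * T2 -> R) (phi : T1 * T2 -> T3).
Hypothesis mD : measurable D.
Hypothesis mw : measurable_fun [set: T1 * T2] w.
Hypothesis w0 : forall x, D x.1 -> (0 <= w x)%R.
Hypothesis mphi : measurable_fun [set: T1 * T2] phi.

Definition mixture (A : set T3) : \bar R :=
  \int[m1]_(x in D) \int[m2]_y (w (x, y) * \1_A (phi (x, y)))%:E.

Let mixture0 : mixture set0 = 0.
Proof.
rewrite /mixture integral0_eq// => x _; rewrite integral0_eq// => y _.
by rewrite indic0 mulr0.
Qed.

Let mixture_ge0 A : 0 <= mixture A.
Proof.
apply: integral_ge0 => x Dx; apply: integral_ge0 => y _.
by rewrite lee_fin mulr_ge0// w0.
Qed.

Let wF A (x : T1 * T2) : \bar R := (Num.max (w x) 0 * \1_A (phi x))%:E.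

Let mF A : measurable A -> measurable_fun [set: T1 * T2] (wF A).
Proof.
move=> mA; apply/measurable_EFinP; apply: measurable_funM.
  exact: measurable_funrpos mw.
by apply: measurableT_comp => //; exact: measurable_indic.
Qed.

Let maxw x y : D x -> Num.max (w (x, y)) 0%R = w (x, y).
Proof. by move=> Dx; apply/max_idPl/w0. Qed.

Let mG A : measurable A -> measurable_fun D
  (fun x => \int[m2]_y (w (x, y) * \1_A (phi (x, y)))%:E).
Proof.
move=> mA.
apply: (eq_measurable_fun (fubini_F m2 (wF A))).
  move=> x; rewrite inE => Dx.
  by apply: eq_integral => y _; rewrite /wF maxw.
apply: measurable_funTS; apply: measurable_fun_fubini_tonelli_F; first exact: mF.
by move=> x; rewrite lee_fin mulr_ge0// le_max lexx orbT.
Qed.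

Let mixture_sigma_additive : semi_sigma_additive mixture.
Proof.
move=> F mFF tF mUF.
rewrite [X in _ --> X](_ : _ = \sum_(n <oo) mixture (F n)).
  apply/cvg_closeP; split; last by rewrite closeE.
  by apply: is_cvg_nneseries => n _ _; exact: mixture_ge0.
rewrite -integral_nneseries//; last 2 first.
- by move=> n; exact: mG.
- move=> n x Dx; apply: integral_ge0 => y _.
  by rewrite lee_fin mulr_ge0// w0.
apply: eq_integral => x; rewrite inE => Dx.
rewrite -integral_nneseries//; last 2 first.
- move=> n.
  rewrite [X in measurable_fun _ X](_ : _ = wF (F n) \o pair x).
    by apply: measurableT_comp; [exact: mF|exact: pair1_measurable].
  by apply/funext => y; rewrite /wF /= maxw.
- by move=> n y _; rewrite lee_fin mulr_ge0// w0.
apply: eq_integral => y _.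
by rewrite EFinM indic_bigcup// -nneseriesZl.
Qed.

HB.instance Definition _ := isMeasure.Build _ _ _ mixture
  mixture0 mixture_ge0 mixture_sigma_additive.

Definition mixtureM : {measure set T3 -> \bar R} := mixture.

End mixture.

Definition dot (R : realType) d (x p : 'cV[R]_d) : R :=
  \sum_(i < d) x i 0 * p i 0.

Lemma measurable_dot (R : realType) d :
  measurable_fun [set: 'cV[R]_d] (fun p => dot p p).
Proof.
by apply: measurable_sum => i; apply: measurable_funM; exact: measurable_coord.
Qed.

Lemma measurable_inv (R : realType) :
  measurable_fun [set: R] (@GRing.inv R).
Proof.
rewrite -(setvU [set (0 : R)]); apply/measurable_funU => //; first exact: measurableC.
split; last exact: measurable_fun_set1.
apply: open_continuous_measurable_fun.
  by rewrite openC; exact: closed_eq.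
by move=> x; rewrite inE => /eqP x0; exact: inv_continuous.
Qed.

Section measures.
Variables (R : realType) (n : nat).
Local Notation Rd := 'cV[R]_n.+1.

Definition omega (x : R * 'cV[R]_n) : R := Num.sqrt (x.1 ^+ 2 + dot x.2 x.2).

Let measurable_omega : measurable_fun [set: R * 'cV[R]_n] omega.
Proof.
apply: (measurableT_comp (continuous_measurable_fun (@sqrt_continuous R))).
apply: measurable_funD.
  exact: measurable_funX.
exact: measurableT_comp (@measurable_dot R n) measurable_snd.
Qed.

Let measurable_omegaV :
  measurable_fun [set: R * 'cV[R]_n] (fun x => (omega x)^-1).
Proof. exact: measurableT_comp (@measurable_inv R) measurable_omega. Qed.

Let omegaV_ge0 (x : R * 'cV[R]_n) : [set` `[0, +oo[] x.1 -> 0 <= (omega x)^-1.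
Proof. by rewrite invr_ge0 sqrtr_ge0. Qed.

Let measurable_shell :
  measurable_fun [set: R * 'cV[R]_n] (fun x => pt (omega x) x.2).
Proof. exact: measurable_pt. Qed.

(* mu = \int_0^oo mu_m d rho(m), where mu_m is the image of the measure
   dp / sqrt (m^2 + p^2) on R^n under p |-> (sqrt (m^2 + p^2), p). *)
Definition mu (rho : {measure set R -> \bar R}) : {measure set Rd -> \bar R} :=
  mixtureM rho (leb R n) (measurable_itv `[0, +oo[)
    measurable_omegaV omegaV_ge0 measurable_shell.

Definition cone : set Rd :=
  [set p : Rd | 0 <= p 0 0 /\ 0 <= p 0 0 ^+ 2 - dot (vecpart p) (vecpart p)].

Let measurable_cone : measurable cone.
Proof.
rewrite (_ : cone = (fun p : Rd => p 0 0) @^-1` `[0, +oo[ `&`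
    (fun p : Rd => p 0 0 ^+ 2 - dot (vecpart p) (vecpart p)) @^-1` `[0, +oo[).
  have m0 : measurable_fun [set: Rd] (fun p => p 0 0).
    exact: measurable_coord.
  apply: measurableI; rewrite -[X in measurable X]setTI.
    exact: m0.
  suff mf : measurable_fun [set: Rd]
    (fun p => p 0 0 ^+ 2 - dot (vecpart p) (vecpart p)) by exact: mf.
  apply: measurable_funB; first exact: measurable_funX.
  exact: measurableT_comp (@measurable_dot R n) (@measurable_vecpart R n).
by apply/seteqP; split => p /=; rewrite !in_itv /= !andbT.
Qed.

(* The density of zeta at (p, x) with respect to dmu(p) dx. *)
Definition cauchy_density (y : Rd * R) : R :=
  pi^-1 * (y.1 0 0 / (y.1 0 0 ^+ 2 + y.2 ^+ 2)).

Let measurable_cauchy : measurable_fun [set: Rd * R] cauchy_density.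
Proof.
have m0 : measurable_fun [set: Rd * R] (fun y => y.1 0 0).
  exact: measurableT_comp (@measurable_coord R n.+1 0) measurable_fst.
apply: measurable_funM => //; apply: measurable_funM => //.
apply: measurableT_comp (@measurable_inv R) _.
by apply: measurable_funD; exact: measurable_funX.
Qed.

Let cauchy_ge0 (y : Rd * R) : cone y.1 -> 0 <= cauchy_density y.
Proof.
move=> [p0 _]; apply: mulr_ge0; first by rewrite invr_ge0 pi_ge0.
by apply: divr_ge0 => //; rewrite addr_ge0 // sqr_ge0.
Qed.

Let measurable_swap_cone :
  measurable_fun [set: Rd * R] (fun y => (y.2, y.1) : R * Rd).
Proof. exact: measurable_swap. Qed.

Definition zeta (rho : {measure set R -> \bar R}) :
    {measure set (R * Rd)%type -> \bar R} :=
  mixtureM (mu rho) (@lebesgue_measure R) measurable_cone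
    measurable_cauchy cauchy_ge0 measurable_swap_cone.

(* (t, p0, p) |-> (t, p) *)
Definition proj_p0 (z : R * Rd) : Rd := pt z.1 (vecpart z.2).

Let measurable_proj_p0 : measurable_fun [set: R * Rd] proj_p0.
Proof.
apply: measurable_pt => //.
exact: measurableT_comp (@measurable_vecpart R n) measurable_snd.
Qed.

Section nu.
Variable rho : {measure set R -> \bar R}.

Definition nu_fun : set Rd -> \bar R := pushforward (zeta rho) proj_p0.

Let nu0 : nu_fun set0 = 0%E.
Proof. exact: measure0. Qed.

Let nu_ge0 A : (0 <= nu_fun A)%E.
Proof. exact: measure_ge0. Qed.

Let nu_sigma_additive : semi_sigma_additive nu_fun.
Proof. exact: measure_semi_sigma_additive. Qed.

HB.instance Definition _ := isMeasure.Build _ _ _ nu_fun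
  nu0 nu_ge0 nu_sigma_additive.

Definition nu : {measure set Rd -> \bar R} := nu_fun.

End nu.

End measures.

Definition expi (R : realType) (a : R) : R[i] := cos a +i* sin a.

Section complex_integral.
Context d (T : measurableType d) (R : realType).
Variable m : {measure set T -> \bar R}.

Definition cmeasurable (f : T -> R[i]) : Prop :=
  measurable_fun setT (fun x => complex.Re (f x)) /\
  measurable_fun setT (fun x => complex.Im (f x)).

Definition cintegrable (f : T -> R[i]) : Prop :=
  m.-integrable setT (fun x => (complex.Re (f x))%:E) /\
  m.-integrable setT (fun x => (complex.Im (f x))%:E).

Definition cintegral (f : T -> R[i]) : R[i] :=
  Rintegral m setT (fun x => complex.Re (f x)) +i*
  Rintegral m setT (fun x => complex.Im (f x)).

End complex_integral.

(* A Hilbert space is represented by a subspace [hdom] of a complex vector space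
   with a positive semidefinite hermitian form; its vectors are the elements of
   [hdom] up to null vectors (e.g. square integrable functions up to equality
   almost everywhere). *)

Section hilbert.
Variable R : realType.
Local Notation C := R[i].

Record hspace (V : lmodType C) := HSpace {
  hdom : set V;
  hform : V -> V -> C (* linear in the first argument *)
}.

Section theory.
Variables (V : lmodType C) (H : hspace V).

Definition hnorm (v : V) : R := Num.sqrt (complex.Re (hform H v v)).

Definition heq (u v : V) : Prop := hnorm (u - v) = 0.

Definition linear_subspace (S : set V) : Prop :=
  S 0 /\ forall (a : C) u v, S u -> S v -> S (a *: u + v).

Definition closed_subspace (S : set V) : Prop :=
  [/\ S `<=` hdom H, linear_subspace S &
      forall v, hdom H v ->
        (forall e, 0 < e -> exists2 w, S w & hnorm (v - w) < e) -> S v].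

Definition closed_span (A : set V) : set V :=
  [set v | hdom H v /\ forall S, closed_subspace S -> A `<=` S -> S v].

Definition dense_in (S A : set V) : Prop :=
  A `<=` S /\
  forall v, S v -> forall e, 0 < e -> exists2 w, A w & hnorm (v - w) < e.

Definition hrestr (S : set V) : hspace V := HSpace S (hform H).

End theory.

Section operators.
Variables (V : lmodType C) (H : hspace V) (W : lmodType C) (K : hspace W).

Definition hlinear (U : V -> W) : Prop :=
  (forall v, hdom H v -> hdom K (U v)) /\
  forall (a : C) u v, hdom H u -> hdom H v ->
    heq K (U (a *: u + v)) (a *: U u + U v).

Definition unitary (U : V -> W) : Prop :=
  [/\ hlinear U,
      forall u v, hdom H u -> hdom H v -> hform K (U u) (U v) = hform H u v &
      forall w, hdom K w -> exists2 v, hdom H v & heq K (U v) w].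

End operators.

Definition bounded_op (V : lmodType C) (H : hspace V) (T : V -> V) : Prop :=
  hlinear H H T /\
  exists M : R, forall v, hdom H v -> hnorm H (T v) <= M * hnorm H v.

Definition unitary_involution (V : lmodType C) (H : hspace V)
    (theta : V -> V) : Prop :=
  unitary H H theta /\ forall v, hdom H v -> heq H (theta (theta v)) v.

(* The completion of [hdom H] modulo null vectors: Cauchy sequences, with the
   limit form (sequences with null difference represent the same vector). *)
Section completion.
Variables (V : lmodType C) (H : hspace V).

Definition cauchy_seqs : set (nat -> V) :=
  [set v | (forall k, hdom H (v k)) /\
    forall e, 0 < e -> exists N, forall j k, (N <= j)%N -> (N <= k)%N ->
      hnorm H (v j - v k) < e].

Definition completion : hspace (nat -> V) := HSpace cauchy_seqs
  (fun u v => lim ((fun k => complex.Re (hform H (u k) (v k))) @ \oo) +i*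
              lim ((fun k => complex.Im (hform H (u k) (v k))) @ \oo)).

End completion.

(* T extends the family Ut (t real) to the closed lower half plane,
   holomorphically in the interior, with boundary values Ut on the real line
   and Ct at - i t for t > 0. *)
Definition analytic_continuation (V : lmodType C) (H : hspace V)
    (Ut Ct : R -> V -> V) : Prop :=
  exists T : C -> V -> V,
  [/\ forall z, complex.Im z <= 0 -> bounded_op H (T z),
      forall t v, hdom H v -> heq H (T (t +i* 0) v) (Ut t v),
      forall t v, 0 < t -> hdom H v -> heq H (T (0 -i* t) v) (Ct t v),
      forall z v, complex.Im z <= 0 -> hdom H v -> forall e, 0 < e ->
        exists2 r : R, 0 < r & forall z', complex.Im z' <= 0 ->
          complex.Re `|z' - z| < r -> hnorm H (T z' v - T z v) < e &
      forall z v, complex.Im z < 0 -> hdom H v -> exists2 D, hdom H D &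
        forall e, 0 < e -> exists2 r : R, 0 < r & forall z', z' != z ->
          complex.Re `|z' - z| < r ->
          hnorm H ((z' - z)^-1 *: (T z' v - T z v) - D) < e].

(* A group realized inside a topological space on which the multiplication is
   defined everywhere, e.g. a matrix group. *)
Record group := Group {
  gsort :> topologicalType;
  gset : set gsort;
  gmul : gsort -> gsort -> gsort;
  gone : gsort;
  gset1 : gset gone;
  gsetM : forall g h, gset g -> gset h -> gset (gmul g h);
  gmulA : forall f g h, gmul f (gmul g h) = gmul (gmul f g) h;
  gmul1g : forall g, gmul gone g = g;
  gmulg1 : forall g, gmul g gone = g;
  gmulV : forall g, gset g ->
    exists h, [/\ gset h, gmul h g = gone & gmul g h = gone]
}.

Section representations.
Variables (G : group) (V : lmodType C) (H : hspace V) (rep : G -> V -> V).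

Definition unitary_rep : Prop :=
  [/\ forall g, gset g -> unitary H H (rep g),
      forall v, hdom H v -> heq H (rep (gone G) v) v,
      forall g h v, gset g -> gset h -> hdom H v ->
        heq H (rep (gmul g h) v) (rep g (rep h v)) &
      forall v, hdom H v -> forall g, gset g -> forall e, 0 < e ->
        \forall g' \near g, gset g' -> hnorm H (rep g' v - rep g v) < e].

(* The Lie algebra of G, as the set of its one-parameter subgroups. *)
Definition one_param (c : R -> G) : Prop :=
  [/\ continuous c, forall t, gset (c t) &
      forall s t, c (s + t) = gmul (c s) (c t)].

Definition lie_derivative (c : R -> G) (F : G -> V) (g : G) (w : V) : Prop :=
  hnorm H ((h^-1)%:C *: (F (gmul g (c h)) - F g) - w) @[h --> 0^'] --> (0 : R).

(* F : G -> H is of class C^k: the iterated derivatives of order <= k along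
   left invariant vector fields exist and are continuous. *)
Fixpoint Ck (k : nat) (F : G -> V) : Prop :=
  [/\ forall g, gset g -> hdom H (F g),
      forall g, gset g -> forall e, 0 < e ->
        \forall g' \near g, gset g' -> hnorm H (F g' - F g) < e &
      if k is k'.+1 then
        forall c, one_param c -> exists2 F' : G -> V,
          (forall g, gset g -> lie_derivative c F g (F' g)) & Ck k' F'
      else True].

Definition smooth_vec : set V :=
  [set v | hdom H v /\ forall k, Ck k (fun g => rep g v)].

(* w = d rep (c) v *)
Definition drep (c : R -> G) (v w : V) : Prop :=
  hdom H w /\ lie_derivative c (fun g => rep g v) (gone G) w.

(* w = d rep (c_1) ... d rep (c_k) v *)
Fixpoint drep_word (cs : seq (R -> G)) (v w : V) : Prop :=
  if cs is c :: cs' then exists2 u, drep_word cs' v u & drep c u w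
  else w = v.

(* Continuous antilinear functionals on the space of smooth vectors, with
   respect to the seminorms v |-> | d rep (c_1) ... d rep (c_k) v |. *)
Definition distribution_vector (alpha : V -> C) : Prop :=
  (forall (a : C) u v, smooth_vec u -> smooth_vec v ->
     alpha (a *: u + v) = conjc a * alpha u + alpha v) /\
  forall e, 0 < e -> exists N : nat, exists ws : nat -> seq (R -> G),
    (forall j i, (i < size (ws j))%N ->
       one_param (nth (fun=> gone G) (ws j) i)) /\
    exists2 r : R, 0 < r & forall v, smooth_vec v ->
      (forall j w, (j < N)%N -> drep_word (ws j) v w -> hnorm H w < r) ->
      complex.Re `|alpha v| < e.

Definition involution_on (tau : G -> G) : Prop :=
  [/\ forall g, gset g -> gset (tau g),
      forall g h, gset g -> gset h -> tau (gmul g h) = gmul (tau g) (tau h),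
      forall g, gset g -> tau (tau g) = g & continuous tau].

(* K is an open subgroup of the group of fixed points of tau. *)
Definition open_fixed_subgroup (tau : G -> G) (K : set G) : Prop :=
  [/\ exists2 U : set G, open U & K = U `&` [set g | gset g /\ tau g = g],
      K (gone G) &
      forall g h, K g -> K h -> K (gmul g h) /\
        forall g', gset g' -> gmul g' g = gone G -> K g'].

(* c lies in the -1-eigenspace of the derivative of tau. *)
Definition in_q (tau : G -> G) (c : R -> G) : Prop :=
  one_param c /\ forall t, tau (c t) = c (- t).

Definition invariant_under (K : set G) (S : set V) : Prop :=
  forall g, K g ->
    (forall v, S v -> S (rep g v)) /\
    (forall v, S v -> exists2 u, S u & heq H (rep g u) v).

Definition reflection_positive_rep (tau : G -> G) (K : set G)
    (Fp : set V) (theta : V -> V) : Prop :=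
  [/\ involution_on tau /\ open_fixed_subgroup tau K,
      unitary_rep /\ unitary_involution H theta,
      closed_subspace H Fp /\ (forall v, Fp v -> 0 <= hform H (theta v) v),
      (forall g v, gset g -> hdom H v ->
         heq H (rep (tau g) v) (theta (rep g (theta v)))) /\
      invariant_under K Fp &
      exists D : set V,
        [/\ linear_subspace D, D `<=` smooth_vec, dense_in H Fp D &
            forall c v, in_q tau c -> D v -> exists2 w, D w & drep c v w]].

End representations.
End hilbert.

Section L2.
Context d (T : measurableType d) (R : realType).
Variable m : {measure set T -> \bar R}.

Definition L2 : hspace (T -> R[i]^o) := HSpace
  [set f : T -> R[i]^o | cmeasurable f /\
    (\int[m]_x (complex.Re (`|f x| ^+ 2))%:E < +oo)%E]
  (fun f g => cintegral m (fun x => f x * conjc (g x))).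

End L2.

Section distributions.
Variables (R : realType) (d : nat).
Local Notation Rd := 'cV[R]_d.
Local Notation C := R[i].

Definition partials (s : seq 'I_d) (f : Rd -> R) : Rd -> R :=
  foldr (fun i g => fun x => 'D_(delta_mx i 0) g x) f s.

Definition smooth_real (f : Rd -> R) : Prop :=
  forall s, continuous (partials s f) /\
    forall i x, derivable (partials s f) x (delta_mx i 0).

Definition smooth (f : Rd -> C) : Prop :=
  smooth_real (fun x => complex.Re (f x)) /\
  smooth_real (fun x => complex.Im (f x)).

(* C_c^oo (O) *)
Definition test_function (O : set Rd) (f : Rd -> C) : Prop :=
  smooth f /\
  exists K : set Rd, [/\ compact K, K `<=` O & forall x, ~ K x -> f x = 0].

Definition japanese (x : Rd) : R := 1 + dot x x.

Definition schwartz (f : Rd -> C) : Prop :=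
  smooth f /\ forall (N : nat) s, exists B : R, forall x,
    japanese x ^+ N * `|partials s (fun x => complex.Re (f x)) x| <= B /\
    japanese x ^+ N * `|partials s (fun x => complex.Im (f x)) x| <= B.

Definition tempered_distribution (D : (Rd -> C) -> C) : Prop :=
  (forall (a : C) f g, schwartz f -> schwartz g ->
     D (fun x => a * f x + g x) = a * D f + D g) /\
  forall e, 0 < e -> exists N : nat, exists2 r : R, 0 < r &
    forall f, schwartz f ->
      (forall s x, (size s <= N)%N ->
         japanese x ^+ N * `|partials s (fun x => complex.Re (f x)) x| < r /\
         japanese x ^+ N * `|partials s (fun x => complex.Im (f x)) x| < r) ->
      complex.Re `|D f| < e.

Definition tempered_measure (m : {measure set Rd -> \bar R}) : Prop :=
  exists N : nat, m.-integrable setT (fun x => ((japanese x ^+ N)^-1)%:E).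

Definition fourier (f : Rd -> C) (p : Rd) : C :=
  cintegral (leb R d) (fun x => f x * expi (- dot x p)).

Definition fourier_measure (m : {measure set Rd -> \bar R})
    (f : Rd -> C) : C :=
  cintegral m (fourier f).

Definition convolution (f g : Rd -> C) (z : Rd) : C :=
  cintegral (leb R d) (fun x => f x * g (z - x)).

Definition conj_inv (f : Rd -> C) (x : Rd) : C := conjc (f (- x)).

Definition positive_definite (D : (Rd -> C) -> C) : Prop :=
  forall f, test_function setT f -> 0 <= D (convolution (conj_inv f) f).

Definition rotation_invariant (D : (Rd -> C) -> C) : Prop :=
  forall (g : 'M[R]_d) f, g^T *m g = 1%:M -> schwartz f ->
    D (fun x => f (g *m x)) = D f.

End distributions.

Section groups.
Variable R : realType.

Section translations.
Variable d : nat.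

Lemma trans_opp (g : 'cV[R]_d) : setT g ->
  exists h, [/\ setT h, h + g = 0 & g + h = 0].
Proof. by move=> _; exists (- g); rewrite addNr addrN. Qed.

Definition translations : group :=
  @Group 'cV[R]_d setT +%R 0 Logic.I (fun _ _ _ _ => Logic.I)
    (@addrA _) (@add0r _) (@addr0 _) trans_opp.

End translations.

Section motions.
Variable d : nat.

Definition orthogonal_mx : set 'M[R]_d := [set g | g^T *m g = 1%:M].

Definition mot_mul (g h : 'cV[R]_d * 'M[R]_d) : 'cV[R]_d * 'M[R]_d :=
  (g.1 + g.2 *m h.1, g.2 *m h.2).

Definition mot_set : set ('cV[R]_d * 'M[R]_d) := [set g | orthogonal_mx g.2].

Lemma mot_set1 : mot_set (0, 1%:M).
Proof. by rewrite /mot_set /orthogonal_mx /= trmx1 mulmx1. Qed.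

Lemma mot_setM g h : mot_set g -> mot_set h -> mot_set (mot_mul g h).
Proof.
rewrite /mot_set /orthogonal_mx /= => gO hO.
by rewrite trmx_mul mulmxA -(mulmxA h.2^T) gO mulmx1.
Qed.

Lemma mot_mulA f g h : mot_mul f (mot_mul g h) = mot_mul (mot_mul f g) h.
Proof. by rewrite /mot_mul /= mulmxDr !mulmxA addrA. Qed.

Lemma mot_mul1g g : mot_mul (0, 1%:M) g = g.
Proof. by case: g => x g; rewrite /mot_mul /= !mul1mx add0r. Qed.

Lemma mot_mulg1 g : mot_mul g (0, 1%:M) = g.
Proof. by case: g => x g; rewrite /mot_mul /= mulmx0 mulmx1 addr0. Qed.

Lemma mot_mulV g : mot_set g ->
  exists h, [/\ mot_set h, mot_mul h g = (0, 1%:M) & mot_mul g h = (0, 1%:M)].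
Proof.
case: g => x g; rewrite /mot_set /orthogonal_mx /= => gO.
have gO' : g *m g^T = 1%:M by exact: mulmx1C.
exists (- (g^T *m x), g^T); rewrite /mot_mul /= trmxK gO gO'.
by rewrite mulmxN mulmxA gO' mul1mx addNr addrN.
Qed.

Definition motions : group :=
  @Group ('cV[R]_d * 'M[R]_d)%type mot_set mot_mul (0, 1%:M)
    mot_set1 mot_setM mot_mulA mot_mul1g mot_mulg1 mot_mulV.

(* (x, g).f (p) = e^{-ixp} f(g^{-1} p); this formula defines both the action
   of Mot(R^d) and, for g in lorentz_up, the representation pi^c. *)
Definition natural_rep (g : 'cV[R]_d * 'M[R]_d) (f : 'cV[R]_d -> R[i]^o) :
    'cV[R]_d -> R[i]^o :=
  fun p => expi (- dot g.1 p) * f (invmx g.2 *m p).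

End motions.

Section reflection.
Variable n : nat.
Local Notation Rd := 'cV[R]_n.+1.

Definition refl_mx : 'M[R]_n.+1 :=
  diag_mx (\row_j if j == 0 then - 1 else 1).

Definition refl (x : Rd) : Rd := refl_mx *m x.

Definition half_space : set Rd := [set x : Rd | 0 < x 0 0].

Definition reflection_positive_distribution (D : (Rd -> R[i]) -> R[i]) : Prop :=
  [/\ positive_definite D,
      forall f, schwartz f -> D (fun x => f (refl x)) = D f &
      forall f, test_function half_space f ->
        0 <= D (convolution (fun x => conj_inv f (refl x)) f)].

Definition space_translations : set Rd := [set x : Rd | x 0 0 = 0].

Definition mot_tau (g : Rd * 'M[R]_n.+1) : Rd * 'M[R]_n.+1 :=
  (refl g.1, refl_mx *m g.2 *m refl_mx).

(* H = R^{d-1} x| O_{d-1}(R) *)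
Definition mot_H : set (Rd * 'M[R]_n.+1) :=
  [set g : Rd * 'M[R]_n.+1 | g.1 0 0 = 0 /\ exists2 k : 'M[R]_n, orthogonal_mx k &
     g.2 = (block_mx 1%:M 0 0 k : 'M[R]_(1 + n))].

Definition minkowski_mx : 'M[R]_n.+1 :=
  diag_mx (\row_j if j == 0 then 1 else - 1).

Definition lorentz_up : set 'M[R]_n.+1 :=
  [set g : 'M[R]_n.+1 | g^T *m minkowski_mx *m g = minkowski_mx /\ 0 < g 0 0].

Definition lorentz_invariant (m : {measure set Rd -> \bar R}) : Prop :=
  forall g A, lorentz_up g -> measurable A ->
    m ((fun p : Rd => g *m p) @^-1` A) = m A.

Definition radon (m : {measure set Rd -> \bar R}) : Prop :=
  forall K : set Rd, compact K -> (m K < +oo)%E.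

End reflection.
End groups.

Section construction.
Variables (R : realType) (n : nat) (rho : {measure set R -> \bar R}).
Local Notation C := R[i].
Local Notation Rd := 'cV[R]_n.+1.
Local Notation X := (R * Rd)%type.

Definition E_space : hspace (X -> C^o) := L2 (zeta n rho).

Definition theta (f : X -> C^o) : X -> C^o := fun z => f (- z.1, z.2).

(* (t, p0, p) |-> e^{-i(x0 t + xp)} f(t, p0, p) *)
Definition rep_E (x : Rd) (f : X -> C^o) : X -> C^o :=
  fun z => expi (- dot x (proj_p0 z)) * f z.

Definition one_E : X -> C^o := fun=> 1.

Definition functional_of (h f : X -> C^o) : C :=
  cintegral (zeta n rho) (fun z => h z * conjc (f z)).

(* pi^{-oo}(phi) h = \int phi(x) pi^{-oo}(x) h dx, computed pointwise on X *)
Definition integrated_rep (phi : Rd -> C) (h : X -> C^o) : X -> C^o :=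
  fun z => cintegral (leb R n.+1) (fun x => phi x * rep_E x h z).

Definition F_space : set (X -> C^o) :=
  closed_span E_space [set integrated_rep phi one_E | phi in test_function setT].

Definition F_plus : set (X -> C^o) :=
  closed_span E_space
    [set integrated_rep phi one_E | phi in test_function (@half_space R n)].

Definition F_zero : set (X -> C^o) :=
  [set v | F_plus v /\ heq E_space (theta v) v].

(* The identification of L^2(R^d, nu) with functions independent of p0 *)
Definition pullback (f : Rd -> C^o) : X -> C^o := fun z => f (proj_p0 z).

Definition F_plus_nu : set (Rd -> C^o) :=
  [set f | hdom (L2 (nu n rho)) f /\ F_plus (pullback f)].

Definition F_zero_nu : set (Rd -> C^o) :=
  [set f | hdom (L2 (nu n rho)) f /\ F_zero (pullback f)].

Definition theta_nu (f : Rd -> C^o) : Rd -> C^o := fun p => f (refl p).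

Definition F_hat : hspace (nat -> (X -> C^o)) :=
  completion (HSpace F_plus (fun u v => hform E_space (theta u) v)).

Definition q_map (v : X -> C^o) : nat -> (X -> C^o) := fun=> v.

Definition hat_op (T : (X -> C^o) -> (X -> C^o)) (v : nat -> (X -> C^o)) :
    nat -> (X -> C^o) := fun k => T (v k).

Definition decay_op (t : R) (f : Rd -> C^o) : Rd -> C^o :=
  fun p => (expR (- (t * p 0 0)))%:C * f p.

End construction.

(* Main.v *)
From HB Require Import structures.
Require Import Defs.
From mathcomp Require Import all_boot all_order all_algebra complex.
From mathcomp Require Import all_classical all_reals all_analysis.
From mathcomp Require Import measurable_realfun ring lra.
Set Implicit Arguments.
Unset Strict Implicit.
Unset Printing Implicit Defensive.
Import Order.TTheory GRing.Theory Num.Theory numFieldNormedType.Exports.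
Local Open Scope classical_set_scope.
Local Open Scope complex_scope.
Local Open Scope ring_scope.

(** Everything rests on one integral: the Poisson kernel
    [(1 / pi) p_0 / (p_0^2 + t^2)] integrated against [e^(i s t)] is
    [e^(- s p_0)] for [s >= 0] ([fourier_cauchy]).

    Smearing the orbit of the constant function 1 by a test function [phi]
    gives the function [(t, p_0, q) |-> fourier phi (t, q)] on X
    ([integrated_repE]). As [nu] is tempered, it is square integrable, and the
    subspace F is [L^2(nu)] pulled back to X ([F_spaceP]). When [phi] lives at
    positive times, integrating out [t] over a point [p] of the cone turns
    [fourier phi] into [laplace phi], the Laplace transform in time and Fourier
    transform in space; applied to a product of two transforms, one of them
    reflected, this gives
    [<theta (orbit phi), orbit psi> = <laplace phi, laplace psi>] in [L^2(mu)]
    ([reflected_form]). Hence the reflected form is positive on F_+, and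
    [orbit phi |-> laplace phi] extends to an isometry of the completion into
    [L^2(mu)] ([extension_unitary]). It is onto because the functions
    [laplace phi] are dense ([laplace_tests_dense]): their closed span is stable
    under multiplication by the kernels of translations into the future, hence
    by all bounded measurable functions ([multipliers_dense]). Moving [phi]
    moves [orbit phi] and [laplace phi] alike; this gives the equivariance
    ([identification_natural]) and the semigroup ([identification_decay]), which
    [e^(- i z p_0)] with [Im z <= 0] joins to the time translations
    ([natural_analytic_continuation]).

    Rotation invariance cannot be seen on the cone. It appears after the
    projection: on the shell of mass [m] the variables [(t, q)] have the density
    [1 / (m^2 + t^2 + q^2)] ([nu_mixture]), so that motions of [R^d] act on
    [L^2(nu)]. The transforms of test functions are smooth vectors for this
    action, because a one-parameter group of motions differentiates [phi] along
    a vector field with affine coefficients ([fourier_generator],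
    [natural_rep_Ck]); those supported at positive times form the dense invariant
    domain of reflection positivity. Translations are motions, which settles the
    representation of [R^d] as well.

    Finally, for a smooth vector [f] all powers of the momenta times [f] are
    square integrable, so [f] decays enough for the pairing with 1 to converge
    and to be continuous ([smooth_vector_bound]). *)

Local Notation Re := complex.Re.
Local Notation Im := complex.Im.

(** * Complex numbers and pre-Hilbert spaces *)

Section complex_numbers.
Variable R : realType.
Local Notation C := R[i].

Definition cmod (z : C) : R := Num.sqrt (Re z ^+ 2 + Im z ^+ 2).
Definition sqmod (z : C) : R := Re z ^+ 2 + Im z ^+ 2.

Lemma cReD (x y : C) : Re (x + y) = Re x + Re y. Proof. by case: x; case: y. Qed.
Lemma cImD (x y : C) : Im (x + y) = Im x + Im y. Proof. by case: x; case: y. Qed.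
Lemma cReN (x : C) : Re (- x) = - Re x. Proof. by case: x. Qed.
Lemma cImN (x : C) : Im (- x) = - Im x. Proof. by case: x. Qed.
Lemma cReB (x y : C) : Re (x - y) = Re x - Re y. Proof. by rewrite cReD cReN. Qed.
Lemma cImB (x y : C) : Im (x - y) = Im x - Im y. Proof. by rewrite cImD cImN. Qed.
Lemma cReM (x y : C) : Re (x * y) = Re x * Re y - Im x * Im y.
Proof. by case: x; case: y. Qed.
Lemma cImM (x y : C) : Im (x * y) = Re x * Im y + Im x * Re y.
Proof. by case: x => a b; case: y. Qed.
Lemma cReJ (x : C) : Re (conjc x) = Re x. Proof. by case: x. Qed.
Lemma cImJ (x : C) : Im (conjc x) = - Im x. Proof. by case: x. Qed.
Lemma complex_eqP (x y : C) : Re x = Re y -> Im x = Im y -> x = y.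
Proof. by case: x => a b; case: y => c d /= -> ->. Qed.

Lemma sqmod_ge0 z : 0 <= sqmod z. Proof. by rewrite addr_ge0 // sqr_ge0. Qed.
Lemma cmod_ge0 z : 0 <= cmod z. Proof. exact: sqrtr_ge0. Qed.
Lemma sqr_cmod z : cmod z ^+ 2 = sqmod z.
Proof. by rewrite sqr_sqrtr // sqmod_ge0. Qed.
Lemma normc_cmod z : `|z| = (cmod z)%:C. Proof. exact: normc_def. Qed.
Lemma Re_norm z : Re `|z| = cmod z. Proof. by rewrite normc_cmod. Qed.
Lemma Re_norm2 z : Re (`|z| ^+ 2) = sqmod z.
Proof. by rewrite -add_Re2_Im2. Qed.
Lemma cmodM x y : cmod (x * y) = cmod x * cmod y.
Proof. by apply: complexI; rewrite rmorphM /= -!normc_cmod normrM. Qed.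
Lemma cmodD x y : cmod (x + y) <= cmod x + cmod y.
Proof. by rewrite -lecR rmorphD /= -!normc_cmod ler_normD. Qed.
Lemma cmodN x : cmod (- x) = cmod x.
Proof. by apply: complexI; rewrite -!normc_cmod normrN. Qed.
Lemma cmodB x y : cmod (x - y) <= cmod x + cmod y.
Proof. by rewrite (le_trans (cmodD _ _)) // cmodN. Qed.
Lemma cmodBC x y : cmod (x - y) = cmod (y - x).
Proof. by rewrite -cmodN opprB. Qed.
Lemma cmodJ x : cmod (conjc x) = cmod x.
Proof. by rewrite /cmod cReJ cImJ sqrrN. Qed.
Lemma cmod0 : cmod 0 = 0. Proof. by rewrite /cmod /= expr0n /= addr0 sqrtr0. Qed.
Lemma cmod1 : cmod 1 = 1.
Proof. by rewrite /cmod /= expr0n /= addr0 expr1n sqrtr1. Qed.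
Lemma cmod_eq0 z : cmod z = 0 -> z = 0.
Proof. by move=> z0; apply/eqP; rewrite -normr_eq0 normc_cmod z0. Qed.
Lemma cmodR (a : R) : cmod a%:C = `|a|.
Proof. by rewrite /cmod /= expr0n /= addr0 sqrtr_sqr. Qed.
Lemma cmodV x : cmod x^-1 = (cmod x)^-1.
Proof.
have [->|x0] := eqVneq x 0; first by rewrite invr0 cmod0 invr0.
apply: (@mulfI _ (cmod x)).
  by apply/eqP => /cmod_eq0/eqP; rewrite (negbTE x0).
rewrite -cmodM divff // cmod1 divff //.
by apply/eqP => /cmod_eq0/eqP; rewrite (negbTE x0).
Qed.
Lemma Re_le_cmod z : `|Re z| <= cmod z.
Proof.
rewrite -sqrtr_sqr ler_wsqrtr // lerDl; exact: sqr_ge0.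
Qed.
Lemma Im_le_cmod z : `|Im z| <= cmod z.
Proof.
rewrite -sqrtr_sqr ler_wsqrtr // lerDr; exact: sqr_ge0.
Qed.
Lemma cmod_le_ReIm z : cmod z <= `|Re z| + `|Im z|.
Proof.
rewrite -[leRHS]ger0_norm ?addr_ge0 // -sqrtr_sqr ler_wsqrtr //.
have := mulr_ge0 (normr_ge0 (Re z)) (normr_ge0 (Im z)).
have := real_normK (num_real (Re z)); have := real_normK (num_real (Im z)).
by move: `|Re z| `|Im z| => a b; nra.
Qed.
Lemma cmod_sub x y : cmod x <= cmod (x - y) + cmod y.
Proof. by rewrite -{1}(subrK y x) cmodD. Qed.

Lemma mul_conjc z : z * conjc z = (sqmod z)%:C.
Proof.
by apply: complex_eqP; rewrite ?cReM ?cImM cReJ cImJ /sqmod /=; ring.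
Qed.
Lemma sqmodE z : sqmod z = Re (z * conjc z). Proof. by rewrite mul_conjc. Qed.

Lemma cge0P (z : C) : 0 <= z <-> Im z = 0 /\ 0 <= Re z.
Proof. by rewrite lecE /=; split => [/andP[/eqP-> ->]//|[-> ->]]; rewrite eqxx. Qed.

Lemma expiD (a b : R) : expi (a + b) = expi a * expi b.
Proof.
by apply: complex_eqP; rewrite ?cReM ?cImM /= ?cosD ?sinD // addrC mulrC.
Qed.
Lemma expi0 : expi 0 = 1 :> C. Proof. by rewrite /expi cos0 sin0. Qed.
Lemma conj_expi (a : R) : conjc (expi a) = expi (- a).
Proof. by rewrite /expi cosN sinN. Qed.
Lemma expiNK (a : R) : expi (- a) * expi a = 1.
Proof. by rewrite -expiD addNr expi0. Qed.
Lemma cmod_expi (a : R) : cmod (expi a) = 1.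
Proof. by rewrite /cmod /= cos2Dsin2 sqrtr1. Qed.
Lemma eqR_le (a b : R) : a = b -> a <= b. Proof. by move->. Qed.
Lemma sqmodM x y : sqmod (x * y) = sqmod x * sqmod y.
Proof. by rewrite -!sqr_cmod cmodM exprMn. Qed.

End complex_numbers.

Section prehilbert.
Variables (R : realType) (V : lmodType R[i]).
Local Notation C := R[i].

Definition prehilbert (H : hspace V) : Prop :=
  [/\ linear_subspace (hdom H),
      forall (a : C) u v w, hdom H u -> hdom H v -> hdom H w ->
        hform H (a *: u + v) w = a * hform H u w + hform H v w,
      forall u v, hdom H u -> hdom H v -> hform H v u = conjc (hform H u v) &
      forall u, hdom H u -> 0 <= hform H u u].

Variable H : hspace V.
Hypothesis HP : prehilbert H.
Local Notation D := (hdom H).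
Local Notation "<| u , v |>" := (hform H u v).
Local Notation nm := (hnorm H).

Section subspace.
Variable S : set V.
Hypothesis SP : linear_subspace S.
Lemma subspace0 : S 0. Proof. by case: SP. Qed.
Lemma subspaceZ (a : C) u : S u -> S (a *: u).
Proof. by case: SP => S0 + Su => /(_ a _ _ Su S0); rewrite addr0. Qed.
Lemma subspaceD u v : S u -> S v -> S (u + v).
Proof. by case: SP => S0 /(_ 1 u v) + Su Sv => /(_ Su Sv); rewrite scale1r. Qed.
Lemma subspaceN u : S u -> S (- u).
Proof. by rewrite -scaleN1r; exact: subspaceZ. Qed.
Lemma subspaceB u v : S u -> S v -> S (u - v).
Proof. by move=> Su Sv; apply: subspaceD => //; exact: subspaceN. Qed.
End subspace.

Let DP : linear_subspace D. Proof. by case: HP. Qed.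
Lemma hdom0 : D 0. Proof. exact: subspace0. Qed.
Lemma hdomZ (a : C) u : D u -> D (a *: u). Proof. exact: subspaceZ. Qed.
Lemma hdomD u v : D u -> D v -> D (u + v). Proof. exact: subspaceD. Qed.
Lemma hdomN u : D u -> D (- u). Proof. exact: subspaceN. Qed.
Lemma hdomB u v : D u -> D v -> D (u - v). Proof. exact: subspaceB. Qed.

Lemma hform0l w : D w -> <| 0, w |> = 0.
Proof.
case: HP => _ h _ _ Dw; have := h (-1) 0 0 w hdom0 hdom0 Dw.
by rewrite scaler0 addr0 mulN1r addNr.
Qed.
Lemma hformDl u v w : D u -> D v -> D w -> <| u + v, w |> = <| u, w |> + <| v, w |>.
Proof. by case: HP => _ h _ _ Du Dv Dw; rewrite -{1}(scale1r u) h // mul1r. Qed.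
Lemma hformZl a u w : D u -> D w -> <| a *: u, w |> = a * <| u, w |>.
Proof.
move=> Du Dw; case: HP => _ h _ _; rewrite -{1}(addr0 (a *: u)) h //; last exact: hdom0.
by rewrite hform0l // addr0.
Qed.
Lemma hform_conj u v : D u -> D v -> <| v, u |> = conjc <| u, v |>.
Proof. by case: HP => _ _ h _; exact: h. Qed.
Lemma hform_ge0 u : D u -> 0 <= <| u, u |>. Proof. by case: HP => _ _ _; exact. Qed.
Lemma hformDr u v w : D u -> D v -> D w -> <| w, u + v |> = <| w, u |> + <| w, v |>.
Proof.
move=> Du Dv Dw.
by rewrite (hform_conj (hdomD Du Dv) Dw) hformDl // rmorphD /= -!hform_conj.
Qed.
Lemma hformZr a u w : D u -> D w -> <| w, a *: u |> = conjc a * <| w, u |>.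
Proof.
move=> Du Dw.
by rewrite (hform_conj (hdomZ a Du) Dw) hformZl // rmorphM /= -hform_conj.
Qed.
Lemma hformNl u w : D u -> D w -> <| - u, w |> = - <| u, w |>.
Proof. by move=> Du Dw; rewrite -scaleN1r hformZl // mulN1r. Qed.
Lemma hformNr u w : D u -> D w -> <| w, - u |> = - <| w, u |>.
Proof. by move=> Du Dw; rewrite -scaleN1r hformZr // rmorphN1 mulN1r. Qed.
Lemma hformBl u v w : D u -> D v -> D w -> <| u - v, w |> = <| u, w |> - <| v, w |>.
Proof. by move=> Du Dv Dw; rewrite hformDl ?hformNl //; exact: hdomN. Qed.
Lemma hformBr u v w : D u -> D v -> D w -> <| w, u - v |> = <| w, u |> - <| w, v |>.
Proof. by move=> Du Dv Dw; rewrite hformDr ?hformNr //; exact: hdomN. Qed.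

Lemma hnorm_ge0 u : 0 <= nm u. Proof. exact: sqrtr_ge0. Qed.
Lemma Re_hform_ge0 u : D u -> 0 <= Re <| u, u |>.
Proof. by move=> /hform_ge0/cge0P[]. Qed.
Lemma hformE u : D u -> <| u, u |> = (nm u ^+ 2)%:C.
Proof.
move=> Du; have /cge0P[Im0 Re0] := hform_ge0 Du.
by apply: complex_eqP => //=; rewrite sqr_sqrtr.
Qed.

Lemma hcauchy_schwarz u v : D u -> D v -> cmod <| u, v |> <= nm u * nm v.
Proof.
move=> Du Dv.
set a := nm v ^+ 2; set c := nm u ^+ 2; set b := <| u, v |>.
have key (x y : C) : 0 <= sqmod x * c + sqmod y * a - 2 * Re (x * conjc y * b).
  have := Re_hform_ge0 (hdomB (hdomZ x Du) (hdomZ y Dv)).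
  have DxU := hdomZ x Du; have DyV := hdomZ y Dv.
  rewrite hformBl ?hformBr //; last exact: hdomB.
  rewrite !(hformZl, hformZr) // !hformE // (hform_conj Du Dv) -/a -/c -/b.
  congr (_ <= _); rewrite !(cReD, cReN, cReM, cImM, cReJ, cImJ, cImN) /= /sqmod; ring.
have b2 : cmod b ^+ 2 <= c * a.
  rewrite sqr_cmod; have a0 : 0 <= a by exact: sqr_ge0.
  have c0 : 0 <= c by exact: sqr_ge0.
  (* if [v] has norm zero, no multiple of it is optimal, but the multiple below
     already forces [b = 0] *)
  have [a_eq0|aneq0] := eqVneq a 0.
    rewrite a_eq0 mulr0; set t := sqmod b; pose s := t / (c + 1).
    have c1 : c + 1 != 0 by rewrite gt_eqF // ltr_wpDl.
    have ts : t = s * (c + 1) by rewrite /s divfK.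
    have := key s%:C b.
    rewrite -mulrA [conjc b * b]mulrC mul_conjc -rmorphM /= a_eq0 mulr0.
    rewrite {1}/sqmod /= expr0n /= !addr0 -/t {1}ts => h.
    have s2 : s ^+ 2 * (c + 2) <= 0.
      by move: h; rewrite [X in 0 <= X -> _](_ : _ = - (s ^+ 2 * (c + 2))) ?oppr_ge0 //; ring.
    have s0 : s ^+ 2 <= 0.
      by rewrite -(pmulr_lle0 _ (_ : 0 < c + 2)) // ltr_wpDl.
    have /eqP : s ^+ 2 == 0 by rewrite eq_le s0 sqr_ge0.
    by move=> /eqP; rewrite sqrf_eq0 => /eqP s00; rewrite ts s00 mul0r.
  have := key a%:C b.
  rewrite -mulrA [conjc b * b]mulrC mul_conjc -rmorphM /= {1}/sqmod /= expr0n /= addr0.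
  have apos : 0 < a by rewrite lt_neqAle eq_sym aneq0.
  rewrite [_ - _](_ : _ = a * (c * a - sqmod b)); last by ring.
  by rewrite pmulr_rge0 // subr_ge0.
rewrite -[leLHS]ger0_norm ?cmod_ge0 // -[leRHS]ger0_norm ?mulr_ge0 ?hnorm_ge0 //.
rewrite -(@ler_pXn2r _ 2) // ?nnegrE ?normr_ge0 // !real_normK ?num_real //.
by rewrite exprMn.
Qed.

Lemma sqr_hnorm u : D u -> nm u ^+ 2 = Re <| u, u |>.
Proof. by move=> Du; rewrite sqr_sqrtr // Re_hform_ge0. Qed.

Lemma hnormD u v : D u -> D v -> nm (u + v) <= nm u + nm v.
Proof.
move=> Du Dv; have Duv := hdomD Du Dv.
rewrite -(@ler_pXn2r _ 2) // ?nnegrE ?addr_ge0 ?hnorm_ge0 // sqr_hnorm //.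
rewrite hformDl // !hformDr // !cReD -!sqr_hnorm // (hform_conj Du Dv) cReJ.
have := hcauchy_schwarz Du Dv; have := Re_le_cmod <| u, v |>.
by rewrite ler_norml => /andP[_]; lra.
Qed.

Lemma hnormZ a u : D u -> nm (a *: u) = cmod a * nm u.
Proof.
move=> Du; rewrite {1}/hnorm hformZl ?hformZr ?hformE //; last exact: hdomZ.
rewrite mulrA mul_conjc -rmorphM /= -sqr_cmod -exprMn sqrtr_sqr ger0_norm //.
by rewrite mulr_ge0 ?cmod_ge0 ?hnorm_ge0.
Qed.

Lemma hnormN u : D u -> nm (- u) = nm u.
Proof. by move=> Du; rewrite -scaleN1r hnormZ // cmodN cmod1 mul1r. Qed.

Lemma hnormBC u v : D u -> D v -> nm (u - v) = nm (v - u).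
Proof. by move=> Du Dv; rewrite -hnormN ?opprB //; exact: hdomB. Qed.

Lemma hnorm_tri u v w : D u -> D v -> D w -> nm (u - w) <= nm (u - v) + nm (v - w).
Proof.
move=> Du Dv Dw; rewrite (_ : u - w = (u - v) + (v - w)); last first.
  by rewrite addrA subrK.
by apply: hnormD; exact: hdomB.
Qed.

Lemma hnorm_sub u v : D u -> D v -> nm u <= nm (u - v) + nm v.
Proof. by move=> Du Dv; rewrite -{1}(subrK v u) hnormD //; exact: hdomB. Qed.

Lemma hnorm0 : nm 0 = 0.
Proof. by rewrite /hnorm hform0l ?sqrtr0 //; exact: hdom0. Qed.

Lemma heq_refl u : heq H u u. Proof. by rewrite /heq subrr hnorm0. Qed.

Lemma heq_sym u v : D u -> D v -> heq H u v -> heq H v u.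
Proof. by move=> Du Dv; rewrite /heq hnormBC. Qed.

Lemma heq_trans u v w : D u -> D v -> D w -> heq H u v -> heq H v w -> heq H u w.
Proof.
move=> Du Dv Dw uv vw; apply/eqP; rewrite eq_le hnorm_ge0 andbT.
by rewrite (le_trans (hnorm_tri Du Dv Dw)) // uv vw addr0.
Qed.

Lemma heqD u v u' v' : D u -> D v -> D u' -> D v' -> heq H u u' -> heq H v v' ->
  heq H (u + v) (u' + v').
Proof.
move=> Du Dv Du' Dv' uu vv; apply/eqP; rewrite eq_le hnorm_ge0 andbT.
rewrite opprD addrACA (le_trans (hnormD _ _)) ?uu ?vv ?addr0 //; exact: hdomB.
Qed.

Lemma heqZ a u u' : D u -> D u' -> heq H u u' -> heq H (a *: u) (a *: u').
Proof.
by move=> Du Du' uu; rewrite /heq -scalerBr hnormZ ?uu ?mulr0 //; exact: hdomB.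
Qed.

Lemma heqB u v u' v' : D u -> D v -> D u' -> D v' -> heq H u u' -> heq H v v' ->
  heq H (u - v) (u' - v').
Proof.
move=> Du Dv Du' Dv' uu vv; rewrite -[- v]scaleN1r -[- v']scaleN1r.
exact: (heqD Du (hdomZ (-1) Dv) Du' (hdomZ (-1) Dv') uu (heqZ (-1) Dv Dv' vv)).
Qed.

Lemma hform_eqr w u v : D w -> D u -> D v -> heq H u v -> <| w, u |> = <| w, v |>.
Proof.
move=> Dw Du Dv uv; apply/eqP; rewrite -subr_eq0 -hformBr //; apply/eqP/cmod_eq0.
apply/eqP; rewrite eq_le cmod_ge0 andbT.
by rewrite (le_trans (hcauchy_schwarz Dw (hdomB Du Dv))) // uv mulr0.
Qed.

Lemma hform_eql w u v : D w -> D u -> D v -> heq H u v -> <| u, w |> = <| v, w |>.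
Proof.
move=> Dw Du Dv uv; rewrite (hform_conj Dw Du) (hform_conj Dw Dv).
by rewrite (hform_eqr _ _ _ uv).
Qed.

Lemma hnorm_eq u v : D u -> D v -> heq H u v -> nm u = nm v.
Proof.
move=> Du Dv uv; rewrite /hnorm; congr (Num.sqrt (Re _)).
by rewrite (hform_eql Du Du Dv uv) (hform_eqr Dv Du Dv uv).
Qed.

Lemma heq_distance u v u' v' : D u -> D v -> D u' -> D v' ->
  heq H u u' -> heq H v v' -> nm (u - v) = nm (u' - v').
Proof. by move=> *; apply: hnorm_eq; [exact: hdomB..|exact: heqB]. Qed.

(** Distances are what closedness is about; zero distances included, closed
    subspaces are stable under [heq]. *)
Lemma closed_subspace_heq S u v : closed_subspace H S -> D u -> S v -> heq H u v -> S u.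
Proof.
move=> [SD _ Sc] Du Sv uv; apply: Sc => // e e0; exists v => //.
by rewrite uv.
Qed.

Lemma hform_perturb u v u' v' : D u -> D v -> D u' -> D v' ->
  cmod (<| u, v |> - <| u', v' |>) <= nm (u - u') * nm v + nm u' * nm (v - v').
Proof.
move=> Du Dv Du' Dv'.
rewrite (_ : _ - _ = <| u - u', v |> + <| u', v - v' |>); last first.
  by rewrite hformBl // hformBr // addrA subrK.
by rewrite (le_trans (cmodD _ _)) // lerD // hcauchy_schwarz //; exact: hdomB.
Qed.

End prehilbert.

Section closures.
Variables (R : realType) (V : lmodType R[i]) (H : hspace V).
Hypothesis HP : prehilbert H.
Local Notation nm := (hnorm H).

Lemma sub_closed_span (A : set V) : A `<=` hdom H -> A `<=` closed_span H A.
Proof. by move=> AH v Av; split; [exact: AH|move=> S _; exact]. Qed.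

Lemma closed_span_min (A S : set V) : closed_subspace H S -> A `<=` S ->
  closed_span H A `<=` S.
Proof. by move=> Sc AS v [_]; exact. Qed.

Lemma closed_span_closed (A : set V) : closed_subspace H (closed_span H A).
Proof.
split=> [v []//| |v Hv vA].
  split; first by split=> [|S [_ [S0 _]]//]; exact: hdom0.
  move=> a u v [Hu hu] [Hv hv]; split; first by apply: hdomD => //; exact: hdomZ.
  by move=> S Sc AS; have [_ [_ Sl] _] := Sc; apply: Sl; [exact: hu|exact: hv].
split=> // S Sc AS; have [_ _ Scl] := Sc; apply: Scl => // e e0.
by have [w [_ hw] vw] := vA e e0; exists w => //; exact: hw.
Qed.

Definition limit_points (A : set V) : set V :=
  [set v | hdom H v /\ forall e, 0 < e -> exists2 w, A w & nm (v - w) < e].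

Lemma limit_points_closed (A : set V) : linear_subspace A -> A `<=` hdom H ->
  closed_subspace H (limit_points A).
Proof.
move=> Al AH; split=> [v []//| |v Hv h].
- split.
    split; first exact: hdom0.
    by move=> e e0; exists 0; [exact: subspace0|rewrite subrr hnorm0].
  move=> a u v [Hu hu] [Hv hv].
  split; first by apply: hdomD => //; exact: hdomZ.
  move=> e e0; have c0 : 0 < cmod a + 1 by rewrite ltr_wpDl // cmod_ge0.
  have [|u' Au' uu'] := hu (e / 2 / (cmod a + 1)); first by rewrite !divr_gt0.
  have [|v' Av' vv'] := hv (e / 2); first by rewrite divr_gt0.
  exists (a *: u' + v'); first by case: Al => _; exact.
  have Hu' := AH _ Au'; have Hv' := AH _ Av'.
  rewrite opprD addrACA -scalerBr (le_lt_trans (hnormD HP _ _)) //.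
  + by apply: hdomZ => //; exact: hdomB.
  + exact: hdomB.
  rewrite hnormZ //; last exact: hdomB.
  rewrite [ltRHS]splitr ler_ltD // (le_trans _ (_ : (cmod a + 1) * nm (u - u') <= _)) //.
    by rewrite ler_wpM2r ?hnorm_ge0 // lerDl.
  by rewrite mulrC -ler_pdivlMr // ltW.
- split=> // e e0; have e20 : 0 < e / 2 by rewrite divr_gt0.
  have [w [Hw hw] vw] := h _ e20; have [x Ax wx] := hw _ e20.
  exists x => //; have Hx := AH _ Ax.
  by rewrite (le_lt_trans (hnorm_tri HP Hv Hw Hx)) // [ltRHS]splitr ltrD.
Qed.

Lemma closed_span_limit (A : set V) : linear_subspace A -> A `<=` hdom H ->
  closed_span H A = limit_points A.
Proof.
move=> Al AH; apply/seteqP; split.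
  apply: closed_span_min; first exact: limit_points_closed.
  move=> v Av; split; first exact: AH.
  by move=> e e0; exists v => //; rewrite subrr hnorm0.
move=> v [Hv hv]; split=> // S [SH Sl Sc] AS; apply: Sc => // e e0.
by have [w Aw vw] := hv e e0; exists w => //; exact: AS.
Qed.

Lemma closed_span_seq (A : set V) v : linear_subspace A -> A `<=` hdom H ->
  closed_span H A v -> exists2 w : nat -> V, (forall k, A (w k)) &
    nm (v - w k) @[k --> \oo] --> (0 : R).
Proof.
move=> Al AH; rewrite closed_span_limit // => -[Hv hv].
have /choice[w wP] k : exists w, A w /\ nm (v - w) < (k.+1%:R)^-1.
  by have [|w] := hv (k.+1%:R)^-1; [rewrite invr_gt0|exists w].
exists w => [k|]; first by have [] := wP k.
apply: (@squeeze_cvgr _ _ _ _ (cst 0) (@harmonic R)); [|exact: cvg_cst|exact: cvg_harmonic].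
by apply: nearW => k; rewrite hnorm_ge0 /= ltW //; have [] := wP k.
Qed.

Lemma closed_subspace_cvg (S : set V) v (w : nat -> V) : closed_subspace H S ->
  hdom H v -> (forall k, S (w k)) -> nm (v - w k) @[k --> \oo] --> (0 : R) -> S v.
Proof.
move=> [_ _ Sc] Hv Sw /cvgrPdist_lt wv; apply: Sc => // e /wv[N _ /(_ N (leqnn N))].
by rewrite sub0r normrN ger0_norm ?hnorm_ge0 // => ?; exists (w N).
Qed.

Lemma hform_cvg u v (us vs : nat -> V) : hdom H u -> hdom H v ->
  (forall k, hdom H (us k)) -> (forall k, hdom H (vs k)) ->
  nm (us k - u) @[k --> \oo] --> (0 : R) -> nm (vs k - v) @[k --> \oo] --> (0 : R) ->
  cmod (hform H (us k) (vs k) - hform H u v) @[k --> \oo] --> (0 : R).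
Proof.
move=> Hu Hv Hus Hvs cu cv.
apply: (@squeeze_cvgr _ _ _ _ (cst 0)
   (fun k => nm (us k - u) * (nm (vs k - v) + nm v) + nm u * nm (vs k - v))).
- apply: nearW => k; rewrite cmod_ge0 /= (le_trans (hform_perturb HP _ _ _ _)) //.
  by rewrite lerD // ler_wpM2l ?hnorm_ge0 // hnorm_sub.
- exact: cvg_cst.
rewrite [X in _ --> X](_ : _ = 0 * (0 + nm v) + nm u * 0); last first.
  by rewrite mul0r mulr0 addr0.
by apply: cvgD; apply: cvgM => //; [apply: cvgD => //; exact: cvg_cst|exact: cvg_cst].
Qed.

End closures.

Section closed_span_maps.
Variables (R : realType) (V W : lmodType R[i]) (H : hspace V) (K : hspace W).
Hypothesis HP : prehilbert H.

Lemma closed_span_map (T : V -> W) (M : R) (A : set V) (S : set W) :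
  (forall (a : R[i]) u v, T (a *: u + v) = a *: T u + T v) ->
  (forall v, hdom H v -> hdom K (T v)) ->
  (forall v, hdom H v -> hnorm K (T v) <= M * hnorm H v) ->
  closed_subspace K S -> A `<=` hdom H -> (forall v, A v -> S (T v)) ->
  forall v, closed_span H A v -> S (T v).
Proof.
move=> Tlin TK TM Scl AH TA v; have [SK [S0 Slin] Scls] := Scl.
have TB u w : T (u - w) = T u - T w.
  by rewrite addrC -scaleN1r Tlin scaleN1r addrC.
have T0 : T 0 = 0 by rewrite -(subrr (0 : V)) TB subrr.
suff : closed_subspace H [set u | hdom H u /\ S (T u)].
  by move=> cl /(closed_span_min cl); case=> // u Au; split; [exact: AH|exact: TA].
split; first by move=> u [].
  split; first by rewrite /= T0; split; [exact: hdom0 HP|exact: S0].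
  move=> a u w [uH Su] [wH Sw]; split; first by case: HP => -[_ +] _ _ _; apply.
  by rewrite Tlin; exact: Slin.
move=> u uH happ; split => //; apply: Scls; first exact: TK.
move=> e e0; have M1 : 0 < `|M| + 1 by rewrite ltr_wpDl.
have [w [wH Sw] uw] := happ (e / (`|M| + 1)) (divr_gt0 e0 M1).
exists (T w) => //; rewrite -TB; have uwH := hdomB HP uH wH.
apply: le_lt_trans (TM _ uwH) _.
apply: (@le_lt_trans _ _ ((`|M| + 1) * hnorm H (u - w))).
  by rewrite ler_wpM2r ?hnorm_ge0 // (le_trans (ler_norm M)) // lerDl.
by rewrite mulrC -ltr_pdivlMr.
Qed.

Lemma image_linear (S : set V) (a : V -> W) : linear_subspace S ->
  (forall (c : R[i]) x y, S x -> S y -> a (c *: x + y) = c *: a x + a y) ->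
  linear_subspace [set a x | x in S].
Proof.
move=> [S0 Slin] al; split.
  exists 0 => //; have := al 1 0 0 S0 S0.
  by rewrite !scale1r addr0 => /esym/eqP; rewrite -subr_eq0 addrK => /eqP.
by move=> c _ _ [x Sx <-] [y Sy <-]; exists (c *: x + y); [exact: Slin|exact: al].
Qed.

End closed_span_maps.


(** * Integrals of complex functions *)

Section cmeasurable.
Context d (T : measurableType d) (R : realType).
Local Notation C := R[i].
Implicit Types f g : T -> C.

Lemma cmeasurable_cst (c : C) : cmeasurable (fun _ : T => c).
Proof. by split; exact: measurable_cst. Qed.

Lemma cmeasurableD f g : cmeasurable f -> cmeasurable g ->
  cmeasurable (fun x => f x + g x).
Proof.
move=> [f1 f2] [g1 g2]; split.
  by under eq_fun do rewrite cReD; exact: measurable_funD.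
by under eq_fun do rewrite cImD; exact: measurable_funD.
Qed.

Lemma cmeasurableM f g : cmeasurable f -> cmeasurable g ->
  cmeasurable (fun x => f x * g x).
Proof.
move=> [f1 f2] [g1 g2]; split.
  by under eq_fun do rewrite cReM; apply: measurable_funB; exact: measurable_funM.
by under eq_fun do rewrite cImM; apply: measurable_funD; exact: measurable_funM.
Qed.

Lemma cmeasurableJ f : cmeasurable f -> cmeasurable (fun x => conjc (f x)).
Proof.
move=> [f1 f2]; split.
  by under eq_fun do rewrite cReJ.
by under eq_fun do rewrite cImJ; exact: measurableT_comp.
Qed.

Lemma cmeasurableN f : cmeasurable f -> cmeasurable (fun x => - f x).
Proof.
move=> mf; rewrite (_ : (fun _ => _) = (fun x => -1 * f x)).
  by apply: cmeasurableM => //; exact: cmeasurable_cst.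
by apply/funext => x; rewrite mulN1r.
Qed.

Lemma cmeasurableB f g : cmeasurable f -> cmeasurable g ->
  cmeasurable (fun x => f x - g x).
Proof. by move=> mf mg; apply: cmeasurableD => //; exact: cmeasurableN. Qed.

Lemma cmeasurable_real (r : T -> R) : measurable_fun setT r ->
  cmeasurable (fun x => (r x)%:C).
Proof. by move=> mr; split => //=; exact: measurable_cst. Qed.

Lemma cmeasurable_expi (r : T -> R) : measurable_fun setT r ->
  cmeasurable (fun x => expi (r x)).
Proof.
move=> mr; split; rewrite /expi /=.
  by apply: measurableT_comp mr; apply: continuous_measurable_fun; exact: continuous_cos.
by apply: measurableT_comp mr; apply: continuous_measurable_fun; exact: continuous_sin.
Qed.

Lemma measurable_sqmod f : cmeasurable f -> measurable_fun setT (fun x => sqmod (f x)).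
Proof. by move=> [f1 f2]; apply: measurable_funD; exact: measurable_funX. Qed.

Lemma measurable_cmod f : cmeasurable f -> measurable_fun setT (fun x => cmod (f x)).
Proof.
move=> /measurable_sqmod mf; apply: measurableT_comp mf.
by apply: continuous_measurable_fun; exact: sqrt_continuous.
Qed.

Lemma cmeasurable_comp d' (T' : measurableType d') (h : T' -> T) f :
  cmeasurable f -> measurable_fun setT h -> cmeasurable (fun x => f (h x)).
Proof.
by move=> [f1 f2] mh; split; [exact: measurableT_comp f1 mh|exact: measurableT_comp f2 mh].
Qed.

End cmeasurable.

Section cintegral.
Context d (T : measurableType d) (R : realType) (m : {measure set T -> \bar R}).
Local Notation C := R[i].
Implicit Types f g : T -> C.

Lemma integrable_scale (c : R) (g : T -> R) : m.-integrable setT (EFin \o g) ->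
  m.-integrable setT (EFin \o (fun x => c * g x)).
Proof.
move=> ig; rewrite (_ : _ \o _ = (fun x => c%:E * (EFin \o g) x)%E) //.
exact: integrableZl.
Qed.

Lemma cintegrable_meas f : cintegrable m f -> cmeasurable f.
Proof.
by move=> [/measurable_int/measurable_EFinP ? /measurable_int/measurable_EFinP ?]; split.
Qed.

Lemma cintegrable_le f (g : T -> R) : cmeasurable f ->
  m.-integrable setT (EFin \o g) -> (forall x, cmod (f x) <= g x) -> cintegrable m f.
Proof.
move=> [f1 f2] ig fg; split.
  apply: (le_integrable _ _ _ ig) => //; first exact/measurable_EFinP.
  move=> x _; rewrite /= lee_fin (le_trans (Re_le_cmod _)) //.
  by rewrite (le_trans (fg x)) // ler_norm.
apply: (le_integrable _ _ _ ig) => //; first exact/measurable_EFinP.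
move=> x _; rewrite /= lee_fin (le_trans (Im_le_cmod _)) //.
by rewrite (le_trans (fg x)) // ler_norm.
Qed.

Lemma cintegrable_cmod f : cintegrable m f ->
  m.-integrable setT (fun x => (cmod (f x))%:E).
Proof.
move=> fi; have mf := cintegrable_meas fi; case: fi => f1 f2.
apply: (@le_integrable _ _ _ m setT _ _
  (fun x => (`|Re (f x)| + `|Im (f x)|)%:E)) => //.
- by apply/measurable_EFinP; exact: measurable_cmod.
- move=> x _; rewrite /= lee_fin.
  by rewrite ger0_norm ?cmod_ge0 // ger0_norm ?addr_ge0 // cmod_le_ReIm.
- exact: (integrableD measurableT (integrable_abse f1) (integrable_abse f2)).
Qed.

Lemma cintegrableP f : cintegrable m f <->
  cmeasurable f /\ (\int[m]_x (cmod (f x))%:E < +oo)%E.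
Proof.
split=> [fi|[mf foo]].
  split; first exact: cintegrable_meas.
  have /integrableP[_] := cintegrable_cmod fi.
  by congr (_ < _)%E; apply: eq_integral => x _ /=; rewrite ger0_norm ?cmod_ge0.
apply: (@cintegrable_le _ (fun x => cmod (f x))) => //; apply/integrableP; split.
  by apply/measurable_EFinP; exact: measurable_cmod.
by move: foo; congr (_ < _)%E; apply: eq_integral => x _ /=; rewrite ger0_norm ?cmod_ge0.
Qed.

Lemma cintegrableD f g : cintegrable m f -> cintegrable m g ->
  cintegrable m (fun x => f x + g x).
Proof.
move=> [f1 f2] [g1 g2]; split.
  under eq_fun do rewrite cReD EFinD; exact: integrableD.
under eq_fun do rewrite cImD EFinD; exact: integrableD.
Qed.

Lemma cintegrableZ (c : C) f : cintegrable m f -> cintegrable m (fun x => c * f x).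
Proof.
move=> fi; apply: (@cintegrable_le _ (fun x => cmod c * cmod (f x))).
- by apply: cmeasurableM; [exact: cmeasurable_cst|exact: cintegrable_meas].
- by apply: integrable_scale; exact: cintegrable_cmod.
- by move=> x; rewrite cmodM.
Qed.

Lemma cintegrable_phase f (r : T -> R) : cintegrable m f -> measurable_fun setT r ->
  cintegrable m (fun x => f x * expi (r x)).
Proof.
move=> fi mr; apply: (cintegrable_le _ (cintegrable_cmod fi)).
  by apply: cmeasurableM; [exact: cintegrable_meas|exact: cmeasurable_expi].
by move=> x; rewrite cmodM cmod_expi mulr1.
Qed.

Lemma cintegrableJ f : cintegrable m f -> cintegrable m (fun x => conjc (f x)).
Proof.
move=> fi; apply: (cintegrable_le (cmeasurableJ (cintegrable_meas fi)) (cintegrable_cmod fi)).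
by move=> x; rewrite cmodJ.
Qed.

Lemma cintegrableN f : cintegrable m f -> cintegrable m (fun x => - f x).
Proof.
move=> fi; apply: (cintegrable_le (cmeasurableN (cintegrable_meas fi)) (cintegrable_cmod fi)).
by move=> x; rewrite cmodN.
Qed.

Lemma cintegrable0 : cintegrable m (fun=> 0).
Proof. by split; rewrite /=; exact: integrable0. Qed.

Lemma eq_cintegral f g : (forall x, f x = g x) -> cintegral m f = cintegral m g.
Proof. by move=> /funext ->. Qed.

Lemma cintegralD f g : cintegrable m f -> cintegrable m g ->
  cintegral m (fun x => f x + g x) = cintegral m f + cintegral m g.
Proof.
move=> [f1 f2] [g1 g2]; apply: complex_eqP; rewrite ?cReD ?cImD /=.
  by under eq_Rintegral do rewrite cReD; rewrite RintegralD.
by under eq_Rintegral do rewrite cImD; rewrite RintegralD.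
Qed.

Lemma cintegralZ (c : C) f : cintegrable m f ->
  cintegral m (fun x => c * f x) = c * cintegral m f.
Proof.
move=> [f1 f2]; apply: complex_eqP; rewrite ?cReM ?cImM /=.
  under eq_Rintegral do rewrite cReM.
  rewrite RintegralB ?RintegralZl //; exact: integrable_scale.
under eq_Rintegral do rewrite cImM.
rewrite RintegralD ?RintegralZl //; exact: integrable_scale.
Qed.

Lemma cintegralZr (c : C) f : cintegrable m f ->
  cintegral m (fun x => f x * c) = cintegral m f * c.
Proof.
by move=> fi; rewrite mulrC -cintegralZ //; apply: eq_cintegral => x; rewrite mulrC.
Qed.

Lemma cintegralN f : cintegrable m f -> cintegral m (fun x => - f x) = - cintegral m f.
Proof.
move=> fi; rewrite -mulN1r -cintegralZ //.
by apply: eq_cintegral => x; rewrite mulN1r.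
Qed.

Lemma cintegralB f g : cintegrable m f -> cintegrable m g ->
  cintegral m (fun x => f x - g x) = cintegral m f - cintegral m g.
Proof.
by move=> fi gi; rewrite cintegralD ?cintegralN //; exact: cintegrableN.
Qed.

Lemma cintegralJ f : cintegrable m f ->
  cintegral m (fun x => conjc (f x)) = conjc (cintegral m f).
Proof.
move=> [f1 f2]; apply: complex_eqP; rewrite ?cReJ ?cImJ /=.
  by under eq_Rintegral do rewrite cReJ.
under eq_Rintegral do rewrite cImJ -mulN1r.
by rewrite RintegralZl // mulN1r.
Qed.

Lemma cintegral0 : cintegral m (fun=> 0) = 0.
Proof.
by apply: complex_eqP; rewrite /= /Rintegral integral0_eq //.
Qed.

Lemma cintegral_real (r : T -> R) :
  cintegral m (fun x => (r x)%:C) = (Rintegral m setT r)%:C.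
Proof.
by apply: complex_eqP => //=; rewrite /Rintegral integral0_eq.
Qed.

(** Turning the integral to the positive real axis reduces the triangle
    inequality to the monotonicity of the real integral. *)
Lemma cmod_cintegral f : cintegrable m f ->
  cmod (cintegral m f) <= Rintegral m setT (fun x => cmod (f x)).
Proof.
move=> fi; set z := cintegral m f.
have [z0|z0] := eqVneq (cmod z) 0.
  by rewrite z0; apply: Rintegral_ge0 => x _; exact: cmod_ge0.
have zpos : 0 < cmod z by rewrite lt_neqAle eq_sym z0 cmod_ge0.
rewrite -(ler_pM2l zpos) -expr2 sqr_cmod.
have [w wz ->] : exists2 w, cmod w = cmod z & sqmod z = Re (cintegral m (fun x => w * f x)).
  by exists (conjc z); [exact: cmodJ|rewrite sqmodE mulrC cintegralZ].
rewrite [leLHS]/= -RintegralZl //; last exact: cintegrable_cmod.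
apply: le_Rintegral => //.
- by case: (cintegrableZ w fi).
- by apply: integrable_scale; exact: cintegrable_cmod.
- by move=> x _; rewrite (le_trans (ler_norm _)) // (le_trans (Re_le_cmod _)) // cmodM wz.
Qed.

Lemma cintegral_ae f g : cmeasurable f -> cmeasurable g ->
  {ae m, forall x, f x = g x} -> cintegral m f = cintegral m g.
Proof.
move=> [f1 f2] [g1 g2] fg; apply: complex_eqP; rewrite /= /Rintegral; congr fine.
  apply: ae_eq_integral => //; [exact/measurable_EFinP|exact/measurable_EFinP|].
  by apply: filterS fg => x /= ->.
apply: ae_eq_integral => //; [exact/measurable_EFinP|exact/measurable_EFinP|].
by apply: filterS fg => x /= ->.
Qed.

Lemma cintegral_dominated (fs : nat -> T -> C) f (g : T -> R) :
  (forall k, cmeasurable (fs k)) -> cmeasurable f ->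
  m.-integrable setT (EFin \o g) ->
  (forall k x, cmod (fs k x) <= g x) ->
  (forall x, cmod (fs k x - f x) @[k --> \oo] --> (0 : R)) ->
  cmod (cintegral m (fs k) - cintegral m f) @[k --> \oo] --> (0 : R).
Proof.
move=> mfs mf ig fsg fsf.
have fg x : cmod (f x) <= g x.
  apply/ler_addgt0Pr => e e0.
  have /cvgrPdist_lt/(_ e e0)[N _ /(_ N (leqnn N))] := fsf x.
  rewrite sub0r normrN ger0_norm ?cmod_ge0 // cmodBC => h.
  by rewrite (le_trans (cmod_sub _ (fs N x))) // addrC lerD // ltW.
have ifs k : cintegrable m (fs k) by exact: cintegrable_le (fsg k).
have if_ : cintegrable m f by exact: cintegrable_le fg.
have i2g : m.-integrable setT (fun x => (2 * g x)%:E) by exact: (integrable_scale 2 ig).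
have h := @dominated_convergence _ _ _ m setT measurableT
  (fun k x => (cmod (fs k x - f x))%:E) (cst 0%E) (fun x => (2 * g x)%:E)
  (fun k => (measurable_EFinP _ _).2 (measurable_cmod (cmeasurableB (mfs k) mf)))
  (measurable_cst _) _ i2g.
have {}h : (\int[m]_x (cmod (fs k x - f x))%:E)%E @[k --> \oo] --> (0:R)%:E.
  rewrite (_ : (0:R)%:E = \int[m]_x (cst 0 x)%E)%E; last by rewrite integral0_eq.
  have [||_ _ //] := h.
  - apply: nearW => x _; apply: cvg_EFin; first exact: nearW.
    exact: fsf.
  - apply: nearW => x k _; rewrite /= lee_fin ger0_norm ?cmod_ge0 //.
    by rewrite (le_trans (cmodB _ _)) // mulr2n mulrDl mul1r lerD.
apply: (@squeeze_cvgr _ _ _ _ (cst 0) (fun k => fine (\int[m]_x (cmod (fs k x - f x))%:E)%E)).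
- apply: nearW => k; rewrite cmod_ge0 /= -cintegralB // cmod_cintegral //.
  by apply: cintegrableD => //; exact: cintegrableN.
- exact: cvg_cst.
- exact: fine_cvg.
Qed.

End cintegral.

(** * Square integrable functions *)

Section L2_space.
Context d (T : measurableType d) (R : realType) (m : {measure set T -> \bar R}).
Local Notation C := R[i].
Local Notation L := (L2 m).
Local Notation nm := (hnorm (L2 m)).
Implicit Types f g : T -> C^o.

Lemma hdom_L2P f : hdom L f <->
  cmeasurable f /\ m.-integrable setT (fun x => (sqmod (f x))%:E).
Proof.
have E : (\int[m]_x (Re (`|f x| ^+ 2))%:E = \int[m]_x `|(sqmod (f x))%:E|)%E.
  by apply: eq_integral => x _; rewrite Re_norm2 gee0_abs // lee_fin sqmod_ge0.
rewrite /L2 /= E; split=> -[mf h]; split => //.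
  by apply/integrableP; split => //; apply/measurable_EFinP; exact: measurable_sqmod.
by case/integrableP : h.
Qed.

Lemma L2_meas f : hdom L f -> cmeasurable f. Proof. by case. Qed.

Lemma L2_sqmod f : hdom L f -> m.-integrable setT (EFin \o (fun x => sqmod (f x))).
Proof. by move=> /hdom_L2P[]. Qed.

Lemma hdom_L2_le f (g : T -> R) : cmeasurable f ->
  m.-integrable setT (EFin \o g) -> {ae m, forall x, sqmod (f x) <= g x} -> hdom L f.
Proof.
move=> mf ig fg; split => //.
case/integrableP: ig => mg; apply: le_lt_trans.
apply: ae_ge0_le_integral => //.
- by move=> x _; rewrite Re_norm2 lee_fin sqmod_ge0.
- apply/measurable_EFinP; rewrite (_ : (fun _ => _) = (fun x => sqmod (f x))).
    exact: measurable_sqmod.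
  by apply/funext => x; rewrite Re_norm2.
- exact: measurableT_comp.
- by apply: filterS fg => x fgx _; rewrite Re_norm2 lee_fin (le_trans fgx) // ler_norm.
Qed.

Lemma sqmodD (x y : C) : sqmod (x + y) <= 2 * (sqmod x + sqmod y).
Proof.
rewrite /sqmod cReD cImD.
have := sqr_ge0 (Re x - Re y); have := sqr_ge0 (Im x - Im y).
by rewrite !sqrrB !sqrrD; lra.
Qed.

Lemma cmodM_le (x y : C) : cmod (x * y) <= sqmod x + sqmod y.
Proof.
rewrite cmodM -!sqr_cmod; have := sqr_ge0 (cmod x - cmod y).
have := sqr_ge0 (cmod x); have := sqr_ge0 (cmod y).
by rewrite sqrrB; lra.
Qed.

Lemma hdom_L2D f g : hdom L f -> hdom L g -> hdom L (f + g).
Proof.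
move=> fL gL; apply: (@hdom_L2_le _ (fun x => 2 * (sqmod (f x) + sqmod (g x)))).
- by apply: cmeasurableD; exact: L2_meas.
- apply: integrable_scale.
  exact: (integrableD measurableT (L2_sqmod fL) (L2_sqmod gL)).
- by apply: nearW => x; exact: sqmodD.
Qed.

Lemma L2_bounded_mul (b : T -> C) f (M : R) : hdom L f -> cmeasurable b ->
  {ae m, forall x, cmod (b x) <= M} -> hdom L (fun x => b x * f x).
Proof.
move=> fL mb bM; apply: (@hdom_L2_le _ (fun x => M ^+ 2 * sqmod (f x))).
- by apply: cmeasurableM => //; exact: L2_meas.
- by apply: integrable_scale; exact: L2_sqmod.
- apply: filterS bM => x bM; rewrite sqmodM ler_wpM2r ?sqmod_ge0 //.
  by rewrite -sqr_cmod ler_sqr ?nnegrE ?cmod_ge0 // (le_trans _ bM) // cmod_ge0.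
Qed.

Lemma hdom_L2Z (a : C) f : hdom L f -> hdom L (a *: f).
Proof.
move=> fL; apply: (@L2_bounded_mul (fun=> a) f (cmod a)) => //.
exact: nearW.
Qed.

Lemma hdom_L20 : hdom L 0.
Proof.
split; first exact: cmeasurable_cst.
rewrite integral0_eq // => x _.
by rewrite Re_norm2 /sqmod /= expr0n /= addr0.
Qed.

Lemma L2_mul_integrable f g : hdom L f -> hdom L g ->
  cintegrable m (fun x => f x * conjc (g x)).
Proof.
move=> fL gL; apply: (@cintegrable_le _ _ _ _ _ (fun x => sqmod (f x) + sqmod (g x))).
- by apply: cmeasurableM; [exact: L2_meas|apply: cmeasurableJ; exact: L2_meas].
- exact: (integrableD measurableT (L2_sqmod fL) (L2_sqmod gL)).
- by move=> x; rewrite (le_trans (cmodM_le _ _)) // lerD2l -!sqr_cmod cmodJ.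
Qed.

Lemma L2_formE f : hform L f f = (Rintegral m setT (fun x => sqmod (f x)))%:C.
Proof. by rewrite -cintegral_real; apply: eq_cintegral => x; rewrite mul_conjc. Qed.

Lemma L2_prehilbert : prehilbert L.
Proof.
split.
- split; first exact: hdom_L20.
  by move=> a u v uL vL; apply: hdom_L2D => //; exact: hdom_L2Z.
- move=> a u v w uL vL wL; rewrite -cintegralZ; last exact: L2_mul_integrable.
  rewrite -cintegralD; [|by apply: cintegrableZ; exact: L2_mul_integrable
    |exact: L2_mul_integrable].
  by apply: eq_cintegral => x /=; rewrite mulrDl mulrA.
- move=> u v uL vL; rewrite -cintegralJ; last exact: L2_mul_integrable.
  by apply: eq_cintegral => x; rewrite rmorphM /= conjcK mulrC.
- move=> u uL; rewrite L2_formE ler0c; apply: Rintegral_ge0 => x _; exact: sqmod_ge0.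
Qed.

Lemma sqr_L2norm f : nm f ^+ 2 = Rintegral m setT (fun x => sqmod (f x)).
Proof.
rewrite sqr_sqrtr L2_formE //=; apply: Rintegral_ge0 => x _; exact: sqmod_ge0.
Qed.

Lemma sqr_L2norm_E f : hdom L f -> ((nm f ^+ 2)%:E = \int[m]_x (sqmod (f x))%:E)%E.
Proof.
move=> fL; rewrite sqr_L2norm /Rintegral fineK //.
exact: integrable_fin_num (L2_sqmod fL).
Qed.

Lemma L2_norm_le f (g : T -> R) : hdom L f -> m.-integrable setT (EFin \o g) ->
  (forall x, 0 <= g x) -> {ae m, forall x, sqmod (f x) <= g x} ->
  nm f ^+ 2 <= Rintegral m setT g.
Proof.
move=> fL ig g0 fg; rewrite -lee_fin sqr_L2norm_E //.
rewrite /Rintegral fineK; last exact: integrable_fin_num ig.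
apply: ae_ge0_le_integral => //.
- by move=> x _; rewrite lee_fin sqmod_ge0.
- by apply/measurable_EFinP; exact: measurable_sqmod (L2_meas fL).
- by move=> x _; rewrite /= lee_fin.
- exact: measurable_int ig.
- by apply: filterS fg => x /= fgx _; rewrite lee_fin.
Qed.

Lemma L2_bounded_norm (b : T -> C) f (M : R) : hdom L f -> cmeasurable b -> 0 <= M ->
  {ae m, forall x, cmod (b x) <= M} -> nm (fun x => b x * f x) <= M * nm f.
Proof.
move=> fL mb M0 bM; have bfL := L2_bounded_mul fL mb bM.
rewrite -(@ler_pXn2r _ 2) // ?nnegrE ?mulr_ge0 ?hnorm_ge0 // exprMn.
rewrite (sqr_L2norm f).
rewrite -RintegralZl //; last exact: L2_sqmod.
apply: L2_norm_le => //.
- by apply: integrable_scale; exact: L2_sqmod.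
- by move=> x; rewrite mulr_ge0 ?sqr_ge0 ?sqmod_ge0.
- apply: filterS bM => x bM; rewrite sqmodM ler_wpM2r ?sqmod_ge0 //.
  by rewrite -sqr_cmod ler_sqr ?nnegrE ?cmod_ge0.
Qed.

Lemma sqmod_eq0 (z : C) : sqmod z = 0 -> z = 0.
Proof. by rewrite -sqr_cmod => /eqP; rewrite sqrf_eq0 => /eqP/cmod_eq0. Qed.

Lemma L2_heqP f g : hdom L f -> hdom L g ->
  heq L f g <-> {ae m, forall x, f x = g x}.
Proof.
move=> fL gL; have fgL := hdomB L2_prehilbert fL gL.
have mfg : measurable_fun setT (fun x => (sqmod ((f - g) x))%:E).
  by apply/measurable_EFinP; exact: measurable_sqmod (L2_meas fgL).
have -> : heq L f g <-> (\int[m]_x `|(sqmod ((f - g) x))%:E| = 0)%E.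
  rewrite (_ : (\int[m]_x _)%E = ((nm (f - g)) ^+ 2)%:E); last first.
    rewrite sqr_L2norm_E //; apply: eq_integral => x _.
    by rewrite gee0_abs // lee_fin sqmod_ge0.
  by rewrite /heq; split=> [->|[/eqP]]; [rewrite expr0n|rewrite sqrf_eq0 => /eqP].
split=> [/(ae_eq_integral_abs m measurableT mfg)|fg].
  by apply: filterS => x /= /(_ Logic.I) [/sqmod_eq0/subr0_eq].
apply/(ae_eq_integral_abs m measurableT mfg); apply: filterS fg => x /= fg _.
by rewrite /sqmod -[(f - g) x]/(f x - g x) fg subrr /= expr0n /= addr0.
Qed.

Lemma L2_norm_eq f g : hdom L f -> hdom L g -> {ae m, forall x, cmod (f x) = cmod (g x)} ->
  nm f = nm g.
Proof.
move=> fL gL fg; apply/eqP; rewrite -(@eqrXn2 _ 2) ?hnorm_ge0 //.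
rewrite -eqe !sqr_L2norm_E //; apply/eqP/ae_eq_integral => //.
- by apply/measurable_EFinP; exact: measurable_sqmod (L2_meas fL).
- by apply/measurable_EFinP; exact: measurable_sqmod (L2_meas gL).
- by apply: filterS fg => x /= fg _; rewrite -!sqr_cmod fg.
Qed.

End L2_space.

(** * Convergence in L2 *)

Section L2_limits.
Context d (T : measurableType d) (R : realType) (m : {measure set T -> \bar R}).
Local Notation C := R[i].
Local Notation L := (L2 m).
Local Notation nm := (hnorm (L2 m)).
Implicit Types f : T -> C^o.
Let LP := L2_prehilbert m.

Lemma cmod_le_cvg (z : nat -> C) (l : C) (M : R) : (forall k, cmod (z k) <= M) ->
  cmod (z k - l) @[k --> \oo] --> (0 : R) -> cmod l <= M.
Proof.
move=> zM zl; apply/ler_addgt0Pr => e e0.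
have /cvgrPdist_lt/(_ e e0)[N _ /(_ N (leqnn N))] := zl.
rewrite sub0r normrN ger0_norm ?cmod_ge0 // cmodBC => h.
by rewrite (le_trans (cmod_sub _ (z N))) // addrC lerD // ltW.
Qed.

Lemma sqmod_cvg (z : nat -> C) (l : C) :
  cmod (z k - l) @[k --> \oo] --> (0 : R) -> sqmod (z k) @[k --> \oo] --> sqmod l.
Proof.
move=> zl.
have zl' : cmod (z k) @[k --> \oo] --> cmod l.
  apply/cvgrPdist_le => e e0; move/cvgrPdist_le/(_ e e0): zl.
  apply: filterS => k; rewrite sub0r normrN ger0_norm ?cmod_ge0 // => h.
  rewrite ler_norml; have := cmod_sub l (z k); have := cmod_sub (z k) l.
  by rewrite (cmodBC l); move: h; lra.
rewrite -sqr_cmod; under eq_fun do rewrite -sqr_cmod.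
rewrite expr2; under eq_fun do rewrite expr2.
exact: cvgM.
Qed.

Lemma sqrt_cvg0 (u : nat -> R) : (forall k, 0 <= u k) ->
  u k ^+ 2 @[k --> \oo] --> (0 : R) -> u k @[k --> \oo] --> (0 : R).
Proof.
move=> u0 /cvgrPdist_lt h; apply/cvgrPdist_lt => e e0.
have e2 : 0 < e ^+ 2 by rewrite exprn_gt0.
apply: filterS (h _ e2) => k; rewrite !sub0r !normrN !ger0_norm ?sqr_ge0 //.
by rewrite ltr_pXn2r ?nnegrE // ltW.
Qed.

Lemma L2_dominated (fs : nat -> T -> C^o) f (g : T -> R) :
  (forall k, cmeasurable (fs k)) -> cmeasurable f ->
  m.-integrable setT (EFin \o (fun x => g x ^+ 2)) ->
  {ae m, forall x, (forall k, cmod (fs k x) <= g x) /\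
     (cmod (fs k x - f x) @[k --> \oo] --> (0 : R))} ->
  [/\ forall k, hdom L (fs k), hdom L f &
      nm (fs k - f) @[k --> \oo] --> (0 : R)].
Proof.
move=> mfs mf ig H.
have sq (z : C) (c : R) : cmod z <= c -> sqmod z <= c ^+ 2.
  move=> zc; rewrite -sqr_cmod ler_sqr ?nnegrE ?cmod_ge0 //.
  by rewrite (le_trans _ zc) // cmod_ge0.
have fsL k : hdom L (fs k).
  by apply: (hdom_L2_le (mfs k) ig); apply: filterS H => x [+ _]; move=> /(_ k)/sq.
have fL : hdom L f.
  apply: (hdom_L2_le mf ig); apply: filterS H => x [gx cx]; apply: sq.
  exact: cmod_le_cvg gx cx.
split=> //; apply: sqrt_cvg0; first by move=> k; exact: hnorm_ge0.
have i4 : m.-integrable setT (EFin \o (fun x => 4 * g x ^+ 2)).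
  exact: integrable_scale.
have mk k : measurable_fun setT (fun x => (sqmod ((fs k - f) x))%:E).
  by apply/measurable_EFinP; apply: measurable_sqmod; exact: cmeasurableB.
have h := @dominated_convergence _ _ _ m setT measurableT
  (fun k x => (sqmod ((fs k - f) x))%:E) (cst 0%E) (fun x => (4 * g x ^+ 2)%:E)
  mk (measurable_cst _) _ i4.
suff : (\int[m]_x (sqmod ((fs k - f) x))%:E)%E @[k --> \oo] --> (0:R)%:E.
  move=> /fine_cvg; apply: cvg_trans; apply: near_eq_cvg; apply: nearW => k.
  by rewrite sqr_L2norm.
rewrite (_ : (0:R)%:E = \int[m]_x (cst 0 x)%E)%E; last by rewrite integral0_eq.
have [||_ _ //] := h.
- apply: filterS H => x [_ cx] _; apply: cvg_EFin; first exact: nearW.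
  have s0 : sqmod (0 : C) = 0 by rewrite /sqmod /= expr0n /= addr0.
  rewrite -[X in _ --> X]s0.
  by apply: (@sqmod_cvg (fun k => fs k x - f x)); under eq_fun do rewrite subr0.
- apply: filterS H => x [gx cx] k _; rewrite gee0_abs ?lee_fin ?sqmod_ge0 //.
  have := sq _ _ (gx k); have := sq _ _ (cmod_le_cvg gx cx).
  have := sqmodD (fs k x) (- f x); rewrite -[(fs k - f) x]/(fs k x - f x).
  by rewrite -[sqmod (- f x)]sqr_cmod cmodN sqr_cmod; lra.
Qed.

Lemma limn_einf_le (u : nat -> \bar R) (c : \bar R) : (forall k, (u k <= c)%E) ->
  (limn_einf u <= c)%E.
Proof.
move=> uc; rewrite limn_einf_lim; apply: lime_le; first exact: is_cvg_einfs.
apply: nearW => k; rewrite /einfs /= (le_trans _ (uc k)) //.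
by apply: ereal_inf_lbound; exists k => /=.
Qed.

(** Fatou for the squared moduli; it takes the place of dominated convergence
    when only the norms are under control. *)
Lemma L2_fatou (fs : nat -> T -> C^o) f (c : R) : (forall k, hdom L (fs k)) ->
  cmeasurable f -> (forall k, nm (fs k) <= c) ->
  {ae m, forall x, cmod (fs k x - f x) @[k --> \oo] --> (0 : R)} ->
  hdom L f /\ nm f <= c.
Proof.
move=> fsL mf fsc H.
have c0 : 0 <= c by rewrite (le_trans _ (fsc 0%N)) // hnorm_ge0.
have mk k : measurable_fun setT (fun x => (sqmod (fs k x))%:E).
  by apply/measurable_EFinP; apply: measurable_sqmod; exact: L2_meas.
have mf2 : measurable_fun setT (fun x => (sqmod (f x))%:E).
  by apply/measurable_EFinP; exact: measurable_sqmod.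
have key : (\int[m]_x (sqmod (f x))%:E <= (c ^+ 2)%:E)%E.
  have -> : (\int[m]_x (sqmod (f x))%:E)%E =
      (\int[m]_x limn_einf (fun k => (sqmod (fs k x))%:E))%E.
    apply: ae_eq_integral => //.
      rewrite (_ : (fun _ => _) =
          (fun x => - limn_esup (-%E \o (fun k => (sqmod (fs k x))%:E)))%E); last first.
        by apply/funext => x; rewrite limn_esupN oppeK.
      apply: measurableT_comp => //; apply: measurable_fun_limn_esup => k.
      exact: measurableT_comp.
    apply: filterS H => x cx _; symmetry; apply: (@cvg_limn_einf_sup _ _ _ _).1.
    by apply: cvg_EFin; [exact: nearW|exact: sqmod_cvg].
  apply: le_trans (fatou m measurableT mk _) _.
    by move=> k x _; rewrite lee_fin sqmod_ge0.
  apply: limn_einf_le => k; rewrite -sqr_L2norm_E // lee_fin.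
  by rewrite ler_sqr ?nnegrE ?hnorm_ge0.
have fL : hdom L f.
  apply/hdom_L2P; split=> //; apply/integrableP; split=> //.
  apply: le_lt_trans (ltry (c ^+ 2)); move: key; congr (_ <= _)%E.
  by apply: eq_integral => x _; rewrite gee0_abs // lee_fin sqmod_ge0.
split=> //; rewrite -(@ler_pXn2r _ 2) ?nnegrE ?hnorm_ge0 //.
by rewrite -lee_fin sqr_L2norm_E.
Qed.

Lemma geometric_increments (a : nat -> R) (K : R) : 0 <= K ->
  (forall j, `|a j.+1 - a j| <= K * (2^-1) ^+ j) -> cvgn a.
Proof.
move=> K0 aK.
have : cvgn (series (telescope a)).
  apply: normed_cvg; apply: (@series_le_cvg _ _ (geometric K (2^-1))).
  - by move=> j /=.
  - by move=> j; rewrite /geometric /= mulr_ge0 // exprn_ge0.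
  - by move=> j; rewrite /geometric /telescope /=; exact: aK.
  - apply: is_cvg_geometric_series; rewrite ger0_norm //; lra.
rewrite telescopeK => /(is_cvgD (is_cvg_cst (a 0%N))).
rewrite (_ : _ + _ = a) //; apply/funext => k.
by rewrite -[LHS]/(a 0 + (a k - a 0)) addrC subrK.
Qed.

(** Completeness: along a rapidly converging subsequence the increments are
    summable almost everywhere, because the series of the rescaled squares
    [4^j |u_(j+1) - u_j|^2] has finite integral. *)
Lemma L2_fast_cvg (us : nat -> T -> C^o) : (forall j, hdom L (us j)) ->
  (forall j, nm (us j.+1 - us j) ^+ 2 <= (4 ^- j) / (2 ^ j.+1)%:R) ->
  exists2 f, cmeasurable f &
    {ae m, forall x, cmod (us j x - f x) @[j --> \oo] --> (0 : R)}.
Proof.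
move=> usL usd.
pose D j x : C := us j.+1 x - us j x.
have mD j : cmeasurable (D j) by apply: cmeasurableB; exact: L2_meas.
pose h j x : \bar R := (4 ^+ j * sqmod (D j x))%:E.
have h0 j x : (0 <= h j x)%E by rewrite lee_fin mulr_ge0 ?sqmod_ge0 // exprn_ge0.
have mh j : measurable_fun setT (h j).
  by apply/measurable_EFinP; apply: measurable_funM => //; exact: measurable_sqmod.
pose S x := (\sum_(0 <= j <oo) h j x)%E.
have mS : measurable_fun setT S.
  by apply: (@ge0_emeasurable_sum _ _ _ setT h xpredT) => //.
have S0 x : (0 <= S x)%E by exact: nneseries_ge0.
have iS : m.-integrable setT S.
  apply/integrableP; split=> //.
  rewrite (_ : (\int[m]_x `|S x|)%E = (\int[m]_x S x)%E); last first.
    by apply: eq_integral => x _; rewrite gee0_abs.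
  rewrite /S integral_nneseries // (le_lt_trans _ (ltry 1)) //.
  apply: le_trans (epsilon_trick0 xpredT (@ler01 R)).
  apply: lee_nneseries => [j _ _|j _]; first exact: integral_ge0.
  rewrite /h (_ : (\int[m]_x _)%E = (4 ^+ j * nm (us j.+1 - us j) ^+ 2)%:E); last first.
    rewrite EFinM sqr_L2norm_E; last exact: hdomB.
    under eq_integral do rewrite EFinM.
    rewrite ge0_integralZl ?lee_fin ?exprn_ge0 //.
      apply/measurable_EFinP; exact: measurable_sqmod.
    by move=> x _; rewrite lee_fin sqmod_ge0.
  rewrite lee_fin (le_trans (ler_wpM2l _ (usd j))) ?exprn_ge0 //.
  by rewrite mulrA divff ?expf_neq0 // mul1r.
pose A := [set x | (S x < +oo)%E].
have mA : measurable A.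
  by rewrite -[A]setTI; exact: (emeasurable_fun_infty_o measurableT mS).
have aeA : {ae m, forall x, A x}.
  apply: filterS (integrable_ae measurableT iS) => x /(_ Logic.I).
  by rewrite /A /= => /fin_numPlt/andP[].
have cv x : A x -> cvgn (fun j => Re (us j x)) /\ cvgn (fun j => Im (us j x)).
  move=> Ax; pose K := Num.sqrt (fine (S x)).
  have DK j : cmod (D j x) <= K * (2^-1) ^+ j.
    have hj : 4 ^+ j * sqmod (D j x) <= fine (S x).
      rewrite -lee_fin fineK; last by rewrite ge0_fin_numE.
      apply: le_trans (nneseries_lim_ge (m := 0%N) j.+1 _) => //.
      by rewrite big_nat_recr //= leeDr // sume_ge0.
    rewrite -[leLHS]ger0_norm ?cmod_ge0 // -sqrtr_sqr.
    have -> : K * (2^-1) ^+ j = Num.sqrt (fine (S x) * ((2^-1) ^+ j) ^+ 2).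
      by rewrite sqrtrM ?fine_ge0 // sqrtr_sqr ger0_norm ?exprn_ge0.
    rewrite ler_wsqrtr // sqr_cmod -exprM mulnC exprM exprVn -exprVn.
    have -> : ((2^-1 : R) ^+ 2) = 4^-1 by rewrite exprVn; congr (_^-1); rewrite -natrX.
    by rewrite exprVn ler_pdivlMr ?exprn_gt0 // mulrC.
  split; apply: (@geometric_increments _ K); rewrite ?sqrtr_ge0 // => j.
    by rewrite -cReB (le_trans (Re_le_cmod _)) // DK.
  by rewrite -cImB (le_trans (Im_le_cmod _)) // DK.
pose v j x : C := us j x * (\1_A x)%:C.
have mv j : cmeasurable (v j).
  apply: cmeasurableM; first exact: L2_meas.
  by apply: cmeasurable_real; exact: measurable_indic.
have vE j x : A x -> v j x = us j x by move=> Ax; rewrite /v indicE mem_set // mulr1.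
have v0 j x : ~ A x -> v j x = 0 by move=> Ax; rewrite /v indicE memNset // mulr0.
have cvv x : cvgn (fun j => Re (v j x)) /\ cvgn (fun j => Im (v j x)).
  have [Ax|nAx] := pselect (A x).
    by under eq_fun do rewrite vE //; under [X in _ /\ cvgn X]eq_fun do rewrite vE //; exact: cv.
  under eq_fun do rewrite v0 //; under [X in _ /\ cvgn X]eq_fun do rewrite v0 //=.
  by split; exact: is_cvg_cst.
exists (fun x => limn (fun j => Re (v j x)) +i* limn (fun j => Im (v j x))).
  split=> /=.
    apply: (@measurable_fun_cvg _ _ _ setT (fun j x => Re (v j x))) => [j|x _].
      by case: (mv j).
    by case: (cvv x).
  apply: (@measurable_fun_cvg _ _ _ setT (fun j x => Im (v j x))) => [j|x _].
    by case: (mv j).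
  by case: (cvv x).
apply: filterS aeA => x Ax.
set l1 := limn _; set l2 := limn _.
have [c1 c2] := cvv x.
have c1' : `|Re (v j x) - l1| @[j --> \oo] --> (0 : R).
  by rewrite -(normr0 R^o) -(subrr l1); apply: cvg_norm; apply: cvgB => //; exact: cvg_cst.
have c2' : `|Im (v j x) - l2| @[j --> \oo] --> (0 : R).
  by rewrite -(normr0 R^o) -(subrr l2); apply: cvg_norm; apply: cvgB => //; exact: cvg_cst.
apply: (@squeeze_cvgr _ _ _ _ (cst 0) (fun j => `|Re (v j x) - l1| + `|Im (v j x) - l2|)).
- apply: nearW => j; rewrite cmod_ge0 /= -vE // (le_trans (cmod_le_ReIm _)) //.
  by rewrite cReB cImB.
- exact: cvg_cst.
- by rewrite -(addr0 (0 : R)); apply: cvgD.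
Qed.

(** A rapidly converging subsequence has a pointwise limit; Fatou bounds the
    distance of the whole Cauchy sequence to it. *)
Lemma L2_complete (us : nat -> T -> C^o) : cauchy_seqs L us ->
  exists2 f, hdom L f & nm (us k - f) @[k --> \oo] --> (0 : R).
Proof.
move=> [usL uc].
pose e j : R := Num.sqrt ((4 ^- j) / (2 ^ j.+1)%:R).
have e0 j : 0 < e j by rewrite sqrtr_gt0 divr_gt0 // ?invr_gt0 ?exprn_gt0 // ltr0n expn_gt0.
have /choice[N NP] j : exists N, forall k l, (N <= k)%N -> (N <= l)%N ->
    nm (us k - us l) < e j by exact: uc.
pose n := fix n j := if j is j'.+1 then maxn (N j) (n j').+1 else N 0%N.
have nN j : (N j <= n j)%N by case: j => //= j; exact: leq_maxl.
have nS j : (n j < n j.+1)%N by exact: leq_maxr.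
have nle j : (j <= n j)%N by elim: j => // j IH; exact: leq_ltn_trans IH (nS j).
have [|f mf fae] := @L2_fast_cvg (us \o n) (fun j => usL (n j)).
  move=> j; rewrite -[leRHS]sqr_sqrtr; last first.
    by rewrite divr_ge0 // invr_ge0 exprn_ge0.
  rewrite ler_sqr ?nnegrE ?hnorm_ge0 ?sqrtr_ge0 // ltW //.
  by apply: NP => //=; rewrite (leq_trans (nN j)) // ltnW.
have key eps : 0 < eps -> exists M, forall k, (M <= k)%N ->
    hdom L (us k - f) /\ nm (us k - f) <= eps.
  move=> eps0; have [M MP] := uc _ eps0; exists M => k Mk.
  apply: (@L2_fatou (fun j => us k - us (n (j + M)%N))).
  - by move=> j; exact: hdomB.
  - by apply: cmeasurableB => //; exact: L2_meas.
  - move=> j; apply/ltW/MP => //.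
    by rewrite (leq_trans _ (nle _)) // leq_addl.
  - apply: filterS fae => x.
    rewrite -(cvg_shiftn M) => h; apply: cvg_trans h; apply: near_eq_cvg; apply: nearW => j.
    rewrite -[RHS]/(cmod ((us k x - us (n (j + M)%N) x) - (us k x - f x))) /=.
    rewrite cmodBC; congr cmod; move: (f x : C) (us k x : C) (us (n (j + M)%N) x : C).
    by move=> a b c; ring.
have fL : hdom L f.
  have [M /(_ M (leqnn M))[h _]] := key 1 ltr01.
  rewrite (_ : f = us M - (us M - f)); first exact: hdomB.
  by rewrite opprB addrC subrK.
exists f => //; apply/cvgrPdist_le => eps eps0; have [M MP] := key _ eps0.
exists M => // k Mk; rewrite sub0r normrN ger0_norm ?hnorm_ge0 //.
by have [] := MP k Mk.
Qed.

End L2_limits.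

(** * Bounded multipliers and density in L2 *)

Section sign_iteration.
Variable R : realType.

Definition sign_step (x : R) : R := (3 * x - x ^+ 3) / 2.

Lemma sign_step_bound (x : R) : `|x| <= 1 -> `|sign_step x| <= 1.
Proof.
rewrite /sign_step !ler_norml => /andP[a b].
have h1 : 0 <= 2 - (3 * x - x ^+ 3).
  rewrite [leRHS](_ : _ = (1 - x) ^+ 2 * (2 + x)); last by ring.
  by rewrite mulr_ge0 ?sqr_ge0 //; lra.
have h2 : 0 <= 2 + (3 * x - x ^+ 3).
  rewrite [leRHS](_ : _ = (1 + x) ^+ 2 * (2 - x)); last by ring.
  by rewrite mulr_ge0 ?sqr_ge0 //; lra.
move: h1 h2; move: (3 * x - x ^+ 3) => y *; apply/andP; split; lra.
Qed.

Lemma iter_sign_bound (x : R) k : `|x| <= 1 -> `|iter k sign_step x| <= 1.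
Proof. by move=> x1; elim: k => // k; exact: sign_step_bound. Qed.

Lemma iter_signN (x : R) k : iter k sign_step (- x) = - iter k sign_step x.
Proof. by elim: k => //= k ->; rewrite /sign_step; field. Qed.

Lemma iter_sign_gt0 (x : R) k : 0 < x -> x <= 1 ->
  x <= iter k sign_step x <= 1 /\ 1 - iter k sign_step x <= (1 - x / 2) ^+ k.
Proof.
move=> x0 x1; elim: k => [|k] /=; first by rewrite expr0 lexx x1; split => //; lra.
move: (iter k _ _) => y [/andP[xy y1] h].
have E : 1 - sign_step y = (1 - y * (1 + y) / 2) * (1 - y).
  by rewrite /sign_step; field.
split.
  have y0 : 0 < y by exact: lt_le_trans xy.
  have h1 : 0 <= 1 - sign_step y.
    rewrite [leRHS](_ : _ = (1 - y) ^+ 2 * (2 + y) / 2); last by rewrite /sign_step; field.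
    by rewrite divr_ge0 ?mulr_ge0 ?sqr_ge0 //; lra.
  have h2 : 0 <= sign_step y - y.
    rewrite [leRHS](_ : _ = y * ((1 - y) * (1 + y)) / 2); last by rewrite /sign_step; field.
    by rewrite divr_ge0 ?mulr_ge0 //; lra.
  move: h1 h2; move: (sign_step y) => z *; apply/andP; split; lra.
have y0 : 0 < y by exact: lt_le_trans xy.
have yy : x <= y * (1 + y) by rewrite mulrDr mulr1 (le_trans xy) // lerDl sqr_ge0.
have yy1 : y * (1 + y) <= 1 * 2 by apply: ler_pM => //; lra.
rewrite E exprS; apply: ler_pM => //; lra.
Qed.

Lemma iter_sign_cvg (x : R) : `|x| <= 1 ->
  iter k sign_step x @[k --> \oo] --> Num.sg x.
Proof.
have pos (y : R) : 0 < y -> y <= 1 -> iter k sign_step y @[k --> \oo] --> (1 : R).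
  move=> y0 y1; apply: (@squeeze_cvgr _ _ _ _ (fun k => 1 - (1 - y / 2) ^+ k) (cst 1)).
  - by apply: nearW => k; have [/andP[_ ->]] := iter_sign_gt0 k y0 y1; rewrite /= andbT; lra.
  - rewrite -[X in _ --> X](subr0 (1 : R)); apply: cvgB; first exact: cvg_cst.
    by apply: cvg_expr; rewrite ger0_norm; lra.
  - exact: cvg_cst.
rewrite ler_norml => /andP[xm xp]; have [x0|x0|->] := ltrgt0P x.
- by rewrite gtr0_sg //; exact: pos.
- rewrite ltr0_sg // (_ : (fun _ => _) = (fun k => - iter k sign_step (- x))); last first.
    by apply/funext => k; rewrite iter_signN opprK.
  by apply: cvgN; apply: pos; lra.
- rewrite sgr0 (_ : (fun _ => _) = cst 0); first exact: cvg_cst.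
  by apply/funext => k; elim: k => //= k ->; rewrite /sign_step expr0n /=; field.
Qed.

End sign_iteration.
Arguments sign_step {R}.

Section multipliers.
Context d (T : measurableType d) (R : realType) (m : {measure set T -> \bar R}).
Local Notation C := R[i].
Local Notation L := (L2 m).
Variable S : set (T -> C^o).
Hypothesis Scl : closed_subspace L S.
Let LP := L2_prehilbert m.
Let SL f : S f -> hdom L f. Proof. by case: Scl => h _ _; exact: h. Qed.
Let Slin : linear_subspace S. Proof. by case: Scl. Qed.

(** Density in [L2] is proved through the bounded functions which leave a given
    closed subspace invariant. *)
Definition multiplier (b : T -> C) : Prop :=
  [/\ cmeasurable b, exists K, forall x, cmod (b x) <= K &
      forall f, S f -> S (fun x => b x * f x)].

Lemma multiplier_cst (c : C) : multiplier (fun=> c).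
Proof.
split; [exact: cmeasurable_cst|by exists (cmod c)|].
by move=> f Sf; exact: (subspaceZ Slin c Sf).
Qed.

Lemma multiplierD b c : multiplier b -> multiplier c -> multiplier (fun x => b x + c x).
Proof.
move=> [mb [K bK] bS] [mc [K' cK'] cS]; split; first exact: cmeasurableD.
  by exists (K + K') => x; rewrite (le_trans (cmodD _ _)) // lerD.
move=> f Sf; rewrite (_ : (fun _ => _) = (fun x => b x * f x) + (fun x => c x * f x)).
  by apply: subspaceD => //; [exact: bS|exact: cS].
by apply/funext => x; rewrite mulrDl.
Qed.

Lemma multiplierM b c : multiplier b -> multiplier c -> multiplier (fun x => b x * c x).
Proof.
move=> [mb [K bK] bS] [mc [K' cK'] cS]; split; first exact: cmeasurableM.
  by exists (K * K') => x; rewrite cmodM ler_pM ?cmod_ge0.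
move=> f Sf; rewrite (_ : (fun _ => _) = (fun x => b x * (c x * f x))).
  by apply: bS; exact: cS.
by apply/funext => x; rewrite mulrA.
Qed.

Lemma multiplierZ (a : C) b : multiplier b -> multiplier (fun x => a * b x).
Proof. by move=> bM; apply: multiplierM => //; exact: multiplier_cst. Qed.

Lemma multiplierB b c : multiplier b -> multiplier c -> multiplier (fun x => b x - c x).
Proof.
move=> bM cM; rewrite (_ : (fun _ => _) = (fun x => b x + (-1) * c x)).
  by apply: multiplierD => //; exact: multiplierZ.
by apply/funext => x; rewrite mulN1r.
Qed.

Lemma cmod_cvg_Re (z : nat -> C) l : cmod (z k - l) @[k --> \oo] --> (0 : R) ->
  Re (z k) @[k --> \oo] --> Re l.
Proof.
move=> /cvgrPdist_le h; apply/cvgrPdist_le => e /h; apply: filterS => k.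
rewrite sub0r normrN ger0_norm ?cmod_ge0 // cmodBC; apply: le_trans.
by rewrite -cReB Re_le_cmod.
Qed.

Lemma cmod_cvg_Im (z : nat -> C) l : cmod (z k - l) @[k --> \oo] --> (0 : R) ->
  Im (z k) @[k --> \oo] --> Im l.
Proof.
move=> /cvgrPdist_le h; apply/cvgrPdist_le => e /h; apply: filterS => k.
rewrite sub0r normrN ger0_norm ?cmod_ge0 // cmodBC; apply: le_trans.
by rewrite -cImB Im_le_cmod.
Qed.

Lemma cmeasurable_cvg (bs : nat -> T -> C) b : (forall k, cmeasurable (bs k)) ->
  (forall x, cmod (bs k x - b x) @[k --> \oo] --> (0 : R)) -> cmeasurable b.
Proof.
move=> mb bb; split.
  apply: (@measurable_fun_cvg _ _ _ setT (fun j x => Re (bs j x))) => [j|x _].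
    by case: (mb j).
  exact: (@cmod_cvg_Re (bs ^~ x)).
apply: (@measurable_fun_cvg _ _ _ setT (fun j x => Im (bs j x))) => [j|x _].
  by case: (mb j).
exact: (@cmod_cvg_Im (bs ^~ x)).
Qed.

(** Dominated convergence makes the algebra of multipliers stable under bounded
    pointwise limits, which is what lets it reach all indicator functions. *)
Lemma multiplier_lim (bs : nat -> T -> C) b (K : R) : (forall k, multiplier (bs k)) ->
  (forall k x, cmod (bs k x) <= K) ->
  (forall x, cmod (bs k x - b x) @[k --> \oo] --> (0 : R)) -> multiplier b.
Proof.
move=> bM bK bb.
have mbs k : cmeasurable (bs k) by case: (bM k).
have mb : cmeasurable b by exact: cmeasurable_cvg mbs bb.
have bK' x : cmod (b x) <= K by exact: (@cmod_le_cvg _ (bs ^~ x)).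
split=> //; first by exists K.
move=> f Sf; have fL := SL Sf.
have m1 k : cmeasurable (fun x => bs k x * f x) by apply: cmeasurableM => //; exact: (L2_meas fL).
have m2 : cmeasurable (fun x => b x * f x) by apply: cmeasurableM => //; exact: (L2_meas fL).
have ig : m.-integrable setT (EFin \o (fun x => (K * cmod (f x)) ^+ 2)).
  rewrite (_ : (fun _ => _) = (fun x => K ^+ 2 * sqmod (f x))).
    by apply: integrable_scale; exact: L2_sqmod.
  by apply/funext => x; rewrite exprMn sqr_cmod.
have [|bkL bL cv] := L2_dominated m1 m2 ig.
  apply: nearW => x; split=> [k|]; first by rewrite cmodM ler_wpM2r ?cmod_ge0.
  rewrite -(mul0r (cmod (f x))).
  under eq_fun do rewrite -mulrBl cmodM.
  by apply: cvgM; [exact: bb|exact: cvg_cst].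
apply: (closed_subspace_cvg Scl bL (w := fun k x => bs k x * f x)) => [k|].
  by case: (bM k) => _ _; exact.
by under eq_fun do rewrite hnormBC //.
Qed.

Lemma multiplier_ae b c : multiplier b -> cmeasurable c -> (exists K, forall x, cmod (c x) <= K) ->
  {ae m, forall x, b x = c x} -> multiplier c.
Proof.
move=> [mb _ bS] mc [K cK] bc; split=> //; first by exists K.
move=> f Sf; have fL := SL Sf.
apply: (closed_subspace_heq Scl _ (bS _ Sf)).
  by apply: (L2_bounded_mul fL mc (M := K)); exact: nearW.
apply/L2_heqP; [|exact/SL/bS|by apply: filterS bc => x /= ->].
by apply: (L2_bounded_mul fL mc (M := K)); exact: nearW.
Qed.

Definition good_set (A : set T) : Prop := multiplier (fun x => (\1_A x)%:C).

Lemma good_setC A : good_set A -> good_set (~` A).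
Proof.
move=> gA; rewrite /good_set (_ : (fun _ => _) = (fun x => 1 - (\1_A x)%:C)).
  by apply: multiplierB => //; exact: multiplier_cst.
by apply/funext => x; rewrite !indicE in_setC; case: (x \in A); rewrite /= ?subr0 ?subrr.
Qed.

Lemma good_setI A B : good_set A -> good_set B -> good_set (A `&` B).
Proof.
move=> gA gB; rewrite /good_set (_ : (fun _ => _) = (fun x => (\1_A x)%:C * (\1_B x)%:C)).
  exact: multiplierM.
by apply/funext => x; rewrite !indicE in_setI; case: (x \in A); case: (x \in B); rewrite /= ?mulr0 ?mulr1.
Qed.

Lemma good_setT : good_set setT.
Proof.
rewrite /good_set (_ : (fun _ => _) = (fun=> 1)); first exact: multiplier_cst.
by apply/funext => x; rewrite indicT.
Qed.

Lemma good_set0 : good_set set0.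
Proof. by rewrite -setCT; apply: good_setC; exact: good_setT. Qed.

Lemma good_setU A B : good_set A -> good_set B -> good_set (A `|` B).
Proof.
by move=> gA gB; rewrite -[A]setCK -[B]setCK -setCI; apply/good_setC/good_setI; exact: good_setC.
Qed.

Lemma good_bigcup (F : nat -> set T) : (forall k, good_set (F k)) -> good_set (\bigcup_k F k).
Proof.
move=> gF.
have gb k : good_set (\big[setU/set0]_(i < k) F i).
  apply: (big_ind good_set) => //; [exact: good_set0|].
  by move=> A B; exact: good_setU.
apply: (@multiplier_lim (fun k x => (\1_(\big[setU/set0]_(i < k) F i) x)%:C) _ 1).
- exact: gb.
- by move=> k x; rewrite cmodR indicE; case: (_ \in _); rewrite /= ?normr1 ?normr0.
- move=> x; apply: cvg_near_cst.
  have [[i _ Fi]|nF] := pselect ((\bigcup_k F k) x).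
    exists i.+1 => // k /= ik; rewrite !indicE mem_set /=.
      by rewrite mem_set; [rewrite subrr cmod0|exists i].
    by rewrite -bigcup_mkord; exists i.
  apply: nearW => k; rewrite !indicE memNset; first by rewrite memNset ?subrr ?cmod0.
  by rewrite -bigcup_mkord => -[i _ Fi]; apply: nF; exists i.
Qed.

Lemma good_sigma_algebra : sigma_algebra setT good_set.
Proof.
split; [exact: good_set0|by move=> A gA; rewrite setTD; exact: good_setC|exact: good_bigcup].
Qed.

Lemma good_bigcap (F : nat -> set T) : (forall k, good_set (F k)) -> good_set (\bigcap_k F k).
Proof.
by move=> gF; rewrite -[X in good_set X]setCK setC_bigcap; apply: good_setC;
  apply: good_bigcup => k; exact: good_setC.
Qed.

(** The iteration [x |-> (3x - x^3)/2] approximates the sign by polynomials that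
    stay in [-1, 1] there. *)
Lemma good_set_gt0 (r : T -> R) : (forall x, `|r x| <= 1) ->
  multiplier (fun x => (r x)%:C) -> good_set [set x | 0 < r x].
Proof.
move=> r1 rM.
have it k : multiplier (fun x => (iter k sign_step (r x))%:C).
  elim: k => //= k IH.
  rewrite (_ : (fun _ => _) = (fun x => (2^-1)%:C * (3%:C * (iter k sign_step (r x))%:C -
     (iter k sign_step (r x))%:C * (iter k sign_step (r x))%:C * (iter k sign_step (r x))%:C))).
    by apply/multiplierZ/multiplierB; [exact: multiplierZ|do !apply: multiplierM => //].
  apply/funext => x; rewrite -!rmorphM -rmorphB -rmorphM /=; congr (_%:C).
  by rewrite /sign_step; field.
have sM : multiplier (fun x => (Num.sg (r x))%:C).
  apply: (multiplier_lim it (K := 1)).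
    by move=> k x; rewrite cmodR iter_sign_bound.
  move=> x; under eq_fun do rewrite -rmorphB cmodR.
  rewrite -(normr0 R^o) -(subrr (Num.sg (r x))); apply: cvg_norm; apply: cvgB.
    exact: iter_sign_cvg.
  exact: cvg_cst.
rewrite /good_set (_ : (fun _ => _) = (fun x => (2^-1)%:C * ((Num.sg (r x))%:C +
    (Num.sg (r x))%:C * (Num.sg (r x))%:C))).
  by apply/multiplierZ/multiplierD => //; exact: multiplierM.
apply/funext => x; rewrite -!rmorphM -rmorphD -rmorphM /=; congr (_%:C).
rewrite indicE; case: (sgrP (r x)) => h.
- by rewrite memNset /=; [rewrite mulr0 addr0 mulr0|rewrite h ltxx].
- by rewrite mem_set //= mulr1; field.
- by rewrite memNset /=; [rewrite mulrNN mulr1 addNr mulr0|apply/negP; rewrite -leNgt ltW].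
Qed.

Lemma multiplier_sum (I : Type) (s : seq I) (F : I -> T -> C) :
  (forall i, multiplier (F i)) -> multiplier (fun x => \sum_(i <- s) F i x).
Proof.
move=> FM; elim: s => [|i s IH].
  by under eq_fun do rewrite big_nil; exact: multiplier_cst.
by under eq_fun do rewrite big_cons; exact: multiplierD.
Qed.

Section all_good.
Import HBNNSimple.
Hypothesis good : forall A, measurable A -> good_set A.

Lemma multiplier_ge0 (b : T -> R) (K : R) : measurable_fun setT b ->
  (forall x, 0 <= b x <= K) -> multiplier (fun x => (b x)%:C).
Proof.
move=> mb bK.
have b0 x : [set: T] x -> (0 <= (EFin \o b) x)%E.
  by move=> _; rewrite /= lee_fin; have /andP[] := bK x.
have [g [gnd gcv]] := approximation measurableT ((measurable_EFinP _ _).2 mb) b0.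
have gb x : g k x @[k --> \oo] --> b x.
  by have /fine_cvg := gcv x Logic.I.
have ndx x : nondecreasing_seq (g ^~ x) by move=> i j ij; have /lefP := gnd _ _ ij; exact.
have g_le k x : g k x <= b x.
  have := nondecreasing_cvgn_le (ndx x) _ k; rewrite (cvg_lim _ (gb x)) //; apply.
  exact: gb.
apply: (@multiplier_lim (fun k x => (g k x)%:C) _ K).
- move=> k; rewrite (_ : (fun _ => _) =
    (fun x => \sum_(y <- finmap.enum_fset (fset_set (range (g k)))) y%:C * (\1_(g k @^-1` [set y]) x)%:C)).
    by apply: multiplier_sum => y; apply: multiplierZ; exact: good.
  apply/funext => x; rewrite {1}fimfunE fsbig_finite //= rmorph_sum /=.
  by apply: eq_bigr => y _; rewrite rmorphM.
- move=> k x; rewrite cmodR ger0_norm //; have /andP[_] := bK x; exact: le_trans.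
- move=> x; under eq_fun do rewrite -rmorphB cmodR.
  rewrite -(normr0 R^o) -(subrr (b x)); apply: cvg_norm; apply: cvgB => //.
  exact: cvg_cst.
Qed.

Lemma measurable_multiplier (b : T -> C) (K : R) : cmeasurable b ->
  (forall x, cmod (b x) <= K) -> multiplier b.
Proof.
have real (r : T -> R) : measurable_fun setT r -> (forall x, `|r x| <= K) ->
    multiplier (fun x => (r x)%:C).
  move=> mr rK.
  rewrite (_ : (fun _ => _) = (fun x => (r x + K)%:C - K%:C)).
    apply: multiplierB; last exact: multiplier_cst.
    apply: (@multiplier_ge0 _ (K + K)) => [|x]; first exact: measurable_funD.
    by have := rK x; rewrite ler_norml => /andP[]; lra.
  by apply/funext => x; rewrite rmorphD addrK.
move=> [m1 m2] bK.
rewrite (_ : b = (fun x => (Re (b x))%:C + 'i * (Im (b x))%:C)).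
  apply: multiplierD; first by apply: real => // x; rewrite (le_trans (Re_le_cmod _)).
  by apply/multiplierZ/real => // x; rewrite (le_trans (Im_le_cmod _)).
by apply/funext => x; rewrite [LHS]complexE.
Qed.

Lemma cmeasurableV (w : T -> C) : cmeasurable w -> cmeasurable (fun x => (w x)^-1).
Proof.
move=> mw; rewrite (_ : (fun _ => _) = (fun x => ((sqmod (w x))^-1)%:C * conjc (w x))).
  apply: cmeasurableM; last exact: cmeasurableJ.
  apply: cmeasurable_real; apply: measurableT_comp (measurable_sqmod mw).
  exact: measurable_inv.
by apply/funext => x; rewrite invc_norm -add_Re2_Im2 fmorphV.
Qed.

(** [f] is the limit of [(f / w) * w], truncated where [f / w] is large. *)
Lemma dense_on_support (w f : T -> C^o) : S w -> hdom L f ->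
  S (fun x => (\1_[set x | w x != 0] x)%:C * f x).
Proof.
move=> Sw fL; have wL := SL Sw; have mw := L2_meas wL; have mf := L2_meas fL.
pose q x : C := f x / w x.
have mq : cmeasurable q by apply: cmeasurableM => //; exact: cmeasurableV.
pose A (k : nat) := [set x | cmod (q x) <= k%:R].
have mA k : measurable (A k).
  have := measurable_cmod mq measurableT (measurable_itv `]-oo, (k%:R : R)]).
  by rewrite setTI; congr measurable; apply/seteqP; split=> x /=; rewrite in_itv.
have mN : measurable [set x | w x != 0].
  have := measurable_cmod mw measurableT (measurable_itv `](0 : R), +oo[).
  rewrite setTI; congr measurable; apply/seteqP; split=> x /=; rewrite in_itv /= andbT.
    by move=> h; apply/eqP => w0; rewrite w0 cmod0 ltxx in h.
  move=> w0; rewrite lt_neqAle cmod_ge0 andbT eq_sym; apply/eqP => /cmod_eq0 wx0.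
  by rewrite wx0 eqxx in w0.
pose b k x : C := (\1_(A k) x)%:C * q x.
have bM k : multiplier (b k).
  apply: (@measurable_multiplier _ k%:R).
    by apply: cmeasurableM => //; apply: cmeasurable_real; exact: measurable_indic.
  move=> x; rewrite cmodM cmodR indicE; case: (boolP (x \in A k)) => [/set_mem h|_] /=.
    by rewrite normr1 mul1r.
  by rewrite normr0 mul0r.
have m1 k : cmeasurable (fun x => b k x * w x).
  by apply: cmeasurableM => //; case: (bM k).
have m2 : cmeasurable (fun x => (\1_[set x | w x != 0] x)%:C * f x).
  by apply: cmeasurableM => //; apply: cmeasurable_real; exact: measurable_indic.
have ig : m.-integrable setT (EFin \o (fun x => cmod (f x) ^+ 2)).
  by under [X in EFin \o X]eq_fun do rewrite sqr_cmod; exact: L2_sqmod.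
have bw k x : b k x * w x = (\1_(A k) x)%:C * ((\1_[set x | w x != 0] x)%:C * f x).
  rewrite /b /q -mulrA; congr (_ * _); rewrite indicE.
  have [w0|w0] := eqVneq (w x : C) 0.
    by rewrite [in RHS]memNset; [rewrite w0 mulr0 mul0r|rewrite /= w0 eqxx].
  by rewrite mem_set //= mul1r divfK.
have ind1 (B : set T) x : cmod (\1_B x : R)%:C <= 1.
  by rewrite cmodR indicE; case: (_ \in _); rewrite /= ?normr1 ?normr0.
have [|bkL bL cv] := L2_dominated m1 m2 ig.
  apply: nearW => x; split=> [k|].
    by rewrite bw !cmodM -[leRHS]mul1r ler_pM ?mulr_ge0 ?cmod_ge0 // ler_piMl ?cmod_ge0.
  apply: cvg_near_cst; exists (Num.truncn (cmod (q x))).+1 => // k /= kq.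
  rewrite bw indicE mem_set ?mul1r ?subrr ?cmod0 // /A /= ltW //.
  have /andP[_ h] := truncn_itv (cmod_ge0 (q x)).
  by apply: lt_le_trans h _; rewrite ler_nat.
apply: (closed_subspace_cvg Scl bL (w := fun k x => b k x * w x)) => [k|].
  by case: (bM k) => _ _; exact.
by under eq_fun do rewrite hnormBC //.
Qed.

(** A closed subspace invariant under all indicators contains, with each of its
    elements [w], everything supported where [w] does not vanish; countably many
    elements without common zero therefore exhaust the whole space. *)
Lemma multipliers_dense (w : nat -> T -> C^o) : (forall j, S (w j)) ->
  {ae m, forall x, exists j, w j x != 0} -> forall f, hdom L f -> S f.
Proof.
move=> Sw wn f fL.
pose B k := \big[setU/set0]_(j < k) [set x | w j x != 0].
have SB k g : hdom L g -> S (fun x => (\1_(B k) x)%:C * g x).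
  elim: k g => [|k IH] g gL.
    rewrite (_ : (fun _ => _) = 0); first by case: Slin.
    by apply/funext => x; rewrite /B big_ord0 indic0 mul0r.
  rewrite (_ : (fun _ => _) = (fun x => (\1_(B k) x)%:C * g x) +
     (fun x => (\1_[set x | w k x != 0] x)%:C * (g - (fun x => (\1_(B k) x)%:C * g x)) x)).
    apply: (subspaceD Slin); first exact: IH.
    by apply: (dense_on_support (Sw k)); apply: (hdomB LP gL); exact/SL/IH.
  apply/funext => x.
  rewrite -[RHS]/((\1_(B k) x)%:C * g x + (\1_[set x | w k x != 0] x)%:C *
      (g x - (\1_(B k) x)%:C * g x)).
  rewrite {1}/B big_ord_recr /= -/(B k) !indicE in_setU.
  by case: (x \in B k); case: (x \in _); rewrite /= ?mul1r ?mul0r ?subr0 ?subrr ?mulr0 ?addr0 ?add0r.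
have mB k : cmeasurable (fun x => (\1_(B k) x)%:C * f x) by exact/L2_meas/SL/SB.
have ig : m.-integrable setT (EFin \o (fun x => cmod (f x) ^+ 2)).
  by under [X in EFin \o X]eq_fun do rewrite sqr_cmod; exact: L2_sqmod.
have [|bkL bL cv] := L2_dominated mB (L2_meas fL) ig.
  apply: filterS wn => x [j wj]; split=> [k|].
    by rewrite cmodM cmodR indicE; case: (_ \in _); rewrite /= ?normr1 ?normr0 ?mul1r ?mul0r ?cmod_ge0.
  apply: cvg_near_cst; exists j.+1 => // k /= jk.
  have Bx : B k x by rewrite /B -(bigcup_mkord k (fun j => [set x | w j x != 0])); exists j.
  by rewrite indicE mem_set //= mul1r subrr cmod0.
apply: (closed_subspace_cvg Scl fL (w := fun k x => (\1_(B k) x)%:C * f x)) => [k|].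
  exact: SB.
by under eq_fun do rewrite hnormBC //.
Qed.

End all_good.
End multipliers.

(** * Lebesgue measure on column vectors *)

Section borel_cV.
Variables (R : realType) (d : nat).
Local Notation Rd := 'cV[R]_d.

Lemma cV_sigma_algebra_min (L : set (set Rd)) : sigma_algebra setT L ->
  (forall i (a : R), L [set x : Rd | a < x i 0]) -> forall A, measurable A -> L A.
Proof.
move=> sL La A mA.
suff : (cV_measurable (R := R) (d := d)) `<=` L by exact.
apply: smallest_sub => //.
rewrite -bigcup_seq => B [i _ [C mC <-]]; rewrite setTI.
suff : [set C | measurable C] `<=` [set C : set R | L ((fun x : Rd => x i 0) @^-1` C)] by exact.
rewrite -[[set C | measurable C]]/(@measurable _ (measurableTypeR R)).
rewrite RGenOInfty.measurableE; apply: smallest_sub.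
  case: sL => L0 LC LU; split.
  - by rewrite /= preimage_set0.
  - by move=> D /= LD; rewrite setTD preimage_setC -setTD; exact: LC.
  - by move=> F LF /=; rewrite preimage_bigcup; exact: LU.
move=> _ [a ->] /=; move: (La i a); congr L.
by apply/seteqP; split=> x /=; rewrite in_itv /= andbT.
Qed.

Lemma measurable_ball_cV (x : Rd) (e : R) : measurable (ball x e).
Proof.
rewrite (_ : ball x e = if 0 < e then \bigcap_(i in [set: 'I_d])
    ((fun y : Rd => y i 0) @^-1` (ball (x i 0) e)) else set0); last first.
  apply/seteqP; split=> [y [e0 h]|y].
    by rewrite e0 => i _; exact: h.
  case: ifPn => // e0 h; split=> // i j; rewrite ord1; exact: h.
case: ifP => _; last exact: measurable0.
apply: fin_bigcap_measurable => // i _; rewrite -[X in measurable X]setTI.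
apply: measurable_coord => //; exact: measurable_ball.
Qed.

(** The measurable sets are generated by the coordinates, so an open set has to
    be covered by countably many cubes, with rational centres. *)
Lemma open_measurable_cV (U : set Rd) : open U -> measurable U.
Proof.
move=> oU.
pose q (c : 'cV[rat]_d) : Rd := \matrix_(i, j) ratr (c i j).
pose I := [set z : 'cV[rat]_d * nat | ball (q z.1) (z.2.+1%:R^-1) `<=` U].
rewrite (_ : U = \bigcup_(z in I) ball (q z.1) (z.2.+1%:R^-1)).
  rewrite bigcup_mkcond; apply: countable_bigcupT_measurable => [|z]; first exact: countableP.
  by case: ifP => _ //; exact: measurable_ball_cV.
apply/seteqP; split=> [x Ux|x [z Iz]]; last exact: Iz.
have /nbhs_ballP[e /= e0 eU] : nbhs x U by exact: open_nbhs_nbhs.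
have [k ke] : exists k : nat, k.+1%:R^-1 < e / 2.
  have /cvgrPdist_lt/(_ (e / 2)) := @cvg_harmonic R; rewrite divr_gt0 // => /(_ isT)[N _ /(_ N (leqnn N))].
  by rewrite sub0r normrN ger0_norm //= => h; exists N.
have /choice[c cP] (i : 'I_d) : exists r : rat, `|ratr r - x i 0| < k.+1%:R^-1.
  have lt : x i 0 - k.+1%:R^-1 < x i 0 + k.+1%:R^-1.
    by rewrite ltrD2l gtrN // invr_gt0.
  have [r /andP[r1 r2]] := rat_in_itvoo lt; exists r.
  by rewrite ltr_distl; apply/andP; split.
have xq : ball (q (\col_i c i)) (k.+1%:R^-1) x.
  split; first by rewrite invr_gt0.
  by move=> i j; rewrite ord1 !mxE; exact: cP.
exists (\col_i c i, k) => //=; rewrite /I /= => y qy; apply: eU.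
rewrite (splitr e); apply: (@ball_triangle _ _ (q (\col_i c i))).
  by apply: ball_sym; apply: le_ball xq; exact: ltW.
by apply: le_ball qy; exact: ltW.
Qed.

Lemma continuous_measurable_cV (f : Rd -> R) : continuous f -> measurable_fun setT f.
Proof.
move=> cf; apply: (measurability _ (RGenOpens.measurableE R)) => _ [_ [a [b ->]] <-].
rewrite setTI; apply: open_measurable_cV.
by apply: open_comp => [x _|]; [exact: cf|exact: interval_open].
Qed.

Lemma continuous_coord (i : 'I_d) : continuous (fun x : Rd => x i 0).
Proof. by move=> x; exact: coord_continuous. Qed.

Lemma measurable_cV_add (a : Rd) : measurable_fun setT (fun x : Rd => x + a).
Proof.
apply: measurable_cVP => i; under eq_fun do rewrite mxE.
by apply: measurable_funD => //; exact: measurable_coord.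
Qed.

Lemma measurable_cV_mulmx (A : 'M[R]_d) : measurable_fun setT (fun x : Rd => A *m x).
Proof.
apply: measurable_cVP => i; under eq_fun do rewrite mxE.
by apply: measurable_sum => j; apply: measurable_funM => //; exact: measurable_coord.
Qed.

Lemma measurable_dotl (p : Rd) : measurable_fun setT (fun x : Rd => dot x p).
Proof.
by apply: measurable_sum => i; apply: measurable_funM => //; exact: measurable_coord.
Qed.

Lemma measurable_dotr (p : Rd) : measurable_fun setT (fun x : Rd => dot p x).
Proof.
by apply: measurable_sum => i; apply: measurable_funM => //; exact: measurable_coord.
Qed.

Lemma dotC (x y : Rd) : dot x y = dot y x.
Proof. by apply: eq_bigr => i _; rewrite mulrC. Qed.
Lemma dotDl (x y z : Rd) : dot (x + y) z = dot x z + dot y z.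
Proof. by rewrite /dot -big_split; apply: eq_bigr => i _; rewrite mxE mulrDl. Qed.
Lemma dotDr (x y z : Rd) : dot z (x + y) = dot z x + dot z y.
Proof. by rewrite dotC dotDl !(dotC z). Qed.
Lemma dotZl a (x y : Rd) : dot (a *: x) y = a * dot x y.
Proof. by rewrite /dot mulr_sumr; apply: eq_bigr => i _; rewrite mxE mulrA. Qed.
Lemma dotZr a (x y : Rd) : dot y (a *: x) = a * dot y x.
Proof. by rewrite dotC dotZl dotC. Qed.
Lemma dotNl (x y : Rd) : dot (- x) y = - dot x y.
Proof. by rewrite -scaleN1r dotZl mulN1r. Qed.
Lemma dotNr (x y : Rd) : dot y (- x) = - dot y x.
Proof. by rewrite dotC dotNl dotC. Qed.
Lemma dot0l (x : Rd) : dot 0 x = 0.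
Proof. by rewrite -(scale0r 0) dotZl mul0r. Qed.
Lemma dot_mulmx (A : 'M[R]_d) (x y : Rd) : dot (A *m x) y = dot x (A^T *m y).
Proof.
rewrite /dot; under eq_bigr do rewrite mxE mulr_suml.
rewrite exchange_big /=; apply: eq_bigr => j _; rewrite mxE mulr_sumr.
by apply: eq_bigr => i _; rewrite mxE mulrA [A i j * _]mulrC.
Qed.
Lemma dot_ge0 (x : Rd) : 0 <= dot x x.
Proof. by apply: sumr_ge0 => i _; rewrite -expr2 sqr_ge0. Qed.
Lemma dot_orthogonal (A : 'M[R]_d) (x y : Rd) : A^T *m A = 1%:M -> dot (A *m x) (A *m y) = dot x y.
Proof. by move=> AA; rewrite dot_mulmx mulmxA AA mul1mx. Qed.
Lemma coord_sqr_le (x : Rd) i : x i 0 ^+ 2 <= dot x x.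
Proof.
by rewrite /dot (bigD1 i) //= -expr2 lerDl sumr_ge0 // => k _; rewrite -expr2 sqr_ge0.
Qed.

Lemma japanese_ge1 (x : Rd) : 1 <= japanese x.
Proof. by rewrite /japanese lerDl dot_ge0. Qed.
Lemma japanese_gt0 (x : Rd) : 0 < japanese x.
Proof. by rewrite (lt_le_trans _ (japanese_ge1 x)). Qed.

Lemma japaneseVX_ge0 (x : Rd) (N : nat) : 0 <= (japanese x ^+ N)^-1.
Proof. by rewrite invr_ge0 exprn_ge0 // ltW // japanese_gt0. Qed.

Lemma measurable_japaneseVX (N : nat) :
  measurable_fun setT (fun x : Rd => (japanese x ^+ N)^-1).
Proof.
apply: measurableT_comp (@measurable_inv R) _; apply: measurable_funX.
by apply: measurable_funD => //; exact: measurable_dot.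
Qed.

End borel_cV.

Section measure_preserving.
Context d1 d2 (T1 : measurableType d1) (T2 : measurableType d2) (R : realType).
Variables (m1 : {measure set T1 -> \bar R}) (m2 : {measure set T2 -> \bar R}).
Variable phi : T1 -> T2.
Hypothesis mphi : measurable_fun setT phi.
Hypothesis m12 : forall A, measurable A -> m1 (phi @^-1` A) = m2 A.
Local Open Scope ereal_scope.

Lemma ge0_integral_preserving (f : T2 -> \bar R) : measurable_fun setT f ->
  (forall x, 0 <= f x) -> \int[m1]_x f (phi x) = \int[m2]_y f y.
Proof.
move=> mf f0.
transitivity (\int[pushforward m1 phi]_y f y).
  by rewrite (ge0_integral_pushforward mphi).
apply: eq_measure_integral => B mB _; exact: m12.
Qed.

Lemma integrable_preserving (f : T2 -> \bar R) : m2.-integrable setT f ->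
  m1.-integrable setT (fun x => f (phi x)).
Proof.
move=> /integrableP[mf foo]; apply/integrableP; split; first exact: measurableT_comp.
by rewrite (ge0_integral_preserving (f := fun y => `|f y|)) //; exact: measurableT_comp.
Qed.

Lemma integral_preserving (f : T2 -> \bar R) : measurable_fun setT f ->
  \int[m1]_x f (phi x) = \int[m2]_y f y.
Proof.
move=> mf; rewrite integralE [RHS]integralE; congr (_ - _).
  by rewrite (funepos_comp f phi) -(ge0_integral_preserving (measurable_funepos mf)) // => x; exact: funepos_ge0.
by rewrite (funeneg_comp f phi) -(ge0_integral_preserving (measurable_funeneg mf)) // => x; exact: funeneg_ge0.
Qed.

Lemma cintegral_preserving (f : T2 -> R[i]) : cmeasurable f ->
  cintegral m1 (fun x => f (phi x)) = cintegral m2 f.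
Proof.
move=> [f1 f2]; rewrite /cintegral /Rintegral; congr (fine _ +i* fine _).
  by rewrite -(integral_preserving (f := fun x => (complex.Re (f x))%:E)) //; exact/measurable_EFinP.
by rewrite -(integral_preserving (f := fun x => (complex.Im (f x))%:E)) //; exact/measurable_EFinP.
Qed.

Lemma cintegrable_preserving (f : T2 -> R[i]) : cintegrable m2 f ->
  cintegrable m1 (fun x => f (phi x)).
Proof. by move=> [f1 f2]; split; [exact: integrable_preserving f1|exact: integrable_preserving f2]. Qed.

End measure_preserving.

Section lebesgue_1d.
Variable R : realType.
Local Notation lam := (@lebesgue_measure R).

Lemma lebesgue_translate (a : R) (A : set R) : measurable A ->
  lam ((fun x => x + a) @^-1` A) = lam A.
Proof.
have mt : measurable_fun [set: measurableTypeR R] (fun x : R => x + a : measurableTypeR R).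
  exact: measurable_funD.
move=> mA; symmetry.
pose m' := pushforward lam (fun x : R => x + a : measurableTypeR R).
apply: (@lebesgue_measure_unique _ m') => // _ [[s t] _ <-].
rewrite -[RHS]/(lam ((fun x : R => x + a) @^-1` `]s, t])).
rewrite (_ : _ @^-1` _ = `]s - a, t - a]%classic); last first.
  by apply/seteqP; split=> x /=; rewrite !in_itv /= ltrBlDr lerBrDr.
rewrite !lebesgue_measure_itv /= !lte_fin ltrD2r.
by case: ifP => // _; rewrite -!EFinB; congr (_%:E); ring.
Qed.

Lemma lebesgue_opp (A : set R) : measurable A -> lam (-%R @^-1` A) = lam A.
Proof.
have mt : measurable_fun [set: measurableTypeR R] (-%R : R -> measurableTypeR R).
  exact: oppr_measurable.
move=> mA; symmetry.
pose m' := pushforward lam (-%R : R -> measurableTypeR R).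
apply: (@lebesgue_measure_unique _ m') => // _ [[s t] _ <-].
rewrite -[RHS]/(lam ((-%R : R -> R) @^-1` `]s, t])).
rewrite (_ : _ @^-1` _ = `[- t, - s[%classic); last first.
  by apply/seteqP; split=> x /=; rewrite !in_itv /= ltrNr lerNl andbC.
rewrite !lebesgue_measure_itv /= !lte_fin ltrN2.
by case: ifP => // _; rewrite -!EFinB; congr (_%:E); ring.
Qed.

Lemma integral_oneDsqr : (\int[lam]_x ((1 + x ^+ 2)^-1)%:E = pi%:E)%E.
Proof.
rewrite (@ge0_symfun_integralT _ (fun x => (1 + x ^+ 2)^-1)).
- by rewrite -set_itvcy (integral0y_oneDsqr R) -EFinM mulrC divfK.
- by move=> x; rewrite invr_ge0 addr_ge0 // sqr_ge0.
- exact: continuous_oneDsqrV.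
- by move=> x /=; rewrite sqrrN.
Qed.

End lebesgue_1d.

Section lebesgue_cV_facts.
Variable R : realType.
Local Notation lam := (@lebesgue_measure R).

Lemma dot_pt n (s t : R) (x y : 'cV[R]_n) : (dot (pt s x) (pt t y) = s * t + dot x y).
Proof.
rewrite /dot (@big_split_ord _ _ _ 1%N n) /= big_ord1 !pt_time; congr (_ + _).
by apply: eq_bigr => i _; rewrite !pt_space.
Qed.

Lemma pt_vecpart n (p : 'cV[R]_n.+1) : pt (p ord0 0) (vecpart p) = p.
Proof.
apply/colP => i; have [j ->|j ->] := split_ordP (i : 'I_(1 + n)).
  by rewrite pt_time ord1; congr (p _ _); exact/val_inj.
by rewrite pt_space mxE.
Qed.

Lemma vecpart_pt n (s : R) (x : 'cV[R]_n) : vecpart (pt s x) = x.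
Proof. exact: col_mxKd. Qed.

Lemma pt_ord0 n (s : R) (x : 'cV[R]_n) : pt s x ord0 0 = s.
Proof.
by rewrite (_ : ord0 = lshift n (ord0 : 'I_1)) ?pt_time //; exact/val_inj.
Qed.

Lemma ptD n (s t : R) (x y : 'cV[R]_n) : pt (s + t) (x + y) = (pt s x + pt t y).
Proof.
apply/colP => i; rewrite [RHS]mxE; have [j ->|j ->] := split_ordP (i : 'I_(1 + n)).
  by rewrite !pt_time.
by rewrite !pt_space mxE.
Qed.

Local Open Scope ereal_scope.

Lemma ge0_integral_leb_cons n (f : 'cV[R]_n.+1 -> \bar R) :
  measurable_fun setT f -> (forall x, 0 <= f x) ->
  \int[leb R n.+1]_x f x = \int[lam]_t \int[leb R n]_x f (pt t x).
Proof.
move=> mf f0.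
have mphi : measurable_fun [set: measurableTypeR R * 'cV[R]_n] (fun x => pt x.1 x.2).
  exact: measurable_pt.
rewrite -[LHS]/(\int[pushforward (lam \x leb R n) (fun x => pt x.1 x.2)]_x f x).
rewrite ge0_integral_pushforward // preimage_setT fubini_tonelli1 //.
- exact: measurableT_comp.
- by move=> x; exact: f0.
Qed.

Definition open_box n (a b : R) : set 'cV[R]_n := [set x | forall i, (a < x i 0%R < b)%R].

Lemma measurable_open_box n (a b : R) : measurable (@open_box n a b).
Proof.
rewrite (_ : open_box a b = \bigcap_(i in [set: 'I_n]) ((fun x : 'cV[R]_n => x i 0%R) @^-1` `]a, b[)).
  apply: fin_bigcap_measurable => // i _; rewrite -[X in measurable X]setTI.
  exact: measurable_coord.
apply/seteqP; split=> x /= h i => [_|]; first by rewrite /= in_itv; exact: h.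
by have := h i Logic.I; rewrite /= in_itv.
Qed.

Lemma leb_box n (a b : R) : (a < b)%R -> leb R n (@open_box n a b) = ((b - a) ^+ n)%:E.
Proof.
move=> ab; elim: n => [|n IH].
  rewrite /= diracE mem_set ?expr0 // => -[] //.
rewrite -[LHS]/((lam \x leb R n) ((fun x => pt x.1 x.2) @^-1` _)).
rewrite (_ : _ @^-1` _ = `]a, b[%classic `*` (@open_box n a b)).
  rewrite product_measure1E //; last exact: measurable_open_box.
  have L : lam `]a, b[%classic = (b - a)%:E.
    by rewrite lebesgue_measure_itv /= lte_fin ab -EFinB.
  by apply: etrans (congr2 mule L IH) _; rewrite -EFinM exprS.
apply/seteqP; split=> [[t x] h|[t x] [/= h1 h2] i].
  split; first by have := h (lshift n (ord0 : 'I_1)); rewrite /= pt_time in_itv.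
  by move=> i; have := h (rshift 1 i); rewrite /= pt_space.
have [j ->|j ->] := split_ordP (i : 'I_(1 + n)).
  by rewrite pt_time; move: h1; rewrite in_itv.
by rewrite pt_space.
Qed.

Lemma leb_translate n (a : 'cV[R]_n) (A : set 'cV[R]_n) : measurable A ->
  leb R n ((fun x => x + a)%R @^-1` A) = leb R n A.
Proof.
elim: n a A => [|n IH] a A mA.
  by congr (leb R 0 _); apply/seteqP; split=> x; rewrite /= [(x + a)%R]flatmx0 [x]flatmx0.
have m1 := measurable_cV_add a.
have mAa : measurable ((fun x => x + a)%R @^-1` A) by rewrite -[X in measurable X]setTI; exact: m1.
have indE (B : set 'cV[R]_n.+1) : measurable B ->
    leb R n.+1 B = \int[lam]_t \int[leb R n]_x (\1_B (pt t x))%:E.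
  move=> mB; rewrite -(@ge0_integral_leb_cons _ (fun x => (\1_B x)%:E)).
  - by rewrite integral_indic // setIT.
  - by apply/measurable_EFinP; exact: measurable_indic.
  - by move=> x; rewrite lee_fin.
rewrite (indE _ mA) (indE _ mAa).
pose F (t : R) := \int[leb R n]_x (\1_A (pt t x))%:E.
have mF : measurable_fun [set: measurableTypeR R] F.
  apply: (@measurable_fun_fubini_tonelli_F _ _ (measurableTypeR R) 'cV[R]_n R (leb R n)
    (fun z => (\1_A (pt z.1 z.2))%:E)).
    by apply/measurable_EFinP; apply: measurableT_comp; [exact: measurable_indic|exact: measurable_pt].
  by move=> x; rewrite lee_fin.
have F0 t : 0 <= F t by apply: integral_ge0 => x _; rewrite lee_fin.
transitivity (\int[lam]_t F (t + a ord0 0)%R).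
  apply: eq_integral => t _.
  have -> : \int[leb R n]_x (\1_((fun x => x + a)%R @^-1` A) (pt t x))%:E =
      \int[leb R n]_x (\1_A (pt (t + a ord0 0)%R (x + vecpart a)%R))%:E.
    by apply: eq_integral => x _; rewrite ptD pt_vecpart /= !indicE.
  pose B := (fun x => pt (t + a ord0 0)%R x) @^-1` A.
  have mB : measurable B.
    rewrite -[X in measurable X]setTI.
    by apply: (measurable_pt (f := fun=> (t + a ord0 0)%R) (g := id)) => //; exact: measurable_cst.
  have -> : F (t + a ord0 0)%R = leb R n B by rewrite -[B]setIT -integral_indic.
  rewrite -(IH (vecpart a)) // -[X in leb R n X]setIT -integral_indic //.
  by rewrite -[X in measurable X]setTI; exact: measurable_cV_add.
have mt : measurable_fun [set: measurableTypeR R] (fun t : R => t + a ord0 0 : measurableTypeR R)%R.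
  exact: measurable_funD.
exact: (ge0_integral_preserving mt (fun B mB => lebesgue_translate (a ord0 0%R) mB) mF F0).
Qed.

Lemma ge0_integral_leb_translate n (a : 'cV[R]_n) (f : 'cV[R]_n -> \bar R) :
  measurable_fun setT f -> (forall x, 0 <= f x) ->
  \int[leb R n]_x f (x + a)%R = \int[leb R n]_x f x.
Proof.
move=> mf f0.
exact: (ge0_integral_preserving (measurable_cV_add a) (fun B mB => leb_translate a mB) mf f0).
Qed.

Lemma japanese_pt n (t : R) (x : 'cV[R]_n) : japanese (pt t x) = (japanese x + t ^+ 2)%R.
Proof. by rewrite /japanese dot_pt expr2; ring. Qed.

(** The Japanese bracket dominates the product of its one-dimensional factors. *)
Lemma integral_japanese_lty n : \int[leb R n]_x ((japanese x ^+ n)^-1)%:E < +oo.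
Proof.
elim: n => [|n IH].
  rewrite (eq_integral (cst 1)) => [|x _]; last by rewrite expr0 invr1.
  by rewrite integral_cst // mul1e /= diracE mem_set // ltry.
rewrite ge0_integral_leb_cons; last 2 first.
- by apply/measurable_EFinP; exact: measurable_japaneseVX.
- by move=> x; rewrite lee_fin japaneseVX_ge0.
set J := \int[leb R n]_x _ in IH.
have J0 : 0 <= J.
  by apply: integral_ge0 => x _; rewrite lee_fin japaneseVX_ge0.
have Jfin : J \is a fin_num by rewrite ge0_fin_numE.
have mn : measurable_fun setT (fun x : 'cV[R]_n => ((japanese x ^+ n)^-1)%:E).
  by apply/measurable_EFinP; exact: measurable_japaneseVX.
apply: (@le_lt_trans _ _ (\int[lam]_t (((1 + t ^+ 2)^-1)%:E * J))).
  apply: ge0_le_integral => //.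
  - move=> t _; apply: integral_ge0 => x _.
    by rewrite lee_fin japaneseVX_ge0.
  - apply: (@measurable_fun_fubini_tonelli_F _ _ (measurableTypeR R) 'cV[R]_n R (leb R n)
      (fun z => ((japanese (pt z.1 z.2) ^+ n.+1)^-1)%:E)).
      apply/measurable_EFinP.
      apply: (measurableT_comp (measurable_japaneseVX _)).
      exact: (measurable_pt measurable_fst measurable_snd).
    by move=> x; rewrite lee_fin japaneseVX_ge0.
  - apply: emeasurable_funM => //; apply/measurable_EFinP.
    by apply: continuous_measurable_fun; exact: continuous_oneDsqrV.
  - move=> t _; rewrite /J -ge0_integralZl //; last 2 first.
    + by move=> x _; rewrite lee_fin japaneseVX_ge0.
    + by rewrite lee_fin invr_ge0 addr_ge0 // sqr_ge0.
    apply: ge0_le_integral => //.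
    + by move=> x _; rewrite lee_fin japaneseVX_ge0.
    + apply/measurable_EFinP; apply: (measurableT_comp (measurable_japaneseVX _)).
      exact: (measurable_pt (f := fun=> t) (g := id)).
    + by apply: emeasurable_funM => //; exact: measurable_cst.
    + move=> x _; rewrite -EFinM lee_fin -invfM lef_pV2 ?posrE; last 2 first.
      * by rewrite exprn_gt0 // japanese_gt0.
      * by rewrite mulr_gt0 ?exprn_gt0 ?japanese_gt0 // ltr_pwDl // sqr_ge0.
      have j1 := japanese_ge1 x; have t0 := sqr_ge0 t.
      rewrite japanese_pt [leRHS]exprS; apply: ler_pM; [lra|by rewrite exprn_ge0 //; lra|lra|].
      by rewrite lerXn2r ?nnegrE //; lra.
rewrite ge0_integralZr //; last 2 first.
- by apply/measurable_EFinP; apply: continuous_measurable_fun; exact: continuous_oneDsqrV.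
- by move=> t _; rewrite lee_fin invr_ge0 addr_ge0 // sqr_ge0.
by rewrite integral_oneDsqr lte_mul_pinfty // lee_fin pi_ge0.
Qed.

Lemma integral_japanese_gt0 n : 0 < \int[leb R n]_x ((japanese x ^+ n)^-1)%:E.
Proof.
have mn : measurable_fun setT (fun x : 'cV[R]_n => ((japanese x ^+ n)^-1)%:E).
  by apply/measurable_EFinP; exact: measurable_japaneseVX.
rewrite lt_neqAle integral_ge0 ?andbT; last first.
  by move=> x _; rewrite lee_fin japaneseVX_ge0.
apply/eqP => E.
have : \int[leb R n]_x `|((japanese x ^+ n)^-1)%:E| = 0.
  rewrite [RHS]E; apply: eq_integral => x _; rewrite gee0_abs //.
  by rewrite lee_fin japaneseVX_ge0.
move=> /(ae_eq_integral_abs _ measurableT mn)[N [mN N0 sub]].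
have : leb R n (@open_box n 0 1) <= leb R n N.
  apply: le_measure; rewrite ?inE //; first exact: measurable_open_box.
  move=> x _; apply: sub => /= /(_ Logic.I) /eqP.
  by rewrite eqe invr_eq0 expf_eq0 gt_eqF ?andbF // japanese_gt0.
by rewrite leb_box // N0 subr0 expr1n lee_fin ler10.
Qed.


(** Orthogonal invariance without determinants. Integrating [1_B (A x + y) j(y)]
    over both variables, with [j] a rotation invariant integrable function, in the
    two possible orders gives [leb (A^-1 B) * J] and [leb B * J]. *)
Lemma leb_orthogonal n (A : 'M[R]_n) (B : set 'cV[R]_n) : A^T *m A = 1%:M -> measurable B ->
  leb R n ((fun x => A *m x)%R @^-1` B) = leb R n B.
Proof.
move=> AA mB; have AA' : (A *m A^T = 1%:M)%R by exact: mulmx1C.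
pose j (x : 'cV[R]_n) := ((japanese x ^+ n)^-1)%:E.
pose J := \int[leb R n]_x j x.
have j0 x : 0 <= j x by rewrite lee_fin japaneseVX_ge0.
have mj : measurable_fun setT j by apply/measurable_EFinP; exact: measurable_japaneseVX.
have J0 : 0 < J by exact: integral_japanese_gt0.
have Jfin : J \is a fin_num by rewrite ge0_fin_numE ?ltW //; exact: integral_japanese_lty.
have mA := measurable_cV_mulmx A.
have mAB : measurable ((fun x => A *m x)%R @^-1` B) by rewrite -[X in measurable X]setTI; exact: mA.
have mi (D : set 'cV[R]_n) : measurable D -> measurable_fun setT (fun x => (\1_D x)%:E : \bar R).
  by move=> mD; apply/measurable_EFinP; exact: measurable_indic.
have i0 (D : set 'cV[R]_n) x : 0 <= (\1_D x)%:E :> \bar R by rewrite lee_fin.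
have mAy : measurable_fun setT (fun z : 'cV[R]_n * 'cV[R]_n => A *m z.1 + z.2)%R.
  apply: measurable_cVP => i; under eq_fun do rewrite mxE.
  apply: measurable_funD; last exact: measurableT_comp (measurable_coord i) measurable_snd.
  apply: (measurableT_comp (measurable_coord i)).
  exact: measurableT_comp mA measurable_fst.
have myA : measurable_fun setT (fun z : 'cV[R]_n * 'cV[R]_n => z.2 - A *m z.1)%R.
  apply: measurable_cVP => i; under eq_fun do rewrite mxE [X in (_ + X)%R]mxE.
  apply: measurable_funB; first exact: measurableT_comp (measurable_coord i) measurable_snd.
  apply: (measurableT_comp (measurable_coord i)).
  exact: measurableT_comp mA measurable_fst.
pose F (z : 'cV[R]_n * 'cV[R]_n) := (\1_B (A *m z.1 + z.2)%R)%:E * j z.2.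
pose G (z : 'cV[R]_n * 'cV[R]_n) := (\1_B z.2)%:E * j (z.2 - A *m z.1)%R.
have mF : measurable_fun setT F.
  apply: emeasurable_funM; first exact: measurableT_comp (mi _ mB) mAy.
  exact: measurableT_comp mj measurable_snd.
have mG : measurable_fun setT G.
  apply: emeasurable_funM; first exact: measurableT_comp (mi _ mB) measurable_snd.
  exact: measurableT_comp mj myA.
have F0 z : 0 <= F z by exact: mule_ge0.
have G0 z : 0 <= G z by exact: mule_ge0.
have pair1 (H : 'cV[R]_n * 'cV[R]_n -> \bar R) x : measurable_fun setT H -> measurable_fun setT (fun y => H (x, y)).
  by move=> mH; exact: measurableT_comp mH (pair1_measurable x).
have pair2 (H : 'cV[R]_n * 'cV[R]_n -> \bar R) y : measurable_fun setT H -> measurable_fun setT (fun x => H (x, y)).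
  by move=> mH; exact: measurableT_comp mH (pair2_measurable y).
have E1 : \int[leb R n]_x \int[leb R n]_y F (x, y) = leb R n B * J.
  transitivity (\int[leb R n]_x \int[leb R n]_y G (x, y)).
    apply: eq_integral => x _.
    rewrite -[RHS](ge0_integral_leb_translate (A *m x)%R (pair1 G x mG) (fun y => G0 (x, y))).
    by apply: eq_integral => y _; rewrite /F /G /= addrK [(A *m x + y)%R]addrC.
  rewrite (fubini_tonelli G mG G0).
  transitivity (\int[leb R n]_y ((\1_B y)%:E * J)).
    apply: eq_integral => y _; rewrite /G /=.
    rewrite ge0_integralZl; [|exact: measurableT| |by move=> x _; exact: j0|exact: i0]; last first.
      exact: measurableT_comp mj (measurableT_comp myA (pair2_measurable y)).
    congr (_ * _).
    rewrite -[RHS](ge0_integral_leb_translate (- (A^T *m y))%R mj j0).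
    apply: eq_integral => x _; congr (_ ^-1)%:E; congr (_ ^+ n)%R.
    rewrite /japanese; congr (1 + _)%R.
    rewrite -(dot_orthogonal (x - A^T *m y)%R (x - A^T *m y)%R AA).
    rewrite mulmxBr mulmxA AA' mul1mx.
    by rewrite -opprB dotNl dotNr opprK.
  rewrite ge0_integralZr; [|exact: measurableT|exact: mi|by move=> y _; exact: i0|exact: ltW].
  by rewrite integral_indic // setIT.
have E2 : \int[leb R n]_x \int[leb R n]_y F (x, y) = leb R n ((fun x => A *m x)%R @^-1` B) * J.
  rewrite (fubini_tonelli F mF F0).
  transitivity (\int[leb R n]_y (leb R n ((fun x => A *m x)%R @^-1` B) * j y)).
    apply: eq_integral => y _; rewrite /F /=.
    rewrite ge0_integralZr; [|exact: measurableT| |by move=> x _; exact: i0|exact: j0]; last first.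
      exact: measurableT_comp (mi _ mB) (measurableT_comp mAy (pair2_measurable y)).
    congr (_ * _).
    rewrite -[in RHS](setIT ((fun x => A *m x)%R @^-1` B)) -integral_indic //.
    rewrite -[RHS](ge0_integral_leb_translate (A^T *m y)%R (mi _ mAB) (i0 _)).
    apply: eq_integral => x _; rewrite !indicE; congr (_ %:R%:E).
    rewrite -[RHS]/(nat_of_bool ((A *m (x + A^T *m y))%R \in B)).
    by rewrite mulmxDr mulmxA AA' mul1mx.
  by rewrite ge0_integralZl.
have := etrans (esym E2) E1.
rewrite -(fineK Jfin) => /(congr1 (fun x => x * ((fine J)^-1)%:E)).
have J1 : (fine J)%:E * ((fine J)^-1)%:E = 1 :> \bar R.
  by rewrite -EFinM divff // gt_eqF // fine_gt0 // J0 -ge0_fin_numE ?ltW.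
by rewrite -!muleA J1 !mule1.
Qed.

End lebesgue_cV_facts.

(** * Fubini for complex functions *)

Section complex_fubini.
Context d1 d2 (T1 : measurableType d1) (T2 : measurableType d2) (R : realType).
Variables (m1 : {sigma_finite_measure set T1 -> \bar R})
          (m2 : {sigma_finite_measure set T2 -> \bar R}).
Local Notation C := R[i].

Lemma real_fubini (f : T1 * T2 -> R) : (m1 \x m2)%E.-integrable setT (EFin \o f) ->
  (forall x, m2.-integrable setT (fun y => (f (x, y))%:E)) ->
  (forall y, m1.-integrable setT (fun x => (f (x, y))%:E)) ->
  Rintegral m1 setT (fun x => Rintegral m2 setT (fun y => f (x, y))) =
  Rintegral m2 setT (fun y => Rintegral m1 setT (fun x => f (x, y))).
Proof.
move=> fi f1 f2; rewrite /Rintegral; congr fine.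
transitivity (\int[m1]_x \int[m2]_y (f (x, y))%:E)%E.
  by apply: eq_integral => x _; rewrite fineK //; exact: integrable_fin_num (f1 x).
rewrite (Fubini fi); apply: eq_integral => y _.
by rewrite fineK //; exact: integrable_fin_num (f2 y).
Qed.

(** Only kernels dominated by a product [g x * h y] occur below. *)
Lemma cfubini (f : T1 * T2 -> C) (g : T1 -> R) (h : T2 -> R) : cmeasurable f ->
  m1.-integrable setT (EFin \o g) -> m2.-integrable setT (EFin \o h) ->
  (forall x y, cmod (f (x, y)) <= g x * h y) ->
  cintegral m1 (fun x => cintegral m2 (fun y => f (x, y))) =
  cintegral m2 (fun y => cintegral m1 (fun x => f (x, y))).
Proof.
move=> mf gi hi fgh.
have mf1 x : cmeasurable (fun y => f (x, y)).
  by apply: (cmeasurable_comp mf); exact: pair1_measurable.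
have mf2 y : cmeasurable (fun x => f (x, y)).
  by apply: (cmeasurable_comp mf); exact: pair2_measurable.
have i1 x : cintegrable m2 (fun y => f (x, y)).
  by apply: (cintegrable_le (mf1 x) (integrable_scale (g x) hi)) => y; exact: fgh.
have i2 y : cintegrable m1 (fun x => f (x, y)).
  apply: (cintegrable_le (mf2 y) (integrable_scale (h y) gi)) => x.
  by rewrite mulrC; exact: fgh.
have ip : cintegrable (m1 \x m2)%E f.
  apply/cintegrableP; split=> //.
  have mc := measurable_cmod mf.
  rewrite (fubini_tonelli1 (fun z => (cmod (f z))%:E)); last 2 first.
  - exact/measurable_EFinP.
  - by move=> z; rewrite lee_fin cmod_ge0.
  have mg : measurable_fun setT g by exact/measurable_EFinP/(measurable_int _ gi).
  have mh : measurable_fun setT h by exact/measurable_EFinP/(measurable_int _ hi).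
  apply: (@le_lt_trans _ _ (\int[m1]_x ((`|g x|)%:E * \int[m2]_y (`|h y|)%:E))%E).
    apply: ge0_le_integral => //.
    - by move=> x _; apply: integral_ge0 => y _; rewrite lee_fin cmod_ge0.
    - apply: (measurable_fun_fubini_tonelli_F (fun z => (cmod (f z))%:E)).
        exact/measurable_EFinP.
      by move=> z; rewrite lee_fin cmod_ge0.
    - apply: emeasurable_funM; last exact: measurable_cst.
      by apply/measurable_EFinP; exact: measurableT_comp.
    - move=> x _; rewrite -ge0_integralZl //; last first.
        by apply/measurable_EFinP; exact: measurableT_comp.
      apply: ge0_le_integral => //.
      + by move=> y _; rewrite lee_fin cmod_ge0.
      + by apply/measurable_EFinP; exact: measurable_cmod.
      + by apply/measurable_EFinP; apply: measurable_funM => //; exact: measurableT_comp.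
      + by move=> y _; rewrite -EFinM lee_fin -normrM (le_trans (fgh x y)) // ler_norm.
  rewrite ge0_integralZr //; last 2 first.
  - by apply/measurable_EFinP; exact: measurableT_comp.
  - by apply: integral_ge0 => y _; rewrite lee_fin.
  apply: lte_mul_pinfty.
  - by apply: integral_ge0 => y _; rewrite lee_fin.
  - rewrite ge0_fin_numE; first by case/integrableP: gi.
    by apply: integral_ge0 => x _; rewrite lee_fin.
  - by case/integrableP: hi.
rewrite /cintegral /=; congr (_ +i* _).
  apply: (@real_fubini (fun z => Re (f z))); first by case: ip.
    by move=> x; case: (i1 x).
  by move=> x; case: (i2 x).
apply: (@real_fubini (fun z => Im (f z))); first by case: ip.
  by move=> x; case: (i1 x).
by move=> x; case: (i2 x).
Qed.

End complex_fubini.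

(** * The Fourier transform of the Cauchy distribution *)

Section cauchy_fourier.
Variable R : realType.
Local Notation lam := (@lebesgue_measure R).

Let w (t : R) : R := (1 + t ^+ 2)^-1.

Let w_gt0 t : 0 < w t. Proof. by rewrite invr_gt0 ltr_pwDl // sqr_ge0. Qed.
Let w_le1 t : w t <= 1.
Proof. by rewrite invf_le1 ?ltr_pwDl ?sqr_ge0 // lerDl sqr_ge0. Qed.
Let wE t : w t * (1 + t ^+ 2) = 1.
Proof. by rewrite mulVf // gt_eqF // ltr_pwDl // sqr_ge0. Qed.
Let w_cont : continuous w. Proof. exact: continuous_oneDsqrV. Qed.
Let mw : measurable_fun setT w. Proof. exact: continuous_measurable_fun. Qed.

Lemma integrable_oneDsqrV : lam.-integrable setT (EFin \o (fun t : R => (1 + t ^+ 2)^-1)).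
Proof.
apply/integrableP; split; first exact/measurable_EFinP.
rewrite (_ : (\int[lam]_x _)%E = (\int[lam]_t (w t)%:E)%E).
  by rewrite integral_oneDsqr ltry.
by apply: eq_integral => t _; rewrite gee0_abs // lee_fin ltW // w_gt0.
Qed.

Let integrable_w (f : R -> R) (K : R) : measurable_fun setT f ->
  (forall t, `|f t| <= K * w t) -> lam.-integrable setT (EFin \o f).
Proof.
move=> mf fK; apply: (le_integrable measurableT _ _ (integrable_scale K integrable_oneDsqrV)).
  exact/measurable_EFinP.
by move=> t _; rewrite /= lee_fin (le_trans (fK t)) // ler_norm.
Qed.

Let tw t : `|t * w t| <= 1.
Proof.
rewrite normrM (gtr0_norm (w_gt0 t)).
have h : `|t| <= 1 + t ^+ 2.
  have := sqr_ge0 (t + 1); have := sqr_ge0 (t - 1); rewrite sqrrB sqrrD.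
  by have := sqr_ge0 t; rewrite ler_norml => *; apply/andP; split; lra.
by rewrite -(wE t) [leRHS]mulrC ler_wpM2r // ltW.
Qed.

Let ttw t : t ^+ 2 * w t = 1 - w t.
Proof. by rewrite -(wE t); ring. Qed.

Let Q s : R := Rintegral lam setT (fun t => cos (s * t) * w t ^+ 2).
Let S s : R := Rintegral lam setT (fun t => t * sin (s * t) * w t ^+ 2).
Let G s : R := Rintegral lam setT (fun t => cos (s * t) * w t).

Let mlin s : measurable_fun setT (fun t : R => s * t).
Proof. exact: measurable_funM. Qed.
Lemma measurable_cos_lin s : measurable_fun setT (fun t : R => cos (s * t)).
Proof.
apply: measurableT_comp (mlin s).
by apply: continuous_measurable_fun; exact: continuous_cos.
Qed.
Lemma measurable_sin_lin s : measurable_fun setT (fun t : R => sin (s * t)).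
Proof.
apply: measurableT_comp (mlin s).
by apply: continuous_measurable_fun; exact: continuous_sin.
Qed.

Lemma cos_abs1 (x : R) : `|cos x| <= 1. Proof. by rewrite ler_norml cos_geN1 cos_le1. Qed.
Lemma sin_abs1 (x : R) : `|sin x| <= 1. Proof. by rewrite ler_norml sin_geN1 sin_le1. Qed.
Let mcos := measurable_cos_lin.
Let msin := measurable_sin_lin.
Let cos1 := cos_abs1.
Let sin1 := sin_abs1.

Let bQ s t : `|cos (s * t) * w t ^+ 2| <= 1 * w t.
Proof.
rewrite mul1r expr2 mulrA normrM (gtr0_norm (w_gt0 t)) ler_piMl ?(ltW (w_gt0 t)) //.
by rewrite normrM mulr_ile1 // gtr0_norm.
Qed.
Let bS s t : `|t * sin (s * t) * w t ^+ 2| <= 1 * w t.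
Proof.
rewrite mul1r expr2 mulrA normrM (gtr0_norm (w_gt0 t)) ler_piMl ?(ltW (w_gt0 t)) //.
by rewrite mulrAC normrM mulr_ile1.
Qed.
Let bG s t : `|cos (s * t) * w t| <= 1 * w t.
Proof. by rewrite mul1r normrM (gtr0_norm (w_gt0 t)) ler_piMl // ltW. Qed.

Let iQ s : lam.-integrable setT (EFin \o (fun t => cos (s * t) * w t ^+ 2)).
Proof. by apply: integrable_w (bQ s); apply: measurable_funM => //; exact: measurable_funX. Qed.
Let iS s : lam.-integrable setT (EFin \o (fun t => t * sin (s * t) * w t ^+ 2)).
Proof.
apply: integrable_w (bS s); apply: measurable_funM; last exact: measurable_funX.
exact: measurable_funM.
Qed.
Let iG s : lam.-integrable setT (EFin \o (fun t => cos (s * t) * w t)).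
Proof. by apply: integrable_w (bG s); exact: measurable_funM. Qed.

Let is_derive_cos_lin (s t : R) : is_derive s 1 (fun s => cos (s * t)) (- (t * sin (s * t))).
Proof.
apply: is_derive_eq; rewrite /GRing.scale /=; ring.
Qed.
Let is_derive_sin_lin (s t : R) : is_derive s 1 (fun s => sin (s * t)) (t * cos (s * t)).
Proof.
apply: is_derive_eq; rewrite /GRing.scale /=; ring.
Qed.

Lemma is_derive_under_integral (f df : R -> R -> R) (g : R -> R) (s : R) :
  (forall s, lam.-integrable setT (EFin \o f s)) ->
  (forall s t : R, is_derive s (1 : R) (fun s => f s t) (df s t)) ->
  (forall t, 0 <= g t) -> lam.-integrable setT (EFin \o g) ->
  (forall s' t, `|s' - s| < 1 -> `|df s' t| <= g t) ->
  is_derive s (1 : R) (fun s => Rintegral lam setT (f s)) (Rintegral lam setT (df s)).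
Proof.
move=> fi dfd g0 gi dfg.
have Is : `]s - 1, s + 1[%classic s by rewrite /= in_itv /= ltrBlDr !ltrDl !ltr01.
have Ii x : `]s - 1, s + 1[%classic x -> lam.-integrable setT (EFin \o f x) by [].
have Id x y : `]s - 1, s + 1[%classic x -> setT y -> derivable (f ^~ y) x 1.
  by move=> _ _; have [] := dfd x y.
have p1 x y : partial1of2 f x y = df x y.
  by rewrite partial1of2E; have [_ <-] := dfd x y.
have Ig x y : `]s - 1, s + 1[%classic x -> setT y -> `|partial1of2 f x y| <= g y.
  rewrite /= in_itv /= => /andP[h1 h2] _; rewrite p1; apply: dfg.
  by rewrite ltr_norml; apply/andP; split; lra.
split; first exact: (derivable_under_integral measurableT Is Ii Id g0 gi Ig).
rewrite -derive1E (differentiation_under_integral measurableT Is Ii Id g0 gi Ig).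
by apply: eq_Rintegral => t _; rewrite p1.
Qed.

(** Translation invariance makes [s |-> \int F (t + s) dt] constant. *)
Lemma integral_derivative_eq0 (F F' : R -> R) (K : R) :
  (forall t, `|F t| <= K * w t) -> measurable_fun setT F' ->
  (forall t : R, is_derive t (1 : R) F (F' t)) -> (forall t, `|F' t| <= K * w t) ->
  Rintegral lam setT F' = 0.
Proof.
move=> FK mF' FF' F'K.
have K0 : 0 <= K.
  have := le_trans (normr_ge0 _) (FK 0).
  by rewrite pmulr_lge0 // w_gt0.
have mF : measurable_fun setT F.
  apply: continuous_measurable_fun => t; apply: differentiable_continuous.
  by apply/derivable1_diffP; have [] := FF' t.
have iF : lam.-integrable setT (EFin \o F) by exact: integrable_w FK.
have tr (H : R -> R) s : measurable_fun setT H ->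
    Rintegral lam setT (fun t => H (t + s)) = Rintegral lam setT H.
  move=> mH; rewrite /Rintegral; congr fine.
  have mt : measurable_fun [set: measurableTypeR R] (fun t : R => t + s : measurableTypeR R).
    exact: measurable_funD.
  apply: (integral_preserving mt (fun B mB => lebesgue_translate s mB) (f := fun t => (H t)%:E)).
  exact/measurable_EFinP.
have wS s t : `|s| < 1 -> w (t + s) <= 3 * w t.
  move=> s1; have h := sqr_ge0 (t + s + s); have s2 : s ^+ 2 <= 1.
    by rewrite -real_normK ?num_real // expr_le1 // ltW.
  rewrite /w -[3]invrK -invfM lef_pV2 ?posrE.
  - rewrite ler_pdivrMl //; move: h; rewrite !sqrrD; have := sqr_ge0 t; have := sqr_ge0 (t + 2 * s).
    by rewrite sqrrD exprMn; nra.
  - by rewrite ltr_pwDl // sqr_ge0.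
  - by rewrite mulr_gt0 ?invr_gt0 // ltr_pwDl // sqr_ge0.
have D : is_derive (0 : R) (1 : R) (fun s => Rintegral lam setT (fun t => F (t + s)))
    (Rintegral lam setT (fun t => F' (t + 0))).
  apply: (@is_derive_under_integral (fun s t => F (t + s)) (fun s t => F' (t + s)) (fun t => 3 * K * w t)).
  - move=> s; have mt : measurable_fun [set: measurableTypeR R] (fun t : R => t + s : measurableTypeR R).
      exact: measurable_funD.
    exact: (integrable_preserving mt (fun B mB => lebesgue_translate s mB) iF).
  - move=> s t; have := FF' (t + s) => h.
    rewrite -[X in is_derive _ _ _ X]mulr1.
    apply: (@is_derive1_comp _ F (fun s => t + s) s (F' (t + s)) 1) => //.
    rewrite -[X in is_derive _ _ _ X]add0r.
    exact: (@is_deriveD _ _ _ (cst t) id s 1 0 1).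
  - by move=> t; rewrite !mulr_ge0 // ltW.
  - by apply: integrable_scale; exact: integrable_oneDsqrV.
  - move=> s t; rewrite subr0 => s1; rewrite (le_trans (F'K _)) // mulrAC -mulrA [_ * K]mulrC.
    by rewrite mulrCA ler_wpM2l // wS.
move: D => [_]; under eq_fun do rewrite tr //.
by rewrite derive_cst; under eq_Rintegral do rewrite addr0; move=> <-.
Qed.

Let derivQ s : is_derive s (1 : R) (fun s => Q s) (- S s).
Proof.
rewrite (_ : - S s = Rintegral lam setT (fun t => - (t * sin (s * t)) * w t ^+ 2)).
  apply: (@is_derive_under_integral _ (fun s t => - (t * sin (s * t)) * w t ^+ 2) (fun t => 1 * w t)) => //.
  - move=> s' t; have h := is_derive_cos_lin s' t.
    by apply: is_derive_eq; rewrite /GRing.scale /= mulr0 add0r mulrC.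
  - by move=> t; rewrite mul1r ltW.
  - by apply: integrable_scale; exact: integrable_oneDsqrV.
  - by move=> s' t _; rewrite mulNr normrN; exact: bS.
rewrite -[LHS]mulN1r -(RintegralZl _ measurableT (iS s)).
by apply: eq_Rintegral => t _; ring.
Qed.

Let derivS s : is_derive s (1 : R) (fun s => S s) (G s - Q s).
Proof.
rewrite (_ : G s - Q s = Rintegral lam setT (fun t => t * (t * cos (s * t)) * w t ^+ 2)).
  apply: (@is_derive_under_integral _ (fun s t => t * (t * cos (s * t)) * w t ^+ 2) (fun t => 1 * w t)) => //.
  - move=> s' t; have h := is_derive_sin_lin s' t.
    by apply: is_derive_eq; rewrite /GRing.scale /=; ring.
  - by move=> t; rewrite mul1r ltW.
  - by apply: integrable_scale; exact: integrable_oneDsqrV.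
  - move=> s' t _.
    rewrite (_ : _ * _ = (t ^+ 2 * w t) * w t * cos (s' * t)); last by ring.
    rewrite ttw mul1r !normrM (gtr0_norm (w_gt0 t)) mulrAC ler_piMl ?(ltW (w_gt0 t)) //.
    by rewrite mulr_ile1 // ger0_norm ?subr_ge0 // lerBlDr lerDl ltW.
rewrite /G /Q -(RintegralB measurableT (iG s) (iQ s)).
apply: eq_Rintegral => t _; have := ttw t; set W := w t; set c := cos _ => h.
by rewrite -mulrBr (_ : W - W ^+ 2 = t ^+ 2 * W ^+ 2); [ring|rewrite expr2 [RHS]mulrA h; ring].
Qed.

Let derivw (t : R) : is_derive t (1 : R) w (- 2 * t * w t ^+ 2).
Proof.
have h : is_derive t (1 : R) (fun t : R => 1 + t ^+ 2) (2 * t).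
  by apply: is_derive_eq; rewrite /GRing.scale /=; ring.
have n0 : 1 + t ^+ 2 != 0 by rewrite gt_eqF // ltr_pwDl // sqr_ge0.
have H := @is_deriveV R (fun t => 1 + t ^+ 2) t (2 * t) 1 n0 h.
rewrite (_ : - 2 * t * w t ^+ 2 = - (1 + t ^+ 2) ^- 2 *: (2 * t)); first exact: H.
by rewrite /GRing.scale /= /w exprVn; ring.
Qed.

Let sG s : s * G s = 2 * S s.
Proof.
have F'K t : `|s * (cos (s * t) * w t) - 2 * (t * sin (s * t) * w t ^+ 2)| <= (`|s| + 2) * w t.
  rewrite (le_trans (ler_normB _ _)) // [leRHS]mulrDl lerD //.
    by rewrite normrM ler_wpM2l // (le_trans (bG s t)) // mul1r.
  by rewrite normrM ger0_norm // ler_wpM2l // (le_trans (bS s t)) // mul1r.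
have FK t : `|sin (s * t) * w t| <= (`|s| + 2) * w t.
  rewrite normrM (gtr0_norm (w_gt0 t)) ler_wpM2r ?(ltW (w_gt0 t)) //.
  by rewrite (le_trans (sin_abs1 _)) // ler_wpDl // ler1n.
have mF : measurable_fun setT (fun t => s * (cos (s * t) * w t) - 2 * (t * sin (s * t) * w t ^+ 2)).
  apply: measurable_funB; first by apply: measurable_funM => //; exact: measurable_funM.
  apply: measurable_funM => //; apply: measurable_funM; last exact: measurable_funX.
  exact: measurable_funM.
have := integral_derivative_eq0 FK mF _ F'K.
rewrite RintegralB //; last 2 first.
- by apply: integrable_scale; exact: iG.
- by apply: integrable_scale; exact: iS.
rewrite RintegralZl ?iG // RintegralZl ?iS // => /(_ _)/eqP.
rewrite subr_eq0 => /(_ _)/eqP; apply.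
move=> t; have h1 := is_derive_sin_lin t s; have h2 := derivw t.
have h3 : is_derive t (1 : R) (fun t => sin (s * t)) (s * cos (s * t)).
  by under eq_fun do rewrite mulrC; rewrite [s * t]mulrC.
by apply: is_derive_eq; rewrite /GRing.scale /=; ring.
Qed.

Let QB s : `|Q s| <= pi.
Proof.
have -> : (pi : R) = Rintegral lam setT w by rewrite /Rintegral integral_oneDsqr.
apply: le_trans (le_normr_Rintegral measurableT (iQ s)) _.
apply: le_Rintegral => //; [exact: integrable_norm (iQ s)|exact: integrable_oneDsqrV|].
by move=> t _; rewrite (le_trans (bQ s t)) // mul1r.
Qed.

Let SB s : `|S s| <= pi.
Proof.
have -> : (pi : R) = Rintegral lam setT w by rewrite /Rintegral integral_oneDsqr.
apply: le_trans (le_normr_Rintegral measurableT (iS s)) _.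
apply: le_Rintegral => //; [exact: integrable_norm (iS s)|exact: integrable_oneDsqrV|].
by move=> t _; rewrite (le_trans (bS s t)) // mul1r.
Qed.

Lemma zero_derivative_cst (f : R -> R) (a : R) :
  (forall x, a <= x -> is_derive x (1 : R) f 0) -> forall x, a <= x -> f x = f a.
Proof.
move=> h x; rewrite le_eqVlt => /predU1P[->//|ax].
have [||c _ /eqP] := @MVT _ f (fun=> 0) a x ax.
- by move=> c; rewrite in_itv /= => /andP[/ltW/h + _].
- apply: continuous_in_subspaceT => c; rewrite inE /= in_itv /= => /andP[/h[+ _] _].
  by move=> /derivable1_diffP/differentiable_continuous.
- by rewrite mul0r subr_eq0 => /eqP.
Qed.

(** The combination [s Q - (1 + s) S] solves [u' = (1 + 2/s) u], whose nonzero
    solutions grow exponentially, while [Q] and [S] are bounded. *)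
Let QS s : 0 < s -> s * Q s = (1 + s) * S s.
Proof.
move=> s0; pose u s := (s * Q s - (1 + s) * S s) * expR (- s) / s ^+ 2.
have du (x : R) : 0 < x -> is_derive x (1 : R) u (0 : R).
  move=> x0; have h1 := derivQ x; have h2 := derivS x.
  have h3 : is_derive x (1 : R) (fun x : R => expR (- x)) (- expR (- x)).
    by apply: is_derive_eq; rewrite mulrN1.
  have x2 : x ^+ 2 != 0 by rewrite expf_eq0 /= gt_eqF.
  have h5 : is_derive x (1 : R) (fun x : R => x ^+ 2) (2 * x).
    by apply: is_derive_eq; rewrite /GRing.scale /=; ring.
  have h4 := @is_deriveV R (fun x => x ^+ 2) x (2 * x) 1 x2 h5.
  apply: is_derive_eq; rewrite /GRing.scale /=.
  have -> : G x = 2 * S x / x by rewrite -sG mulrAC divff ?mul1r // gt_eqF.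
  by field; rewrite gt_eqF.
have ub x : 1 <= x -> `|u x| <= 3 * pi / x.
  move=> x1; have x0 : 0 < x by exact: lt_le_trans x1.
  have p0 := pi_gt0 R.
  rewrite /u !normrM [`|expR _|]ger0_norm ?expR_ge0 // normrV ?unitfE ?expf_eq0 ?gt_eqF //.
  rewrite [`|x ^+ 2|]ger0_norm ?sqr_ge0 // expr2 invfM mulrA.
  rewrite ler_wpM2r ?invr_ge0 ?(ltW x0) // ler_pdivrMr //.
  have e1 : expR (- x) <= 1 by rewrite -expR0 ler_expR oppr_le0 ltW.
  apply: (@le_trans _ _ (`|x * Q x - (1 + x) * S x|)).
    by rewrite ler_piMr.
  rewrite (le_trans (ler_normB _ _)) // !normrM (gtr0_norm x0).
  have -> : `|1 + x| = 1 + x by rewrite ger0_norm // addr_ge0 // ltW.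
  have := QB x; have := SB x; nra.
have u0 : u s = 0.
  apply/eqP; rewrite -normr_le0; apply/ler_addgt0Pr => e e0; rewrite add0r.
  pose x := Num.max (Num.max s 1) (3 * pi / e).
  have sx : s <= x by rewrite !le_max lexx.
  have x1 : 1 <= x by rewrite !le_max lexx orbT.
  have xe : 3 * pi / e <= x by rewrite !le_max lexx orbT.
  rewrite -(@zero_derivative_cst u s _ x sx) => [|y sy]; last first.
    by apply: du; exact: lt_le_trans sy.
  rewrite (le_trans (ub x x1)) // ler_pdivrMr ?(lt_le_trans _ x1) //.
  by rewrite -ler_pdivrMl // mulrC.
move: u0; rewrite /u => /eqP; rewrite !mulf_eq0 invr_eq0 expf_eq0 /= [s == 0]gt_eqF //.
by rewrite [expR _ == 0]gt_eqF ?expR_gt0 // !orbF subr_eq0 => /eqP.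
Qed.

Let S0 : S 0 = 0.
Proof.
rewrite /S (_ : (fun t => _) = cst 0); last first.
  by apply/funext => t; rewrite mul0r sin0 mulr0 mul0r.
by rewrite /Rintegral integral0_eq.
Qed.

Let Q_solution s : 0 <= s -> Q s = Q 0 * (1 + s) * expR (- s).
Proof.
move=> s0; pose z (s : R) := Q s * expR s / (1 + s).
have : z s = z 0.
  apply: zero_derivative_cst => // x x0.
  have h1 := derivQ x.
  have x1 : 1 + x != 0 by rewrite gt_eqF // ltr_pwDl.
  have h3 : is_derive x (1 : R) (fun x : R => 1 + x) (1 : R).
    rewrite -[X in is_derive _ _ _ X]add0r.
    exact: (@is_deriveD _ _ _ (cst (1 : R)) id x 1 0 1).
  have h4 := @is_deriveV R (fun x => 1 + x) x 1 1 x1 h3.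
  apply: is_derive_eq; rewrite /GRing.scale /=.
  have E : (1 + x) * S x = x * Q x.
    by move: x0; rewrite le_eqVlt => /predU1P[<-|/QS//]; rewrite S0 mulr0 mul0r.
  have -> : S x = x * Q x / (1 + x) by rewrite -E mulrAC divff ?mul1r.
  by field.
rewrite /z expR0 addr0 divr1 mulr1 => <-; rewrite expRN; field.
by rewrite !gt_eqF ?expR_gt0 // ltr_pwDl.
Qed.

Let S_solution s : 0 < s -> S s = Q 0 * s * expR (- s).
Proof.
move=> s0; have s1 : 1 + s != 0 by rewrite gt_eqF // ltr_pwDl // ltW.
apply: (mulfI s1); rewrite -QS // Q_solution ?ltW //; ring.
Qed.

Let G_solution s : 0 < s -> G s = 2 * Q 0 * expR (- s).
Proof.
move=> s0; apply: (mulfI (_ : s != 0)); first by rewrite gt_eqF.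
by rewrite sG S_solution //; ring.
Qed.

Let G0 : G 0 = 2 * Q 0.
Proof.
have [D E] := derivS 0.
have cv : h^-1 *: (S (h *: (1 : R) + 0) - S 0) @[h --> (0 : R)^'+] --> G 0 - Q 0.
  rewrite -E; apply: cvg_dnbhs_at_right; exact: D.
have cv' : h^-1 *: (S (h *: (1 : R) + 0) - S 0) @[h --> (0 : R)^'+] --> Q 0.
  have : Q 0 * expR (- h) @[h --> (0 : R)^'+] --> Q 0 * expR (- 0).
    apply: cvg_at_right_filter; apply: cvgM; first exact: cvg_cst.
    apply: (continuous_comp (f := -%R)); first exact: opp_continuous.
    exact: continuous_expR.
  rewrite oppr0 expR0 mulr1; apply: cvg_trans; apply: near_eq_cvg.
  near=> h; have h0 : 0 < h by near: h; exact: nbhs_right_gt.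
  rewrite S0 subr0 addr0 /GRing.scale /= mulr1 S_solution //.
  by field; rewrite gt_eqF.
have : G 0 - Q 0 = Q 0 by apply: cvg_unique cv cv'.
by lra.
Unshelve. all: by end_near. Qed.

Lemma fourier_oneDsqrV s : 0 <= s ->
  Rintegral lam setT (fun t => cos (s * t) * (1 + t ^+ 2)^-1) = pi * expR (- s).
Proof.
have Gpi : G 0 = pi.
  rewrite /G (_ : (fun t => _) = w); first by rewrite /Rintegral integral_oneDsqr.
  by apply/funext => t; rewrite mul0r cos0 mul1r.
rewrite -/(G s) -Gpi le_eqVlt => /predU1P[<-|s0]; first by rewrite oppr0 expR0 mulr1.
by rewrite G_solution // G0.
Qed.

End cauchy_fourier.

Section cauchy_kernel.
Variable R : realType.
Local Notation lam := (@lebesgue_measure R).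

Lemma lebesgue_scale (a : R) (A : set R) : 0 < a -> measurable A ->
  lam A = (a%:E * lam ((fun x => a * x)%R @^-1` A))%E.
Proof.
move=> a0 mA.
have mt : measurable_fun [set: measurableTypeR R] (fun x : R => a * x : measurableTypeR R).
  exact: measurable_funM.
pose m' := mscale (NngNum (ltW a0)) (pushforward lam (fun x : R => a * x : measurableTypeR R)).
have -> : (a%:E * lam ((fun x => a * x)%R @^-1` A))%E = m' mt A by [].
apply: (@lebesgue_measure_unique _ (m' mt)) => // _ [[s t] _ <-].
rewrite -[RHS]/(a%:E * lam ((fun x : R => a * x)%R @^-1` `]s, t]%classic))%E.
rewrite (_ : _ @^-1` _ = `]s / a, t / a]%classic); last first.
  by apply/seteqP; split=> x /=; rewrite !in_itv /= ltr_pdivrMr // ler_pdivlMr // ![x * a]mulrC.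
rewrite !lebesgue_measure_itv /= !lte_fin ltr_pM2r ?invr_gt0 //.
case: ifP => // _; last by rewrite mule0.
by rewrite -!EFinB -EFinM; congr (_%:E); field; rewrite gt_eqF.
Qed.

Lemma ge0_integral_scale (a : R) (f : R -> \bar R) : 0 < a -> measurable_fun setT f ->
  (forall x, (0 <= f x)%E) -> (\int[lam]_x f x = a%:E * \int[lam]_x f (a * x)%R)%E.
Proof.
move=> a0 mf f0.
have mt : measurable_fun [set: measurableTypeR R] (fun x : R => a * x : measurableTypeR R).
  exact: measurable_funM.
pose m' := mscale (NngNum (ltW a0)) (pushforward lam (fun x : R => a * x : measurableTypeR R)).
transitivity (\int[m' mt]_x f x)%E.
  by apply: eq_measure_integral => B mB _; exact: lebesgue_scale.
rewrite ge0_integral_mscale // (ge0_integral_pushforward mt) //.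
Qed.

Definition cauchy_fun (a t : R) : R := pi^-1 * (a / (a ^+ 2 + t ^+ 2)).

Lemma cauchy_fun_ge0 a t : 0 <= a -> 0 <= cauchy_fun a t.
Proof. by move=> a0; rewrite mulr_ge0 ?invr_ge0 ?pi_ge0 // divr_ge0 // addr_ge0 // sqr_ge0. Qed.

Lemma measurable_cauchy_fun a : measurable_fun setT (cauchy_fun a).
Proof.
apply: measurable_funM => //; apply: measurable_funM => //.
by apply: measurableT_comp (@measurable_inv R) _; apply: measurable_funD => //; exact: measurable_funX.
Qed.

Lemma cauchy_fun_scale a t : 0 < a -> a * cauchy_fun a (a * t) = pi^-1 * (1 + t ^+ 2)^-1.
Proof.
move=> a0; rewrite /cauchy_fun mulrCA; congr (_ * _).
have t1 : 1 + t ^+ 2 != 0 by rewrite gt_eqF // ltr_pwDl // sqr_ge0.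
rewrite (_ : a ^+ 2 + (a * t) ^+ 2 = a * (a * (1 + t ^+ 2))); last by ring.
by field; rewrite t1 gt_eqF.
Qed.

Lemma integral_cauchy_fun a : 0 < a -> (\int[lam]_t (cauchy_fun a t)%:E = 1)%E.
Proof.
move=> a0; rewrite (ge0_integral_scale a0); last 2 first.
- by apply/measurable_EFinP; exact: measurable_cauchy_fun.
- by move=> t; rewrite lee_fin cauchy_fun_ge0 // ltW.
rewrite -ge0_integralZl //; last 3 first.
- apply/measurable_EFinP; apply: measurableT_comp (measurable_cauchy_fun a) _.
  exact: measurable_funM.
- by move=> t _; rewrite lee_fin cauchy_fun_ge0 // ltW.
- by rewrite lee_fin ltW.
under eq_integral do rewrite -EFinM cauchy_fun_scale // EFinM.
rewrite ge0_integralZl //; last 3 first.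
- by apply/measurable_EFinP; apply: continuous_measurable_fun; exact: continuous_oneDsqrV.
- by move=> t _; rewrite lee_fin invr_ge0 addr_ge0 // sqr_ge0.
- by rewrite lee_fin invr_ge0 pi_ge0.
by rewrite integral_oneDsqr -EFinM mulVf // gt_eqF // pi_gt0.
Qed.

Lemma integrable_cauchy_fun a : 0 < a -> lam.-integrable setT (EFin \o cauchy_fun a).
Proof.
move=> a0; apply/integrableP; split.
  by apply/measurable_EFinP; exact: measurable_cauchy_fun.
rewrite (_ : (\int[lam]_x _)%E = 1%E) ?ltry // -(integral_cauchy_fun a0).
by apply: eq_integral => t _; rewrite gee0_abs // lee_fin cauchy_fun_ge0 // ltW.
Qed.

Lemma Rintegral_scale (a : R) (f : R -> R) : 0 < a -> lam.-integrable setT (EFin \o f) ->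
  Rintegral lam setT f = Rintegral lam setT (fun x => a * f (a * x)).
Proof.
move=> a0 fi; have mf : measurable_fun setT (EFin \o f) by exact: measurable_int fi.
have mt : measurable_fun [set: measurableTypeR R] (fun x : R => a * x : measurableTypeR R).
  exact: measurable_funM.
have E (g : R -> \bar R) : measurable_fun setT g -> (forall x, (0 <= g x)%E) ->
    (\int[lam]_x g x = \int[lam]_x (a%:E * g (a * x)%R))%E.
  move=> mg g0; rewrite (ge0_integral_scale a0) // ge0_integralZl //.
  - exact: measurableT_comp mg mt.
  - by rewrite lee_fin ltW.
rewrite /Rintegral; congr fine; rewrite integralE [RHS]integralE.
rewrite (E _ (measurable_funepos mf)); last by move=> x; exact: funepos_ge0.
rewrite (E _ (measurable_funeneg mf)); last by move=> x; exact: funeneg_ge0.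
have h : (fun x => (a * f (a * x))%:E) = (fun x => a%:E * ((EFin \o f) \o (fun x => a * x)%R) x)%E.
  by apply/funext => x.
congr (_ - _)%E; apply: eq_integral => x _.
  by rewrite h (ge0_funeposM _ (ltW a0)) [in RHS]funepos_comp.
by rewrite h (ge0_funenegM _ (ltW a0)) [in RHS]funeneg_comp.
Qed.

(** The Poisson kernel of the upper half plane: its Fourier transform is
    [exp (- a |s|)], because the one of [1 / (1 + t^2)] is [pi exp (- |s|)]. *)
Lemma fourier_cauchy a s : 0 < a -> 0 <= s ->
  cintegral lam (fun t => (cauchy_fun a t)%:C * expi (s * t)) = (expR (- (a * s)))%:C.
Proof.
move=> a0 s0.
have mc : measurable_fun setT (fun t : R => cos (s * t) * cauchy_fun a t).
  by apply: measurable_funM; [exact: measurable_cos_lin|exact: measurable_cauchy_fun].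
have ms : measurable_fun setT (fun t : R => sin (s * t) * cauchy_fun a t).
  by apply: measurable_funM; [exact: measurable_sin_lin|exact: measurable_cauchy_fun].
have ic : lam.-integrable setT (EFin \o (fun t : R => cos (s * t) * cauchy_fun a t)).
  apply: (le_integrable measurableT _ _ (integrable_cauchy_fun a0)); first exact/measurable_EFinP.
  move=> t _; rewrite /= lee_fin normrM ler_piMl // cos_abs1 //.
apply: complex_eqP => /=; last first.
  rewrite (_ : (fun t => _) = (fun t => sin (s * t) * cauchy_fun a t)); last first.
    by apply/funext => t; rewrite mul0r addr0 mulrC.
  have odd : Rintegral lam setT (fun t => sin (s * t) * cauchy_fun a t) =
      - Rintegral lam setT (fun t => sin (s * t) * cauchy_fun a t).
    rewrite -[RHS]mulN1r -RintegralZl //; last first.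
      apply: (le_integrable measurableT _ _ (integrable_cauchy_fun a0)); first exact/measurable_EFinP.
      by move=> t _; rewrite /= lee_fin normrM ler_piMl // sin_abs1.
    rewrite /Rintegral; congr fine.
    have mo : measurable_fun [set: measurableTypeR R] (-%R : R -> measurableTypeR R).
      exact: oppr_measurable.
    rewrite -[LHS](integral_preserving mo (fun B mB => lebesgue_opp mB)); last exact/measurable_EFinP.
    by apply: eq_integral => t _; rewrite mulrN sinN /cauchy_fun sqrrN mulN1r mulNr.
  by move: odd; set I := Rintegral _ _ _ => /eqP; rewrite -addr_eq0 -mulr2n mulrn_eq0 => /eqP.
rewrite (_ : (fun t => _) = (fun t => cos (s * t) * cauchy_fun a t)); last first.
  by apply/funext => t; rewrite mul0r subr0 mulrC.
rewrite (Rintegral_scale a0 ic).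
rewrite (_ : (fun t => _) = (fun t => pi^-1 * (cos ((a * s) * t) * (1 + t ^+ 2)^-1))).
  rewrite RintegralZl //; last first.
    apply: (le_integrable measurableT _ _ (integrable_oneDsqrV R)).
      apply/measurable_EFinP; apply: measurable_funM; first exact: measurable_cos_lin.
      by apply: continuous_measurable_fun; exact: continuous_oneDsqrV.
    by move=> t _; rewrite /= lee_fin normrM ler_piMl // cos_abs1.
  by rewrite fourier_oneDsqrV ?mulr_ge0 ?(ltW a0) // mulrA mulVf ?mul1r // gt_eqF // pi_gt0.
apply/funext => t; rewrite mulrCA cauchy_fun_scale // mulrCA; congr (_ * (cos _ * _)).
by ring.
Qed.

End cauchy_kernel.

(** * Differentiable and smooth functions *)

Section c1_functions.
Variable R : realType.

Lemma cvg_mx T (F : set_system T) {FF : Filter F} m n (f : T -> 'M[R]_(m, n)) (l : 'M[R]_(m, n)) :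
  (forall i j, (fun x => f x i j) @ F --> l i j) -> f @ F --> l.
Proof.
move=> fl; apply/cvg_mx_entourageP => A entA.
apply: filter_forall => i; apply: filter_forall => j.
have h := (@cvg_app_entourageP _ _ _ _ FF _).1 (fl i j) A entA.
suff : \forall x \near F, (l i j, f x i j) \in A by [].
by apply: filterS h => x; rewrite inE.
Qed.

Lemma cvg_finsum T (F : set_system T) {FF : Filter F} (I : Type) (s : seq I) (f : I -> T -> R) (l : I -> R) :
  (forall i, f i @ F --> l i) -> (fun x => \sum_(i <- s) f i x) @ F --> \sum_(i <- s) l i.
Proof.
move=> fl; elim: s => [|i s IH].
  by rewrite big_nil; under eq_fun do rewrite big_nil; exact: cvg_cst.
by rewrite big_cons; under eq_fun do rewrite big_cons; exact: cvgD.
Qed.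

Lemma continuous_affine m n (A : 'M[R]_(m, n)) (b : 'cV[R]_m) :
  continuous (fun x : 'cV[R]_n => A *m x + b).
Proof.
move=> x; apply: (@cvg_mx _ (nbhs x) (nbhs_filter x)) => i j; rewrite mxE.
under eq_fun do rewrite mxE; apply: cvgD; last exact: cvg_cst.
rewrite mxE; under eq_fun do rewrite mxE.
apply: (@cvg_finsum _ (nbhs x) (nbhs_filter x)) => k; apply: cvgM; first exact: cvg_cst.
exact: coord_continuous.
Qed.

Lemma is_deriveP (V : normedModType R) (f : V -> R) (x v : V) d :
  is_derive x v f d <-> (fun h : R => h^-1 * (f (h *: v + x) - f x)) @ 0^' --> d.
Proof.
split => [[df <-]|df]; first exact: df.
apply: DeriveDef; first by apply/cvg_ex; exists d.
exact: cvg_lim df.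
Qed.

Section normed.
Variable V : normedModType R.
Implicit Types (f : V -> R) (x y v e : V).

Lemma is_derive_line f x v (s : R) d :
  is_derive (s *: v + x) v f d <-> is_derive s (1 : R) (fun t => f (t *: v + x)) d.
Proof.
rewrite is_deriveP; split => [h|[dg <-]].
  apply: DeriveDef; first by apply/cvg_ex; exists d; move: h; under eq_fun do rewrite addrA -scalerDl -[X in (X + s) *: v](mulr1 _).
  by apply: cvg_lim => //; move: h; under eq_fun do rewrite addrA -scalerDl -[X in (X + s) *: v](mulr1 _).
by under eq_fun do rewrite addrA -scalerDl -[X in (X + s) *: v](mulr1 _); exact: dg.
Qed.

Lemma line_MVT f e y (b : R) : (forall z, derivable f z e) ->
  exists2 s : R, 0 <= s <= 1 & f (b *: e + y) - f y = b * 'D_e f ((s * b) *: e + y).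
Proof.
move=> df.
have dg (t : R) : is_derive t (1 : R) (fun t : R => f ((t * b) *: e + y)) ('D_e f ((t * b) *: e + y) * b).
  apply: (@is_derive1_comp _ (fun s => f (s *: e + y)) (fun t => t * b)).
    by apply/is_derive_line; exact: derivableP.
  apply/(is_deriveP (V := R^o)); apply: cvg_near_cst.
  by near=> h; rewrite [h *: _]mulr1 mulrDl addrK mulrA mulVf ?mul1r //; near: h; exact: nbhs_dnbhs_neq.
have [|s s01] := @MVT_segment R (fun t : R => f ((t * b) *: e + y)) _ 0 1 ler01 (fun t _ => dg t).
  apply: continuous_subspaceT => t; apply: differentiable_continuous.
  by apply/derivable1_diffP; case: (dg t).
rewrite subr0 mulr1 mul1r mul0r scale0r add0r => E.
by exists s; rewrite // E mulrC.
Unshelve. all: by end_near. Qed.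

(** A function whose derivative in the direction [e] is continuous may be
    followed along [e] after any other direction; the mean value theorem turns
    the increment into a value of that derivative at a nearby point. *)
Lemma is_derive_add_dir f x v e (a d : R) : (forall z, derivable f z e) ->
  {for x, continuous (fun z => 'D_e f z)} -> is_derive x v f d ->
  is_derive x (v + a *: e) f (d + a * 'D_e f x).
Proof.
move=> df ce /is_deriveP fv; apply/is_deriveP; rewrite [d + _]addrC.
have mvt (h : R) := @line_MVT f e (h *: v + x) (h * a) df.
pose s h := projT1 (cid2 (mvt h)).
have sP h : 0 <= s h <= 1 /\ f ((h * a) *: e + (h *: v + x)) - f (h *: v + x) =
    (h * a) * 'D_e f ((s h * (h * a)) *: e + (h *: v + x)).
  by rewrite /s; case: cid2.
have key : (fun h : R => a * 'D_e f ((s h * (h * a)) *: e + (h *: v + x)) +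
    h^-1 * (f (h *: v + x) - f x)) @ 0^' --> a * 'D_e f x + d.
  apply: cvgD => //; apply: cvgMl_tmp.
  suff cx : (fun h : R => (s h * (h * a)) *: e + (h *: v + x)) @ 0^' --> x.
    exact: (cvg_comp _ _ cx ce).
  have c0 : (fun h : R => h) @ 0^' --> (0 : R) by apply: cvg_within.
  rewrite -[X in _ --> X]add0r; apply: cvgD; last first.
    by rewrite -[X in _ --> X]add0r -[X in X + x](scale0r v); apply: cvgD; [exact: cvgZr_tmp|exact: cvg_cst].
  rewrite -(scale0r e); apply: cvgZr_tmp.
  apply/cvgrPdist_le => ep ep0; have c1 : (fun h : R => a * h) @ 0^' --> a * 0 by exact: cvgMl_tmp.
  move/cvgrPdist_le: c1 => /(_ _ ep0).
  apply: filterS => h; rewrite mulr0 !sub0r !normrN [a * _]mulrC; apply: le_trans.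
  have [/andP[s0 s1] _] := sP h.
  by rewrite normrM ger0_norm // ler_piMl.
apply: cvg_trans key; apply: near_eq_cvg; near=> h.
have h0 : h != 0 by near: h; exact: nbhs_dnbhs_neq.
have [_ E] := sP h.
rewrite (_ : h *: (v + a *: e) + x = (h * a) *: e + (h *: v + x)); last first.
  by rewrite scalerDr scalerA addrA [h *: v + _]addrC.
have -> : f ((h * a) *: e + (h *: v + x)) =
    (h * a) * 'D_e f ((s h * (h * a)) *: e + (h *: v + x)) + f (h *: v + x) by rewrite -E subrK.
rewrite -[_ * _ + _ - f x]addrA [in RHS]mulrDr; congr (_ + _).
by rewrite !mulrA mulVf // mul1r.
Unshelve. all: by end_near. Qed.

Lemma is_derive_dir0 f x : is_derive x 0 f 0.
Proof.
by apply/is_deriveP; under eq_fun do rewrite scaler0 add0r subrr mulr0; exact: cvg_cst.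
Qed.

End normed.

Lemma is_derive_dir d (f : 'cV[R]_d -> R) (x v : 'cV[R]_d) :
  (forall i z, derivable f z (delta_mx i 0)) ->
  (forall i, continuous (fun z => 'D_(delta_mx i 0) f z)) ->
  is_derive x v f (\sum_i v i 0 * 'D_(delta_mx i 0) f x).
Proof.
move=> df cf; have ->  : v = \sum_i v i 0 *: delta_mx i 0.
  apply/matrixP => i j; rewrite ord1 summxE (bigD1 i) //= big1 ?addr0 => [|k ki].
    by rewrite !mxE !eqxx mulr1.
  by rewrite !mxE eq_sym (negbTE ki) mulr0.
have E i : (\sum_i v i 0 *: delta_mx i 0 : 'cV[R]_d) i 0 = v i 0.
  rewrite summxE (bigD1 i) //= big1 ?addr0 => [|k ki].
    by rewrite !mxE !eqxx mulr1.
  by rewrite !mxE eq_sym (negbTE ki) mulr0.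
under [X in is_derive _ _ _ X]eq_bigr do rewrite E.
elim: (index_enum _) => [|i s IH]; first by rewrite !big_nil; exact: is_derive_dir0.
by rewrite !big_cons addrC [X in is_derive _ _ _ X]addrC; apply: is_derive_add_dir => //; exact: cf.
Qed.

End c1_functions.

Section flat_functions.
Variable R : realType.

(** The functions [y^(-m) exp (- 1 / y)], extended by zero to [y <= 0]: the
    derivative of one of them is a combination of two others, hence they are
    smooth. *)
Definition flat (m : nat) (y : R) : R :=
  if 0 < y then y^-1 ^+ m * expR (- y^-1) else 0.

Lemma flat_ge0 m y : 0 <= flat m y.
Proof.
by rewrite /flat; case: ifP => // y0; rewrite mulr_ge0 ?expR_ge0 // exprn_ge0 // invr_ge0 ltW.
Qed.

Lemma flat_le m y : flat m y <= m.+2`!%:R * y ^+ 2.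
Proof.
rewrite /flat; case: ifPn => [y0|_]; last by rewrite mulr_ge0 // sqr_ge0.
have z0 : 0 < y^-1 by rewrite invr_gt0.
have e1 : y^-1 ^+ m.+2 / m.+2`!%:R <= expR y^-1.
  by apply: le_trans (expR_ge1Dxn m.+1 (ltW z0)); rewrite lerDr.
rewrite expRN ler_pdivrMr ?expR_gt0 // -mulrA.
apply: le_trans (ler_wpM2l (ler0n _ _) (ler_wpM2l (sqr_ge0 y) e1)).
have F0 : m.+2`!%:R != 0 :> R by rewrite pnatr_eq0 -lt0n fact_gt0.
have yn : y != 0 by rewrite gt_eqF.
rewrite (exprS _ m.+1) (exprS _ m); set F := m.+2`!%:R; set Y := y^-1 ^+ m.
by rewrite (_ : F * _ = Y) //; field; rewrite F0 yn.
Qed.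

Lemma is_derive_flat m (y : R) :
  is_derive y (1 : R) (flat m) (flat m.+2 y - m%:R * flat m.+1 y).
Proof.
have [y0|y0|<-] := ltgtP 0 y; last first.
- rewrite {2 3}/flat ltxx mulr0 subr0; apply/(is_deriveP (V := R^o)).
  have c0 : (fun h : R => h) @ 0^' --> (0 : R) by apply: cvg_within.
  have c1 : (fun h : R => m.+2`!%:R * h) @ 0^' --> m.+2`!%:R * (0 : R) by exact: cvgMl_tmp.
  apply/cvgrPdist_le => ep ep0; move/cvgrPdist_le: c1 => /(_ _ ep0).
  apply: filterS2 (nbhs_dnbhs_neq _) => h h0; rewrite mulr0 !sub0r !normrN; apply: le_trans.
  rewrite [h *: _]mulr1 addr0 {2}/flat ltxx subr0 !normrM normfV [`|flat _ _|]ger0_norm ?flat_ge0 //.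
  rewrite mulrC ler_pdivrMr ?normr_gt0 //; apply: le_trans (flat_le m h) _.
  by rewrite -mulrA ger0_norm // -normrM -expr2 [`|_ ^+ 2|]ger0_norm ?sqr_ge0.
- have -> : flat m.+2 y - m%:R * flat m.+1 y = 0.
    by rewrite /flat (lt_gtF y0) mulr0 subr0.
  have d0 : is_derive y (1 : R) (fun _ : R => 0 : R) 0.
    by apply/(is_deriveP (V := R^o)); under eq_fun do rewrite subrr mulr0; exact: cvg_cst.
  apply: near_eq_is_derive d0.
  near=> z; rewrite /flat ifF //; apply/negbTE; rewrite -leNgt.
  by apply: ltW; near: z; exact: lt_nbhsl.
apply: (@near_eq_is_derive _ _ _ (fun y : R => y^-1 ^+ m * expR (- y^-1))).
  near=> z; rewrite /flat ifT //.
  by near: z; exact: lt_nbhsr.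
have yn : y != 0 by rewrite gt_eqF.
have dV : is_derive y (1 : R) (fun y : R => y^-1) (- y^-1 ^+ 2).
  have := @is_deriveV R id y 1 1 yn (is_derive_id _ _).
  by rewrite [_ *: _]mulr1 -exprVn.
have dE : is_derive y (1 : R) (expR \o (fun y : R => - y^-1)) (expR (- y^-1) * (y^-1 ^+ 2)).
  apply: (@is_derive1_comp R expR (fun y => - y^-1) _ _ _ (is_derive_expR _)).
  by rewrite -[y^-1 ^+ 2]opprK; exact: is_deriveN.
have h := is_deriveM (is_deriveX m dV) dE.
rewrite exprfctE in h; apply: (is_derive_eq h).
suff : y^-1 ^+ m * (expR (- y^-1) * y^-1 ^+ 2) +
    expR (- y^-1) * ((m%:R * y^-1 ^+ m.-1) * - y^-1 ^+ 2) = flat m.+2 y - m%:R * flat m.+1 y by [].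
rewrite /flat y0; case: m h => [|m] h; first by rewrite !mul0r mulr0 addr0 subr0 expr0 mul1r mulrC.
rewrite [m.+1.-1]/=; rewrite (exprS _ m.+2) !(exprS _ m.+1) !(exprS _ m); ring.
Unshelve. all: by end_near. Qed.

End flat_functions.

Section smooth_functions.
Variables (R : realType) (d : nat).
Local Notation Rd := 'cV[R]_d.
Local Notation unitv i := (delta_mx i 0 : Rd).
Implicit Types f g : Rd -> R.

(** A property stable under partial derivatives which entails continuity and
    partial differentiability entails smoothness. *)
Lemma smooth_real_coind (P : (Rd -> R) -> Prop) f :
  (forall f, P f -> continuous f /\
     forall i, exists2 g, P g & forall x, is_derive x (unitv i) f (g x)) ->
  P f -> smooth_real f.
Proof.
move=> PP Pf s.
have Ps : P (partials s f).
  elim: s => [|i s /PP[_ /(_ i)[g Pg dg]]] //=.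
  by rewrite (_ : (fun x => _) = g) //; apply/funext => x; case: (dg x).
have [cs ds] := PP _ Ps; split=> // i x.
by have [g _ dg] := ds i; case: (dg x).
Qed.

Lemma smooth_continuous f : smooth_real f -> continuous f.
Proof. by move=> /(_ [::])[]. Qed.

Lemma smooth_derivable f i x : smooth_real f -> derivable f x (unitv i).
Proof. by move=> /(_ [::])[_]; apply. Qed.

Lemma partials_rcons s i f : partials (rcons s i) f = partials s (fun x => 'D_(unitv i) f x).
Proof. by rewrite /partials foldr_rcons. Qed.

Lemma smooth_partial f i : smooth_real f -> smooth_real (fun x => 'D_(unitv i) f x).
Proof. by move=> sf s; rewrite -partials_rcons; exact: sf. Qed.

Lemma smooth_dir f x v : smooth_real f ->
  is_derive x v f (\sum_i v i 0 * 'D_(unitv i) f x).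
Proof.
move=> sf; apply: is_derive_dir => i; first by move=> z; exact: smooth_derivable.
by apply: smooth_continuous; exact: smooth_partial.
Qed.

(** All the ways of building smooth functions that are used below, at once:
    the class is stable under partial derivatives. *)
Inductive generated : (Rd -> R) -> Prop :=
| gen_affine f (A : 'M[R]_d) b : smooth_real f -> generated (fun x => f (A *m x + b))
| gen_coord i : generated (fun x => x i 0)
| gen_cst c : generated (fun=> c)
| gen_add f g : generated f -> generated g -> generated (fun x => f x + g x)
| gen_mul f g : generated f -> generated g -> generated (fun x => f x * g x)
| gen_flat m f : generated f -> generated (fun x => flat m (f x)).

Lemma gen_sum (I : Type) (s : seq I) (F : I -> Rd -> R) :
  (forall i, generated (F i)) -> generated (fun x => \sum_(i <- s) F i x).
Proof.
move=> gF; elim: s => [|i s IH].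
  by under eq_fun do rewrite big_nil; exact: gen_cst.
by under eq_fun do rewrite big_cons; exact: gen_add.
Qed.

Lemma generated_smooth f : generated f -> smooth_real f.
Proof.
apply: smooth_real_coind => {}f; elim=> {f}.
- move=> f A b sf; split.
    by move=> x; apply: continuous_comp; [exact: continuous_affine|exact: smooth_continuous].
  move=> i; exists (fun x => \sum_j A j i * 'D_(unitv j) f (A *m x + b)).
    apply: (@gen_sum _ _ (fun j x => A j i * 'D_(unitv j) f (A *m x + b))) => j.
    by apply: gen_mul; [exact: gen_cst|exact: (gen_affine A b (smooth_partial j sf))].
  move=> x; have /is_deriveP h := smooth_dir (A *m x + b) (A *m unitv i) sf.
  apply/is_deriveP; move: h.
  under eq_fun => h do rewrite addrA scalemxAr -mulmxDr.
  by under eq_bigr => j _ do rewrite -colE mxE.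
- move=> i; split; first exact: continuous_coord.
  move=> j; exists (fun=> (i == j)%:R); first exact: gen_cst.
  move=> x; apply/is_deriveP; apply: cvg_near_cst; near=> h.
  rewrite !mxE eqxx andbT addrK mulrA mulVf ?mul1r //.
  by near: h; exact: nbhs_dnbhs_neq.
- move=> c; split; first exact: cst_continuous.
  by move=> i; exists (fun=> 0); [exact: gen_cst|move=> x; exact: is_derive_cst].
- move=> f g gf [cf df] gg [cg dg]; split; first by move=> x; exact: cvgD (cf x) (cg x).
  move=> i; have [f' gf' df'] := df i; have [g' gg' dg'] := dg i.
  by exists (fun x => f' x + g' x); [exact: gen_add|move=> x; exact: is_deriveD].
- move=> f g gf [cf df] gg [cg dg]; split; first by move=> x; exact: cvgM (cf x) (cg x).
  move=> i; have [f' gf' df'] := df i; have [g' gg' dg'] := dg i.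
  exists (fun x => f x * g' x + g x * f' x); last by move=> x; exact: is_deriveM.
  by apply: gen_add; exact: gen_mul.
- move=> m f gf [cf df]; split.
    move=> x; apply: continuous_comp; first exact: cf.
    apply: differentiable_continuous; apply/derivable1_diffP.
    by case: (is_derive_flat m (f x)).
  move=> i; have [f' gf' df'] := df i.
  exists (fun x => (flat m.+2 (f x) + (- m%:R) * flat m.+1 (f x)) * f' x).
    apply: gen_mul => //; apply: gen_add; first exact: gen_flat.
    by apply: gen_mul; [exact: gen_cst|exact: gen_flat].
  move=> x; have := df' x; rewrite -[X in is_derive X](add0r x) -[X in X + x](scale0r (unitv i)).
  move=> /is_derive_line dl; apply/is_derive_line.
  apply: (@is_derive1_comp _ (flat m) (fun t : R => f (t *: unitv i + x))) => //.
  by rewrite scale0r add0r mulNr; exact: is_derive_flat.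
Unshelve. all: by end_near. Qed.

Lemma smooth_gen f : smooth_real f -> generated f.
Proof.
move=> sf; rewrite (_ : f = fun x => f (1%:M *m x + 0)); first exact: gen_affine.
by apply/funext => x; rewrite mul1mx addr0.
Qed.

Lemma smooth_add f g : smooth_real f -> smooth_real g -> smooth_real (fun x => f x + g x).
Proof. by move=> /smooth_gen gf /smooth_gen gg; apply: generated_smooth; exact: gen_add. Qed.

Lemma smooth_scale c f : smooth_real f -> smooth_real (fun x => c * f x).
Proof. by move=> /smooth_gen gf; apply: generated_smooth; apply: gen_mul => //; exact: gen_cst. Qed.

Lemma smooth_coord_mul i f : smooth_real f -> smooth_real (fun x => x i 0 * f x).
Proof. by move=> /smooth_gen gf; apply: generated_smooth; apply: gen_mul => //; exact: gen_coord. Qed.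

Lemma smooth_cst (c : R) : smooth_real ((fun=> c) : Rd -> R).
Proof. by apply: generated_smooth; exact: gen_cst. Qed.

Lemma smooth_affine f (A : 'M[R]_d) b : smooth_real f -> smooth_real (fun x => f (A *m x + b)).
Proof. by move=> sf; apply: generated_smooth; exact: gen_affine. Qed.

Lemma smooth_bump (c : Rd) (r : R) : smooth_real (fun x => flat 0 (r + (- 1) * dot (x - c) (x - c))).
Proof.
apply: generated_smooth; apply: gen_flat; apply: gen_add; first exact: gen_cst.
apply: gen_mul; first exact: gen_cst.
rewrite /dot; apply: gen_sum => i.
have gi : generated (fun x => (x - c) i 0).
  by under eq_fun do rewrite !mxE; apply: gen_add; [exact: gen_coord|exact: gen_cst].
exact: gen_mul.
Qed.

End smooth_functions.

Section test_functions.
Variables (R : realType) (d : nat).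
Local Notation Rd := 'cV[R]_d.
Local Notation C := R[i].
Local Notation unitv i := (delta_mx i 0 : Rd).
Implicit Types (f g : Rd -> C) (O : set Rd).

Definition cpartial (i : 'I_d) f (x : Rd) : C :=
  'D_(unitv i) (fun x => Re (f x)) x +i* 'D_(unitv i) (fun x => Im (f x)) x.

Lemma smooth_cpartial i f : smooth f -> smooth (cpartial i f).
Proof. by move=> [sr si]; exact: (conj (smooth_partial i sr) (smooth_partial i si)). Qed.

Lemma smooth_cmeasurable f : smooth f -> cmeasurable f.
Proof.
move=> [sr si]; split; first exact: (continuous_measurable_cV (smooth_continuous sr)).
exact: (continuous_measurable_cV (smooth_continuous si)).
Qed.

Lemma smooth_cD f g : smooth f -> smooth g -> smooth (fun x => f x + g x).
Proof.
move=> [fr fi] [gr gi]; split.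
  by under eq_fun do rewrite cReD; exact: smooth_add.
by under eq_fun do rewrite cImD; exact: smooth_add.
Qed.

Lemma smooth_cZ (a : C) f : smooth f -> smooth (fun x => a * f x).
Proof.
move=> [fr fi]; split.
  under eq_fun do rewrite cReM -mulNr; apply: smooth_add; exact: smooth_scale.
by under eq_fun do rewrite cImM; apply: smooth_add; exact: smooth_scale.
Qed.

Lemma smooth_ccoord i f : smooth f -> smooth (fun x => (x i 0)%:C * f x).
Proof.
move=> [fr fi]; split.
  under eq_fun do rewrite cReM mul0r subr0; exact: smooth_coord_mul.
by under eq_fun do rewrite cImM mul0r addr0; exact: smooth_coord_mul.
Qed.

Lemma smooth_caffine f (A : 'M[R]_d) b : smooth f -> smooth (fun x => f (A *m x + b)).
Proof. by move=> [fr fi]; split; [exact: (smooth_affine A b fr)|exact: (smooth_affine A b fi)]. Qed.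

Lemma compact_closed_cV (K : set Rd) : compact K -> closed K.
Proof. by apply: compact_closed; exact: norm_hausdorff. Qed.

Lemma derive_outside (K : set Rd) (f : Rd -> R) i : closed K -> (forall x, ~ K x -> f x = 0) ->
  forall x, ~ K x -> 'D_(unitv i) f x = 0.
Proof.
move=> clK f0 x Kx; rewrite (@near_eq_derive _ _ _ f (cst (0 : R))) ?derive_cst //.
have : nbhs x (~` K) by apply: open_nbhs_nbhs; split => //; exact: closed_openC.
by apply: filterS => y /f0.
Qed.

Lemma cpartial_outside (K : set Rd) f i : closed K -> (forall x, ~ K x -> f x = 0) ->
  forall x, ~ K x -> cpartial i f x = 0.
Proof.
move=> clK f0 x Kx; apply: complex_eqP => /=; apply: derive_outside Kx => // y Ky /=; by rewrite f0.
Qed.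

Lemma partials_outside (K : set Rd) (f : Rd -> R) s : closed K -> (forall x, ~ K x -> f x = 0) ->
  forall x, ~ K x -> partials s f x = 0.
Proof. by move=> clK f0; elim: s => [|i s IH] //= x Kx; exact: derive_outside Kx. Qed.

Lemma test_cpartial O i f : test_function O f -> test_function O (cpartial i f).
Proof.
move=> [sf [K [cK KO f0]]]; split; first exact: smooth_cpartial.
by exists K; split=> // x; apply: cpartial_outside => //; exact: compact_closed_cV.
Qed.

Lemma test_D O f g : test_function O f -> test_function O g -> test_function O (fun x => f x + g x).
Proof.
move=> [sf [K [cK KO f0]]] [sg [L [cL LO g0]]]; split; first exact: smooth_cD.
exists (K `|` L); split; first exact: compactU.
  by move=> x [/KO|/LO].
by move=> x /not_orP[Kx Lx]; rewrite f0 // g0 // addr0.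
Qed.

Lemma test_Z O (a : C) f : test_function O f -> test_function O (fun x => a * f x).
Proof.
move=> [sf [K [cK KO f0]]]; split; first exact: smooth_cZ.
by exists K; split=> // x Kx; rewrite f0 // mulr0.
Qed.

Lemma test_coord O i f : test_function O f -> test_function O (fun x => (x i 0)%:C * f x).
Proof.
move=> [sf [K [cK KO f0]]]; split; first exact: smooth_ccoord.
by exists K; split=> // x Kx; rewrite f0 // mulr0.
Qed.

Lemma test_0 O : test_function O (fun=> 0).
Proof.
split; first by split; exact: smooth_cst.
by exists set0; split => //; exact: compact0.
Qed.

Lemma test_affine O O' f (A B : 'M[R]_d) b : A *m B = 1%:M ->
  (forall x, O x -> O' (B *m (x - b))) ->
  test_function O f -> test_function O' (fun x => f (A *m x + b)).
Proof.
move=> AB OO' [sf [K [cK KO f0]]]; split; first exact: smooth_caffine.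
exists [set B *m (x - b) | x in K]; split.
- rewrite (_ : [set _ | _ in K] = [set B *m x + - (B *m b) | x in K]).
    by apply: continuous_compact => //; apply: continuous_subspaceT; exact: continuous_affine.
  by apply/seteqP; split=> y [x Kx <-]; exists x => //; rewrite mulmxBr.
- by move=> y [x /KO Ox <-]; exact: OO'.
- move=> x Kx; apply: f0 => Kax; apply: Kx; exists (A *m x + b) => //.
  by rewrite addrK mulmxA (mulmx1C AB) mul1mx.
Qed.

Lemma test_sub O O' f : O `<=` O' -> test_function O f -> test_function O' f.
Proof.
by move=> OO' [sf [K [cK KO f0]]]; split => //; exists K; split=> // x /KO /OO'.
Qed.

Lemma test_sum O (I : Type) (s : seq I) (F : I -> Rd -> C) :
  (forall i, test_function O (F i)) -> test_function O (fun x => \sum_(i <- s) F i x).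
Proof.
move=> tF; elim: s => [|i s IH].
  by under eq_fun do rewrite big_nil; exact: test_0.
by under eq_fun do rewrite big_cons; exact: test_D.
Qed.

Lemma continuous_japanese : continuous (@japanese R d).
Proof.
move=> x; rewrite /japanese /dot; apply: (@cvgD R R^o _ (nbhs x) (nbhs_filter x)); first exact: cvg_cst.
by apply: (@cvg_finsum _ _ (nbhs x) (nbhs_filter x)) => i; apply: cvgM; exact: coord_continuous.
Qed.

Lemma test_schwartz O f : test_function O f -> schwartz f.
Proof.
move=> [sf [K [cK KO f0]]]; split => // N s.
have clK := compact_closed_cV cK.
have bnd (h : Rd -> R) : smooth_real h -> (forall x, ~ K x -> h x = 0) ->
    exists B : R, forall x, japanese x ^+ N * `|partials s h x| <= B.
  move=> sh h0; pose H x := japanese x ^+ N * `|partials s h x|.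
  have cH : continuous H.
    move=> x; apply: (@cvgM R _ (nbhs x) (nbhs_filter x)).
      elim: (N) => [|k IH]; first by under eq_fun do rewrite expr0; exact: cvg_cst.
      rewrite exprS; under eq_fun do rewrite exprS.
      by apply: (@cvgM R _ (nbhs x) (nbhs_filter x)) => //; exact: continuous_japanese.
    by apply: cvg_norm; exact: (sh s).1.
  have [M [_ MP]] := compact_bounded (continuous_compact (continuous_subspaceT cH) cK).
  exists (Num.max 0 (M + 1)) => x; have [Kx|Kx] := pselect (K x).
    rewrite le_max; apply/orP; right; apply: le_trans (ler_norm _) _.
    by apply: (MP (M + 1)); [rewrite ltrDl|exists x].
  by rewrite (partials_outside s clK h0 Kx) normr0 mulr0 le_max lexx.
have [|Br HBr] := bnd (fun x => Re (f x)) sf.1; first by move=> x /f0 ->.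
have [|Bi HBi] := bnd (fun x => Im (f x)) sf.2; first by move=> x /f0 ->.
by exists (Num.max Br Bi) => x; rewrite !le_max HBr HBi orbT.
Qed.

Lemma schwartz_cpartial f i : schwartz f -> schwartz (cpartial i f).
Proof.
move=> [sf bf]; split; first exact: smooth_cpartial.
move=> N s; have [B HB] := bf N (rcons s i).
by exists B => x; have := HB x; rewrite !partials_rcons.
Qed.

Lemma schwartz_rapid f (N : nat) : schwartz f ->
  exists2 B : R, 0 <= B & forall x, cmod (f x) <= B * (japanese x ^+ N)^-1.
Proof.
move=> [sf /(_ N [::])[B HB]].
have le x : cmod (f x) <= (2 * B) * (japanese x ^+ N)^-1.
  have j0 : 0 < japanese x ^+ N by rewrite exprn_gt0 // japanese_gt0.
  rewrite ler_pdivlMr // mulrC; apply: le_trans (ler_wpM2l (ltW j0) (cmod_le_ReIm _)) _.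
  by rewrite mulrDr mulr2n mulrDl mul1r; apply: lerD; have [] := HB x.
exists (2 * B) => //; have := le 0; have j0 : 0 < japanese (0 : Rd) ^+ N by rewrite exprn_gt0 // japanese_gt0.
by move/(le_trans (cmod_ge0 _)); rewrite pmulr_lge0 // invr_gt0.
Qed.

Lemma integrable_japanese : (leb R d).-integrable setT (EFin \o (fun x : Rd => (japanese x ^+ d)^-1)).
Proof.
apply/integrableP; split; first by apply/measurable_EFinP; exact: measurable_japaneseVX.
under eq_integral => x _ do rewrite /= ger0_norm ?invr_ge0 ?exprn_ge0 ?(ltW (japanese_gt0 x)) //.
exact: integral_japanese_lty.
Qed.

Lemma rapid_integrable f (B : R) : cmeasurable f ->
  (forall x, cmod (f x) <= B * (japanese x ^+ d)^-1) -> cintegrable (leb R d) f.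
Proof.
by move=> mf bf; apply: cintegrable_le mf (integrable_scale B integrable_japanese) bf.
Qed.

Lemma schwartz_integrable f : schwartz f -> cintegrable (leb R d) f.
Proof.
move=> sf; have [B _ HB] := schwartz_rapid d sf.
by apply: rapid_integrable HB; apply: smooth_cmeasurable; case: sf.
Qed.

Definition japanese_mass : R := Rintegral (leb R d) setT (fun x : Rd => (japanese x ^+ d)^-1).

Lemma cmod_cintegral_rapid f (B : R) : cmeasurable f ->
  (forall x, cmod (f x) <= B * (japanese x ^+ d)^-1) ->
  cmod (cintegral (leb R d) f) <= B * japanese_mass.
Proof.
move=> mf bf; have fi := rapid_integrable mf bf.
apply: le_trans (cmod_cintegral fi) _.
rewrite /japanese_mass -RintegralZl //; last exact: integrable_japanese.
apply: le_Rintegral => //.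
  exact: cintegrable_cmod fi.
exact: integrable_scale integrable_japanese.
Qed.

Lemma japanese_mass_ge0 : 0 <= japanese_mass.
Proof.
apply: Rintegral_ge0 => x _.
exact: japaneseVX_ge0.
Qed.

End test_functions.

(** * The Fourier transform of Schwartz functions *)

Section exponential_increments.
Variable R : realType.
Local Notation C := R[i].

Lemma sin_increment (b y : R) : exists2 s : R, 0 <= s <= 1 & sin (b + y) - sin y = b * cos (s * b + y).
Proof.
have [|s s01] := @line_MVT R R^o (@sin R) 1 y b; first by move=> z; case: (is_derive_sin z).
rewrite ![_ *: (1 : R^o)]mulr1 => ->; exists s => //; congr (_ * _).
by have [_ ->] := is_derive_sin (s * b + y).
Qed.

Lemma cos_increment (b y : R) : exists2 s : R, 0 <= s <= 1 & cos (b + y) - cos y = - (b * sin (s * b + y)).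
Proof.
have [|s s01] := @line_MVT R R^o (@cos R) 1 y b; first by move=> z; case: (is_derive_cos z).
rewrite ![_ *: (1 : R^o)]mulr1 => ->; exists s => //; rewrite -mulrN; congr (_ * _).
by have [_ ->] := is_derive_cos (s * b + y).
Qed.

Lemma cmod_expiB (a b : R) : cmod (expi a - expi b) <= 2 * `|a - b|.
Proof.
apply: le_trans (cmod_le_ReIm _) _; rewrite cReB cImB /=.
have [s _] := cos_increment (a - b) b; have [t _] := sin_increment (a - b) b.
rewrite !subrK => -> ->; rewrite normrN !normrM mulr2n mulrDl mul1r.
by apply: lerD; rewrite ler_piMr // ?sin_abs1 ?cos_abs1.
Qed.

Lemma sin_le_abs (x : R) : `|sin x| <= `|x|.
Proof.
have [s _] := sin_increment x 0; rewrite !addr0 sin0 subr0 => ->.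
by rewrite normrM ler_piMr // cos_abs1.
Qed.

Lemma cmod_expi_taylor (x : R) : cmod (expi x - 1 - (0 +i* x)) <= 2 * x ^+ 2.
Proof.
apply: le_trans (cmod_le_ReIm _) _; rewrite !cReB !cImB /= !subr0.
have le (s : R) : 0 <= s <= 1 -> `|s * x| <= `|x|.
  by move=> /andP[s0 s1]; rewrite normrM ger0_norm // ler_piMl.
have x2 : `|x| * `|x| = x ^+ 2 by rewrite -normrM -expr2 ger0_norm ?sqr_ge0.
rewrite mulr2n mulrDl mul1r -x2; apply: lerD.
  have [s s01] := cos_increment x 0; rewrite !addr0 cos0 => ->.
  by rewrite normrN normrM ler_wpM2l // (le_trans (sin_le_abs _)) // le.
have [s s01] := sin_increment x 0; rewrite !addr0 sin0 subr0 => ->.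
have -> : x * cos (s * x) - x = x * (cos (s * x) - 1) by rewrite mulrBr mulr1.
rewrite normrM ler_wpM2l //.
have [t t01] := cos_increment (s * x) 0; rewrite !addr0 cos0 => ->.
by rewrite normrN normrM (le_trans _ (le _ s01)) // ler_piMr // sin_abs1.
Qed.

Lemma cmod_cvg_unique (z : nat -> C) (a b : C) : cmod (z k - a) @[k --> \oo] --> (0 : R) ->
  cmod (z k - b) @[k --> \oo] --> (0 : R) -> a = b.
Proof.
move=> za zb; apply: complex_eqP.
  exact: cvg_unique (cmod_cvg_Re za) (cmod_cvg_Re zb).
exact: cvg_unique (cmod_cvg_Im za) (cmod_cvg_Im zb).
Qed.

(** Limits along sequences, since dominated convergence will be applied to the
    Fourier integrals of these quotients. *)
Lemma expi_quotient (a b : R) (ak hk : nat -> R) : hk @ \oo --> (0 : R) -> (forall k, hk k != 0) ->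
  ((ak k - a) / hk k) @[k --> \oo] --> b ->
  cmod (((hk k)^-1)%:C * (expi (ak k) - expi a) - (0 +i* b) * expi a) @[k --> \oo] --> (0 : R).
Proof.
move=> h0 hn qb; pose q k := (ak k - a) / hk k.
apply: (@squeeze_cvgr _ _ _ _ (cst 0) (fun k => 2 * (q k ^+ 2 * `|hk k|) + `|q k - b|)); last 2 first.
- exact: cvg_cst.
- have E : 2 * (b ^+ 2 * `|0 : R|) + `|b - b| = 0 by rewrite subrr !normr0 !mulr0 addr0.
  rewrite -E.
  apply: cvgD; last by apply: cvg_norm; apply: cvgB => //; exact: cvg_cst.
  apply: cvgMl_tmp; apply: cvgM; last exact: cvg_norm.
  by rewrite expr2; under eq_fun do rewrite expr2; exact: cvgM.
apply: nearW => k; rewrite cmod_ge0 /=.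
have qE : ak k = q k * hk k + a by rewrite divfK // subrK.
rewrite qE expiD.
have -> : ((hk k)^-1)%:C * (expi (q k * hk k) * expi a - expi a) - (0 +i* b) * expi a =
    (((hk k)^-1)%:C * (expi (q k * hk k) - 1 - (0 +i* (q k * hk k))) + (0 +i* (q k - b))) * expi a.
  have -> : (0 +i* (q k * hk k)) = (hk k)%:C * (0 +i* q k).
    by apply: complex_eqP; rewrite ?cReM ?cImM /=; ring.
  have -> : (0 +i* (q k - b)) = (0 +i* q k) - (0 +i* b).
    by apply: complex_eqP; rewrite ?cReB ?cImB /=; ring.
  have hh : ((hk k)^-1)%:C * (hk k)%:C = 1.
    by rewrite -rmorphM /= mulVf.
  by rewrite !mulrBr !mulrA hh; ring.
rewrite cmodM cmod_expi mulr1; apply: le_trans (cmodD _ _) _; apply: lerD.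
  rewrite cmodM cmodR normfV mulrC ler_pdivrMr ?normr_gt0 //.
  apply: le_trans (cmod_expi_taylor _) _.
  have hh : `|hk k| * `|hk k| = hk k ^+ 2 by rewrite -expr2 real_normK ?num_real.
  by rewrite exprMn -hh !mulrA.
by apply: le_trans (cmod_le_ReIm _) _; rewrite /= normr0 add0r.
Qed.

End exponential_increments.

Section fourier_transform.
Variables (R : realType) (d : nat).
Local Notation Rd := 'cV[R]_d.
Local Notation C := R[i].
Local Notation unitv i := (delta_mx i 0 : Rd).
Local Notation leb := (leb R d).
Local Notation jd := (fun x : Rd => (japanese x ^+ d)^-1).
Implicit Types (f g : Rd -> C).

Lemma japanese_peetre (x y : Rd) : japanese (x + y) <= 2 * (japanese x * japanese y).
Proof.
have := dot_ge0 (x - y); rewrite /japanese !dotDl !dotDr !dotNl !dotNr (dotC y x) opprK.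
have := dot_ge0 x; have := dot_ge0 y.
set a := dot x x; set b := dot y y; set c := dot x y => b0 a0 h.
have := mulr_ge0 a0 b0; nra.
Qed.

Lemma japaneseVX_le (N : nat) (x y : Rd) (c : R) : japanese x <= c * japanese y ->
  (japanese y ^+ N)^-1 <= c ^+ N * (japanese x ^+ N)^-1.
Proof.
move=> h; have jx := japanese_gt0 x; have jy := japanese_gt0 y.
have := lerXn2r N _ _ h; rewrite !nnegrE (ltW jx) (le_trans (ltW jx) h) => /(_ isT isT).
rewrite exprMn => h'.
by rewrite ler_pdivlMr ?exprn_gt0 // mulrC ler_pdivrMr ?exprn_gt0.
Qed.

Lemma coord_le_japanese (x : Rd) i : `|x i 0| <= japanese x.
Proof.
have := coord_sqr_le x i.
rewrite /japanese -[x i 0 ^+ 2]real_normK ?num_real //.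
have := sqr_ge0 (`|x i 0| - 1); nra.
Qed.

Lemma dot_le_japanese (x p : Rd) : `|dot x p| <= japanese x * \sum_i `|p i 0|.
Proof.
apply: le_trans (ler_norm_sum _ _ _) _; rewrite mulr_sumr; apply: ler_sum => i _.
by rewrite normrM ler_wpM2r // coord_le_japanese.
Qed.

Lemma cmeasurable_phase (p : Rd) : cmeasurable (fun x : Rd => expi (- dot x p)).
Proof.
by apply: cmeasurable_expi; apply: measurable_funN; exact: measurable_dotl.
Qed.

Lemma cmeasurable_kernel f p : cmeasurable f -> cmeasurable (fun x => f x * expi (- dot x p)).
Proof. by move=> mf; apply: cmeasurableM => //; exact: cmeasurable_phase. Qed.

Lemma integrable_kernel f p : cintegrable leb f -> cintegrable leb (fun x => f x * expi (- dot x p)).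
Proof.
by move=> fi; apply: cintegrable_phase => //; apply: measurable_funN; exact: measurable_dotl.
Qed.

Lemma cintegrableB f g : cintegrable leb f -> cintegrable leb g -> cintegrable leb (fun x => f x - g x).
Proof. by move=> fi gi; apply: cintegrableD => //; exact: cintegrableN. Qed.

Lemma fourier_linear (a : C) f g p : cintegrable leb f -> cintegrable leb g ->
  fourier (fun x => a * f x + g x) p = a * fourier f p + fourier g p.
Proof.
move=> fi gi; rewrite /fourier -cintegralZ; last exact: integrable_kernel.
rewrite -cintegralD; last exact: integrable_kernel.
  by apply: eq_cintegral => x; rewrite mulrDl mulrA.
by apply: cintegrableZ; exact: integrable_kernel.
Qed.

Lemma fourier_sum (I : Type) (s : seq I) (F : I -> Rd -> C) p : (forall i, cintegrable leb (F i)) ->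
  fourier (fun x => \sum_(i <- s) F i x) p = \sum_(i <- s) fourier (F i) p.
Proof.
move=> Fi; elim: s => [|i s IH].
  rewrite big_nil /fourier -[RHS](cintegral0 leb).
  by apply: eq_cintegral => x; rewrite big_nil mul0r.
have si : cintegrable leb (fun x => \sum_(i <- s) F i x).
  elim: s {IH} => [|j s IH]; first by under eq_fun do rewrite big_nil; exact: cintegrable0.
  by under eq_fun do rewrite big_cons; exact: cintegrableD.
rewrite big_cons -IH -[fourier (F i) p]mul1r -fourier_linear //.
by apply: eq_cintegral => x; rewrite big_cons mul1r.
Qed.

Lemma cvg_dominated T (G : set_system T) {FF : Filter G} (F S : T -> R) (l : R) :
  (forall q, `|l - F q| <= S q) -> S @ G --> (0 : R) -> F @ G --> l.
Proof.
move=> FS S0; apply/cvgrPdist_le => e e0; move/cvgrPdist_le: S0 => /(_ _ e0).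
apply: filterS => q; rewrite sub0r normrN; apply: le_trans.
exact: le_trans (FS q) (ler_norm _).
Qed.

Lemma fourier_lipschitz f : schwartz f ->
  exists2 K : R, 0 <= K & forall p q, cmod (fourier f p - fourier f q) <= K * \sum_i `|p i 0 - q i 0|.
Proof.
move=> sf; have mf : cmeasurable f by apply: smooth_cmeasurable; case: sf.
have [B B0 HB] := schwartz_rapid d.+1 sf; have fi := schwartz_integrable sf.
exists (2 * B * japanese_mass R d) => [|p q]; first by rewrite !mulr_ge0 // japanese_mass_ge0.
rewrite /fourier -cintegralB; [|exact: integrable_kernel..].
set s := \sum_i _; rewrite -mulrA [_ * s]mulrC mulrA; apply: cmod_cintegral_rapid.
  by apply: cmeasurableB; exact: cmeasurable_kernel.
move=> x; rewrite -mulrBr cmodM.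
apply: le_trans (ler_pM (cmod_ge0 _) (cmod_ge0 _) (HB x) (cmod_expiB _ _)) _.
rewrite -opprD normrN -dotNr -dotDr.
have := dot_le_japanese x (p - q); rewrite (eq_bigr (fun i => `|p i 0 - q i 0|)); last by move=> i _; rewrite !mxE.
rewrite -/s => ds.
have j0 := japanese_gt0 x; have jd0 : 0 < japanese x ^+ d by rewrite exprn_gt0.
apply: (@le_trans _ _ (B * (japanese x ^+ d.+1)^-1 * (2 * (japanese x * s)))).
  by rewrite ler_wpM2l // ?ler_wpM2l // mulr_ge0 // invr_ge0 exprn_ge0 // ltW.
apply: eqR_le; rewrite exprS; field.
by rewrite !gt_eqF.
Qed.

Lemma measurable_fourier f : schwartz f -> cmeasurable (fourier f).
Proof.
move=> sf; have [K K0 HK] := fourier_lipschitz sf.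
have lip (F : Rd -> R) : (forall p q, `|F p - F q| <= cmod (fourier f p - fourier f q)) ->
    measurable_fun setT F.
  move=> HF; apply: continuous_measurable_cV => p.
  pose S (q : Rd) : R := K * \sum_i `|p i 0 - q i 0|.
  have Sp : S q @[q --> p] --> K * \sum_(i < d) `|p i 0 - p i 0|.
    apply: (@cvgM R _ (nbhs p) (nbhs_filter p)); first exact: cvg_cst.
    apply: (@cvg_finsum _ _ (nbhs p) (nbhs_filter p) _ _ (fun i (q : Rd) => `|p i 0 - q i 0|)) => i; apply: cvg_norm.
    by apply: cvgB; [exact: cvg_cst|exact: coord_continuous].
  rewrite big1 ?mulr0 in Sp; last by move=> i _; rewrite subrr normr0.
  apply: (@cvg_dominated _ (nbhs p) (nbhs_filter p) F S _ _ Sp) => q.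
  exact: le_trans (HF p q) (HK p q).
by split; apply: lip => p q; [rewrite -cReB; exact: Re_le_cmod|rewrite -cImB; exact: Im_le_cmod].
Qed.

Lemma fourier_translate f a p : cintegrable leb f ->
  fourier (fun x => f (x + a)) p = expi (dot a p) * fourier f p.
Proof.
move=> fi; have mf := cintegrable_meas fi.
rewrite /fourier -cintegralZ; last exact: integrable_kernel.
rewrite -[RHS](cintegral_preserving (measurable_cV_add a) (fun A mA => leb_translate a mA)).
  apply: eq_cintegral => x; rewrite dotDl opprD expiD -[LHS]mulr1 -(expiNK (dot a p)).
  by set e1 := expi _; set e2 := expi _; set e3 := expi _; ring.
by apply: cmeasurableM; [exact: cmeasurable_cst|exact: cmeasurable_kernel].
Qed.

Lemma fourier_orthogonal f (A : 'M[R]_d) p : A^T *m A = 1%:M -> cmeasurable f ->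
  fourier (fun x => f (A *m x)) p = fourier f (A *m p).
Proof.
move=> AO mf; rewrite /fourier -[RHS](cintegral_preserving (measurable_cV_mulmx A) (fun B mB => leb_orthogonal AO mB)).
  by apply: eq_cintegral => x; rewrite dot_orthogonal.
exact: cmeasurable_kernel.
Qed.

Lemma fourier_conj_inv f p : cintegrable leb f -> fourier (conj_inv f) p = conjc (fourier f p).
Proof.
move=> fi; have mf := cintegrable_meas fi.
have NO : ((-1)%:M : 'M[R]_d)^T *m (-1)%:M = 1%:M.
  by rewrite tr_scalar_mx -scalar_mxM mulrNN mulr1.
have conjM (x y : C) : conjc (x * y) = conjc x * conjc y by rewrite rmorphM.
rewrite /fourier -cintegralJ; last exact: integrable_kernel.
rewrite -[RHS](cintegral_preserving (measurable_cV_mulmx (-1)%:M) (fun B mB => leb_orthogonal NO mB)).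
  by apply: eq_cintegral => x; rewrite conjM conj_expi mul_scalar_mx scaleN1r dotNl opprK.
by apply: cmeasurableJ; exact: cmeasurable_kernel.
Qed.

Lemma partial_increment f i x (h : R) (B : R) :
  smooth f -> (forall x, cmod (cpartial i f x) <= B * jd x) -> 0 <= B -> `|h| <= 1 ->
  cmod (f (x + h *: unitv i) - f x) <= `|h| * (2 * (4 ^+ d * B) * jd x).
Proof.
move=> [sr si] HB B0 h1; apply: le_trans (cmod_le_ReIm _) _.
have near (s : R) : 0 <= s <= 1 -> cmod (cpartial i f ((s * h) *: unitv i + x)) <= 4 ^+ d * B * jd x.
  move=> /andP[s0 s1]; apply: le_trans (HB _) _; rewrite mulrAC [_ * B]mulrC ler_wpM2l //.
  apply: japaneseVX_le; set y := _ *: _.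
  have xE : x = (y + x) + - y by rewrite [y + x]addrC addrK.
  rewrite {1}xE; apply: le_trans (japanese_peetre _ _) _.
  rewrite [X in 2 * X]mulrC mulrA ler_wpM2r ?(ltW (japanese_gt0 _)) //.
  rewrite /japanese dotNl dotNr opprK dotZl dotZr /dot (bigD1 i) //= big1 ?addr0 => [|j ji].
    rewrite !mxE !eqxx /= !mulr1.
    have : `|s * h| <= 1 by rewrite normrM ger0_norm // mulr_ile1.
    rewrite -(ler_sqr (x := `|_|)) ?nnegrE // expr1n real_normK ?num_real // expr2; lra.
  by rewrite !mxE (negbTE ji) /= mul0r.
have inc (F : Rd -> R) : smooth_real F -> (forall x, `|'D_(unitv i) F x| <= cmod (cpartial i f x)) ->
    `|F (x + h *: unitv i) - F x| <= `|h| * (4 ^+ d * B * jd x).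
  move=> sF HF; rewrite [x + _]addrC; have [s s01] := @line_MVT R _ F (unitv i) x h (fun z => smooth_derivable sF).
  move=> ->; rewrite normrM ler_wpM2l //; exact: le_trans (HF _) (near _ s01).
rewrite cReB cImB mulr2n [(1 + 1) * _]mulrDl mul1r [(_ + _) * jd x]mulrDl mulrDr.
apply: lerD.
  exact: (inc (fun y => Re (f y)) sr (fun y => Re_le_cmod (cpartial i f y))).
exact: (inc (fun y => Im (f y)) si (fun y => Im_le_cmod (cpartial i f y))).
Qed.

Lemma cvg_harmonic_dnbhs : (fun k : nat => (k.+1%:R^-1 : R)) @ \oo --> (0 : R)^'.
Proof.
move=> P hP; have h : \forall k \near \oo, (k.+1%:R^-1 != 0 :> R) -> P (k.+1%:R^-1) := @cvg_harmonic R _ hP.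
suff : \forall k \near \oo, P (k.+1%:R^-1 : R) by [].
by apply: filterS h => k; apply; rewrite invr_eq0 pnatr_eq0.
Qed.

(** Integration by parts, by comparing the two limits of the Fourier transforms
    of difference quotients. *)
Lemma fourier_cpartial f i p : schwartz f ->
  fourier (cpartial i f) p = (0 +i* p i 0) * fourier f p.
Proof.
move=> sf; have fi := schwartz_integrable sf; have mf := cintegrable_meas fi.
have spf := schwartz_cpartial i sf; have [B B0 HB] := schwartz_rapid d spf.
have smf : smooth f by case: sf.
pose h k : R := k.+1%:R^-1; have hn k : h k != 0 by rewrite invr_eq0 pnatr_eq0.
have h0 : h @ \oo --> (0 : R) by exact: cvg_harmonic.
pose F k (x : Rd) : C := ((h k)^-1)%:C * (f (x + h k *: unitv i) - f x).
have mt (a : Rd) : cmeasurable (fun x : Rd => f (x + a)).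
  exact: (cmeasurable_comp mf (measurable_cV_add a)).
have mF k : cmeasurable (F k).
  by apply: cmeasurableM; [exact: cmeasurable_cst|apply: cmeasurableB].
have FE k : cintegral leb (fun x => F k x * expi (- dot x p)) =
    ((h k)^-1)%:C * (expi (h k * p i 0) - expi 0) * fourier f p.
  have it : cintegrable leb (fun x => f (x + h k *: unitv i)).
    exact: (cintegrable_preserving (measurable_cV_add _) (fun A mA => leb_translate _ mA)).
  have := fourier_translate (h k *: unitv i) p fi.
  rewrite dotZl (_ : dot (unitv i) p = p i 0); last first.
    rewrite /dot (bigD1 i) //= big1 ?addr0 => [|j ji]; first by rewrite mxE !eqxx mul1r.
    by rewrite mxE (negbTE ji) mul0r.
  rewrite expi0 -mulrA mulrBl mul1r => <-.
  rewrite /fourier -cintegralB; [|exact: integrable_kernel..].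
  rewrite -cintegralZ; last by apply: cintegrableB; exact: integrable_kernel.
  by apply: eq_cintegral => x; rewrite /F -mulrBl mulrA.
have lim1 : cmod (cintegral leb (fun x => F k x * expi (- dot x p)) - fourier (cpartial i f) p) @[k --> \oo] --> (0 : R).
  apply: (@cintegral_dominated _ _ _ _ (fun k x => F k x * expi (- dot x p)) _ (fun x => 2 * (4 ^+ d * B) * jd x)).
  - by move=> k; exact: cmeasurable_kernel.
  - by apply: cmeasurable_kernel; apply: smooth_cmeasurable; case: spf.
  - exact: integrable_scale (integrable_japanese R d).
  - move=> k x; rewrite cmodM cmod_expi mulr1 /F cmodM cmodR normfV mulrC ler_pdivrMr ?normr_gt0 //.
    rewrite mulrC; apply: partial_increment => //.
    by rewrite ger0_norm ?invr_ge0 // invf_le1 // ler1n.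
  - move=> x; under eq_fun do rewrite -mulrBl cmodM cmod_expi mulr1.
    have part (G : Rd -> R) : smooth_real G ->
        (h k)^-1 * (G (x + h k *: unitv i) - G x) @[k --> \oo] --> 'D_(unitv i) G x.
      move=> sG; have /is_deriveP := derivableP (@smooth_derivable _ _ _ i x sG).
      move=> /(cvg_comp _ _ cvg_harmonic_dnbhs).
      by apply: cvg_trans; apply: near_eq_cvg; apply: nearW => k /=; rewrite [x + _]addrC.
    apply: (@squeeze_cvgr _ _ _ _ (cst 0) (fun k => `|(h k)^-1 * (Re (f (x + h k *: unitv i)) - Re (f x)) - Re (cpartial i f x)| +
       `|(h k)^-1 * (Im (f (x + h k *: unitv i)) - Im (f x)) - Im (cpartial i f x)|)).
    + apply: nearW => k; rewrite cmod_ge0 /=; apply: le_trans (cmod_le_ReIm _) _.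
      by rewrite !cReB !cImB /F cReM cImM /= !mul0r subr0 addr0 !cReB !cImB.
    + exact: cvg_cst.
    + have nz (u : nat -> R) (l : R) : u @ \oo --> l -> `|u k - l| @[k --> \oo] --> (0 : R).
        move=> ul; apply/cvgrPdist_le => e e0; move/cvgrPdist_le: ul => /(_ _ e0).
        by apply: filterS => k; rewrite sub0r normrN normr_id distrC.
      rewrite -[X in _ --> X](addr0 0); apply: cvgD.
        exact: nz _ _ (part _ smf.1).
      exact: nz _ _ (part _ smf.2).
have lim2 : cmod (cintegral leb (fun x => F k x * expi (- dot x p)) - (0 +i* p i 0) * fourier f p) @[k --> \oo] --> (0 : R).
  under eq_fun do rewrite FE -mulrBl cmodM.
  have sc (u : nat -> R) (c : R) : u @ \oo --> (0 : R) -> (u k * c) @[k --> \oo] --> (0 : R).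
    by move=> u0; rewrite -[X in _ --> X](mul0r c); exact: cvgMr_tmp.
  apply: sc.
  rewrite -[0 +i* p i 0]mulr1 -expi0; apply: expi_quotient => //.
  apply: cvg_near_cst; apply: nearW => k.
  by rewrite subr0 mulrAC divff // mul1r.
exact: cmod_cvg_unique lim1 lim2.
Qed.

Lemma iter_cpartial f i k : schwartz f -> schwartz (iter k (cpartial i) f).
Proof. by move=> sf; elim: k => //= k IH; exact: schwartz_cpartial. Qed.

Lemma fourier_iter_cpartial f i k p : schwartz f ->
  fourier (iter k (cpartial i) f) p = (0 +i* p i 0) ^+ k * fourier f p.
Proof.
move=> sf; elim: k => [|k IH]; first by rewrite expr0 mul1r.
by rewrite iterS fourier_cpartial ?IH ?exprS ?mulrA //; exact: iter_cpartial.
Qed.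

Lemma Re_iter_cpartial f i k :
  (fun x => Re (iter k (cpartial i) f x)) = partials (nseq k i) (fun x => Re (f x)).
Proof. by elim: k => //= k <-. Qed.

Lemma Im_iter_cpartial f i k :
  (fun x => Im (iter k (cpartial i) f x)) = partials (nseq k i) (fun x => Im (f x)).
Proof. by elim: k => //= k <-. Qed.

Lemma japanese_le_some_coord (p : Rd) :
  japanese p <= d.+1%:R \/ exists i, japanese p <= d.+1%:R * p i 0 ^+ 2.
Proof.
have [np|lp] := leP (japanese p) d.+1%:R; first by left.
have [[i hi]|/forallNP hn] := pselect (exists i, japanese p <= d.+1%:R * p i 0 ^+ 2); first by right; exists i.
have := japanese_gt0 p; set j := japanese p => j0.
have : d.+1%:R * j < j + \sum_(i < d) j.
  rewrite {1}/j /japanese mulrDr mulr1; apply: ltr_leD => //.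
  rewrite /dot mulr_sumr; apply: ler_sum => i _; rewrite -expr2.
  by have /negP := hn i; rewrite -ltNge => /ltW.
suff -> : d.+1%:R * j = j + \sum_(i < d) j by rewrite ltxx.
by rewrite sumr_const card_ord -natr1 mulrDl mul1r mulr_natl addrC.
Qed.

Definition axis_words (M : nat) : seq (seq 'I_d) := [::] :: [seq nseq (2 * M) i | i <- enum 'I_d].

(** Decay of the Fourier transform, uniform in a finite number of Schwartz
    seminorms: a power of [1 + p^2] is controlled by one coordinate, which is
    a power of a partial derivative on the other side. *)
Lemma fourier_decay (M : nat) : exists2 K : R, 0 <= K & forall f (r : R), schwartz f ->
  (forall s x, s \in axis_words M ->
     japanese x ^+ d * `|partials s (fun x => Re (f x)) x| <= r /\
     japanese x ^+ d * `|partials s (fun x => Im (f x)) x| <= r) ->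
  forall p, cmod (fourier f p) <= K * r * (japanese p ^+ M)^-1.
Proof.
exists (d.+1%:R ^+ M * (2 * japanese_mass R d)) => [|f r sf fr p].
  by rewrite !mulr_ge0 // ?exprn_ge0 // japanese_mass_ge0.
have bnd g : schwartz g -> (forall x, japanese x ^+ d * `|Re (g x)| <= r /\ japanese x ^+ d * `|Im (g x)| <= r) ->
    cmod (fourier g p) <= 2 * r * japanese_mass R d.
  move=> sg gr; apply: cmod_cintegral_rapid.
    by apply: cmeasurable_kernel; apply: smooth_cmeasurable; case: sg.
  move=> x; rewrite cmodM cmod_expi mulr1; apply: le_trans (cmod_le_ReIm _) _.
  have j0 : 0 < japanese x ^+ d by rewrite exprn_gt0 // japanese_gt0.
  rewrite ler_pdivlMr // mulrC mulrDr mulr2n mulrDl mul1r.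
  by apply: lerD; have [] := gr x.
have jM : 0 < japanese p ^+ M by rewrite exprn_gt0 // japanese_gt0.
rewrite ler_pdivlMr // mulrC.
suff : japanese p ^+ M * cmod (fourier f p) <= d.+1%:R ^+ M * (2 * r * japanese_mass R d).
  by move/le_trans; apply; rewrite -!mulrA [_ * r]mulrC !mulrA.
have f0 : cmod (fourier f p) <= 2 * r * japanese_mass R d.
  by apply: bnd => // x; exact: (fr [::] x (mem_head _ _)).
have j0 := ltW (japanese_gt0 p).
have [h|[i h]] := japanese_le_some_coord p.
  apply: ler_pM => //; [exact: exprn_ge0|exact: cmod_ge0|].
  by rewrite lerXn2r ?nnegrE.
have fi : cmod (fourier (iter (2 * M) (cpartial i) f) p) <= 2 * r * japanese_mass R d.
  apply: bnd; first exact: iter_cpartial.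
  move=> x; have := fr (nseq (2 * M) i) x; rewrite inE map_f ?mem_enum // orbT => /(_ isT).
  by rewrite -Re_iter_cpartial -Im_iter_cpartial.
apply: le_trans (ler_wpM2l _ fi); last by rewrite exprn_ge0.
rewrite fourier_iter_cpartial // cmodM mulrA ler_wpM2r ?cmod_ge0 //.
have -> : cmod ((0 +i* p i 0) ^+ (2 * M)) = (p i 0 ^+ 2) ^+ M.
  have c1 : cmod (0 +i* p i 0) = `|p i 0| by rewrite /cmod /= expr0n /= add0r sqrtr_sqr.
  rewrite -exprM -[in RHS](ger0_norm (x := p i 0 ^+ (2 * M))); last by rewrite exprM exprn_ge0 // sqr_ge0.
  rewrite normrX -c1; elim: (2 * M)%N => [|k IH]; first by rewrite !expr0 cmod1.
  by rewrite !exprS cmodM IH.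
by rewrite -exprMn lerXn2r ?nnegrE // mulr_ge0 // sqr_ge0.
Qed.

Lemma schwartz_seminorms f (ss : seq (seq 'I_d)) : schwartz f -> exists2 r : R, 0 <= r & forall s x, s \in ss ->
  japanese x ^+ d * `|partials s (fun x => Re (f x)) x| <= r /\
  japanese x ^+ d * `|partials s (fun x => Im (f x)) x| <= r.
Proof.
move=> [_ sf]; elim: ss => [|s ss [r r0 IH]]; first by exists 0.
have [B HB] := sf d s; exists (Num.max r B) => [|t x]; first by rewrite le_max r0.
rewrite inE !le_max => /orP[/eqP->|/IH -/(_ x)[-> ->//]].
by have [-> ->] := HB x; rewrite !orbT.
Qed.

Lemma fourier_rapid f (M : nat) : schwartz f ->
  exists2 K : R, 0 <= K & forall p, cmod (fourier f p) <= K * (japanese p ^+ M)^-1.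
Proof.
move=> sf; have [K K0 HK] := fourier_decay M; have [r r0 Hr] := schwartz_seminorms (axis_words M) sf.
by exists (K * r); [exact: mulr_ge0|exact: HK].
Qed.

(** The points [q k] approach [p] along a curve with velocity [v]; the
    derivative falls on the kernel, where it multiplies [f] by [- i dot x v]. *)
Lemma fourier_quotient f (p v : Rd) (q : nat -> Rd) (h : nat -> R) : schwartz f ->
  h @ \oo --> (0 : R) -> (forall k, h k != 0) ->
  (forall i, ((q k i 0 - p i 0) / h k) @[k --> \oo] --> v i 0) ->
  cmod (((h k)^-1)%:C * (fourier f (q k) - fourier f p) -
    fourier (fun x => (0 +i* (- dot x v)) * f x) p) @[k --> \oo] --> (0 : R).
Proof.
move=> sf h0 hn qv; have fi := schwartz_integrable sf; have mf := cintegrable_meas fi.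
have [B B0 HB] := schwartz_rapid d.+1 sf.
pose w k : R := \sum_i `|(q k i 0 - p i 0) / h k|.
have [W W0 HW] : exists2 W : R, 0 <= W & forall k, w k <= W.
  have cw : w @ \oo --> \sum_i `|v i 0|.
    by apply: (@cvg_finsum _ _ _ _) => i; exact: cvg_norm.
  have /cvg_seq_bounded[W [_ HW]] : cvgn w by apply/cvg_ex; eexists; exact: cw.
  exists (`|W| + 1) => [|k]; first by rewrite addr_ge0.
  apply: le_trans (ler_norm _) _; apply: (HW (`|W| + 1)) => //.
  by apply: le_lt_trans (ler_norm _) _; rewrite ltrDl.
pose G k x : C := f x * (((h k)^-1)%:C * (expi (- dot x (q k)) - expi (- dot x p))).
have GE k : ((h k)^-1)%:C * (fourier f (q k) - fourier f p) = cintegral leb (G k).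
  rewrite /fourier -cintegralB; [|exact: integrable_kernel..].
  rewrite -cintegralZ; last by apply: cintegrableB; exact: integrable_kernel.
  by apply: eq_cintegral => x; rewrite /G -mulrBr mulrCA.
under eq_fun do rewrite GE.
apply: (@cintegral_dominated _ _ _ _ G _ (fun x => (B * (2 * W)) * jd x)).
- move=> k; apply: cmeasurableM => //; apply: cmeasurableM; first exact: cmeasurable_cst.
  by apply: cmeasurableB; exact: cmeasurable_phase.
- apply: cmeasurable_kernel; apply: cmeasurableM => //.
  split => /=; first exact: measurable_cst.
  by apply: measurable_funN; exact: measurable_dotl.
- exact: integrable_scale (integrable_japanese R d).
- move=> k x; rewrite /G !cmodM cmodR normfV.
  have j0 := japanese_gt0 x; have jd0 : 0 < japanese x ^+ d by rewrite exprn_gt0.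
  have e1 : `|h k|^-1 * cmod (expi (- dot x (q k)) - expi (- dot x p)) <= 2 * (japanese x * W).
    rewrite mulrC ler_pdivrMr ?normr_gt0 //; apply: le_trans (cmod_expiB _ _) _.
    rewrite -opprD normrN -dotNr -dotDr -!mulrA; apply: ler_wpM2l => //.
    apply: le_trans (dot_le_japanese x (q k - p)) _; apply: ler_wpM2l; first exact: ltW.
    rewrite -ler_pdivrMr ?normr_gt0 // mulr_suml; apply: le_trans (HW k).
    by apply: ler_sum => i _; rewrite !mxE normrM normfV.
  apply: le_trans (ler_pM (cmod_ge0 _) _ (HB x) e1) _.
    by rewrite mulr_ge0 ?cmod_ge0 // invr_ge0.
  apply: eqR_le; rewrite exprS; field.
  by rewrite !gt_eqF.
move=> x; rewrite /G.
have -> : (fun k => cmod (f x * (((h k)^-1)%:C * (expi (- dot x (q k)) - expi (- dot x p))) -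
     (0 +i* - dot x v) * f x * expi (- dot x p))) =
   (fun k => cmod (f x) * cmod (((h k)^-1)%:C * (expi (- dot x (q k)) - expi (- dot x p)) -
     (0 +i* - dot x v) * expi (- dot x p))).
  by apply/funext => k; rewrite -cmodM; congr cmod; ring.
rewrite -[X in _ --> X](mulr0 (cmod (f x))); apply: cvgMl_tmp.
apply: expi_quotient => //.
have -> : (fun k => (- dot x (q k) - - dot x p) / h k) =
    (fun k => \sum_i (- x i 0) * ((q k i 0 - p i 0) / h k)).
  apply/funext => k; rewrite -opprD -dotNr -dotDr mulNr /dot mulr_suml -sumrN.
  by apply: eq_bigr => i _; rewrite !mxE mulNr mulrA.
rewrite /dot -sumrN; under eq_bigr do rewrite -mulNr.
by apply: (@cvg_finsum _ _ _ _) => i; apply: cvgMl_tmp.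
Qed.

Lemma fourier_convolution f g p : schwartz f -> schwartz g ->
  fourier (convolution f g) p = fourier f p * fourier g p.
Proof.
move=> sf sg; have fi := schwartz_integrable sf; have gi := schwartz_integrable sg.
have mf := cintegrable_meas fi; have mg := cintegrable_meas gi.
have [Bf Bf0 Hf] := schwartz_rapid (d + d) sf; have [Bg Bg0 Hg] := schwartz_rapid d sg.
pose F (zx : Rd * Rd) : C := f zx.2 * g (zx.1 - zx.2) * expi (- dot zx.1 p).
have mF : cmeasurable F.
  apply: cmeasurableM; first apply: cmeasurableM.
  - exact: (cmeasurable_comp mf measurable_snd).
  - apply: (cmeasurable_comp mg); apply: measurable_cVP => i.
    under eq_fun do rewrite !mxE.
    apply: measurable_funB.
      exact: measurableT_comp (measurable_coord i) measurable_fst.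
    exact: measurableT_comp (measurable_coord i) measurable_snd.
  - exact: (cmeasurable_comp (cmeasurable_phase p) measurable_fst).
transitivity (cintegral leb (fun z => cintegral leb (fun x => F (z, x)))).
  apply: eq_cintegral => z; rewrite /convolution -cintegralZr //.
  apply: (@rapid_integrable _ _ _ (Bf * Bg)).
    apply: cmeasurableM => //; apply: (cmeasurable_comp mg); apply: measurable_cVP => i.
    by under eq_fun do rewrite !mxE; apply: measurable_funB => //; exact: measurable_coord.
  move=> x; rewrite cmodM mulrAC [leRHS]mulrC [leRHS]mulrC.
  apply: ler_pM; rewrite ?cmod_ge0 //.
    apply: le_trans (Hf x) _; rewrite ler_wpM2l // lef_pV2 ?posrE ?exprn_gt0 ?japanese_gt0 //.
    by rewrite ler_weXn2l ?japanese_ge1 // leq_addr.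
  apply: le_trans (Hg _) _; rewrite ler_piMr // invf_le1 ?exprn_gt0 ?japanese_gt0 //.
  by rewrite exprn_ege1 // japanese_ge1.
rewrite (@cfubini _ _ _ _ _ leb leb F (fun z => Bg * 2 ^+ d * jd z) (fun x => Bf * jd x)) //; last 3 first.
- exact: integrable_scale (integrable_japanese R d).
- exact: integrable_scale (integrable_japanese R d).
- move=> z x; rewrite /F /= !cmodM cmod_expi mulr1.
  apply: le_trans (ler_pM (cmod_ge0 _) (cmod_ge0 _) (Hf x) (Hg (z - x))) _.
  have jz : (japanese (z - x) ^+ d)^-1 <= (2 * japanese x) ^+ d * jd z.
    apply: japaneseVX_le; rewrite -{1}[z](subrK x) mulrAC -mulrA; exact: japanese_peetre.
  have j0 : 0 < japanese x ^+ d by rewrite exprn_gt0 // japanese_gt0.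
  have jz0 : 0 < japanese z ^+ d by rewrite exprn_gt0 // japanese_gt0.
  apply: (@le_trans _ _ (Bf * (japanese x ^+ (d + d))^-1 * (Bg * ((2 * japanese x) ^+ d * jd z)))).
    by rewrite ler_wpM2l ?ler_wpM2l // mulr_ge0 // invr_ge0 exprn_ge0 // ltW // japanese_gt0.
  apply: eqR_le; rewrite exprD exprMn; field.
  by rewrite !gt_eqF.
rewrite -cintegralZr; last exact: integrable_kernel.
apply: eq_cintegral => x /=.
have := fourier_translate (- x) p gi; rewrite /fourier => gE.
transitivity (f x * cintegral leb (fun z => g (z - x) * expi (- dot z p))).
  rewrite -cintegralZ; first by apply: eq_cintegral => z; rewrite /F /= mulrA.
  apply: integrable_kernel.
  exact: (cintegrable_preserving (measurable_cV_add _) (fun A mA => leb_translate _ mA)).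
by rewrite gE dotNl mulrA.
Qed.

End fourier_transform.

(** * Measures on the mass shells and their projections *)

Section mixture_integral.
Local Open Scope ereal_scope.
Context d1 d2 d3 (T1 : measurableType d1) (T2 : measurableType d2)
  (T3 : measurableType d3) (R : realType).
Variables (m1 : {measure set T1 -> \bar R})
  (m2 : {sigma_finite_measure set T2 -> \bar R}) (D : set T1)
  (w : T1 * T2 -> R) (phi : T1 * T2 -> T3).
Variables (mD : measurable D) (mw : measurable_fun [set: T1 * T2] w)
  (w0 : forall x, D x.1 -> (0 <= w x)%R) (mphi : measurable_fun [set: T1 * T2] phi).
Local Notation M := (mixtureM m1 m2 mD mw w0 mphi).
Implicit Types f g : T3 -> \bar R.

Let wp (z : T1 * T2) : R := Num.max (w z) 0%R.

Let mwp : measurable_fun setT (fun z => (wp z)%:E).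
Proof. by apply/measurable_EFinP; exact: measurable_funrpos mw. Qed.

Let wp0 z : 0 <= (wp z)%:E.
Proof. by rewrite lee_fin le_max lexx orbT. Qed.

Let I f (x : T1) := \int[m2]_y ((wp (x, y))%:E * f (phi (x, y))).

Let mker f x : measurable_fun setT f ->
  measurable_fun setT (fun y => (wp (x, y))%:E * f (phi (x, y))).
Proof.
move=> mf; apply: emeasurable_funM.
  exact: measurableT_comp mwp (pair1_measurable x).
by apply: measurableT_comp mf _; exact: measurableT_comp mphi (pair1_measurable x).
Qed.

Let ker0 f x y : (forall z, 0 <= f z) -> 0 <= (wp (x, y))%:E * f (phi (x, y)).
Proof. by move=> f0; rewrite mule_ge0. Qed.

Let mI f : measurable_fun setT f -> (forall z, 0 <= f z) -> measurable_fun D (I f).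
Proof.
move=> mf f0; apply: measurable_funTS.
apply: (@measurable_fun_fubini_tonelli_F _ _ _ _ _ m2 (fun z => (wp z)%:E * f (phi z))).
  by apply: emeasurable_funM => //; exact: measurableT_comp mf mphi.
by move=> z; rewrite mule_ge0.
Qed.

Let I0 f x : (forall z, 0 <= f z) -> 0 <= I f x.
Proof. by move=> f0; apply: integral_ge0 => y _; exact: ker0. Qed.

Let E f := \int[M]_z f z = \int[m1]_(x in D) I f x.

Let E_indic A : measurable A -> E (fun z => (\1_A z)%:E).
Proof.
move=> mA; rewrite /E (integral_indic M measurableT mA) setIT.
apply: (@eq_integral _ _ _ m1) => x; rewrite inE => Dx.
apply: (@eq_integral _ _ _ m2) => y _; rewrite /wp EFinM (max_idPl _) //; exact: (w0 (x := (x, y))).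
Qed.

Let E_add f g : measurable_fun setT f -> measurable_fun setT g ->
  (forall z, 0 <= f z) -> (forall z, 0 <= g z) -> E f -> E g -> E (fun z => f z + g z).
Proof.
move=> mf mg f0 g0 Ef Eg; rewrite /E (ge0_integralD M measurableT (fun z _ => f0 z) mf (fun z _ => g0 z) mg) Ef Eg.
rewrite -(ge0_integralD m1 mD (fun x _ => I0 x f0) (mI mf f0) (fun x _ => I0 x g0) (mI mg g0)).
apply: eq_integral => x _; rewrite /I.
rewrite -(ge0_integralD m2 measurableT (fun y _ => ker0 x y f0) (mker x mf) (fun y _ => ker0 x y g0) (mker x mg)).
by apply: eq_integral => y _; rewrite ge0_muleDr.
Qed.

Let E_scale (c : R) f : (0 <= c)%R -> measurable_fun setT f ->
  (forall z, 0 <= f z) -> E f -> E (fun z => c%:E * f z).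
Proof.
move=> c0 mf f0 Ef; have c0' : 0 <= c%:E by rewrite lee_fin.
rewrite /E (ge0_integralZl M measurableT mf (fun z _ => f0 z) c0') Ef.
rewrite -(ge0_integralZl m1 mD (mI mf f0) (fun x _ => I0 x f0) c0').
apply: eq_integral => x _; rewrite /I.
rewrite -(ge0_integralZl m2 measurableT (mker x mf) (fun y _ => ker0 x y f0) c0').
by apply: eq_integral => y _; rewrite muleCA.
Qed.

Let E0 : E (fun=> 0).
Proof.
rewrite /E integral0 integral0_eq // => x _; rewrite /I integral0_eq // => y _.
by rewrite mule0.
Qed.

Import HBNNSimple.

Let E_simple (h : {nnsfun T3 >-> R}) : E (fun z => (h z)%:E).
Proof.
have h0 r z : (0 <= r * \1_(h @^-1` [set r]) z)%R.
  by have := nnfun_muleindic_ge0 h r z; rewrite -EFinM lee_fin.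
have mA r : measurable (h @^-1` [set r]) by have := measurable_funP h measurableT [set r] (measurable_set1 r); rewrite setTI.
have term r : E (fun z => (r * \1_(h @^-1` [set r]) z)%:E).
  have [r0|r0] := leP 0%R r.
    under [fun z => _]eq_fun do rewrite EFinM.
    apply: (E_scale r0 _ _ (E_indic (mA r))); last by move=> z; rewrite lee_fin.
    by apply/measurable_EFinP; exact: measurable_indic.
  rewrite (_ : (fun z => _) = fun=> 0) //.
  by apply/funext => z; rewrite preimage_nnfun0 // indic0 mulr0.
have mterm r : measurable_fun setT (fun z => (r * \1_(h @^-1` [set r]) z)%:E).
  by apply/measurable_EFinP; apply: measurable_funM => //; exact: measurable_indic.
pose s : seq R := finmap.enum_fset (fset_set (range h)).
have -> : (fun z => (h z)%:E) = (fun z => \sum_(r <- s) (r * \1_(h @^-1` [set r]) z)%:E).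
  by apply/funext => z; rewrite fimfunE fsbig_finite // sumEFin.
have : E (fun z => \sum_(r <- s) (r * \1_(h @^-1` [set r]) z)%:E) /\
    measurable_fun setT (fun z => \sum_(r <- s) (r * \1_(h @^-1` [set r]) z)%:E).
  elim: s => [|r s' [IH mIH]].
    under [fun z => _]eq_fun do rewrite big_nil.
    by split; last exact: measurable_cst.
  under [fun z => _]eq_fun do rewrite big_cons.
  split; last by apply: emeasurable_funD.
  apply: (E_add (mterm r) mIH _ _ (term r) IH); first by move=> z; rewrite lee_fin.
  by move=> z; apply: sume_ge0 => t _; rewrite lee_fin.
by case.
Qed.

Lemma ge0_integral_mixture f : measurable_fun setT f -> (forall z, 0 <= f z) ->
  \int[M]_z f z = \int[m1]_(x in D) \int[m2]_y ((w (x, y))%:E * f (phi (x, y))).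
Proof.
move=> mf f0; transitivity (\int[m1]_(x in D) I f x); last first.
  apply: eq_integral => x; rewrite inE => Dx; apply: eq_integral => y _.
  by rewrite /wp (max_idPl _) // w0.
pose f_ := nnsfun_approx measurableT mf.
have mf_ k : measurable_fun setT (fun z => (f_ k z)%:E) by exact/measurable_EFinP.
have f_0 k z : 0 <= (f_ k z)%:E by rewrite lee_fin.
have ndf z a b : (a <= b)%N -> (f_ a z)%:E <= (f_ b z)%:E.
  by move=> ab; rewrite lee_fin; exact/lefP/nd_nnsfun_approx.
have limf z : lim ((f_ k z)%:E @[k --> \oo]) = f z.
  by apply/cvg_lim => //=; exact: cvg_nnsfun_approx.
transitivity (\int[M]_z (lim ((f_ k z)%:E @[k --> \oo]))).
  by apply: eq_integral => z _; rewrite limf.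
rewrite (monotone_convergence M measurableT mf_ (fun k z _ => f_0 k z) (fun z _ a b ab => ndf z a b ab)).
have -> : (fun k => \int[M]_z (f_ k z)%:E) = (fun k => \int[m1]_(x in D) I (fun z => (f_ k z)%:E) x).
  by apply/funext => k; exact: E_simple.
rewrite -monotone_convergence //; last 3 first.
- by move=> k; exact: mI.
- by move=> k x _; exact: I0.
- move=> x _ a b ab; apply: ge0_le_integral => //.
  + by move=> y _; apply: (ker0 (f := fun z => (f_ a z)%:E)).
  + exact: (mker (f := fun z => (f_ a z)%:E)).
  + exact: (mker (f := fun z => (f_ b z)%:E)).
  + by move=> y _; rewrite lee_wpmul2l // ndf.
apply: eq_integral => x _; rewrite /I -monotone_convergence //; last 3 first.
- by move=> k; exact: (mker (f := fun z => (f_ k z)%:E)).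
- by move=> k y _; apply: (ker0 (f := fun z => (f_ k z)%:E)).
- by move=> y _ a b ab; rewrite lee_wpmul2l // ndf.
apply: eq_integral => y _; rewrite -[in RHS]limf; apply: cvg_lim => //.
by apply: cvgeZl => //; rewrite limf; exact: cvg_nnsfun_approx.
Qed.

End mixture_integral.

Lemma measure_indic d (T : measurableType d) (R : realType) (m : {measure set T -> \bar R}) (A : set T) :
  measurable A -> m A = (\int[m]_x (\1_A x : R)%:E)%E.
Proof. by move=> mA; rewrite (integral_indic m measurableT mA) setIT. Qed.

Section spectral_measures.
Variables (R : realType) (n : nat) (rho : {measure set R -> \bar R}).
Local Notation Rd := 'cV[R]_n.+1.
Local Notation X := (R * Rd)%type.
Local Notation lam := (@lebesgue_measure R).
Local Notation mu := (mu n rho).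
Local Notation zeta := (zeta n rho).
Local Notation nu := (nu n rho).

Lemma energy_pt (s : R) (x : 'cV[R]_n) : pt s x 0 0 = s.
Proof. exact: pt_ord0. Qed.

Lemma measurable_energy : measurable_fun setT (fun p : Rd => p 0 0).
Proof. exact: measurable_coord. Qed.

Lemma omega_ge0 (x : R * 'cV[R]_n) : 0 <= omega x.
Proof. exact: sqrtr_ge0. Qed.

Lemma sqr_omega (x : R * 'cV[R]_n) : omega x ^+ 2 = x.1 ^+ 2 + dot x.2 x.2.
Proof. by rewrite sqr_sqrtr // addr_ge0 ?sqr_ge0 ?dot_ge0. Qed.

Lemma ge0_integral_mu (f : Rd -> \bar R) : measurable_fun setT f -> (forall z, 0 <= f z)%E ->
  (\int[mu]_p f p = \int[rho]_(m in `[0%R, +oo[) \int[leb R n]_q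
     (((omega (m, q))^-1)%:E * f (pt (omega (m, q)) q)))%E.
Proof. by move=> mf f0; rewrite ge0_integral_mixture. Qed.

Let ge0_integral_zeta_cone (F : X -> \bar R) : measurable_fun setT F -> (forall z, 0 <= F z)%E ->
  (\int[zeta]_z F z = \int[mu]_(p in @cone R n) \int[lam]_t ((cauchy_density (p, t))%:E * F (t, p)))%E.
Proof. by move=> mF F0; rewrite ge0_integral_mixture. Qed.

Lemma mu_null (A : set Rd) :
  (forall m (q : 'cV[R]_n), 0 <= m -> omega (m, q) != 0 -> ~ A (pt (omega (m, q)) q)) -> mu A = 0%E.
Proof.
move=> hA; rewrite /mu /mixtureM /= /mixture.
apply: integral0_eq => m /=; rewrite in_itv /= andbT => m0.
apply: integral0_eq => q _.
have [->|w0] := eqVneq (omega (m, q)) 0; first by rewrite invr0 mul0r.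
by rewrite indicE memNset ?mulr0 //; exact: hA.
Qed.

Lemma measurable_cone : measurable (@cone R n).
Proof.
have m0 := measurable_energy.
have m1 : measurable_fun [set: Rd] (fun p => p 0 0 ^+ 2 - dot (vecpart p) (vecpart p)).
  apply: measurable_funB; first exact: measurable_funX.
  exact: measurableT_comp (@measurable_dot R n) (@measurable_vecpart R n).
rewrite (_ : @cone R n = (fun p : Rd => p 0 0) @^-1` `[0, +oo[ `&`
    (fun p : Rd => p 0 0 ^+ 2 - dot (vecpart p) (vecpart p)) @^-1` `[0, +oo[).
  by apply: measurableI; rewrite -[X in measurable X]setTI; [exact: m0|exact: m1].
by apply/seteqP; split => p /=; rewrite !in_itv /= !andbT.
Qed.

Lemma mu_coneC : mu (~` @cone R n) = 0%E.
Proof.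
apply: mu_null => m q m0 _; apply; rewrite /cone /= energy_pt vecpart_pt omega_ge0.
by split => //; rewrite sqr_omega /= addrK sqr_ge0.
Qed.

(** The weight [1 / omega] gives no mass to the vertex of the cone, since the
    inverse of 0 is 0. *)
Lemma energy_gt0_ae : {ae mu, forall p : Rd, 0 < p 0 0}.
Proof.
exists [set p : Rd | p 0 0 <= 0]; split.
- rewrite (_ : [set p : Rd | _] = (fun p : Rd => p 0 0) @^-1` `]-oo, 0]).
    by rewrite -[X in measurable X]setTI; exact: measurable_energy.
  by apply/seteqP; split => p /=; rewrite in_itv.
- apply: mu_null => m q m0 w0 /=; rewrite energy_pt => w1.
  by move/negP: w0; apply; rewrite eq_le w1 omega_ge0.
- by move=> p /= /negP; rewrite -leNgt.
Qed.

Lemma measurable_cauchy_energy : measurable_fun setT (fun y : Rd * R => cauchy_fun `|y.1 0 0| y.2).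
Proof.
have m0 : measurable_fun setT (fun y : Rd * R => `|y.1 0 0|).
  by apply: measurableT_comp => //; exact: measurableT_comp measurable_energy measurable_fst.
apply: measurable_funM => //; apply: measurable_funM => //.
apply: measurableT_comp (@measurable_inv R) _.
by apply: measurable_funD; exact: measurable_funX.
Qed.

Lemma measurable_zeta_inner (F : X -> \bar R) : measurable_fun setT F -> (forall z, 0 <= F z)%E ->
  measurable_fun setT (fun p : Rd => \int[lam]_t ((cauchy_fun `|p 0%R 0%R| t)%:E * F (t, p)))%E.
Proof.
move=> mF F0.
apply: (@measurable_fun_fubini_tonelli_F _ _ _ _ _ lam
  (fun y : Rd * R => ((cauchy_fun `|y.1 0%R 0%R| y.2)%:E * F (y.2, y.1))%E)).
  apply: emeasurable_funM; first by apply/measurable_EFinP; exact: measurable_cauchy_energy.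
  have ms : measurable_fun setT (fun y : Rd * R => (y.2, y.1) : X) by exact: measurable_swap.
  exact: (measurableT_comp mF ms).
by move=> y; rewrite mule_ge0 // lee_fin cauchy_fun_ge0.
Qed.

Lemma ge0_integral_zeta (F : X -> \bar R) : measurable_fun setT F -> (forall z, 0 <= F z)%E ->
  (\int[zeta]_z F z = \int[mu]_p \int[lam]_t ((cauchy_fun `|p 0%R 0%R| t)%:E * F (t, p)))%E.
Proof.
move=> mF F0; rewrite (ge0_integral_zeta_cone mF F0).
rewrite [RHS](ge0_negligible_integral (measurableC measurable_cone) measurableT); last 3 first.
- exact: measurable_zeta_inner.
- by move=> p _; apply: integral_ge0 => t _; rewrite mule_ge0 // lee_fin cauchy_fun_ge0.
- exact: mu_coneC.
rewrite setDE setTI setCK; apply: eq_integral => p; rewrite inE => -[p0 _].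
by apply: eq_integral => t _; rewrite /cauchy_density /cauchy_fun /= ger0_norm.
Qed.

Lemma measurable_time_refl : measurable_fun setT (fun z : X => (- z.1, z.2)).
Proof.
apply/measurable_fun_pair; last exact: measurable_snd.
by apply: measurableT_comp => //; exact: measurable_fst.
Qed.

Lemma zeta_time_refl (A : set X) : measurable A -> zeta ((fun z => (- z.1, z.2)) @^-1` A) = zeta A.
Proof.
move=> mA; have mB : measurable ((fun z : X => (- z.1, z.2)) @^-1` A).
  by rewrite -[X in measurable X]setTI; exact: measurable_time_refl.
have mo : measurable_fun [set: measurableTypeR R] (-%R : R -> measurableTypeR R).
  exact: oppr_measurable.
have m1 (B : set X) : measurable B -> measurable_fun setT (fun z : X => (\1_B z : R)%:E).
  by move=> mB'; apply/measurable_EFinP; exact: measurable_indic.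
rewrite (measure_indic _ mB) (measure_indic _ mA).
rewrite (ge0_integral_zeta (m1 _ mA)); last by move=> z; rewrite lee_fin.
rewrite (ge0_integral_zeta (m1 _ mB)); last by move=> z; rewrite lee_fin.
apply: eq_integral => p _.
rewrite -[RHS](ge0_integral_preserving mo (fun B mB => lebesgue_opp mB)); last 2 first.
- apply: emeasurable_funM.
    by apply/measurable_EFinP; exact: measurable_cauchy_fun.
  exact: measurableT_comp (m1 _ mA) (pair2_measurable p).
- by move=> t; rewrite mule_ge0 // lee_fin cauchy_fun_ge0.
by apply: eq_integral => t _; rewrite /cauchy_fun sqrrN.
Qed.

Lemma measurable_proj : measurable_fun setT (@proj_p0 R n).
Proof.
apply: measurable_pt; first exact: measurable_fst.
exact: measurableT_comp (@measurable_vecpart R n) measurable_snd.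
Qed.

Lemma nu_proj (A : set Rd) : measurable A -> zeta (@proj_p0 R n @^-1` A) = nu A.
Proof. by []. Qed.

Lemma measurable_cV0 : measurable [set (0 : 'cV[R]_n)].
Proof.
rewrite (_ : [set _] = \bigcap_(i in [set: 'I_n]) ((fun x : 'cV[R]_n => x i 0) @^-1` [set (0 : R)])).
  apply: fin_bigcap_measurable => // i _; rewrite -[X in measurable X]setTI.
  exact: measurable_coord.
apply/seteqP; split => x /=; first by move=> -> i _ /=; rewrite mxE.
by move=> h; apply/matrixP => i j; rewrite ord1 mxE; exact: h.
Qed.

Lemma leb_point : (0 < n)%N -> leb R n [set (0%R : 'cV[R]_n)] = 0%E.
Proof.
move=> n0; apply/eqP; rewrite eq_le measure_ge0 andbT.
have box e : 0 < e -> e <= 1 -> (leb R n [set (0%R : 'cV[R]_n)] <= e%:E)%E.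
  move=> e0 e1; have e2 : - (e / 2) < e / 2 by rewrite gtrN // divr_gt0.
  apply: (@le_trans _ _ (leb R n (@open_box R n (- (e / 2)) (e / 2)))).
    apply: le_measure; rewrite ?inE.
    - exact: measurable_cV0.
    - exact: measurable_open_box.
    - by move=> x -> i; rewrite mxE oppr_lt0 !divr_gt0.
  rewrite leb_box // lee_fin opprK -splitr -[leRHS]expr1.
  by apply: ler_wiXn2l => //; exact: ltW.
apply/lee_addgt0Pr => e e0; rewrite add0e.
have [e1|/ltW e1] := leP e 1; first exact: box.
by apply: le_trans (box 1 ltr01 (lexx 1)) _; rewrite lee_fin.
Qed.

(** For [m = 0] and [n = 0] the shell is the single point 0, where [1 / omega]
    is zero by the convention on the inverse of 0. *)
Definition mass_kernel (m : R) (y : Rd) : R :=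
  if (m == 0) && (n == 0%N) then 0 else pi^-1 / (m ^+ 2 + dot y y).

Lemma mass_kernel_ge0 m y : 0 <= mass_kernel m y.
Proof.
rewrite /mass_kernel; case: ifP => // _.
by rewrite divr_ge0 ?invr_ge0 ?pi_ge0 // addr_ge0 ?sqr_ge0 ?dot_ge0.
Qed.

Lemma measurable_mass_kernel m : measurable_fun setT (mass_kernel m).
Proof.
rewrite /mass_kernel; have [c|c] := boolP ((m == 0) && (n == 0%N)); first exact: measurable_cst.
apply: measurable_funM => //; apply: measurableT_comp (@measurable_inv R) _.
by apply: measurable_funD => //; exact: measurable_dot.
Qed.

(** Over the shell of mass [m], the weight [1 / omega] cancels the numerator of
    the Cauchy density of width [omega], and [m^2 + q^2 + t^2] remains: the
    density no longer distinguishes [t] from the space variables. *)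
Lemma nu_mixture (A : set Rd) : measurable A ->
  (nu A = \int[rho]_(m in `[0%R, +oo[) \int[leb R n.+1]_y (mass_kernel m y * \1_A y)%:E)%E.
Proof.
move=> mA; have mAp : measurable (@proj_p0 R n @^-1` A).
  by rewrite -[X in measurable X]setTI; exact: measurable_proj.
have m1 : measurable_fun setT (fun z : X => (\1_(@proj_p0 R n @^-1` A) z : R)%:E).
  by apply/measurable_EFinP; exact: measurable_indic.
have mA1 : measurable_fun setT (fun y : Rd => (\1_A y : R)%:E).
  by apply/measurable_EFinP; exact: measurable_indic.
rewrite -(nu_proj mA) (measure_indic _ mAp) (ge0_integral_zeta m1); last by [].
rewrite ge0_integral_mu; last 2 first.
- by apply: (measurable_zeta_inner m1) => z; rewrite lee_fin.
- by move=> p; apply: integral_ge0 => t _; rewrite mule_ge0 // lee_fin cauchy_fun_ge0.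
apply: eq_integral => m; rewrite inE /= in_itv /= andbT => m0.
have mker : measurable_fun setT (fun y : Rd => (mass_kernel m y * \1_A y)%:E).
  by apply/measurable_EFinP; apply: measurable_funM; [exact: measurable_mass_kernel|exact: measurable_indic].
have ker0 y : (0 <= (mass_kernel m y * \1_A y)%:E)%E.
  by rewrite lee_fin mulr_ge0 // mass_kernel_ge0.
have mpt2 : measurable_fun setT (fun z : 'cV[R]_n * R => pt z.2 z.1).
  by apply: measurable_pt; [exact: measurable_snd|exact: measurable_fst].
have mpt1 : measurable_fun setT (fun z : R * 'cV[R]_n => pt z.1 z.2).
  by apply: measurable_pt; [exact: measurable_fst|exact: measurable_snd].
rewrite ge0_integral_leb_cons //.
rewrite (@fubini_tonelli _ _ _ _ _ lam (leb R n) (fun z : R * 'cV[R]_n => (mass_kernel m (pt z.1 z.2) * \1_A (pt z.1 z.2))%:E)%E) //=; last first.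
  exact: measurableT_comp mker mpt1.
pose g (q : 'cV[R]_n) (t : R) : R := (omega (m, q))^-1 * cauchy_fun (omega (m, q)) t * \1_A (pt t q).
have gE q t : ~~ ((m == 0) && ((n == 0%N) || (q == 0))) -> g q t = mass_kernel m (pt t q) * \1_A (pt t q).
  move=> mq; rewrite /g; congr (_ * _); rewrite /mass_kernel ifF; last first.
    by apply: contraNF mq => /andP[-> ->].
  have wn0 : omega (m, q) != 0.
    rewrite -(sqrf_eq0 (omega _)) sqr_omega /= paddr_eq0 ?sqr_ge0 ?dot_ge0 // sqrf_eq0.
    apply: contra mq => /andP[-> qq]; rewrite /=; apply/orP; right; apply/eqP/matrixP => i j.
    rewrite ord1 mxE; apply/eqP; rewrite -sqrf_eq0 eq_le sqr_ge0 andbT.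
    by rewrite -(eqP qq) coord_sqr_le.
  rewrite dot_pt /cauchy_fun sqr_omega /= mulrCA; congr (_ * _).
  by rewrite mulrA mulVf // mul1r addrAC -expr2 addrA.
have LE q : ((((omega (m, q))^-1)%:E * \int[lam]_t ((cauchy_fun `|pt (omega (m, q)) q 0%R 0%R| t)%:E *
      (\1_(@proj_p0 R n @^-1` A) (t, pt (omega (m, q)) q))%:E)) = \int[lam]_t (g q t)%:E)%E.
  rewrite -ge0_integralZl //; last 3 first.
  - apply: emeasurable_funM; first by apply/measurable_EFinP; exact: measurable_cauchy_fun.
    exact: measurableT_comp m1 (pair2_measurable _).
  - by move=> t _; rewrite mule_ge0 // lee_fin cauchy_fun_ge0.
  - by rewrite lee_fin invr_ge0 omega_ge0.
  apply: eq_integral => t _; rewrite energy_pt (ger0_norm (omega_ge0 _)) -!EFinM /g mulrA.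
  have -> : \1_(@proj_p0 R n @^-1` A) (t, pt (omega (m, q)) q) = \1_A (pt t (vecpart (pt (omega (m, q)) q))) :> R by [].
  by rewrite vecpart_pt.
under eq_integral => q _ do rewrite LE.
have mg : measurable_fun setT (fun z : 'cV[R]_n * R => (g z.1 z.2)%:E).
  apply/measurable_EFinP; apply: measurable_funM; last first.
    exact: measurableT_comp (measurable_indic mA) mpt2.
  have mo : measurable_fun setT (fun z : 'cV[R]_n * R => omega (m, z.1)).
    apply: (measurableT_comp (continuous_measurable_fun (@sqrt_continuous R))).
    by rewrite /=; apply: measurable_funD; [exact: measurable_cst|exact: measurableT_comp (@measurable_dot R n) measurable_fst].
  apply: measurable_funM; first exact: measurableT_comp (@measurable_inv R) mo.
  apply: measurable_funM => //; apply: measurable_funM => //.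
  by apply: measurableT_comp (@measurable_inv R) _; apply: measurable_funD; exact: measurable_funX.
have g0 q t : (0 <= (g q t)%:E)%E.
  rewrite lee_fin /g mulr_ge0 //; apply: mulr_ge0; first by rewrite invr_ge0 omega_ge0.
  exact: cauchy_fun_ge0 (omega_ge0 _).
case: (boolP ((m == 0) && (n == 0%N))) => [/andP[m00 n00]|mn].
  apply: eq_integral => q _; apply: eq_integral => t _.
  rewrite /g /mass_kernel m00 n00 /= mul0r /omega (eqP m00) /= expr0n add0r.
  rewrite (_ : dot q q = 0) ?sqrtr0 ?invr0 ?mul0r //.
  rewrite /dot big1 // => i _; have := ltn_ord i; rewrite {2}(eqP n00) ltn0 //.
have [m00|m00] := eqVneq m 0; last first.
  by apply: eq_integral => q _; apply: eq_integral => t _; rewrite gE // negb_and m00.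
have n0 : (0 < n)%N by rewrite lt0n; move: mn; rewrite m00 eqxx.
apply: ge0_ae_eq_integral => //.
- apply: (@measurable_fun_fubini_tonelli_F _ _ _ _ _ lam (fun z : 'cV[R]_n * R => (g z.1 z.2)%:E)) => //.
- apply: (@measurable_fun_fubini_tonelli_F _ _ _ _ _ lam (fun z : 'cV[R]_n * R => (mass_kernel m (pt z.2 z.1) * \1_A (pt z.2 z.1))%:E)) => //.
  exact: measurableT_comp mker mpt2.
- by move=> q _; apply: integral_ge0.
- by move=> q _; apply: integral_ge0.
exists [set (0%R : 'cV[R]_n)]; split; [exact: measurable_cV0| |].
- exact: leb_point.
- move=> q /= h; apply: contrapT => q0; apply: h => _; apply: eq_integral => t _; rewrite gE //.
  by rewrite m00 eqxx /= (gtn_eqF n0) /=; apply/eqP.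
Qed.

(** Lebesgue measure and the densities [mass_kernel m] are rotation invariant. *)
Lemma nu_orthogonal (g : 'M[R]_n.+1) (A : set Rd) : g^T *m g = 1%:M -> measurable A ->
  nu ((fun p => g *m p) @^-1` A) = nu A.
Proof.
move=> gO mA; have mB : measurable ((fun p : Rd => g *m p) @^-1` A).
  by rewrite -[X in measurable X]setTI; exact: measurable_cV_mulmx.
rewrite (nu_mixture mA) (nu_mixture mB); apply: eq_integral => m _.
rewrite -[RHS](ge0_integral_preserving (measurable_cV_mulmx g) (fun B mB => leb_orthogonal gO mB)).
- apply: eq_integral => y _; congr (_ * _)%:E.
  by rewrite /mass_kernel dot_orthogonal.
- by apply/measurable_EFinP; apply: measurable_funM; [exact: measurable_mass_kernel|exact: measurable_indic].
- by move=> y; rewrite lee_fin mulr_ge0 // mass_kernel_ge0.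
Qed.

Definition spatial_mx (k : 'M[R]_n) : 'M[R]_n.+1 := block_mx 1%:M 0 0 k : 'M[R]_(1 + n).

Lemma spatial_mulmx k (s : R) (x : 'cV[R]_n) : spatial_mx k *m pt s x = pt s (k *m x).
Proof.
apply: etrans (mul_block_col (1%:M : 'M[R]_1) 0 0 k (s%:M : 'cV[R]_1) x) _.
by rewrite mul1mx !mul0mx addr0 add0r.
Qed.

Lemma mu_spatial (k : 'M[R]_n) (A : set Rd) : k^T *m k = 1%:M -> measurable A ->
  mu ((fun p => spatial_mx k *m p) @^-1` A) = mu A.
Proof.
move=> kO mA; rewrite /mu /mixtureM /= /mixture; apply: eq_integral => m _.
have mF : measurable_fun setT (fun q : 'cV[R]_n => ((omega (m, q))^-1 * \1_A (pt (omega (m, q)) q))%:E).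
  have mo : measurable_fun setT (fun q : 'cV[R]_n => omega (m, q)).
    apply: (measurableT_comp (continuous_measurable_fun (@sqrt_continuous R))).
    by rewrite /=; apply: measurable_funD; [exact: measurable_cst|exact: measurable_dot].
  apply/measurable_EFinP; apply: measurable_funM.
    exact: measurableT_comp (@measurable_inv R) mo.
  by apply: measurableT_comp (measurable_indic mA) _; exact: measurable_pt.
rewrite -[RHS](ge0_integral_preserving (measurable_cV_mulmx k) (fun B mB => leb_orthogonal kO mB) mF).
  apply: eq_integral => q _.
  have -> : omega (m, k *m q) = omega (m, q) by rewrite /omega /= dot_orthogonal.
  by congr (_ * _)%:E; rewrite -spatial_mulmx.
by move=> q; rewrite lee_fin mulr_ge0 // invr_ge0 omega_ge0.
Qed.

End spectral_measures.

Section parameter_integrals.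
Context d1 d2 (T1 : measurableType d1) (T2 : measurableType d2) (R : realType).
Variable m2 : {sigma_finite_measure set T2 -> \bar R}.

Lemma measurable_param_integral (f : T1 * T2 -> R) : measurable_fun setT f ->
  measurable_fun setT (fun x => Rintegral m2 setT (fun y => f (x, y))).
Proof.
move=> mf; have mE : measurable_fun setT (EFin \o f) by exact/measurable_EFinP.
rewrite (_ : (fun x => _) = fine \o (fun x => \int[m2]_y (EFin \o f)^\+%E (x, y) - \int[m2]_y (EFin \o f)^\-%E (x, y))%E).
  apply: measurableT_comp; first exact: fine_measurable.
  apply: emeasurable_funB.
    apply: (@measurable_fun_fubini_tonelli_F _ _ _ _ _ m2 ((EFin \o f)^\+)%E).
      exact: measurable_funepos.
    by move=> z; exact: funepos_ge0.
  apply: (@measurable_fun_fubini_tonelli_F _ _ _ _ _ m2 ((EFin \o f)^\-)%E).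
    exact: measurable_funeneg.
  by move=> z; exact: funeneg_ge0.
apply/funext => x; rewrite /Rintegral /= integralE; congr (fine (_ - _)%E).
  apply: eq_integral => y _.
  by rewrite -[RHS]/((((EFin \o f)^\+)%E \o pair x) y) -funepos_comp.
apply: eq_integral => y _.
by rewrite -[RHS]/((((EFin \o f)^\-)%E \o pair x) y) -funeneg_comp.
Qed.

Lemma cmeasurable_param_integral (f : T1 * T2 -> R[i]) : cmeasurable f ->
  cmeasurable (fun x => cintegral m2 (fun y => f (x, y))).
Proof.
move=> [mr mi]; split; first exact: (measurable_param_integral mr).
exact: (measurable_param_integral mi).
Qed.

End parameter_integrals.

Section zeta_integrals.
Variables (R : realType) (n : nat) (rho : {measure set R -> \bar R}).
Local Notation Rd := 'cV[R]_n.+1.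
Local Notation X := (R * Rd)%type.
Local Notation C := R[i].
Local Notation lam := (@lebesgue_measure R).
Local Notation mu := (mu n rho).
Local Notation zeta := (zeta n rho).
Local Notation cau p t := (cauchy_fun `|p 0%R 0%R| t).

Lemma cauchy_integrable a : 0 <= a -> lam.-integrable setT (EFin \o cauchy_fun a).
Proof.
rewrite le_eqVlt => /orP[/eqP<-|]; last exact: integrable_cauchy_fun.
rewrite (_ : EFin \o _ = cst 0%E); first exact: integrable0.
by apply/funext => t; rewrite /= /cauchy_fun mul0r mulr0.
Qed.

Let inner_integrable (F : X -> R) (M : R) (p : Rd) : measurable_fun setT F -> (forall z, `|F z| <= M) ->
  lam.-integrable setT (EFin \o (fun t => cau p t * F (t, p))).
Proof.
move=> mF FM; apply: (le_integrable measurableT _ _ (integrable_scale M (cauchy_integrable (normr_ge0 (p 0 0))))).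
  apply/measurable_EFinP; apply: measurable_funM; first exact: measurable_cauchy_fun.
  exact: measurableT_comp mF (pair2_measurable p).
move=> t _; rewrite /= lee_fin normrM ger0_norm ?cauchy_fun_ge0 // mulrC.
apply: le_trans (ler_norm _); rewrite ler_wpM2r ?cauchy_fun_ge0 //.
Qed.

Let zeta_ge0 (F : X -> R) (M : R) : measurable_fun setT F -> (forall z, 0 <= F z <= M) ->
  (\int[zeta]_z (F z)%:E = \int[mu]_p (Rintegral lam setT (fun t => cau p t * F (t, p)))%:E)%E.
Proof.
move=> mF FM; have F0 z : 0 <= F z by have /andP[] := FM z.
rewrite ge0_integral_zeta; [|exact/measurable_EFinP|by move=> z; rewrite lee_fin].
apply: eq_integral => p _.
rewrite /Rintegral fineK; first by apply: eq_integral => t _; rewrite EFinM.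
apply: integrable_fin_num => //; apply: (@inner_integrable F M) => // z.
by rewrite ger0_norm //; have /andP[] := FM z.
Qed.

Let measurable_inner (F : X -> R) : measurable_fun setT F ->
  measurable_fun setT (fun p : Rd => Rintegral lam setT (fun t => cau p t * F (t, p))).
Proof.
move=> mF; apply: (@measurable_param_integral _ _ Rd _ R lam (fun y : Rd * R => cau y.1 y.2 * F (y.2, y.1))).
apply: measurable_funM; first exact: measurable_cauchy_energy.
have ms : measurable_fun setT (fun y : Rd * R => (y.2, y.1) : X) by exact: measurable_swap.
exact: (measurableT_comp mF ms).
Qed.

Lemma Rintegral_zeta (F : X -> R) (M : R) : zeta.-integrable setT (EFin \o F) -> (forall z, `|F z| <= M) ->
  Rintegral zeta setT F = Rintegral mu setT (fun p : Rd => Rintegral lam setT (fun t => cau p t * F (t, p))).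
Proof.
move=> Fi FM; have mF : measurable_fun setT F by apply/measurable_EFinP; exact: measurable_int Fi.
pose Fp z := Num.max (F z) 0; pose Fn z := Num.max (- F z) 0.
have M0 : 0 <= M by apply: le_trans (FM (0, 0)).
have mp : measurable_fun setT Fp by exact: measurable_funrpos.
have mn : measurable_fun setT Fn by exact: measurable_funrneg.
have Fp01 z : 0 <= Fp z <= M.
  by rewrite le_max lexx orbT /= ge_max M0 andbT (le_trans (ler_norm _) (FM z)).
have Fn01 z : 0 <= Fn z <= M.
  by rewrite le_max lexx orbT /= ge_max M0 andbT (le_trans (ler_norm _)) // normrN.
have FE z : F z = Fp z - Fn z.
  rewrite /Fp /Fn; have [F0|F0] := leP 0 (F z).
    by rewrite (max_idPr _) ?oppr_le0 // subr0.
  by rewrite (max_idPl _) ?oppr_ge0 ?ltW // opprK add0r.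
have part (G : X -> R) : measurable_fun setT G -> (forall z, 0 <= G z <= M) -> (forall z, G z <= `|F z|) ->
   [/\ zeta.-integrable setT (EFin \o G),
       mu.-integrable setT (EFin \o (fun p : Rd => Rintegral lam setT (fun t => cau p t * G (t, p)))) &
       Rintegral zeta setT G = Rintegral mu setT (fun p : Rd => Rintegral lam setT (fun t => cau p t * G (t, p)))].
  move=> mG G01 GF.
  have Gi : zeta.-integrable setT (EFin \o G).
    apply: (le_integrable measurableT _ _ Fi); first exact/measurable_EFinP.
    by move=> z _; rewrite /= lee_fin ger0_norm //; have /andP[] := G01 z.
  split => //; last by rewrite /Rintegral (zeta_ge0 mG G01).
  apply/integrableP; split; first by apply/measurable_EFinP; exact: measurable_inner.
  under eq_integral => p _.
    rewrite gee0_abs; first over.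
    rewrite lee_fin; apply: Rintegral_ge0 => t _; rewrite mulr_ge0 ?cauchy_fun_ge0 //.
    by have /andP[] := G01 (t, p).
  rewrite -(zeta_ge0 mG G01); have /integrableP[_] := Gi.
  apply: le_lt_trans; apply: ge0_le_integral => //.
  - by move=> z _; rewrite lee_fin; have /andP[] := G01 z.
  - exact/measurable_EFinP.
  - by apply: measurableT_comp => //; exact/measurable_EFinP.
  - by move=> z _; rewrite /= lee_fin ler_norm.
have [pi1 pi2 pE] := part _ mp Fp01 (fun z => ltac:(by rewrite ge_max ler_norm normr_ge0)).
have [ni1 ni2 nE] := part _ mn Fn01 (fun z => ltac:(by rewrite ge_max -normrN ler_norm normr_ge0)).
transitivity (Rintegral zeta setT (fun z => Fp z - Fn z)).
  by congr Rintegral; apply/funext => z.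
rewrite (RintegralB measurableT pi1 ni1) pE nE -(RintegralB measurableT pi2 ni2); apply: eq_Rintegral => p _.
rewrite -RintegralB //.
- by apply: eq_Rintegral => t _; rewrite FE mulrBr.
- by apply: (@inner_integrable Fp M) => // z; rewrite ger0_norm; have /andP[] := Fp01 z.
- by apply: (@inner_integrable Fn M) => // z; rewrite ger0_norm; have /andP[] := Fn01 z.
Qed.

(** The bound makes every inner integral finite, the Cauchy density being
    integrable. *)
Lemma cintegral_zeta (F : X -> C) (M : R) : cintegrable zeta F -> (forall z, cmod (F z) <= M) ->
  cintegral zeta F = cintegral mu (fun p : Rd => cintegral lam (fun t => (cau p t)%:C * F (t, p))).
Proof.
move=> [fr fi] FM; apply: complex_eqP => /=.
  rewrite (Rintegral_zeta fr (fun z => le_trans (Re_le_cmod _) (FM z))).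
  by apply: eq_Rintegral => p _; apply: eq_Rintegral => t _; rewrite cReM /= mul0r subr0.
rewrite (Rintegral_zeta fi (fun z => le_trans (Im_le_cmod _) (FM z))).
by apply: eq_Rintegral => p _; apply: eq_Rintegral => t _; rewrite cImM /= mul0r addr0.
Qed.

End zeta_integrals.

(** * The Poisson kernel and the reflected inner product *)

Section laplace_transform.
Variables (R : realType) (n : nat).
Local Notation Rd := 'cV[R]_n.+1.
Local Notation C := R[i].
Local Notation lam := (@lebesgue_measure R).
Local Notation leb := (leb R n.+1).
Local Notation half := (@half_space R n).
Implicit Types (f g : Rd -> C) (x p : Rd).

(** The Fourier transform in the space variables and the Laplace transform in
    time: the values of [fourier f] continued to the imaginary time [- i p_0].
    The absolute value keeps the kernel bounded off the cone as well. *)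
Definition laplace_kernel x p : C :=
  (expR (- (x 0 0 * `|p 0 0|)))%:C * expi (- dot (vecpart x) (vecpart p)).

Definition laplace f p : C := cintegral leb (fun x => f x * laplace_kernel x p).

Definition supported f := forall x, ~ half x -> f x = 0.

Lemma test_supported f : test_function half f -> supported f.
Proof. by move=> [_ [K [_ KO f0]]] x hx; apply: f0 => /KO. Qed.

Lemma measurable_laplace_kernel :
  cmeasurable (fun z : Rd * Rd => laplace_kernel z.1 z.2).
Proof.
have me1 : measurable_fun setT (fun z : Rd * Rd => z.1 0 0).
  exact: measurableT_comp (@measurable_coord R n.+1 0) measurable_fst.
have me2 : measurable_fun setT (fun z : Rd * Rd => z.2 0 0).
  exact: measurableT_comp (@measurable_coord R n.+1 0) measurable_snd.
apply: cmeasurableM.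
  apply: cmeasurable_real; apply: measurableT_comp; first exact: measurable_expR.
  apply: measurableT_comp => //; apply: measurable_funM => //.
  exact: measurableT_comp.
apply: cmeasurable_expi; apply: measurableT_comp => //; rewrite /dot.
apply: measurable_sum => i; apply: measurable_funM.
  apply: measurableT_comp (measurable_coord i) _.
  exact: measurableT_comp (@measurable_vecpart R n) measurable_fst.
apply: measurableT_comp (measurable_coord i) _.
exact: measurableT_comp (@measurable_vecpart R n) measurable_snd.
Qed.

Lemma cmeasurable_laplace_kernel p : cmeasurable (fun x => laplace_kernel x p).
Proof. exact: (cmeasurable_comp measurable_laplace_kernel (pair2_measurable p)). Qed.

Lemma laplace_kernel_meas (a : Rd) : cmeasurable (laplace_kernel a).
Proof. exact: (cmeasurable_comp measurable_laplace_kernel (pair1_measurable a)). Qed.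

Lemma laplace_kernel_le1 (a p : Rd) : 0 <= a 0 0 -> cmod (laplace_kernel a p) <= 1.
Proof.
move=> a0; rewrite /laplace_kernel cmodM cmod_expi mulr1 cmodR ger0_norm ?expR_ge0 //.
by rewrite -[leRHS]expR0 ler_expR oppr_le0 mulr_ge0.
Qed.

Lemma cmod_laplace f x p : supported f -> cmod (f x * laplace_kernel x p) <= cmod (f x).
Proof.
move=> sf; have [hx|hx] := pselect (half x); last by rewrite sf // mul0r.
by have k1 := laplace_kernel_le1 p (ltW hx); rewrite cmodM ler_piMr ?cmod_ge0.
Qed.

Lemma integrable_laplace f p : supported f -> cintegrable leb f ->
  cintegrable leb (fun x => f x * laplace_kernel x p).
Proof.
move=> sf fi; apply: (cintegrable_le _ (cintegrable_cmod fi)); last by move=> x; exact: cmod_laplace.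
by apply: cmeasurableM; [exact: cintegrable_meas fi|exact: cmeasurable_laplace_kernel].
Qed.

Lemma measurable_laplace f : cmeasurable f -> cmeasurable (laplace f).
Proof.
move=> mf; apply: (@cmeasurable_param_integral _ _ Rd Rd R leb (fun z => f z.2 * laplace_kernel z.2 z.1)).
apply: cmeasurableM; first exact: (cmeasurable_comp mf measurable_snd).
have ms : measurable_fun setT (fun y : Rd * Rd => (y.2, y.1)) by exact: measurable_swap.
exact: (cmeasurable_comp measurable_laplace_kernel ms).
Qed.

Lemma laplace_linear (a : C) f g p : supported f -> supported g -> cintegrable leb f -> cintegrable leb g ->
  laplace (fun x => a * f x + g x) p = a * laplace f p + laplace g p.
Proof.
move=> sf sg fi gi; rewrite /laplace -cintegralZ; last exact: integrable_laplace.
rewrite -cintegralD; last exact: integrable_laplace.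
  by apply: eq_cintegral => x; rewrite mulrDl mulrA.
by apply: cintegrableZ; exact: integrable_laplace.
Qed.

Lemma integrable_cauchy_bounded (a K : R) (B : R -> C) : 0 < a -> cmeasurable B ->
  (forall t, cmod (B t) <= K) -> cintegrable lam (fun t => (cauchy_fun a t)%:C * B t).
Proof.
move=> a0 mB BK; apply: (cintegrable_le _ (integrable_scale K (integrable_cauchy_fun a0))).
  by apply: cmeasurableM => //; apply: cmeasurable_real; exact: measurable_cauchy_fun.
move=> t; have c0 := cauchy_fun_ge0 t (ltW a0).
by rewrite cmodM cmodR ger0_norm // mulrC ler_wpM2r.
Qed.

Lemma poisson_fubini (a K : R) (B : R -> C) f : 0 < a -> cmeasurable B ->
  (forall t, cmod (B t) <= K) -> cintegrable leb f ->
  cintegral lam (fun t => (cauchy_fun a t)%:C * (B t * cintegral leb (fun y => f y * expi (y 0%R 0%R * t)))) =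
  cintegral leb (fun y => f y * cintegral lam (fun t => (cauchy_fun a t)%:C * (B t * expi (y 0%R 0%R * t)))).
Proof.
move=> a0 mB BK fi; have mf := cintegrable_meas fi.
pose F (z : R * Rd) : C := (cauchy_fun a z.1)%:C * (B z.1 * (f z.2 * expi (z.2 0 0 * z.1))).
have mF : cmeasurable F.
  apply: cmeasurableM.
    by apply: cmeasurable_real; exact: measurableT_comp (measurable_cauchy_fun a) measurable_fst.
  apply: cmeasurableM; first exact: (cmeasurable_comp mB measurable_fst).
  apply: cmeasurableM; first exact: (cmeasurable_comp mf measurable_snd).
  apply: cmeasurable_expi; apply: measurable_funM => //.
  exact: measurableT_comp (@measurable_coord R n.+1 0) measurable_snd.
transitivity (cintegral lam (fun t => cintegral leb (fun y => F (t, y)))).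
  apply: eq_cintegral => t; have kt : cintegrable leb (fun y => f y * expi (y 0%R 0%R * t)).
    by apply: cintegrable_phase => //; apply: measurable_funM => //; exact: measurable_energy.
  by rewrite -cintegralZ // -cintegralZ //; exact: cintegrableZ.
rewrite (@cfubini _ _ _ _ _ lam leb F (fun t => K * cauchy_fun a t) (fun y => cmod (f y))) //; last 3 first.
- by apply: integrable_scale; exact: integrable_cauchy_fun.
- exact: cintegrable_cmod.
- move=> t y; have c0 := cauchy_fun_ge0 t (ltW a0).
  rewrite /F /= !cmodM !cmod_expi mulr1 cmodR ger0_norm // mulrA.
  by apply: ler_wpM2r; rewrite ?cmod_ge0 // mulrC ler_wpM2r.
apply: eq_cintegral => y; rewrite -cintegralZ.
  by apply: eq_cintegral => t; rewrite /F /=; ring.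
apply: (integrable_cauchy_bounded (K := K)) => // [|t]; last by rewrite cmodM cmod_expi mulr1.
by apply: cmeasurableM => //; apply: cmeasurable_expi; exact: measurable_funM.
Qed.

(** Integrating against the Poisson kernel continues [e^(i s t)] to imaginary
    time; this is the mechanism behind the whole construction. *)
Lemma poisson_continuation (a s : R) f : 0 < a -> 0 <= s -> supported f -> cintegrable leb f ->
  cintegral lam (fun t => (cauchy_fun a t)%:C * (expi (s * t) * cintegral leb (fun y => f y * expi (y 0%R 0%R * t)))) =
  (expR (- (a * s)))%:C * cintegral leb (fun y => f y * (expR (- (a * y 0 0)))%:C).
Proof.
move=> a0 s0 sf fi; have mf := cintegrable_meas fi.
rewrite (poisson_fubini (K := 1) (B := fun t => expi (s * t)) a0 _ _ fi); last 2 first.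
- by apply: cmeasurable_expi; exact: measurable_funM.
- by move=> t; rewrite cmod_expi.
rewrite -cintegralZ; last first.
  apply: (cintegrable_le _ (cintegrable_cmod fi)).
    apply: cmeasurableM => //; apply: cmeasurable_real; apply: measurableT_comp; first exact: measurable_expR.
    by apply: measurableT_comp => //; apply: measurable_funM => //; exact: measurable_energy.
  move=> y; have [hy|hy] := pselect (half y); last by rewrite sf // mul0r cmod0.
  rewrite cmodM cmodR ger0_norm ?expR_ge0 // ler_piMr ?cmod_ge0 // -[leRHS]expR0 ler_expR oppr_le0.
  by rewrite mulr_ge0 // ltW.
apply: eq_cintegral => y.
have [hy|hy] := pselect (half y); last by rewrite sf // !mul0r mulr0.
rewrite mulrCA -rmorphM /= -expRD -opprD -mulrDr -fourier_cauchy //; last by rewrite addr_ge0 // ltW.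
by congr (_ * _); apply: eq_cintegral => t; rewrite mulrDl expiD.
Qed.

Lemma dot_split (x p : Rd) : dot x p = x 0 0 * p 0 0 + dot (vecpart x) (vecpart p).
Proof. by rewrite -{1}(pt_vecpart x) -{1}(pt_vecpart p) dot_pt. Qed.

Lemma fourier_time f (t : R) (q : 'cV[R]_n) :
  fourier f (pt t q) = cintegral leb (fun x => f x * expi (- dot (vecpart x) q) * expi (- (x 0 0 * t))).
Proof.
apply: eq_cintegral => x; rewrite dot_split energy_pt vecpart_pt opprD expiD -mulrA.
by congr (_ * _); rewrite mulrC.
Qed.

(** Both transforms are integrals of phases [e^(i x_0 t)]; continuing the first
    of them, with the second one kept inside the average over [t], and then the
    second gives the two Laplace factors. *)
Lemma poisson_product f g p : 0 < p 0 0 -> supported f -> supported g ->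
  schwartz f -> schwartz g ->
  cintegral lam (fun t => (cauchy_fun `|p 0%R 0%R| t)%:C *
     (fourier f (pt (- t) (vecpart p)) * conjc (fourier g (pt t (vecpart p))))) =
  laplace f p * conjc (laplace g p).
Proof.
move=> p0 sf sg scf scg; set a := `|p 0 0|; have a0 : 0 < a by rewrite normr_gt0 gt_eqF.
have fi := schwartz_integrable scf; have gi := schwartz_integrable scg.
pose Phi x := f x * expi (- dot (vecpart x) (vecpart p)).
pose Psi x := conjc (g x) * expi (dot (vecpart x) (vecpart p)).
have md : measurable_fun setT (fun x : Rd => dot (vecpart x) (vecpart p)).
  exact: measurableT_comp (measurable_dotl _) (@measurable_vecpart R n).
have Phi_i : cintegrable leb Phi by apply: cintegrable_phase => //; exact: measurableT_comp.
have Psi_i : cintegrable leb Psi by apply: cintegrable_phase => //; exact: cintegrableJ.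
have sPhi : supported Phi by move=> x hx; rewrite /Phi sf // mul0r.
have sPsi : supported Psi by move=> x hx; rewrite /Psi sg // conjc0 mul0r.
have conjM (x y : C) : conjc (x * y) = conjc x * conjc y by rewrite rmorphM.
have fE t : fourier f (pt (- t) (vecpart p)) = cintegral leb (fun x => Phi x * expi (x 0 0 * t)).
  by rewrite fourier_time; apply: eq_cintegral => x; rewrite mulrN opprK.
have gE t : conjc (fourier g (pt t (vecpart p))) = cintegral leb (fun x => Psi x * expi (x 0 0 * t)).
  rewrite /fourier -cintegralJ; last exact: integrable_kernel.
  apply: eq_cintegral => x; rewrite conjM conj_expi opprK dot_split energy_pt vecpart_pt expiD /Psi.
  by rewrite -!mulrA; congr (_ * _); rewrite mulrC.
under eq_cintegral => t do rewrite fE gE.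
pose L := cintegral leb (fun y => Psi y * (expR (- (a * y 0 0)))%:C).
have LE : conjc (laplace g p) = L.
  rewrite /laplace -cintegralJ; last exact: integrable_laplace.
  apply: eq_cintegral => y; rewrite /laplace_kernel !conjM conj_expi opprK /Psi -!mulrA; congr (_ * _).
  by rewrite mulrC; congr (_ * _); rewrite -/a [y 0 0 * a]mulrC; apply: complex_eqP => /=; rewrite ?oppr0.
have FE : laplace f p = cintegral leb (fun x => Phi x * (expR (- (a * x 0 0)))%:C).
  apply: eq_cintegral => x; rewrite /laplace_kernel /Phi -!mulrA; congr (_ * _).
  by rewrite mulrC -/a [x 0 0 * a]mulrC.
rewrite LE FE -cintegralZr; last first.
  have := integrable_laplace p sf fi; congr (cintegrable leb _); apply/funext => x.
  by rewrite /laplace_kernel /Phi -!mulrA; congr (_ * _); rewrite mulrC -/a [x 0 0 * a]mulrC.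
pose B (t : R) := cintegral leb (fun y => Psi y * expi (y 0 0 * t)).
have mB : cmeasurable B.
  apply: (@cmeasurable_param_integral _ _ R Rd R leb (fun z : R * Rd => Psi z.2 * expi (z.2 0 0 * z.1))).
  apply: cmeasurableM; first exact: (cmeasurable_comp (cintegrable_meas Psi_i) measurable_snd).
  apply: cmeasurable_expi; apply: measurable_funM => //.
  exact: measurableT_comp (@measurable_coord R n.+1 0) measurable_snd.
pose KB := Rintegral leb setT (fun y => cmod (Psi y)).
have BK t : cmod (B t) <= KB.
  have ki : cintegrable leb (fun y => Psi y * expi (y 0%R 0%R * t)).
    by apply: cintegrable_phase => //; apply: measurable_funM => //; exact: measurable_energy.
  apply: le_trans (cmod_cintegral ki) _; apply: eqR_le.
  by apply: eq_Rintegral => y _; rewrite cmodM cmod_expi mulr1.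
under eq_cintegral => t do rewrite [X in _ * X]mulrC.
rewrite (poisson_fubini a0 mB BK Phi_i); apply: eq_cintegral => x.
have [hx|hx] := pselect (half x); last by rewrite sPhi // !mul0r.
rewrite -mulrA; congr (_ * _); rewrite -(poisson_continuation a0 (ltW hx) sPsi Psi_i).
by apply: eq_cintegral => t; rewrite [B t * _]mulrC.
Qed.

End laplace_transform.

Section weighted_composition.
Context d1 d2 (T1 : measurableType d1) (T2 : measurableType d2) (R : realType).
Variables (m1 : {measure set T1 -> \bar R}) (m2 : {measure set T2 -> \bar R}).
Variable h : T1 -> T2.
Hypothesis mh : measurable_fun setT h.
Hypothesis m12 : forall A, measurable A -> m1 (h @^-1` A) = m2 A.

Lemma L2_composition (f : T2 -> R[i]^o) : hdom (L2 m2) f -> hdom (L2 m1) (fun x => f (h x)).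
Proof.
move=> /hdom_L2P[mf fi]; apply/hdom_L2P; split; first exact: (cmeasurable_comp mf mh).
exact: (integrable_preserving mh m12 fi).
Qed.

Lemma form_composition (f g : T2 -> R[i]^o) : hdom (L2 m2) f -> hdom (L2 m2) g ->
  hform (L2 m1) (fun x => f (h x)) (fun x => g (h x)) = hform (L2 m2) f g.
Proof.
move=> [mf _] [mg _]; rewrite /hform /= -[RHS](cintegral_preserving mh m12) //.
by apply: cmeasurableM => //; exact: cmeasurableJ.
Qed.

Variable b : T1 -> R[i].
Hypothesis mb : cmeasurable b.
Hypothesis b1 : forall x, cmod (b x) = 1.
Local Notation wcomp f := (fun x => b x * f (h x)).

Lemma L2_weighted_composition (f : T2 -> R[i]^o) : hdom (L2 m2) f -> hdom (L2 m1) (wcomp f).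
Proof.
move=> /L2_composition fh; apply: (L2_bounded_mul (M := 1) fh mb).
by apply: aeW => x; rewrite b1.
Qed.

Lemma form_weighted_composition (f g : T2 -> R[i]^o) : hdom (L2 m2) f -> hdom (L2 m2) g ->
  hform (L2 m1) (wcomp f) (wcomp g) = hform (L2 m2) f g.
Proof.
move=> fL gL; rewrite -(form_composition fL gL); apply: eq_cintegral => x.
by rewrite rmorphM mulrACA mul_conjc -sqr_cmod b1 expr1n mul1r.
Qed.

End weighted_composition.

Section orbit_vectors.
Variables (R : realType) (n : nat) (rho : {measure set R -> \bar R}).
Hypothesis nu_tempered : tempered_measure (nu n rho).
Local Notation Rd := 'cV[R]_n.+1.
Local Notation X := (R * Rd)%type.
Local Notation C := R[i].
Local Notation lam := (@lebesgue_measure R).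
Local Notation mu := (mu n rho).
Local Notation zeta := (zeta n rho).
Local Notation nu := (nu n rho).
Local Notation E := (E_space n rho).
Local Notation half := (@half_space R n).
Local Notation orbit phi := (integrated_rep phi (@one_E R n)).
Implicit Types (phi psi : Rd -> C) (f : Rd -> C^o) (v : X -> C^o).

Lemma integrated_repE phi : orbit phi = pullback (fourier phi).
Proof.
apply/funext => z; rewrite /integrated_rep /pullback /fourier.
by apply: eq_cintegral => x; rewrite /rep_E /one_E mulr1.
Qed.

Lemma fourier_bounded phi : schwartz phi -> exists K : R, forall p, cmod (fourier phi p) <= K.
Proof.
move=> sphi; have [K K0 HK] := fourier_rapid 0 sphi.
by exists K => p; have := HK p; rewrite expr0 invr1 mulr1.
Qed.

Lemma rapid_L2 f : cmeasurable f ->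
  (forall N, exists K, forall p, cmod (f p) <= K * (japanese p ^+ N)^-1) -> hdom (L2 nu) f.
Proof.
move=> mf fr; have [N iN] := nu_tempered; have [K HK] := fr N.
apply: (hdom_L2_le mf (integrable_scale (K ^+ 2) iN)); apply: aeW => p; rewrite /=.
have j0 : 0 < japanese p ^+ N by rewrite exprn_gt0 // japanese_gt0.
have j1 : (japanese p ^+ N)^-1 <= 1 by rewrite invf_le1 // exprn_ege1 // japanese_ge1.
rewrite -sqr_cmod; apply: (@le_trans _ _ ((K * (japanese p ^+ N)^-1) ^+ 2)).
  by rewrite ler_sqr ?nnegrE ?cmod_ge0 ?(le_trans (cmod_ge0 _) (HK p)).
by rewrite exprMn ler_wpM2l ?sqr_ge0 // expr2 ler_piMr // invr_ge0 ltW.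
Qed.

Lemma fourier_L2 phi : schwartz phi -> hdom (L2 nu) (fourier phi).
Proof.
move=> sphi; apply: rapid_L2; first exact: measurable_fourier.
by move=> N; have [K _ HK] := fourier_rapid N sphi; exists K.
Qed.

Lemma fourier_integrable phi : schwartz phi -> cintegrable nu (fourier phi).
Proof.
move=> sphi; have [N iN] := nu_tempered; have [K K0 HK] := fourier_rapid N sphi.
exact: (cintegrable_le (measurable_fourier sphi) (integrable_scale K iN) HK).
Qed.

Lemma pullback_L2 f : hdom (L2 nu) f -> hdom E (pullback f).
Proof. exact: (L2_composition (@measurable_proj R n) (@nu_proj R n rho)). Qed.

Lemma pullback_form f g : hdom (L2 nu) f -> hdom (L2 nu) g ->
  hform E (pullback f) (pullback g) = hform (L2 nu) f g.
Proof. exact: (form_composition (@measurable_proj R n) (@nu_proj R n rho)). Qed.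

Lemma pullback_norm f : hdom (L2 nu) f -> hnorm E (pullback f) = hnorm (L2 nu) f.
Proof. by move=> fL; rewrite /hnorm pullback_form. Qed.

Lemma pullbackB f g : pullback f - pullback g = pullback (f - g) :> (X -> C^o).
Proof. by []. Qed.

Lemma orbit_E phi : schwartz phi -> hdom E (orbit phi).
Proof. by move=> sphi; rewrite integrated_repE; apply: pullback_L2; exact: fourier_L2. Qed.

Lemma theta_E v : hdom E v -> hdom E (theta v).
Proof. exact: (L2_composition (@measurable_time_refl R n) (@zeta_time_refl R n rho)). Qed.

Lemma theta_form v w : hdom E v -> hdom E w -> hform E (theta v) (theta w) = hform E v w.
Proof. exact: (form_composition (@measurable_time_refl R n) (@zeta_time_refl R n rho)). Qed.

Lemma theta_norm v : hdom E v -> hnorm E (theta v) = hnorm E v.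
Proof. by move=> vE; rewrite /hnorm theta_form. Qed.

Lemma thetaK v : theta (theta v) = v.
Proof. by apply/funext => -[t p]; rewrite /theta /= opprK. Qed.

Lemma vecpart_refl (p : Rd) : vecpart (refl p) = vecpart p.
Proof.
by apply/matrixP => i j; rewrite mxE [RHS]mxE /refl /refl_mx mul_diag_mx !mxE /= mul1r.
Qed.

Lemma energy_refl (p : Rd) : refl p 0 0 = - p 0 0.
Proof. by rewrite /refl /refl_mx mul_diag_mx !mxE eqxx mulN1r. Qed.

Lemma reflE (p : Rd) : refl p = pt (- p 0 0) (vecpart p).
Proof. by rewrite -energy_refl -vecpart_refl -[LHS]pt_vecpart. Qed.

Lemma theta_pullback f : theta (pullback f) = pullback (theta_nu f).
Proof.
apply/funext => -[t p]; rewrite /theta /pullback /theta_nu /proj_p0 /= reflE.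
by rewrite energy_pt vecpart_pt.
Qed.

(** Over [p] of positive energy, the square of [laplace phi] is a Cauchy average
    of products of two values of [fourier phi], and these are square integrable
    for [zeta]. *)
Lemma laplace_L2 phi : test_function half phi -> hdom (L2 mu) (laplace phi).
Proof.
move=> tphi; have sc := test_schwartz tphi; have su := test_supported tphi.
have ml : cmeasurable (laplace phi).
  by apply: measurable_laplace; apply: smooth_cmeasurable; case: sc.
pose f z : R := sqmod (theta (orbit phi) z) + sqmod (orbit phi z).
have oE := orbit_E sc; have tE := theta_E oE.
have fi : zeta.-integrable setT (EFin \o f).
  have /hdom_L2P[_ i1] := tE; have /hdom_L2P[_ i2] := oE.
  rewrite (_ : EFin \o f = (fun z => (sqmod (theta (orbit phi) z))%:E) \+ (fun z => (sqmod (orbit phi z))%:E))%E //.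
  exact: integrableD.
have f0 z : 0 <= f z by rewrite addr_ge0 // sqmod_ge0.
have mf : measurable_fun setT f by apply/measurable_EFinP; exact: measurable_int fi.
have mE : measurable_fun setT (EFin \o f) by exact/measurable_EFinP.
have [K HK] := fourier_bounded sc.
have K0 : 0 <= K by apply: le_trans (cmod_ge0 _) (HK 0).
apply/hdom_L2P; split => //; apply/integrableP; split.
  by apply/measurable_EFinP; exact: measurable_sqmod.
under eq_integral => p _ do rewrite gee0_abs ?lee_fin ?sqmod_ge0 //.
have /integrableP[_] := fi; apply: le_lt_trans.
under [X in (_ <= X)%E]eq_integral => z _ do rewrite gee0_abs ?lee_fin ?f0 //.
rewrite (@ge0_integral_zeta _ _ rho (EFin \o f)) //.
apply: ae_ge0_le_integral => //.
- by move=> p _; rewrite lee_fin sqmod_ge0.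
- by apply/measurable_EFinP; exact: measurable_sqmod.
- by move=> p _; apply: integral_ge0 => t _; rewrite mule_ge0 // lee_fin ?cauchy_fun_ge0.
- by apply: (@measurable_zeta_inner R n (EFin \o f)) => // z; rewrite lee_fin.
apply: filterS (energy_gt0_ae n rho) => p p0 _.
pose G t := (cauchy_fun `|p 0 0| t)%:C * (fourier phi (pt (- t) (vecpart p)) * conjc (fourier phi (pt t (vecpart p)))).
have mfo := measurable_fourier sc.
have mpt (s : R -> R) : measurable_fun setT s -> cmeasurable (fun t => fourier phi (pt (s t) (vecpart p))).
  move=> ms; apply: (cmeasurable_comp mfo); apply: measurable_pt => //.
have mG : cmeasurable G.
  apply: cmeasurableM; first by apply: cmeasurable_real; exact: measurable_cauchy_fun.
  by apply: cmeasurableM; [apply: mpt; exact: oppr_measurable|apply: cmeasurableJ; exact: mpt].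
have Gi : cintegrable lam G.
  apply: (cintegrable_le _ (integrable_scale (K * K) (cauchy_integrable (normr_ge0 (p 0 0))))); first exact: mG.
  move=> t.
  rewrite /G !cmodM cmodJ cmodR ger0_norm ?cauchy_fun_ge0 // mulrC ler_wpM2r ?cauchy_fun_ge0 //.
  exact: ler_pM (cmod_ge0 _) (cmod_ge0 _) (HK _) (HK _).
have := poisson_product p0 su su sc sc; rewrite mul_conjc -/G => GE.
have : sqmod (laplace phi p) <= Rintegral lam setT (fun t => cmod (G t)).
  rewrite -[leLHS]ger0_norm ?sqmod_ge0 // -cmodR -GE; exact: cmod_cintegral.
rewrite -lee_fin; move/le_trans; apply.
have Gi2 := cintegrable_cmod Gi.
rewrite /Rintegral fineK; last exact: integrable_fin_num Gi2.
apply: ge0_le_integral => //.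
- by move=> t _; rewrite lee_fin cmod_ge0.
- by apply/measurable_EFinP; exact: measurable_cmod.
- apply: emeasurable_funM; first by apply/measurable_EFinP; exact: measurable_cauchy_fun.
  exact: measurableT_comp mE (pair2_measurable p).
move=> t _; rewrite -EFinM lee_fin /G cmodM cmodR ger0_norm ?cauchy_fun_ge0 //.
rewrite ler_wpM2l ?cauchy_fun_ge0 // cmodM cmodJ -cmodM; apply: le_trans (cmodM_le _ _) _.
by rewrite /f integrated_repE /theta /pullback /proj_p0 /=.
Qed.

(** The integral over [zeta] is an average over [t] followed by an integral over
    the cone; [poisson_product] evaluates the average. *)
Lemma reflected_form phi psi : test_function half phi -> test_function half psi ->
  hform E (theta (orbit phi)) (orbit psi) = hform (L2 mu) (laplace phi) (laplace psi).
Proof.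
move=> tphi tpsi; have sc := test_schwartz tphi; have sc' := test_schwartz tpsi.
have [K HK] := fourier_bounded sc; have [K' HK'] := fourier_bounded sc'.
have oE := orbit_E sc; have oE' := orbit_E sc'; have tE := theta_E oE.
rewrite -[hform (L2 mu) _ _]/(cintegral mu (fun p => laplace phi p * conjc (laplace psi p))).
rewrite -[hform E _ _]/(cintegral zeta (fun z => theta (orbit phi) z * conjc (orbit psi z))).
rewrite (@cintegral_zeta _ _ rho (fun z => theta (orbit phi) z * conjc (orbit psi z)) (K * K')); last 2 first.
- exact: (L2_mul_integrable tE oE').
- move=> z; rewrite cmodM cmodJ !integrated_repE /theta /pullback.
  exact: ler_pM (cmod_ge0 _) (cmod_ge0 _) (HK _) (HK' _).
apply: cintegral_ae.
- apply: (@cmeasurable_param_integral _ _ Rd _ R lam (fun y : Rd * R => (cauchy_fun `|y.1 0 0| y.2)%:C *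
     (theta (orbit phi) (y.2, y.1) * conjc (orbit psi (y.2, y.1))))).
  have ms : measurable_fun setT (fun y : Rd * R => (y.2, y.1) : X) by exact: measurable_swap.
  apply: cmeasurableM; first by apply: cmeasurable_real; exact: measurable_cauchy_energy.
  apply: cmeasurableM; first exact: (cmeasurable_comp (L2_meas tE) ms).
  by apply: cmeasurableJ; exact: (cmeasurable_comp (L2_meas oE') ms).
- apply: cmeasurableM; first exact: L2_meas (laplace_L2 tphi).
  by apply: cmeasurableJ; exact: L2_meas (laplace_L2 tpsi).
apply: filterS (energy_gt0_ae n rho) => p p0.
rewrite -(poisson_product p0 (test_supported tphi) (test_supported tpsi) sc sc').
by apply: eq_cintegral => t; rewrite !integrated_repE /theta /pullback /proj_p0 /=.
Qed.

End orbit_vectors.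

(** * Motions acting on transforms *)

Section covariance.
Variables (R : realType) (n : nat).
Local Notation Rd := 'cV[R]_n.+1.
Local Notation C := R[i].
Local Notation leb := (leb R n.+1).
Implicit Types (phi psi : Rd -> C) (g : Rd * 'M[R]_n.+1).

Lemma orthogonal_inv m (A : 'M[R]_m) : A^T *m A = 1%:M -> invmx A = A^T.
Proof.
move=> AO; have uA : A \in unitmx by case: (mulmx1_unit AO).
by rewrite -[LHS]mul1mx -AO -mulmxA mulmxV // mulmx1.
Qed.

Lemma orthogonalC m (A : 'M[R]_m) : A^T *m A = 1%:M -> A^T^T *m A^T = 1%:M.
Proof. by move=> AO; rewrite trmxK; exact: mulmx1C. Qed.

(** The action of a motion on functions, [phi] being composed with the inverse
    motion. *)
Definition move g phi : Rd -> C := fun y => phi (g.2^T *m y - g.2^T *m g.1).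

Lemma moveE g phi : move g phi = (fun y => (fun x => phi (g.2^T *m x)) (y + (- g.1))).
Proof. by apply/funext => y; rewrite /move mulmxDr mulmxN. Qed.

Lemma rotate_integrable (A : 'M[R]_n.+1) phi : A^T *m A = 1%:M -> cintegrable leb phi ->
  cintegrable leb (fun x => phi (A *m x)).
Proof.
move=> AO; apply: (cintegrable_preserving (measurable_cV_mulmx A)) => B mB; exact: leb_orthogonal.
Qed.

Lemma fourier_move g phi : mot_set g -> cintegrable leb phi ->
  fourier (move g phi) = natural_rep g (fourier phi).
Proof.
move=> gO fi; apply/funext => p.
have gO' := orthogonalC gO; have fi' := rotate_integrable gO' fi.
rewrite moveE (fourier_translate _ _ fi') (fourier_orthogonal _ gO' (cintegrable_meas fi)).
by rewrite dotNl /natural_rep orthogonal_inv.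
Qed.

Lemma test_move (O O' : set Rd) g phi : mot_set g -> (forall x, O x -> O' (g.2 *m x + g.1)) ->
  test_function O phi -> test_function O' (move g phi).
Proof.
move=> gO OO'; apply: (@test_affine _ _ _ _ _ g.2^T g.2 (- (g.2^T *m g.1))) => // x Ox.
by rewrite opprK mulmxDr mulmxA (mulmx1C gO) mul1mx; exact: OO'.
Qed.

Lemma laplace_kernelD x y p : laplace_kernel (x + y : Rd) p = laplace_kernel x p * laplace_kernel y p.
Proof.
rewrite /laplace_kernel (_ : vecpart (x + y) = vecpart x + vecpart y); last first.
  by rewrite /vecpart linearD.
rewrite mxE mulrDl opprD expRD dotDl opprD expiD rmorphM /=.
by set a := _%:C; set b := _%:C; ring.
Qed.

Lemma laplace_translate phi a p : cmeasurable phi -> supported phi -> cintegrable leb phi ->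
  laplace (fun y => phi (y - a)) p = laplace_kernel a p * laplace phi p.
Proof.
move=> mf sf fi; rewrite /laplace -cintegralZ; last exact: integrable_laplace.
rewrite -[RHS](cintegral_preserving (measurable_cV_add (- a)) (fun A mA => leb_translate (- a) mA)).
  by apply: eq_cintegral => x; rewrite [in RHS]mulrCA -laplace_kernelD [a + _]addrC subrK.
apply: cmeasurableM; first exact: cmeasurable_cst.
by apply: cmeasurableM => //; exact: cmeasurable_laplace_kernel.
Qed.

Lemma spatial_tr (k : 'M[R]_n) : (spatial_mx k)^T = spatial_mx k^T.
Proof.
by apply: etrans (tr_block_mx (1%:M : 'M[R]_1) 0 0 k) _; rewrite trmx1 !trmx0.
Qed.

Lemma spatial_orthogonal (k : 'M[R]_n) : k^T *m k = 1%:M -> (spatial_mx k)^T *m spatial_mx k = 1%:M.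
Proof.
move=> kO; rewrite spatial_tr.
apply: etrans (mulmx_block (1%:M : 'M[R]_1) 0 0 k^T 1%:M 0 0 k) _.
by rewrite !mulmx0 !mul0mx mulmx1 kO !addr0 !add0r; exact/esym/(@scalar_mx_block _ 1 n 1).
Qed.

Lemma energy_spatial (k : 'M[R]_n) (x : Rd) : (spatial_mx k *m x) 0 0 = x 0 0.
Proof. by rewrite -{1}(pt_vecpart x) spatial_mulmx energy_pt. Qed.

Lemma vecpart_spatial (k : 'M[R]_n) (x : Rd) : vecpart (spatial_mx k *m x) = k *m vecpart x.
Proof. by rewrite -{1}(pt_vecpart x) spatial_mulmx vecpart_pt. Qed.

Lemma laplace_rotate phi (k : 'M[R]_n) p : k^T *m k = 1%:M -> cmeasurable phi ->
  laplace (fun y => phi (spatial_mx k *m y)) p = laplace phi (spatial_mx k *m p).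
Proof.
move=> kO mf; rewrite /laplace -[RHS](cintegral_preserving (measurable_cV_mulmx (spatial_mx k))
   (fun B mB => leb_orthogonal (spatial_orthogonal kO) mB)).
  apply: eq_cintegral => x; congr (_ * _).
  by rewrite /laplace_kernel !energy_spatial !vecpart_spatial dot_orthogonal.
by apply: cmeasurableM => //; exact: cmeasurable_laplace_kernel.
Qed.

Lemma mot_H_set g : mot_H g -> mot_set g.
Proof. by move=> [_ [k kO gk]]; rewrite /mot_set /orthogonal_mx /= gk; exact: spatial_orthogonal. Qed.

Lemma laplace_move g phi : mot_H g -> supported phi -> cintegrable leb phi ->
  laplace (move g phi) = natural_rep g (laplace phi).
Proof.
move=> gH sf fi; apply/funext => p; have mf := cintegrable_meas fi.
have gO := mot_H_set gH; have gi := orthogonal_inv gO.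
case: gH => g0 [k kO gk]; have kO' := orthogonalC kO.
have g2T : g.2^T = spatial_mx k^T by rewrite gk; exact: spatial_tr.
rewrite moveE (@laplace_translate (fun x => phi (g.2^T *m x)) g.1).
- rewrite g2T (laplace_rotate _ kO' mf) -g2T /natural_rep gi; congr (_ * _).
  by rewrite /laplace_kernel g0 mul0r oppr0 expR0 mul1r dot_split g0 mul0r add0r.
- exact: (cmeasurable_comp mf (measurable_cV_mulmx _)).
- by move=> x hx; apply: sf; rewrite /half_space /= g2T energy_spatial.
- by apply: rotate_integrable => //; exact: orthogonalC.
Qed.

End covariance.

(** * Density of the transforms of test functions *)

Section multipliers_of_a_span.
Context d (T : measurableType d) (R : realType) (m : {measure set T -> \bar R}).
Local Notation C := R[i].
Local Notation L := (L2 m).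
Implicit Types (f : T -> C^o) (b : T -> C).

Lemma span_multiplier (A : set (T -> C^o)) b (K : R) : A `<=` hdom L ->
  cmeasurable b -> 0 <= K -> (forall x, cmod (b x) <= K) ->
  (forall f, A f -> closed_span L A (fun x => b x * f x)) -> multiplier (closed_span L A) b.
Proof.
move=> AL mb K0 bK bA; have LP := L2_prehilbert m.
have Scl := closed_span_closed LP A.
split => //; first by exists K.
apply: (closed_span_map LP (T := fun f : T -> C^o => (fun x => b x * f x)) (M := K) _ _ _ Scl AL bA).
- by move=> a f g; apply/funext => x; rewrite mulrDr; congr (_ + _); rewrite mulrCA.
- by move=> f fL; apply: (L2_bounded_mul fL mb); apply: aeW => x; exact: bK.
- by move=> f fL; exact: (L2_bounded_norm fL mb K0 (aeW _ bK)).
Qed.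

Variable S : set (T -> C^o).
Hypothesis Scl : closed_subspace L S.

Lemma sin_multiplier (r : T -> R) : multiplier S (fun x => expi (r x)) ->
  multiplier S (fun x => expi (- r x)) -> multiplier S (fun x => (sin (r x))%:C).
Proof.
move=> m1 m2.
have := multiplierM (multiplier_cst Scl (0 +i* (- 2^-1))) (multiplierB Scl m1 m2).
congr (multiplier S _); apply/funext => x; rewrite /expi cosN sinN.
by apply: complex_eqP; rewrite ?cReM ?cImM ?cReB ?cImB /=; field.
Qed.

(** The set [r > a] is obtained from the sets [sin ((r - a) / k) > 0], because
    [(r - a) / k] eventually lies in the interval where the sine has the sign
    of its argument. *)
Lemma good_set_gt (r : T -> R) (a : R) :
  (forall k : nat, multiplier S (fun x => (sin ((r x - a) / k.+1%:R))%:C)) ->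
  good_set S [set x | a < r x].
Proof.
move=> ms; pose G k : set T := [set x | 0 < sin ((r x - a) / k.+1%:R)].
have gG k : good_set S (G k) by apply: (good_set_gt0 Scl _ (ms k)) => x; exact: sin_abs1.
have -> : [set x | a < r x] = \bigcup_N \bigcap_j G (N + j)%N.
  apply/seteqP; split => x /=; pose y := r x - a.
    move=> ax; have y0 : 0 < y by rewrite subr_gt0.
    exists (Num.truncn y) => // j _; rewrite /G /= -/y.
    have k0 : 0 < (Num.truncn y + j).+1%:R :> R by rewrite ltr0n.
    apply: sin_gt0_pi; rewrite divr_gt0 //=; apply: (@lt_le_trans _ _ 1); last first.
      by apply: le_trans (@pi_ge2 R); rewrite ler1n.
    rewrite ltr_pdivrMr // mul1r; have /andP[_ h] := truncn_itv (ltW y0).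
    by apply: lt_le_trans h _; rewrite ler_nat ltnS leq_addr.
  move=> [N _ h]; rewrite ltNge; apply/negP => ra.
  have y0 : 0 <= - y by rewrite oppr_ge0 subr_le0.
  have := h (Num.truncn (- y)) Logic.I; rewrite /G /= -/y.
  set k := (N + _)%N; have k0 : 0 < k.+1%:R :> R by rewrite ltr0n.
  rewrite -[y]opprK mulNr sinN oppr_gt0 ltNge => /negP; apply.
  apply: sin_ge0_pi; rewrite divr_ge0 ?(ltW k0) //=; apply: (@le_trans _ _ 1); last first.
    by apply: le_trans (@pi_ge2 R); rewrite ler1n.
  rewrite ler_pdivrMr // mul1r ltW //; have /andP[_ h'] := truncn_itv y0.
  by apply: lt_le_trans h' _; rewrite ler_nat ltnS leq_addl.
apply: (good_bigcup Scl) => N; apply: (good_bigcap Scl) => j; exact: gG.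
Qed.

End multipliers_of_a_span.

Section bump_functions.
Variables (R : realType) (n : nat).
Local Notation Rd := 'cV[R]_n.+1.
Local Notation C := R[i].
Local Notation leb := (leb R n.+1).
Local Notation half := (@half_space R n).

Lemma leb_open_gt0 (U : set Rd) x : open U -> U x -> (0 < leb U)%E.
Proof.
move=> oU Ux; have : nbhs x U by apply: open_nbhs_nbhs; split.
move=> /nbhs_ballP[e /= e0 xU].
have e2 : - e < e by rewrite gtrN.
apply: (@lt_le_trans _ _ (leb ((fun y => y + (- x)) @^-1` @open_box R n.+1 (- e) e))).
  rewrite leb_translate; last exact: measurable_open_box.
  by rewrite leb_box // lte_fin exprn_gt0 // opprK addr_gt0.
apply: le_measure; rewrite ?inE.
- by rewrite -[X in measurable X]setTI; apply: measurable_cV_add => //; exact: measurable_open_box.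
- exact: open_measurable_cV.
- move=> y /= hy; apply: xU; split => // i j; rewrite ord1 /ball /=.
  by have := hy i; rewrite !mxE distrC ltr_norml.
Qed.

(** The bumps shrink to the origin inside the half space. Near the origin
    [cos (dot x q)] is positive, so for each [q] some bump has a transform which
    does not vanish at [q]: they are the functions without common zero required
    by [multipliers_dense]. *)
Definition bump_radius (j : nat) : R := j.+1%:R^-1.

Definition bump_center (j : nat) : Rd := pt (2 * bump_radius j) 0.

Local Notation sqdist j x := (dot (x - bump_center j) (x - bump_center j)).

Definition bump (j : nat) (x : Rd) : C :=
  (flat 0 (bump_radius j ^+ 2 + (- 1) * sqdist j x))%:C.

Lemma bump_radius_gt0 j : 0 < bump_radius j.
Proof. by rewrite invr_gt0 ltr0n. Qed.

Lemma bump_coord j x i : sqdist j x <= bump_radius j ^+ 2 ->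
  `|x i 0 - bump_center j i 0| <= bump_radius j.
Proof.
move=> h; have r0 := ltW (bump_radius_gt0 j).
rewrite -(ler_sqr (x := `|_|)) ?nnegrE // real_normK ?num_real //.
by apply: le_trans h; have := coord_sqr_le (x - bump_center j) i; rewrite !mxE.
Qed.

Lemma compact_box m (a b : 'cV[R]_m) : compact [set x : 'cV[R]_m | forall i, a i 0 <= x i 0 <= b i 0].
Proof.
have cB := @rV_compact R m (fun i => `[a i 0, b i 0]%classic) (fun i => @segment_compact R (a i 0) (b i 0)).
have -> : [set x : 'cV[R]_m | forall i, a i 0 <= x i 0 <= b i 0] =
   [set x^T | x in [set v : 'rV[R]_m | forall i, `[a i 0, b i 0]%classic (v ord0 i)]].
  apply/seteqP; split => [x hx|_ [v hv <-] i] /=.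
    exists x^T; last by rewrite trmxK.
    by move=> i /=; rewrite in_itv mxE; exact: hx.
  by have := hv i; rewrite /= in_itv mxE.
apply: continuous_compact => //; apply: continuous_subspaceT => v.
apply: (@cvg_mx _ _ (nbhs v) (nbhs_filter v)) => i j.
by rewrite mxE; under eq_fun do rewrite mxE; exact: coord_continuous.
Qed.

Lemma continuous_sqdist (c : Rd) : continuous (fun x : Rd => dot (x - c) (x - c)).
Proof.
move=> x; rewrite /dot; apply: (@cvg_finsum _ _ (nbhs x) (nbhs_filter x)) => i.
have cx : (y - c) i 0 @[y --> x] --> (x - c) i 0.
  rewrite !mxE; under eq_fun do rewrite !mxE; apply: (@cvgB R R^o _ (nbhs x) (nbhs_filter x)).
    exact: coord_continuous.
  exact: cvg_cst.
by apply: (@cvgM R _ (nbhs x) (nbhs_filter x)).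
Qed.

Lemma test_bump j : test_function half (bump j).
Proof.
have r0 := bump_radius_gt0 j.
split; first by split; [exact: smooth_bump|exact: smooth_cst].
pose K : set Rd := [set x | sqdist j x <= bump_radius j ^+ 2].
have Kb x i : K x -> `|x i 0 - bump_center j i 0| <= bump_radius j by exact: bump_coord.
exists K; split.
- apply: (@subclosed_compact _ _ [set x : Rd | forall i, (bump_center j - const_mx (bump_radius j)) i 0 <= x i 0 <= (bump_center j + const_mx (bump_radius j)) i 0]).
  + apply: (@closed_comp _ _ (fun x : Rd => sqdist j x) [set y | y <= bump_radius j ^+ 2]).
      by move=> x _; exact: continuous_sqdist.
    exact: closed_le.
  + exact: compact_box.
  + by move=> x Kx i; have := Kb x i Kx; rewrite !mxE ler_distl.
- move=> x /(Kb x 0); rewrite energy_pt ler_distl => /andP[h _].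
  by rewrite /half_space /=; apply: lt_le_trans h; rewrite mulr2n mulrDl mul1r addrK.
- move=> x /negP; rewrite -ltNge => h; rewrite /bump /flat ifF //.
  by apply/negbTE; rewrite -leNgt mulN1r subr_le0 ltW.
Qed.

Lemma bump_gt0 j x : sqdist j x < bump_radius j ^+ 2 ->
  0 < Re (bump j x).
Proof.
by move=> h; rewrite /bump /= /flat mulN1r subr_gt0 h mulr_gt0 ?expR_gt0 // exprn_gt0.
Qed.

Lemma bump_ge0 j x : 0 <= Re (bump j x).
Proof. exact: flat_ge0. Qed.

Lemma bump_integral_neq0 j (k : Rd -> C) : cintegrable leb (fun x => bump j x * k x) ->
  (forall x, sqdist j x <= bump_radius j ^+ 2 -> 0 < Re (k x)) ->
  cintegral leb (fun x => bump j x * k x) != 0.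
Proof.
move=> [ir _] kpos; apply/eqP => /(congr1 (@complex.Re _)) /= I0.
pose U : set Rd := [set x | sqdist j x < bump_radius j ^+ 2].
have oU : open U.
  apply: (@open_comp _ _ (fun x : Rd => sqdist j x) [set y | y < bump_radius j ^+ 2]).
    by move=> x _; exact: continuous_sqdist.
  exact: open_lt.
have ReE x : Re (bump j x * k x) = Re (bump j x) * Re (k x) by rewrite cReM /= mul0r subr0.
have ge0 x : 0 <= Re (bump j x * k x).
  have [h|h] := leP (sqdist j x) (bump_radius j ^+ 2).
    by rewrite ReE mulr_ge0 ?bump_ge0 // ltW // kpos.
  by rewrite ReE /bump /= /flat ifF ?mul0r // mulN1r; apply/negbTE; rewrite -leNgt subr_le0 ltW.
have gtU x : U x -> 0 < Re (bump j x * k x).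
  by move=> Ux; rewrite ReE mulr_gt0 ?bump_gt0 // kpos // ltW.
have J0 : (\int[leb]_x `|(Re (bump j x * k x))%:E| = 0)%E.
  under eq_integral => x _ do rewrite gee0_abs ?lee_fin ?ge0 //.
  have fin := integrable_fin_num measurableT ir.
  by rewrite -(fineK fin) -[fine _]/(Rintegral leb setT (fun x => Re (bump j x * k x))) I0.
have /(ae_eq_integral_abs leb measurableT (measurable_int _ ir)) := J0.
move=> [N [mN N0 sN]].
have U0 : (0 < leb U)%E.
  apply: (@leb_open_gt0 _ (bump_center j)) => //.
  by rewrite /U /= subrr dot0l exprn_gt0 // bump_radius_gt0.
move: U0; rewrite ltNge => /negP; apply; rewrite -N0; apply: le_measure; rewrite ?inE //.
  exact: open_measurable_cV.
move=> x Ux; apply: sN => /= /(_ Logic.I) [] h.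
by have := gtU x Ux; rewrite h ltxx.
Qed.

Lemma bump_cos (q : Rd) : exists j, forall x,
  sqdist j x <= bump_radius j ^+ 2 -> 0 < cos (dot x q).
Proof.
pose s : R := \sum_i `|q i 0|; have s0 : 0 <= s by apply: sumr_ge0.
have s6 : 0 <= 6 * s by rewrite mulr_ge0.
exists (Num.truncn (6 * s)) => x hx; set j := Num.truncn _ in hx *.
have r0 := bump_radius_gt0 j.
have xi i : `|x i 0| <= 3 * bump_radius j.
  have h := bump_coord i hx.
  have ci : `|bump_center j i 0| <= 2 * bump_radius j.
    rewrite /bump_center; have [k ->|k ->] := split_ordP (i : 'I_(1 + n)).
      by rewrite pt_time ger0_norm // mulr_ge0 // ltW.
    by rewrite pt_space mxE normr0 mulr_ge0 // ltW.
  rewrite -[x i 0](subrK (bump_center j i 0)); apply: le_trans (ler_normD _ _) _.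
  by apply: le_trans (lerD h ci) _; rewrite -[X in X + _]mul1r -mulrDl.
have : `|dot x q| <= 2^-1.
  apply: (@le_trans _ _ (3 * bump_radius j * s)).
    apply: le_trans (ler_norm_sum _ _ _) _; rewrite mulr_sumr; apply: ler_sum => i _.
    by rewrite normrM ler_wpM2r.
  have /andP[_ h] := truncn_itv s6.
  rewrite mulrAC /bump_radius ler_pdivrMr ?ltr0n //.
  have h' : 6 * s <= j.+1%:R by rewrite ltW.
  by move: h'; set J := j.+1%:R => h'; lra.
move=> h; apply: cos_gt0_pihalf; rewrite -ltr_norml; apply: le_lt_trans h _.
by apply: lt_le_trans (@pihalf_ge1 R); rewrite invf_lt1 // ltr1n.
Qed.

End bump_functions.

Section translations_and_axes.
Variables (R : realType) (n : nat).
Local Notation Rd := 'cV[R]_n.+1.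

Lemma test_translate (O O' : set Rd) (a : Rd) phi : (forall x, O x -> O' (x + a)) ->
  test_function O phi -> test_function O' (fun y => phi (y - a)).
Proof.
move=> OO' tphi; rewrite (_ : (fun y => _) = (fun y => phi (1%:M *m y + (- a)))).
  apply: (test_affine (B := 1%:M) _ _ tphi); first by rewrite mulmx1.
  by move=> x Ox; rewrite mul1mx opprK; exact: OO'.
by apply/funext => y; rewrite mul1mx.
Qed.

Definition axis (i : 'I_n.+1) (c : R) : Rd := c *: delta_mx i 0.

Lemma dot_axis i c (p : Rd) : dot (axis i c) p = c * p i 0.
Proof.
rewrite /axis dotZl; congr (_ * _); rewrite /dot (bigD1 i) //= big1 ?addr0 => [|j ji].
  by rewrite mxE !eqxx mul1r.
by rewrite mxE (negbTE ji) mul0r.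
Qed.

End translations_and_axes.

Section density.
Variables (R : realType) (n : nat) (rho : {measure set R -> \bar R}).
Hypothesis nu_tempered : tempered_measure (nu n rho).
Local Notation Rd := 'cV[R]_n.+1.
Local Notation X := (R * Rd)%type.
Local Notation C := R[i].
Local Notation mu := (mu n rho).
Local Notation zeta := (zeta n rho).
Local Notation nu := (nu n rho).
Local Notation E := (E_space n rho).
Local Notation half := (@half_space R n).

Let EP : prehilbert E := L2_prehilbert zeta.
Let NP := L2_prehilbert nu.
Let MP := L2_prehilbert mu.

Definition fourier_tests : set (Rd -> C^o) := [set fourier phi | phi in test_function setT].

Definition laplace_tests : set (Rd -> C^o) := [set laplace phi | phi in test_function half].

Lemma fourier_tests_L2 : fourier_tests `<=` hdom (L2 nu).
Proof. by move=> _ [phi tphi <-]; apply: fourier_L2 => //; exact: test_schwartz tphi. Qed.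

Lemma laplace_tests_L2 : laplace_tests `<=` hdom (L2 mu).
Proof. by move=> _ [phi tphi <-]; exact: laplace_L2. Qed.

(** Translating a test function multiplies its transform by a character, so the
    closed span is stable under all characters, hence under all indicators. *)
Lemma fourier_tests_dense f : hdom (L2 nu) f -> closed_span (L2 nu) fourier_tests f.
Proof.
have Scl := closed_span_closed NP fourier_tests.
have me a : multiplier (closed_span (L2 nu) fourier_tests) (fun p => expi (dot a p)).
  apply: (@span_multiplier _ _ _ nu fourier_tests _ 1) => //.
  - exact: fourier_tests_L2.
  - by apply: cmeasurable_expi; exact: measurable_dotr.
  - by move=> p; rewrite cmod_expi.
  move=> _ [phi tphi <-]; apply: (sub_closed_span fourier_tests_L2).
  exists (fun y => phi (y - (- a))); first exact: (@test_translate R n setT setT).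
  apply/funext => p; under [LHS]eq_cintegral => x do rewrite opprK.
  by apply: fourier_translate; apply: schwartz_integrable; exact: test_schwartz tphi.
have good A : measurable A -> good_set (closed_span (L2 nu) fourier_tests) A.
  apply: (cV_sigma_algebra_min (good_sigma_algebra Scl)) => i a.
  apply: (good_set_gt Scl) => k; apply: (sin_multiplier Scl).
    have := multiplierM (multiplier_cst Scl (expi (- (a / k.+1%:R)))) (me (axis i k.+1%:R^-1)).
    congr (multiplier _ _); apply/funext => p; rewrite dot_axis -expiD; congr expi.
    by rewrite mulrBl addrC mulrC.
  have := multiplierM (multiplier_cst Scl (expi (a / k.+1%:R))) (me (axis i (- k.+1%:R^-1))).
  congr (multiplier _ _); apply/funext => p; rewrite dot_axis -expiD; congr expi.
  by rewrite mulrBl opprB mulNr [_ * p _ _]mulrC.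
apply: (multipliers_dense Scl good (w := fun j => fourier (@bump R n j))).
  move=> j; apply: (sub_closed_span fourier_tests_L2); exists (bump j) => //.
  by apply: (test_sub _ (test_bump R n j)) => x.
apply: aeW => p; have [j hj] := bump_cos p; exists j.
apply: bump_integral_neq0; last by move=> x /hj; rewrite /= cosN.
by apply: integrable_kernel; apply: schwartz_integrable; exact: test_schwartz (test_bump R n j).
Qed.

(** As for [fourier_tests_dense], except that only translations into the future
    preserve the half space: they supply the multipliers [exp (- s p_0)], which
    separate the energies. *)
Lemma laplace_tests_dense f : hdom (L2 mu) f -> closed_span (L2 mu) laplace_tests f.
Proof.
have Scl := closed_span_closed MP laplace_tests.
have mi i (a : R) : cmeasurable (fun p => (\1_[set x : Rd | a < x i 0] p : R)%:C).
  apply: cmeasurable_real; apply: measurable_indic.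
  rewrite [X in measurable X](_ : _ = (fun x : Rd => x i 0) @^-1` `]a, +oo[).
    by rewrite -[X in measurable X]setTI; exact: measurable_coord.
  by apply/seteqP; split => x /=; rewrite in_itv /= andbT.
have bi i (a : R) : exists K, forall p, cmod (\1_[set x : Rd | a < x i 0] p : R)%:C <= K.
  by exists 1 => p; rewrite cmodR ger0_norm // indicE lern1 leq_b1.
have me (a : Rd) : 0 <= a 0 0 -> multiplier (closed_span (L2 mu) laplace_tests) (fun p => laplace_kernel a p).
  move=> a0; apply: (@span_multiplier _ _ _ mu laplace_tests _ 1) => //.
  - exact: laplace_tests_L2.
  - exact: laplace_kernel_meas.
  - by move=> p; exact: laplace_kernel_le1.
  move=> _ [phi tphi <-]; apply: (sub_closed_span laplace_tests_L2).
  exists (fun y => phi (y - a)).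
    apply: (@test_translate R n half half) => // x; rewrite /half_space /= mxE => x0.
    by rewrite ltr_pwDl.
  have sc := test_schwartz tphi; have fi := schwartz_integrable sc.
  by apply/funext => p; apply: laplace_translate => //; [exact: cintegrable_meas fi|exact: test_supported].
have good A : measurable A -> good_set (closed_span (L2 mu) laplace_tests) A.
  apply: (cV_sigma_algebra_min (good_sigma_algebra Scl)) => i a.
  have [j ij|j ij] := split_ordP (i : 'I_(1 + n)); last first.
    have axis0 c : @axis R n i c 0 0 = 0.
      rewrite /axis !mxE (_ : (0 : 'I_n.+1) == i = false) ?mulr0 //=.
      by apply/negbTE; rewrite ij -val_eqE.
    have axisE c p : laplace_kernel (@axis R n i c) p = expi (- (c * p i 0)).
      rewrite /laplace_kernel axis0 mul0r oppr0 expR0 mul1r; congr (expi (- _)).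
      by have := @dot_axis R n i c p; rewrite dot_split axis0 mul0r add0r.
    apply: (good_set_gt Scl) => k; apply: (sin_multiplier Scl).
      have h : 0 <= @axis R n i (- k.+1%:R^-1) 0 0 by rewrite axis0.
      have := multiplierM (multiplier_cst Scl (expi (- (a / k.+1%:R)))) (me _ h).
      congr (multiplier _ _); apply/funext => p; rewrite axisE -expiD; congr expi.
      by rewrite mulrBl mulNr opprK addrC [_ * p _ _]mulrC.
    have h : 0 <= @axis R n i k.+1%:R^-1 0 0 by rewrite axis0.
    have := multiplierM (multiplier_cst Scl (expi (a / k.+1%:R))) (me _ h).
    congr (multiplier _ _); apply/funext => p; rewrite axisE -expiD; congr expi.
    by rewrite mulrBl opprB [_ * p _ _]mulrC.
  have i0 : i = 0 by apply/val_inj; rewrite ij /=; have := ltn_ord j; case: (val j).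
  have [a0|a0] := leP 0 a; last first.
    apply: (multiplier_ae Scl (good_setT Scl) (mi i a) (bi i a)).
    apply: filterS (energy_gt0_ae n rho) => p p0.
    by rewrite !indicE in_setT mem_set //= i0 (lt_trans a0 p0).
  pose r (p : Rd) : R := expR (- a) - expR (- `|p 0 0|).
  have gr : good_set (closed_span (L2 mu) laplace_tests) [set p | 0 < r p].
    apply: (good_set_gt0 Scl) => [p|].
      rewrite /r ler_norml; have := expR_ge0 (- a); have := expR_ge0 (- `|p 0 0|).
      have : expR (- a) <= 1 by rewrite -expR0 ler_expR oppr_le0.
      have : expR (- `|p 0 0|) <= 1 by rewrite -expR0 ler_expR oppr_le0.
      set x := expR _; set y := expR _ => x1 y1 x0 y0.
      by apply/andP; split; lra.
    have h : 0 <= (pt 1 0 : Rd) 0 0 by rewrite energy_pt.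
    have := multiplierB Scl (multiplier_cst Scl (expR (- a))%:C) (me _ h).
    congr (multiplier _ _); apply/funext => p; rewrite /laplace_kernel energy_pt mul1r vecpart_pt dot0l oppr0 expi0 mulr1.
    by rewrite /r rmorphB.
  apply: (multiplier_ae Scl gr (mi i a) (bi i a)).
  apply: filterS (energy_gt0_ae n rho) => p p0; congr (_%:C); rewrite !indicE; congr (_%:R).
  congr nat_of_bool; apply/idP/idP; rewrite !inE /= /r subr_gt0 ltr_expR ltrN2 i0 ger0_norm // ltW //.
apply: (multipliers_dense Scl good (w := fun j => laplace (@bump R n j))).
  by move=> j; apply: (sub_closed_span laplace_tests_L2); exists (bump j) => //; exact: test_bump.
apply: aeW => p; have [j hj] := bump_cos (pt 0 (vecpart p)); exists j.
have tb := test_bump R n j.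
apply: bump_integral_neq0.
  by apply: integrable_laplace; [exact: test_supported tb|apply: schwartz_integrable; exact: test_schwartz tb].
move=> x /hj; rewrite dot_split energy_pt mulr0 add0r vecpart_pt => c0.
by rewrite /laplace_kernel cReM /= mul0r subr0 cosN mulr_gt0 ?expR_gt0.
Qed.

Lemma F_space_closed : closed_subspace E (F_space rho).
Proof. exact: closed_span_closed EP _. Qed.

Lemma F_plus_closed : closed_subspace E (F_plus rho).
Proof. exact: closed_span_closed EP _. Qed.

Lemma small_eq0 (x : R) : 0 <= x -> (forall e, 0 < e -> x <= e) -> x = 0.
Proof.
move=> x0 h; apply/eqP; rewrite eq_le x0 andbT; apply/ler_addgt0Pr => e e0.
by rewrite add0r; exact: h.
Qed.

Lemma pullback_F f : hdom (L2 nu) f -> F_space rho (pullback f).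
Proof.
move=> fL; apply: (closed_span_map NP (T := fun f : Rd -> C^o => pullback f : X -> C^o) (M := 1)
  _ _ _ F_space_closed fourier_tests_L2 _ (fourier_tests_dense fL)) => //.
- by move=> g; exact: pullback_L2.
- by move=> g gL; rewrite mul1r pullback_norm.
move=> _ [phi tphi <-]; rewrite -integrated_repE; apply: sub_closed_span; last by exists phi.
by move=> _ [psi tpsi <-]; apply: orbit_E => //; exact: test_schwartz tpsi.
Qed.

End density.

(** * Isometric extension to a completion *)

Section null_sequences.
Variable R : realType.
Implicit Types (x y z : nat -> R).

Lemma cvg0_le x z : (forall k, 0 <= z k <= x k) -> x k @[k --> \oo] --> (0 : R) ->
  z k @[k --> \oo] --> (0 : R).
Proof.
move=> zx x0; apply: (@squeeze_cvgr _ _ _ _ (fun=> 0) x) => //; last exact: cvg_cst.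
by apply: nearW => k; exact: zx.
Qed.

Lemma cvg0_eq x z : (forall k, x k = z k) -> x k @[k --> \oo] --> (0 : R) ->
  z k @[k --> \oo] --> (0 : R).
Proof. by move=> xz; rewrite (_ : (fun k => z k) = (fun k => x k)) //; apply/funext => k. Qed.

Lemma cvg0D x y : x k @[k --> \oo] --> (0 : R) -> y k @[k --> \oo] --> (0 : R) ->
  (x k + y k) @[k --> \oo] --> (0 : R).
Proof. by move=> x0 y0; rewrite -[X in _ --> X](addr0 (0 : R)); exact: cvgD. Qed.

Lemma cvg0M x y (l : R) : x k @[k --> \oo] --> (0 : R) -> y k @[k --> \oo] --> l ->
  (x k * y k) @[k --> \oo] --> (0 : R).
Proof. by move=> x0 yl; rewrite -(mul0r l); exact: cvgM. Qed.

Lemma cst_cvg0 x (c : R) : 0 <= c -> (forall k, c <= x k) -> x k @[k --> \oo] --> (0 : R) -> c = 0.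
Proof.
move=> c0 cx x0; apply/eqP; rewrite eq_le c0 andbT.
by apply: (ler_cvg_to (cvg_cst c) x0); apply: nearW.
Qed.

End null_sequences.

Section cauchy_sequences.
Variables (R : realType) (V : lmodType R[i]) (H : hspace V).
Hypothesis HP : prehilbert H.

Lemma cauchy_near (us vs : nat -> V) : cauchy_seqs H us -> (forall k, hdom H (vs k)) ->
  hnorm H (us k - vs k) @[k --> \oo] --> (0 : R) -> cauchy_seqs H vs.
Proof.
move=> [uH uC] vH uv; split => // e e0; have e3 : 0 < e / 3 by rewrite divr_gt0.
have [N HN] := uC _ e3; move/cvgrPdist_lt: uv => /(_ _ e3) [N' _ HN'].
have close k : (N' <= k)%N -> hnorm H (us k - vs k) < e / 3.
  by move=> /HN'; rewrite /= sub0r normrN ger0_norm // hnorm_ge0.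
exists (maxn N N') => j k; rewrite !geq_max => /andP[Nj Nj'] /andP[Nk Nk'].
apply: le_lt_trans (hnorm_tri HP (vH j) (uH j) (vH k)) _.
apply: (@le_lt_trans _ _ (hnorm H (us j - vs j) + (hnorm H (us j - us k) + hnorm H (us k - vs k)))).
  by rewrite (hnormBC HP (vH j) (uH j)) lerD2l; exact: hnorm_tri.
have := close j Nj'; have := close k Nk'; have := HN j k Nj Nk.
by set x := hnorm H _; set y := hnorm H _; set z := hnorm H _ => ? ? ?; lra.
Qed.

Lemma cauchy_cvg (us : nat -> V) v : hdom H v -> (forall k, hdom H (us k)) ->
  hnorm H (v - us k) @[k --> \oo] --> (0 : R) -> cauchy_seqs H us.
Proof.
move=> vH uH; apply: cauchy_near => //; split => // e e0; exists 0%N => j k _ _.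
by rewrite subrr hnorm0.
Qed.

End cauchy_sequences.

(** Two parametrizations [a] and [b] of dense subspaces with the same Gram
    matrix identify the completion of the first space with the second. *)
Section isometric_extension.
Variables (R : realType) (P V W : lmodType R[i]) (H : hspace V) (K : hspace W).
Hypotheses (HP : prehilbert H) (KP : prehilbert K).
Local Notation C := R[i].
Local Notation nH := (hnorm H).
Local Notation nK := (hnorm K).
Variables (S : set P) (a : P -> V) (b : P -> W).
Hypothesis Slin : linear_subspace S.
Hypothesis a_linear : forall (c : C) x y, S x -> S y -> a (c *: x + y) = c *: a x + a y.
Hypothesis b_linear : forall (c : C) x y, S x -> S y -> b (c *: x + y) = c *: b x + b y.
Hypothesis aH : forall x, S x -> hdom H (a x).
Hypothesis bK : forall x, S x -> hdom K (b x).
Hypothesis ab_form : forall x y, S x -> S y -> hform H (a x) (a y) = hform K (b x) (b y).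
Hypothesis a_dense : forall v, hdom H v -> forall e, 0 < e -> exists2 x, S x & nH (v - a x) < e.
Hypothesis b_dense : forall w, hdom K w -> forall e, 0 < e -> exists2 x, S x & nK (w - b x) < e.
Hypothesis K_complete : forall ws, cauchy_seqs K ws ->
  exists2 w, hdom K w & nK (ws k - w) @[k --> \oo] --> (0 : R).

(** Elements of the completion are Cauchy sequences; [u] and [f] correspond when
    one sequence of parameters approximates both. *)
Definition represents (u : nat -> V) (f : W) : Prop :=
  [/\ forall k, hdom H (u k), hdom K f & exists xs : nat -> P,
    [/\ forall k, S (xs k), nH (u k - a (xs k)) @[k --> \oo] --> (0 : R) &
        nK (f - b (xs k)) @[k --> \oo] --> (0 : R)]].

Lemma ab_dist x y : S x -> S y -> nH (a x - a y) = nK (b x - b y).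
Proof.
move=> Sx Sy; have Sxy : S (x - y) by exact: (subspaceB Slin).
have -> : a x - a y = a (x - y) by rewrite addrC -scaleN1r -a_linear // scaleN1r addrC.
have -> : b x - b y = b (x - y) by rewrite addrC -scaleN1r -b_linear // scaleN1r addrC.
by rewrite /hnorm ab_form.
Qed.

Lemma ab_norm x : S x -> nH (a x) = nK (b x).
Proof. by move=> Sx; rewrite /hnorm ab_form. Qed.

Lemma approx_seq (U : lmodType C) (L : hspace U) (c : P -> U) (us : nat -> U) :
  (forall k, exists2 x, S x & hnorm L (us k - c x) < k.+1%:R^-1) ->
  exists2 xs : nat -> P, forall k, S (xs k) & hnorm L (us k - c (xs k)) @[k --> \oo] --> (0 : R).
Proof.
move=> h; have {}h k : exists x, S x /\ hnorm L (us k - c x) < k.+1%:R^-1.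
  by have [x Sx ux] := h k; exists x.
have [xs xsP] := choice h; exists xs => [k|]; first by case: (xsP k).
apply: (@cvg0_le _ (fun k => k.+1%:R^-1)) => [k|]; last exact: cvg_harmonic.
by rewrite hnorm_ge0 ltW //; case: (xsP k).
Qed.

Let invS_gt0 k : 0 < k.+1%:R^-1 :> R. Proof. by rewrite invr_gt0 ltr0n. Qed.

Lemma represents_cauchy u f : represents u f -> hdom (completion H) u.
Proof.
move=> [uH fK [xs [Sxs ux fx]]].
have axC : cauchy_seqs H (fun k => a (xs k)).
  have [_ bC] : cauchy_seqs K (fun k => b (xs k)).
    by apply: (cauchy_cvg KP fK) => // k; exact: bK.
  split => [k|e e0]; first exact: aH.
  by have [N HN] := bC e e0; exists N => j k Nj Nk; rewrite ab_dist //; exact: HN.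
apply: (cauchy_near HP axC uH); apply: (cvg0_eq _ ux) => k; apply: (hnormBC HP) => //; exact: aH.
Qed.

Lemma represents_exists u : hdom (completion H) u -> exists f, represents u f.
Proof.
move=> uC; have [uH _] := uC.
have [xs Sxs ux] := approx_seq (fun k => a_dense (uH k) (invS_gt0 k)).
have [_ aC] : cauchy_seqs H (fun k => a (xs k)).
  by apply: (cauchy_near HP uC) => // k; exact: aH.
have bC : cauchy_seqs K (fun k => b (xs k)).
  split => [k|e e0]; first exact: bK.
  by have [N HN] := aC e e0; exists N => j k Nj Nk; rewrite -ab_dist //; exact: HN.
have [f fK bf] := K_complete bC; exists f; split => //; exists xs; split => //.
apply: (cvg0_eq _ bf) => k; apply: (hnormBC KP) => //; exact: bK.
Qed.

Lemma represents_unique u f g : represents u f -> represents u g -> heq K f g.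
Proof.
move=> [uH fK [xs [Sxs ux fx]]] [_ gK [ys [Sys uy gy]]].
apply: (cst_cvg0 (x := fun k => nK (f - b (xs k)) + (nH (u k - a (xs k)) + (nH (u k - a (ys k)) + nK (g - b (ys k)))))).
- exact: hnorm_ge0.
- move=> k; have bx := bK (Sxs k); have yb := bK (Sys k).
  apply: le_trans (hnorm_tri KP fK bx gK) _; rewrite lerD2l.
  apply: le_trans (hnorm_tri KP bx yb gK) _; rewrite addrA (hnormBC KP yb gK) lerD2r.
  rewrite -ab_dist //; have ax := aH (Sxs k); have ay := aH (Sys k).
  by apply: le_trans (hnorm_tri HP ax (uH k) ay) _; rewrite (hnormBC HP ax (uH k)).
- by apply: cvg0D => //; apply: cvg0D => //; exact: cvg0D.
Qed.

Lemma represents_linear (c : C) u v f g : represents u f -> represents v g ->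
  represents (c *: u + v) (c *: f + g).
Proof.
move=> [uH fK [xs [Sxs ux fx]]] [vH gK [ys [Sys vy gy]]].
have dH k := hdomD HP (hdomZ HP c (uH k)) (vH k).
have dK := hdomD KP (hdomZ KP c fK) gK.
have dS k : S (c *: xs k + ys k) by case: Slin => _; apply.
have cvgs (x y : nat -> R) : x k @[k --> \oo] --> (0 : R) -> y k @[k --> \oo] --> (0 : R) ->
    (cmod c * x k + y k) @[k --> \oo] --> (0 : R).
  move=> x0 y0; apply: cvg0D => //; under eq_fun do rewrite mulrC.
  by apply: (cvg0M x0); exact: cvg_cst.
have bound (U : lmodType C) (L : hspace U) (LP : prehilbert L) (p q p' q' : U) :
    hdom L p -> hdom L q -> hdom L p' -> hdom L q' ->
    hnorm L ((c *: p + q) - (c *: p' + q')) <= cmod c * hnorm L (p - p') + hnorm L (q - q').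
  move=> pL qL pL' qL'; rewrite opprD addrACA -scalerBr.
  have d1 := hdomB LP pL pL'; have d2 := hdomB LP qL qL'.
  by rewrite -(hnormZ LP c d1); exact: (hnormD LP (hdomZ LP c d1) d2).
split => //; exists (fun k => c *: xs k + ys k); split => //.
- apply: cvg0_le (cvgs _ _ ux vy) => k; rewrite hnorm_ge0 /= a_linear //.
  by apply: bound => //; exact: aH.
- apply: cvg0_le (cvgs _ _ fx gy) => k; rewrite hnorm_ge0 /= b_linear //.
  by apply: bound => //; exact: bK.
Qed.

Lemma represents_form u v f g : represents u f -> represents v g ->
  hform (completion H) u v = hform K f g.
Proof.
move=> [uH fK [xs [Sxs ux fx]]] [vH gK [ys [Sys vy gy]]].
have sw h zs : hdom K h -> (forall k, S (zs k)) -> nK (h - b (zs k)) @[k --> \oo] --> (0 : R) ->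
    nK (b (zs k) - h) @[k --> \oo] --> (0 : R).
  move=> hK Szs; apply: cvg0_eq => k; apply: (hnormBC KP) => //; exact: bK.
have bcv := hform_cvg KP fK gK (fun k => bK (Sxs k)) (fun k => bK (Sys k)) (sw _ _ fK Sxs fx) (sw _ _ gK Sys gy).
have cv : cmod (hform H (u k) (v k) - hform K f g) @[k --> \oo] --> (0 : R).
  have pcv : (nH (u k - a (xs k)) * (nH (v k - a (ys k)) + (nK g + nK (g - b (ys k)))) +
      nH (v k - a (ys k)) * (nK f + nK (f - b (xs k))) +
      cmod (hform K (b (xs k)) (b (ys k)) - hform K f g)) @[k --> \oo] --> (0 : R).
    apply: cvg0D => //; apply: cvg0D.
      by apply: (cvg0M ux); apply: cvgD; [exact: vy|apply: cvgD; [exact: cvg_cst|exact: gy]].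
    by apply: (cvg0M vy); apply: cvgD; [exact: cvg_cst|exact: fx].
  apply: cvg0_le pcv => k; rewrite cmod_ge0 /=.
  have ax := aH (Sxs k); have ay := aH (Sys k); have bx := bK (Sxs k); have yb := bK (Sys k).
  rewrite -[hform H _ _](subrK (hform H (a (xs k)) (a (ys k)))) -addrA.
  apply: le_trans (cmodD _ _) _; rewrite ab_form // lerD2r -ab_form //.
  apply: le_trans (hform_perturb HP (uH k) (vH k) ax ay) _; apply: lerD.
    rewrite ler_wpM2l ?hnorm_ge0 //; apply: le_trans (hnorm_sub HP (vH k) ay) _.
    by rewrite lerD2l ab_norm // addrC (hnormBC KP gK yb); exact: hnorm_sub.
  rewrite mulrC ler_wpM2l ?hnorm_ge0 // ab_norm // addrC (hnormBC KP fK bx).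
  exact: hnorm_sub.
apply: complex_eqP; rewrite /completion /=; apply: cvg_lim => //.
  exact: (cmod_cvg_Re cv).
exact: (cmod_cvg_Im cv).
Qed.

Lemma represents_onto f : hdom K f -> exists u, represents u f.
Proof.
move=> fK; have [xs Sxs fx] := approx_seq (us := fun=> f) (fun k => b_dense fK (invS_gt0 k)).
exists (fun k => a (xs k)); split => //; first by move=> k; exact: aH.
exists xs; split => //; rewrite (_ : (fun k => _) = (fun=> 0)); first exact: cvg_cst.
by apply/funext => k; rewrite subrr hnorm0.
Qed.

(** An operator which acts on the parameters, contracting both distances to the
    parametrized vectors, acts compatibly on both sides. *)
Lemma represents_transport u f u' f' (m : P -> P) : represents u f ->
  (forall k, hdom H (u' k)) -> hdom K f' -> (forall x, S x -> S (m x)) ->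
  (forall k x, S x -> nH (u' k - a (m x)) <= nH (u k - a x)) ->
  (forall x, S x -> nK (f' - b (m x)) <= nK (f - b x)) -> represents u' f'.
Proof.
move=> [uH fK [xs [Sxs ux fx]]] uH' fK' mS mH mK; split => //.
exists (fun k => m (xs k)); split => [k|//|]; first exact: mS.
  by apply: cvg0_le ux => k; rewrite hnorm_ge0 mH.
by apply: cvg0_le fx => k; rewrite hnorm_ge0 mK.
Qed.

Definition extension (u : nat -> V) : W := xget 0 [set f | represents u f].

Lemma extensionP u : hdom (completion H) u -> represents u (extension u).
Proof. by move=> /represents_exists[f uf]; exact: (@xgetI _ _ _ f). Qed.

Lemma extension_represents u f : represents u f -> heq K (extension u) f.
Proof.
by move=> uf; exact: represents_unique (extensionP (represents_cauchy uf)) uf.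
Qed.

Lemma extension_unitary : unitary (completion H) K extension.
Proof.
split.
- split => [u /extensionP[]//|c u v /extensionP uf /extensionP vg].
  by apply: extension_represents; exact: represents_linear.
- by move=> u v /extensionP uf /extensionP vg; rewrite -(represents_form uf vg).
- move=> f /represents_onto[u uf]; exists u; first exact: represents_cauchy uf.
  exact: extension_represents.
Qed.

End isometric_extension.

(** * The identification of the completion *)

Section translation_operators.
Variables (R : realType) (n : nat) (rho : {measure set R -> \bar R}).
Local Notation Rd := 'cV[R]_n.+1.
Local Notation X := (R * Rd)%type.
Local Notation C := R[i].
Local Notation mu := (mu n rho).
Local Notation nu := (nu n rho).
Local Notation E := (E_space n rho).

Lemma phase_meas_cV (a : Rd) : cmeasurable (fun p : Rd => expi (- dot a p)).
Proof. by apply: cmeasurable_expi; apply: measurable_funN; exact: measurable_dotr. Qed.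

Let phase_meas (a : Rd) : cmeasurable (fun z : X => expi (- dot a (proj_p0 z))).
Proof. exact: (cmeasurable_comp (phase_meas_cV a) (@measurable_proj R n)). Qed.

Lemma rep_E_hdom a v : hdom E v -> hdom E (rep_E a v).
Proof.
exact: (L2_weighted_composition (@measurable_id _ _ setT) (fun A _ => erefl) (phase_meas a) (fun x => cmod_expi _)).
Qed.

Lemma rep_E_form a v w : hdom E v -> hdom E w -> hform E (rep_E a v) (rep_E a w) = hform E v w.
Proof.
exact: (form_weighted_composition (@measurable_id _ _ setT) (fun A _ => erefl) (fun x => cmod_expi _)).
Qed.

Lemma rep_E_norm a v : hdom E v -> hnorm E (rep_E a v) = hnorm E v.
Proof. by move=> vE; rewrite /hnorm rep_E_form. Qed.

Lemma rep_E_linear a (c : C) (u v : X -> C^o) : rep_E a (c *: u + v) = c *: rep_E a u + rep_E a v.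
Proof. by apply/funext => z; rewrite /rep_E mulrDr; congr (_ + _); rewrite mulrCA. Qed.

Lemma rep_EB a (u v : X -> C^o) : rep_E a (u - v) = rep_E a u - rep_E a v.
Proof. by apply/funext => z; rewrite /rep_E mulrBr. Qed.

Lemma rep_ED a b (v : X -> C^o) : rep_E (a + b) v = rep_E a (rep_E b v).
Proof. by apply/funext => z; rewrite /rep_E dotDl opprD expiD mulrA. Qed.

Lemma rep_E0 (v : X -> C^o) : rep_E 0 v = v.
Proof. by apply/funext => z; rewrite /rep_E dot0l oppr0 expi0 mul1r. Qed.

Lemma rep_E_pullback a f : rep_E a (pullback f) = pullback (fun p => expi (- dot a p) * f p) :> (X -> C^o).
Proof. by []. Qed.

Section preserved_measure.
Variable m : {measure set Rd -> \bar R}.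
Variable g : Rd * 'M[R]_n.+1.
Hypothesis m_g : forall A, measurable A -> m ((fun p => invmx g.2 *m p) @^-1` A) = m A.

Lemma natural_rep_hdom f : hdom (L2 m) f -> hdom (L2 m) (natural_rep g f).
Proof.
exact: (L2_weighted_composition (measurable_cV_mulmx _) m_g (phase_meas_cV g.1) (fun x => cmod_expi _)).
Qed.

Lemma natural_rep_form f f' : hdom (L2 m) f -> hdom (L2 m) f' ->
  hform (L2 m) (natural_rep g f) (natural_rep g f') = hform (L2 m) f f'.
Proof.
exact: (form_weighted_composition (measurable_cV_mulmx _) m_g (fun x => cmod_expi _)).
Qed.

Lemma natural_rep_norm f : hdom (L2 m) f -> hnorm (L2 m) (natural_rep g f) = hnorm (L2 m) f.
Proof. by move=> fL; rewrite /hnorm natural_rep_form. Qed.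

End preserved_measure.

Lemma natural_rep_linear (g : Rd * 'M[R]_n.+1) (c : C) u v :
  natural_rep g (c *: u + v) = c *: natural_rep g u + natural_rep g v.
Proof. by apply/funext => z; rewrite /natural_rep mulrDr; congr (_ + _); rewrite mulrCA. Qed.

Lemma natural_repB (g : Rd * 'M[R]_n.+1) u v :
  natural_rep g (u - v) = natural_rep g u - natural_rep g v.
Proof. by apply/funext => z; rewrite /natural_rep mulrBr. Qed.

Lemma nu_motion (g : Rd * 'M[R]_n.+1) : mot_set g ->
  forall A, measurable A -> nu ((fun p => invmx g.2 *m p) @^-1` A) = nu A.
Proof. by move=> gO A mA; rewrite (orthogonal_inv gO); exact: (nu_orthogonal rho (orthogonalC gO) mA). Qed.

Lemma mu_motion (g : Rd * 'M[R]_n.+1) : mot_H g ->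
  forall A, measurable A -> mu ((fun p => invmx g.2 *m p) @^-1` A) = mu A.
Proof.
move=> gH A mA; have gO := mot_H_set gH; have [_ [k kO gE]] := gH.
have {}gE : g.2 = spatial_mx k := gE.
by rewrite (orthogonal_inv gO) gE spatial_tr; exact: (mu_spatial rho (orthogonalC kO) mA).
Qed.

End translation_operators.

Section reflected_space.
Variables (R : realType) (n : nat) (rho : {measure set R -> \bar R}).
Hypothesis nu_tempered : tempered_measure (nu n rho).
Local Notation Rd := 'cV[R]_n.+1.
Local Notation X := (R * Rd)%type.
Local Notation C := R[i].
Local Notation mu := (mu n rho).
Local Notation zeta := (zeta n rho).
Local Notation nu := (nu n rho).
Local Notation E := (E_space n rho).
Local Notation half := (@half_space R n).
Local Notation orbit phi := (integrated_rep phi (@one_E R n) : X -> C^o).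
Local Notation tests := (test_function half : set (Rd -> C^o)).

Let EP : prehilbert E := L2_prehilbert zeta.
Let MP := L2_prehilbert mu.

Lemma tests_linear (O : set Rd) : linear_subspace (test_function O : set (Rd -> C^o)).
Proof.
split; first exact: test_0.
by move=> a f g tf tg; apply: (test_D (f := fun x => a * f x)) => //; exact: test_Z.
Qed.

Lemma orbit_linear (c : C) phi psi : schwartz phi -> schwartz psi ->
  orbit (c *: (phi : Rd -> C^o) + (psi : Rd -> C^o)) = c *: orbit phi + orbit psi.
Proof.
move=> sphi spsi; rewrite !integrated_repE; apply/funext => z; rewrite /pullback.
by apply: fourier_linear; exact: schwartz_integrable.
Qed.

Lemma laplace_tests_linear (c : C) phi psi : tests phi -> tests psi ->
  laplace (c *: (phi : Rd -> C^o) + (psi : Rd -> C^o)) = c *: (laplace phi : Rd -> C^o) + (laplace psi : Rd -> C^o).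
Proof.
move=> tphi tpsi; apply/funext => p.
apply: laplace_linear; try exact: test_supported.
  by apply: schwartz_integrable; exact: test_schwartz tphi.
by apply: schwartz_integrable; exact: test_schwartz tpsi.
Qed.

Lemma fourier_images_linear O : linear_subspace [set (fourier phi : Rd -> C^o) | phi in test_function O].
Proof.
apply: (image_linear (tests_linear O)) => c phi psi tphi tpsi; apply/funext => p.
by apply: fourier_linear; apply: schwartz_integrable; [exact: test_schwartz tphi|exact: test_schwartz tpsi].
Qed.

Lemma orbits_E O : [set orbit phi | phi in test_function O] `<=` hdom E.
Proof. by move=> _ [phi tphi <-]; apply: orbit_E => //; exact: test_schwartz tphi. Qed.

Lemma orbits_linear O : linear_subspace [set orbit phi | phi in test_function O].
Proof.
apply: (image_linear (tests_linear O)) => c phi psi tphi tpsi.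
by apply: orbit_linear; [exact: test_schwartz tphi|exact: test_schwartz tpsi].
Qed.

Lemma orbit_seq O v : closed_span E [set orbit phi | phi in test_function O] v ->
  exists2 phis : nat -> Rd -> C, forall k, test_function O (phis k) &
  hnorm E (v - orbit (phis k)) @[k --> \oo] --> (0 : R).
Proof.
move=> /(closed_span_seq EP (orbits_linear O) (@orbits_E O))[w wA vw].
have h k : exists phi, test_function O phi /\ orbit phi = w k.
  by have [phi ? ?] := wA k; exists phi.
have [phis phisP] := choice h; exists phis => [k|]; first by case: (phisP k).
by apply: (cvg0_eq _ vw) => k; case: (phisP k) => _ ->.
Qed.

(** Pullback is isometric on [L^2(nu)], which is complete, so its image is
    closed. *)
Lemma F_spaceP v : F_space rho v <->
  hdom E v /\ exists2 f, hdom (L2 nu) f & heq E v (pullback f).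
Proof.
split=> [vF|[vE [f fL vf]]]; last first.
  exact: (closed_subspace_heq (@F_space_closed R n rho) vE (pullback_F nu_tempered fL) vf).
have vE : hdom E v by case: vF.
split=> //; have [phis tphis vphi] := orbit_seq vF.
have sc k := test_schwartz (tphis k).
have fsL k := fourier_L2 nu_tempered (sc k); have oE k := orbit_E nu_tempered (sc k).
have fsC : cauchy_seqs (L2 nu) (fun k => fourier (phis k)).
  have [_ oC] := cauchy_cvg EP vE oE vphi; split => [k|e e0]; first exact: fsL.
  have [N HN] := oC e e0; exists N => j k Nj Nk; have := HN j k Nj Nk.
  by have dL := hdomB (L2_prehilbert nu) (fsL j) (fsL k); rewrite !integrated_repE pullbackB pullback_norm.
have [f fL ff] := L2_complete fsC; exists f => //.
apply: (cst_cvg0 (x := fun k => hnorm E (v - orbit (phis k)) + hnorm (L2 nu) (fourier (phis k) - f))).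
- exact: hnorm_ge0.
- move=> k; apply: le_trans (hnorm_tri EP vE (oE k) (pullback_L2 fL)) _; rewrite lerD2l integrated_repE.
  by have dL := hdomB (L2_prehilbert nu) (fsL k) fL; rewrite pullbackB pullback_norm.
- exact: cvg0D.
Qed.

Lemma F_plus_orbit phi : tests phi -> F_plus rho (orbit phi).
Proof. by move=> tphi; apply: (sub_closed_span (@orbits_E half)); exists phi. Qed.

Lemma F_plus_seq v : F_plus rho v -> exists2 phis : nat -> Rd -> C, forall k, tests (phis k) &
  hnorm E (v - orbit (phis k)) @[k --> \oo] --> (0 : R).
Proof. exact: orbit_seq. Qed.

Lemma theta_linear (c : C) (u v : X -> C^o) : theta (c *: u + v) = c *: theta u + theta v.
Proof. by []. Qed.

Lemma theta_normB u v : hdom E u -> hdom E v -> hnorm E (theta u - theta v) = hnorm E (u - v).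
Proof.
move=> uE vE; have uvE := hdomB EP uE vE.
by have -> : theta u - theta v = theta (u - v) by []; rewrite theta_norm.
Qed.

Lemma F_plus_E v : F_plus rho v -> hdom E v. Proof. by case. Qed.

(** The elements of F_+ are limits of orbits of test functions, where the
    reflected form is the form of [L^2(mu)]. *)
Lemma reflection_positive v : F_plus rho v -> 0 <= hform E (theta v) v.
Proof.
move=> vF; have [phis tphis vphi] := F_plus_seq vF; have vE := F_plus_E vF.
have oE k := orbit_E nu_tempered (test_schwartz (tphis k)).
have sw : hnorm E (orbit (phis k) - v) @[k --> \oo] --> (0 : R).
  by apply: (cvg0_eq _ vphi) => k; apply: (hnormBC EP).
have tsw : hnorm E (theta (orbit (phis k)) - theta v) @[k --> \oo] --> (0 : R).
  by apply: (cvg0_eq _ sw) => k; exact: (esym (theta_normB (oE k) vE)).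
have cv := hform_cvg EP (theta_E vE) vE (fun k => theta_E (oE k)) oE tsw sw.
have pos k : 0 <= hform E (theta (orbit (phis k))) (orbit (phis k)).
  by rewrite reflected_form //; apply: (hform_ge0 MP); exact: laplace_L2.
apply/cge0P; split.
  apply: (cvg_unique _ (cmod_cvg_Im cv)) => //.
  by apply: (cvg0_eq _ (cvg_cst 0)) => k; have /cge0P[->] := pos k.
apply: (ler_cvg_to (cvg_cst 0) (cmod_cvg_Re cv)); apply: nearW => k.
by have /cge0P[] := pos k.
Qed.

(** Its completion is the space on which [identification] is defined; vectors of
    norm zero are allowed. *)
Definition theta_space : hspace (X -> C^o) :=
  HSpace (F_plus rho) (fun u v => hform E (theta u) v).

Lemma theta_formE u v : hform theta_space u v = hform E (theta u) v.
Proof. by []. Qed.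

Lemma theta_prehilbert : prehilbert theta_space.
Proof.
split => /=.
- by case: (@F_plus_closed R n rho).
- move=> a u v w /F_plus_E uE /F_plus_E vE /F_plus_E wE; rewrite theta_linear.
  by case: EP => _ lin _ _; exact: (lin a _ _ _ (theta_E uE) (theta_E vE) wE).
- move=> u v /F_plus_E uE /F_plus_E vE; have tuE := theta_E uE.
  rewrite -!/(hform E _ _) -[LHS](theta_form (theta_E vE) uE) thetaK.
  exact: (hform_conj EP tuE vE).
- exact: reflection_positive.
Qed.

Lemma theta_norm_le v : F_plus rho v -> hnorm theta_space v <= hnorm E v.
Proof.
move=> vF; have vE := F_plus_E vF; have tE := theta_E vE.
rewrite -(ler_sqr (x := hnorm _ _)) ?nnegrE ?hnorm_ge0 // (sqr_hnorm theta_prehilbert) // theta_formE.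
apply: le_trans (ler_norm _) _; apply: le_trans (Re_le_cmod _) _.
by apply: le_trans (hcauchy_schwarz EP tE vE) _; rewrite theta_norm // expr2.
Qed.

Lemma F_plusB (u v : X -> C^o) : F_plus rho u -> F_plus rho v -> F_plus rho (u - v).
Proof. by have [_ /subspaceB + _] := @F_plus_closed R n rho; exact. Qed.

Lemma theta_space_approx v : F_plus rho v -> forall e, 0 < e ->
  exists2 phi : Rd -> C^o, tests phi & hnorm theta_space (v - orbit phi) < e.
Proof.
move=> vF e e0; have [phis tphis /cvgrPdist_lt/(_ e e0)[N _ HN]] := F_plus_seq vF.
exists (phis N) => //; apply: le_lt_trans (theta_norm_le (F_plusB vF (F_plus_orbit (tphis N)))) _.
by have := HN N (leqnn N); rewrite /= sub0r normrN ger0_norm // hnorm_ge0.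
Qed.

Lemma laplace_approx f : hdom (L2 mu) f -> forall e, 0 < e ->
  exists2 phi : Rd -> C^o, tests phi & hnorm (L2 mu) (f - laplace phi) < e.
Proof.
move=> fL e e0; have := laplace_tests_dense nu_tempered fL.
rewrite closed_span_limit //; last 2 first.
- exact: (image_linear (tests_linear half) laplace_tests_linear).
- exact: laplace_tests_L2.
by move=> [_ /(_ e e0)[_ [phi tphi <-] h]]; exists phi.
Qed.

(** The identification of the completion: it sends the class of [orbit phi]
    to [laplace phi]. *)
Definition identification : (nat -> X -> C^o) -> Rd -> C^o :=
  @extension R (Rd -> C^o) (X -> C^o) (Rd -> C^o) theta_space (L2 mu) tests
    (fun phi => orbit phi) (@laplace R n).

Local Notation represents u f :=
  (@represents R (Rd -> C^o) (X -> C^o) (Rd -> C^o) theta_space (L2 mu) tests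
    (fun phi => orbit phi) (@laplace R n) u f).

Let a_lin (c : C) phi psi (tphi : tests phi) (tpsi : tests psi) :=
  orbit_linear c (test_schwartz tphi) (test_schwartz tpsi).

Let form_lap phi psi (tphi : tests phi) (tpsi : tests psi) :
  hform theta_space (orbit phi) (orbit psi) = hform (L2 mu) (laplace phi) (laplace psi).
Proof. by rewrite theta_formE; exact: (reflected_form nu_tempered tphi tpsi). Qed.

Let lap_L2 phi : tests phi -> hdom (L2 mu) (laplace phi). Proof. exact: laplace_L2. Qed.

Lemma identification_unitary : unitary (F_hat n rho) (L2 mu) identification.
Proof.
exact: (extension_unitary theta_prehilbert MP (tests_linear half) a_lin laplace_tests_linear
  F_plus_orbit lap_L2 form_lap theta_space_approx laplace_approx (@L2_complete _ _ _ mu)).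
Qed.

Lemma identificationP u : hdom (F_hat n rho) u -> represents u (identification u).
Proof.
exact: (extensionP theta_prehilbert MP (tests_linear half) a_lin laplace_tests_linear
  F_plus_orbit lap_L2 form_lap theta_space_approx (@L2_complete _ _ _ mu)).
Qed.

Lemma identification_represents u f : represents u f -> heq (L2 mu) (identification u) f.
Proof.
exact: (extension_represents theta_prehilbert MP (tests_linear half) a_lin laplace_tests_linear
  F_plus_orbit lap_L2 form_lap theta_space_approx (@L2_complete _ _ _ mu)).
Qed.

Lemma q_hdom v : F_plus rho v -> hdom (F_hat n rho) (q_map v).
Proof.
move=> vF; split => [//|e e0]; exists 0%N => j k _ _.
by rewrite /q_map subrr (hnorm0 theta_prehilbert).
Qed.

Lemma refl_orthogonal : (refl_mx R n)^T *m refl_mx R n = 1%:M.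
Proof.
apply/matrixP => i j; rewrite /refl_mx tr_diag_mx mulmx_diag !mxE.
by case: (i =P j) => // _; case: ifP => _; rewrite ?mulrNN mulr1.
Qed.

Lemma theta_nu_hdom f : hdom (L2 nu) f -> hdom (L2 nu) (theta_nu f).
Proof.
apply: (L2_composition (measurable_cV_mulmx (refl_mx R n))) => A mA.
exact: (nu_orthogonal rho refl_orthogonal mA).
Qed.

Lemma orbit_move g phi : mot_set g -> tests phi -> orbit (move g phi) = pullback (natural_rep g (fourier phi)).
Proof.
move=> gO tphi; rewrite integrated_repE fourier_move //.
by apply: schwartz_integrable; exact: test_schwartz tphi.
Qed.

Lemma move_H_half g x : mot_H g -> half x -> half (g.2 *m x + g.1).
Proof.
move=> [g0 [k _ gE]]; rewrite /half_space /= mxE g0 addr0 gE.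
by rewrite (energy_spatial k x).
Qed.

Lemma move_H_tests g phi : mot_H g -> tests phi -> tests (move g phi).
Proof. by move=> gH; apply: test_move => [|x]; [exact: mot_H_set|exact: move_H_half]. Qed.

Lemma F_plus_natural g (f : Rd -> C^o) : mot_H g -> F_plus_nu rho f -> F_plus rho (pullback (natural_rep g f)).
Proof.
move=> gH [fL fF]; have gO := mot_H_set gH; have gL := nu_motion rho gO.
have [phis tphis fphi] := F_plus_seq fF.
apply: (closed_subspace_cvg (@F_plus_closed R n rho) _ (w := fun k => orbit (move g (phis k)))).
- exact: pullback_L2 (natural_rep_hdom gL fL).
- by move=> k; apply: F_plus_orbit; exact: move_H_tests.
- apply: (cvg0_eq _ fphi) => k; rewrite orbit_move // pullbackB -natural_repB integrated_repE pullbackB.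
  have dL := hdomB (L2_prehilbert nu) fL (fourier_L2 nu_tempered (test_schwartz (tphis k))).
  by rewrite (pullback_norm (natural_rep_hdom gL dL)) (natural_rep_norm gL dL) -(pullback_norm dL).
Qed.

Lemma theta_nu_natural g (f : Rd -> C^o) : mot_H g -> theta_nu (natural_rep g f) = natural_rep g (theta_nu f).
Proof.
move=> gH; have gO := mot_H_set gH; have [g0 [k kO gE]] := gH; apply/funext => p.
rewrite /theta_nu /natural_rep; congr (expi (- _) * f _).
  by rewrite !dot_split g0 !mul0r vecpart_refl.
have {}gE : g.2 = spatial_mx k := gE.
rewrite (orthogonal_inv gO) gE spatial_tr.
by rewrite !reflE spatial_mulmx energy_spatial vecpart_spatial.
Qed.

(** A motion [g] fixing the time coordinate preserves the half space and commutes
    with the reflection, and maps [phi] to [move g phi] on either side. *)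
Lemma identification_natural g (f : Rd -> C^o) : mot_H g -> F_plus_nu rho f ->
  heq (L2 mu) (identification (q_map (pullback (natural_rep g f))))
              (natural_rep g (identification (q_map (pullback f)))).
Proof.
move=> gH fF; have [fL pF] := fF; have gO := mot_H_set gH; have gN := nu_motion rho gO.
have gM := mu_motion rho gH; have uP := identificationP (q_hdom pF).
have tf h := @theta_nu_hdom h.
apply: identification_represents; apply: (represents_transport (m := move g) uP).
- by move=> k; exact: F_plus_natural.
- by apply: natural_rep_hdom => //; case: uP.
- by move=> phi; exact: move_H_tests.
- move=> k phi tphi; have sphi := test_schwartz tphi; have phL := fourier_L2 nu_tempered sphi.
  have dL := hdomB (L2_prehilbert nu) fL phL.
  rewrite /q_map orbit_move // pullbackB -natural_repB integrated_repE pullbackB /hnorm !theta_formE.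
  have nL := natural_rep_hdom gN dL.
  rewrite !theta_pullback (pullback_form (tf _ nL) nL) (pullback_form (tf _ dL) dL).
  by rewrite (theta_nu_natural _ gH) (natural_rep_form gN (tf _ dL) dL).
- move=> phi tphi; rewrite laplace_move //; last 2 first.
  + exact: test_supported tphi.
  + by apply: schwartz_integrable; exact: test_schwartz tphi.
  have [_ fM _] := uP.
  have dL := hdomB MP fM (laplace_L2 nu_tempered tphi).
  by rewrite -natural_repB natural_rep_norm.
Qed.

End reflected_space.

Section semigroup.
Variables (R : realType) (n : nat) (rho : {measure set R -> \bar R}).
Hypothesis nu_tempered : tempered_measure (nu n rho).
Local Notation Rd := 'cV[R]_n.+1.
Local Notation X := (R * Rd)%type.
Local Notation C := R[i].
Local Notation mu := (mu n rho).
Local Notation zeta := (zeta n rho).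
Local Notation E := (E_space n rho).
Local Notation half := (@half_space R n).
Local Notation orbit phi := (integrated_rep phi (@one_E R n) : X -> C^o).
Local Notation tests := (test_function half : set (Rd -> C^o)).
Local Notation Th := (theta_space n rho).

Let EP : prehilbert E := L2_prehilbert zeta.
Let MP := L2_prehilbert mu.

Lemma half_translate (a : Rd) x : 0 <= a 0 0 -> half x -> half (x + a).
Proof. by move=> a0; rewrite /half_space /= mxE => x0; rewrite ltr_pwDl. Qed.

Lemma tests_translate (a : Rd) phi : 0 <= a 0 0 -> tests phi -> tests (fun y => phi (y - a)).
Proof. by move=> a0; apply: test_translate => x; exact: half_translate. Qed.

Lemma rep_E_orbit (a : Rd) phi : schwartz phi -> rep_E a (orbit phi) = orbit (fun y => phi (y - a)).
Proof.
move=> sphi; rewrite !integrated_repE rep_E_pullback; congr pullback; apply/funext => p.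
by rewrite -dotNl; apply/esym/fourier_translate; exact: schwartz_integrable.
Qed.

Lemma F_plus_translate (a : Rd) v : 0 <= a 0 0 -> F_plus rho v -> F_plus rho (rep_E a v).
Proof.
move=> a0; apply: (closed_span_map EP (rep_E_linear a) (@rep_E_hdom R n rho a) (M := 1) _ (@F_plus_closed R n rho) (orbits_E nu_tempered (O := half))).
  by move=> u uE; rewrite mul1r rep_E_norm.
move=> _ [phi tphi <-]; rewrite rep_E_orbit; last exact: test_schwartz tphi.
by apply: F_plus_orbit => //; exact: tests_translate.
Qed.

Lemma laplace_tests_translate (a : Rd) phi : tests phi ->
  laplace (fun y => phi (y - a)) = (fun p => laplace_kernel a p * laplace phi p).
Proof.
move=> tphi; have sc := test_schwartz tphi; apply/funext => p; apply: laplace_translate.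
- by apply: smooth_cmeasurable; case: sc.
- exact: test_supported tphi.
- exact: schwartz_integrable.
Qed.

(** Translations into the future contract the reflected norm, since they
    become multiplication by the kernel of modulus at most one. *)
Lemma translate_contraction (a : Rd) v : 0 <= a 0 0 -> F_plus rho v ->
  hnorm Th (rep_E a v) <= hnorm Th v.
Proof.
move=> a0 vF; have HP := theta_prehilbert nu_tempered.
have nE phi : tests phi -> hnorm Th (orbit phi) = hnorm (L2 mu) (laplace phi).
  by move=> tphi; rewrite /hnorm theta_formE (reflected_form nu_tempered tphi tphi).
apply/ler_addgt0Pr => e e0; have e2 : 0 < e / 2 by rewrite divr_gt0.
have [phis tphis /cvgrPdist_lt/(_ _ e2)[N _ HN]] := F_plus_seq nu_tempered vF.
have := HN N (leqnn N); have tphi := tphis N; set phi := phis N in tphi *.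
have oF := F_plus_orbit nu_tempered tphi; have TF u uF := @F_plus_translate a u a0 uF.
have vE := F_plus_E vF; have oE := F_plus_E oF.
have dE := hdomB EP vE oE; have dF := F_plusB vF oF.
rewrite /= sub0r normrN ger0_norm ?hnorm_ge0 // => ve.
apply: le_trans (hnorm_sub HP (TF _ vF) (TF _ oF)) _; rewrite -rep_EB.
have h1 : hnorm Th (rep_E a (v - orbit phi)) <= e / 2.
  apply: le_trans (theta_norm_le nu_tempered (TF _ dF)) _.
  by rewrite rep_E_norm // ltW.
have h2 : hnorm Th (rep_E a (orbit phi)) <= hnorm Th (orbit phi).
  rewrite rep_E_orbit; last exact: test_schwartz tphi.
  rewrite (nE _ (tests_translate a0 tphi)) (nE _ tphi) laplace_tests_translate //.
  rewrite -[leRHS]mul1r; have lL := laplace_L2 nu_tempered tphi.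
  exact: (L2_bounded_norm lL (laplace_kernel_meas a) ler01 (aeW _ (fun p => laplace_kernel_le1 p a0))).
have h3 : hnorm Th (orbit phi) <= e / 2 + hnorm Th v.
  apply: le_trans (hnorm_sub HP oF vF) _; rewrite lerD2r (hnormBC HP oF vF).
  by apply: le_trans (theta_norm_le nu_tempered dF) _; exact: ltW.
by move: h1 h2 h3; set x := hnorm _ _; set y := hnorm _ _; set z := hnorm _ _; set w := hnorm _ _ => *; lra.
Qed.

Lemma hat_translate (a : Rd) u : 0 <= a 0 0 -> hdom (F_hat n rho) u ->
  hdom (F_hat n rho) (hat_op (rep_E a) u).
Proof.
move=> a0 [uF uC]; split => [k|e e0]; first exact: (F_plus_translate a0 (uF k)).
have [N HN] := uC e e0; exists N => j k Nj Nk.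
rewrite /hat_op -rep_EB.
by apply: le_lt_trans (translate_contraction a0 (F_plusB (uF j) (uF k))) _; exact: HN.
Qed.

Lemma decay_hdom (t : R) (f : Rd -> C^o) : 0 < t -> hdom (L2 mu) f -> hdom (L2 mu) (decay_op t f).
Proof.
move=> t0 fM; apply: (L2_bounded_mul (M := 1) fM).
  apply: cmeasurable_real; apply: measurableT_comp => //; apply: measurable_funN.
  by apply: measurable_funM => //; exact: measurable_energy.
apply: filterS (energy_gt0_ae n rho) => p p0.
by rewrite cmodR ger0_norm ?expR_ge0 // -expR0 ler_expR oppr_le0 mulr_ge0 // ltW.
Qed.

Lemma identification_decay (t : R) u : 0 < t -> hdom (F_hat n rho) u ->
  heq (L2 mu) (identification rho (hat_op (rep_E (pt t 0)) u))
    (decay_op t (identification rho u)).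
Proof.
move=> t0 uC; have [uF _] := uC; have a0 : 0 <= (pt t 0 : Rd) 0 0 by rewrite energy_pt ltW.
have uP := identificationP nu_tempered uC; have [_ fM _] := uP.
set f := identification rho u in uP fM *.
pose f' : Rd -> C^o := fun p => laplace_kernel (pt t 0) p * f p.
have kle p := laplace_kernel_le1 p a0.
have f'M : hdom (L2 mu) f'.
  by apply: (L2_bounded_mul (M := 1) fM (laplace_kernel_meas _)); exact: aeW.
have rf : heq (L2 mu) (identification rho (hat_op (rep_E (pt t 0)) u)) f'.
  apply: (identification_represents nu_tempered).
  apply: (represents_transport (m := fun phi => (fun y => phi (y - pt t 0))) uP).
  - by move=> k; exact: (F_plus_translate a0 (uF k)).
  - exact: f'M.
  - by move=> phi; exact: tests_translate.
  - move=> k phi tphi; rewrite -rep_E_orbit; last exact: test_schwartz tphi.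
    rewrite /hat_op -rep_EB.
    exact: (translate_contraction a0 (F_plusB (uF k) (F_plus_orbit nu_tempered tphi))).
  - move=> phi tphi; rewrite laplace_tests_translate //.
    have lM := laplace_L2 nu_tempered tphi.
    rewrite (_ : _ - _ = (fun p => laplace_kernel (pt t 0) p * (f - laplace phi) p)); last first.
      by apply/funext => p; rewrite mulrBr.
    rewrite -[leRHS]mul1r.
    exact: (L2_bounded_norm (hdomB MP fM lM) (laplace_kernel_meas _) ler01 (aeW _ kle)).
have [_ iM _] := identificationP nu_tempered (hat_translate a0 uC).
have ae : {ae mu, forall p, f' p = decay_op t f p}.
  apply: filterS (energy_gt0_ae n rho) => p p0.
  rewrite /f' /decay_op /laplace_kernel energy_pt vecpart_pt dot0l oppr0 expi0 mulr1.
  by rewrite gtr0_norm.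
have dM := decay_hdom t0 fM.
apply: (heq_trans MP iM f'M dM rf).
exact/(L2_heqP f'M dM).
Qed.

End semigroup.

(** * Analytic continuation of the time translations *)

Section exponential_estimates.
Variable R : realType.
Implicit Types (x y a s : R).
Local Notation C := R[i].

Lemma expR_lipschitz x y : x <= 0 -> y <= 0 -> `|expR x - expR y| <= `|x - y|.
Proof.
wlog xy : x y / x <= y.
  by move=> h x0 y0; have [/h->//|/ltW/h] := leP x y; rewrite distrC [`|y - x|]distrC => ->.
move=> x0 y0; rewrite !ler0_norm ?subr_le0 ?ler_expR // !opprB.
rewrite -[expR x](mulr1) -[x in leLHS](subrK y) expRD mulr1 -{1}[expR y]mul1r -mulrBl.
have : 1 + (x - y) <= expR (x - y) by exact: expR_ge1Dx.
have : expR y <= 1 by rewrite -expR0 ler_expR.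
have := expR_gt0 y; set u := expR y; set v := expR _ => u0 u1 h.
have h1 : 1 - v <= y - x by lra.
apply: (@le_trans _ _ ((y - x) * u)); first by rewrite ler_wpM2r // ltW.
by rewrite ler_piMr // subr_ge0.
Qed.

Lemma expR_taylor1 x : `|expR x - 1 - x| <= x ^+ 2 * expR `|x|.
Proof.
have h1 := expR_ge1Dx x; have h2 := expR_ge1Dx (- x).
have e0 := expR_gt0 x.
have h3 : expR x - 1 - x <= x * (expR x - 1).
  have : (1 - x) * expR x <= 1.
    rewrite -[leRHS](expRxMexpNx_1 x) [leRHS]mulrC ler_wpM2r // ltW //.
  by set u := expR x => h; lra.
rewrite ger0_norm; last by move: h1; set u := expR x => h1; lra.
apply: le_trans h3 _; have [x0|x0] := leP 0 x.
  rewrite ger0_norm // expr2 -mulrA ler_wpM2l //.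
  have : (1 - x) * expR x <= 1 by rewrite -[leRHS](expRxMexpNx_1 x) [leRHS]mulrC ler_wpM2r // ltW.
  by set u := expR x => h; lra.
rewrite ltr0_norm //; have e1 : 1 <= expR (- x) by rewrite -expR0 ler_expR oppr_ge0 ltW.
apply: (@le_trans _ _ (x ^+ 2)); last by rewrite ler_peMr // sqr_ge0.
rewrite expr2 ler_nM2l //; move: h1; set u := expR x => h1; lra.
Qed.

(** [e^(- i z a)]: the phase of a time translation for real [z], and the decay
    [e^(- t a)] at [z = - i t]. *)
Definition wick (a : R) (z : C) : C := (expR (Im z * a))%:C * expi (- (Re z * a)).

Lemma wickD a z w : wick a (z + w) = wick a z * wick a w.
Proof.
rewrite /wick cReD cImD !mulrDl opprD expRD expiD rmorphM mulrACA; congr (_ * _).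
Qed.

Lemma cmod_wick a z : cmod (wick a z) = expR (Im z * a).
Proof. by rewrite /wick cmodM cmod_expi mulr1 cmodR ger0_norm // expR_ge0. Qed.

Lemma wick_lipschitz a z w : 0 <= a -> Im z <= 0 -> Im w <= 0 ->
  cmod (wick a z - wick a w) <= 3 * a * cmod (z - w).
Proof.
move=> a0 z0 w0.
have -> : wick a z - wick a w = (expR (Im z * a) - expR (Im w * a))%:C * expi (- (Re z * a)) +
    (expR (Im w * a))%:C * (expi (- (Re z * a)) - expi (- (Re w * a))).
  by rewrite /wick rmorphB; ring.
apply: le_trans (cmodD _ _) _; rewrite !cmodM cmod_expi mulr1 !cmodR.
have h1 : `|expR (Im z * a) - expR (Im w * a)| <= a * cmod (z - w).
  apply: le_trans (expR_lipschitz _ _) _; rewrite ?mulr_le0_ge0 //.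
  rewrite -mulrBl normrM (ger0_norm a0) mulrC ler_wpM2l // -cImB; exact: Im_le_cmod.
have h2 : cmod (expi (- (Re z * a)) - expi (- (Re w * a))) <= 2 * (a * cmod (z - w)).
  apply: le_trans (cmod_expiB _ _) _; rewrite ler_wpM2l // -opprD normrN -mulrBl normrM.
  by rewrite (ger0_norm a0) mulrC ler_wpM2l // -cReB; exact: Re_le_cmod.
have h3 : `|expR (Im w * a)| <= 1.
  by rewrite ger0_norm ?expR_ge0 // -expR0 ler_expR mulr_le0_ge0.
apply: (@le_trans _ _ (a * cmod (z - w) + 1 * (2 * (a * cmod (z - w))))); last by apply: eqR_le; ring.
by apply: lerD => //; apply: ler_pM => //; exact: cmod_ge0.
Qed.

Lemma wick_taylor a z : 0 <= a ->
  cmod (wick a z - 1 - (0 -i* a) * z) <= 5 * (cmod z * a) ^+ 2 * expR (cmod z * a).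
Proof.
move=> a0; pose x := Im z * a; pose y := - (Re z * a); pose m := cmod z * a.
have m0 : 0 <= m by rewrite mulr_ge0 // cmod_ge0.
have xm : `|x| <= m by rewrite normrM (ger0_norm a0) ler_wpM2r // Im_le_cmod.
have ym : `|y| <= m by rewrite normrN normrM (ger0_norm a0) ler_wpM2r // Re_le_cmod.
have e1 : 1 <= expR m by rewrite -expR0 ler_expR.
have -> : wick a z - 1 - (0 -i* a) * z = (expR x - 1 - x)%:C * expi y +
    (x%:C * (expi y - expi 0) + (expi y - 1 - (0 +i* y))).
  rewrite expi0 /wick -/x -/y.
  have -> : (0 -i* a) * z = x%:C + (0 +i* y).
    by apply: complex_eqP; rewrite ?cReM ?cImM ?cReD ?cImD /= /x /y; ring.
  by rewrite !rmorphB; ring.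
have sq b : `|b| <= m -> b ^+ 2 <= m ^+ 2 by move=> bm; rewrite -[b ^+ 2]real_normK ?num_real // ler_sqr ?nnegrE.
have m2 : 0 <= m ^+ 2 by exact: sqr_ge0.
have t1 : cmod ((expR x - 1 - x)%:C * expi y) <= m ^+ 2 * expR m.
  rewrite cmodM cmod_expi mulr1 cmodR; apply: le_trans (expR_taylor1 x) _.
  by apply: ler_pM; rewrite ?sqr_ge0 ?expR_ge0 ?ler_expR // sq.
have t2 : cmod (x%:C * (expi y - expi 0)) <= 2 * m ^+ 2.
  rewrite cmodM cmodR; apply: le_trans (ler_wpM2l (normr_ge0 _) (cmod_expiB _ _)) _.
  by rewrite subr0 mulrCA ler_wpM2l // expr2; apply: ler_pM.
have t3 : cmod (expi y - 1 - (0 +i* y)) <= 2 * m ^+ 2.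
  by apply: le_trans (cmod_expi_taylor y) _; rewrite ler_wpM2l // sq.
apply: le_trans (cmodD _ _) _; apply: (@le_trans _ _ (m ^+ 2 * expR m + (2 * m ^+ 2 + 2 * m ^+ 2))).
  by apply: lerD => //; apply: le_trans (cmodD _ _) _; exact: lerD.
have : m ^+ 2 * 1 <= m ^+ 2 * expR m by rewrite ler_wpM2l.
rewrite mulr1 -mulrA -/m; set u := m ^+ 2 * _; set v := m ^+ 2 => h; lra.
Qed.

Lemma sqr_expRN_le a s : 0 < s -> 0 <= a -> a ^+ 2 * expR (- (s * a)) <= 4 / s ^+ 2.
Proof.
move=> s0 a0; rewrite expRN -ler_pdivlMr ?invr_gt0 ?expR_gt0 // invrK.
have h : s * a / 2 <= expR (s * a / 2).
  by apply: le_trans (expR_ge1Dx _); rewrite lerDr.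
have := ler_pM _ _ h h; rewrite -expRD -splitr => h2.
rewrite mulrAC ler_pdivlMr ?exprn_gt0 //.
have {}h2 : s * a / 2 * (s * a / 2) <= expR (s * a) by apply: h2; rewrite divr_ge0 // mulr_ge0 // ltW.
by move: h2; set u := expR _ => h2; rewrite -exprMn [a * s]mulrC; set w := s * a in h2 *; rewrite expr2; lra.
Qed.

Lemma id_expRN_le a s : 0 < s -> 0 <= a -> a * expR (- (s * a)) <= s^-1.
Proof.
move=> s0 a0; rewrite expRN -ler_pdivlMr ?invr_gt0 ?expR_gt0 // invrK mulrC.
rewrite ler_pdivlMr // mulrC; apply: le_trans (expR_ge1Dx _); by rewrite lerDr.
Qed.

End exponential_estimates.

Section continuation.
Variables (R : realType) (n : nat) (rho : {measure set R -> \bar R}).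
Local Notation Rd := 'cV[R]_n.+1.
Local Notation C := R[i].
Local Notation mu := (mu n rho).
Let MP := L2_prehilbert mu.

Definition wick_op (z : C) (f : Rd -> C^o) : Rd -> C^o := fun p => wick `|p 0 0| z * f p.

Lemma cmeasurable_wick z : cmeasurable (fun p : Rd => wick `|p 0 0| z).
Proof.
have ma : measurable_fun setT (fun p : Rd => `|p 0 0|).
  by apply: measurableT_comp => //; exact: measurable_energy.
apply: cmeasurableM.
  by apply: cmeasurable_real; apply: measurableT_comp => //; exact: measurable_funM.
by apply: cmeasurable_expi; apply: measurable_funN; exact: measurable_funM.
Qed.

Lemma wick_op_bound z (p : Rd) : Im z <= 0 -> cmod (wick `|p 0 0| z) <= 1.
Proof. by move=> z0; rewrite cmod_wick -expR0 ler_expR mulr_le0_ge0. Qed.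

Lemma wick_op_hdom z f : Im z <= 0 -> hdom (L2 mu) f -> hdom (L2 mu) (wick_op z f).
Proof.
move=> z0 fM; apply: (L2_bounded_mul (M := 1) fM (cmeasurable_wick z)).
by apply: aeW => p; exact: wick_op_bound.
Qed.

Lemma wick_op_real t f : hdom (L2 mu) f ->
  heq (L2 mu) (wick_op (t +i* 0) f) (natural_rep (pt t 0, 1%:M) f).
Proof.
move=> fM; have h1 : hdom (L2 mu) (wick_op (t +i* 0) f) by exact: wick_op_hdom.
have ae : {ae mu, forall p, wick_op (t +i* 0) f p = natural_rep (pt t 0, 1%:M) f p}.
  apply: filterS (energy_gt0_ae n rho) => p p0.
  rewrite /wick_op /natural_rep /wick /= mul0r expR0 mul1r invmx1 mul1mx.
  by rewrite dot_split energy_pt vecpart_pt dot0l addr0 gtr0_norm.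
suff h2 : hdom (L2 mu) (natural_rep (pt t 0, 1%:M) f) by exact/(L2_heqP h1 h2).
apply: (hdom_L2_le (g := fun x => sqmod (wick_op (t +i* 0) f x))).
- apply: cmeasurableM; first exact: phase_meas_cV.
  by rewrite invmx1; under eq_fun do rewrite mul1mx; case: fM.
- exact: L2_sqmod.
- by apply: filterS ae => p ->.
Qed.

Lemma wick_op_decay t f : 0 < t -> hdom (L2 mu) f ->
  heq (L2 mu) (wick_op (0 -i* t) f) (decay_op t f).
Proof.
move=> t0 fM; have h1 : hdom (L2 mu) (wick_op (0 -i* t) f).
  by apply: wick_op_hdom => //=; rewrite oppr_le0 ltW.
apply/(L2_heqP h1 (decay_hdom t0 fM)); apply: filterS (energy_gt0_ae n rho) => p p0.
by rewrite /wick_op /decay_op /wick /= mul0r oppr0 expi0 mulr1 gtr0_norm // mulNr.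
Qed.

Lemma wick_op_continuous z f : Im z <= 0 -> hdom (L2 mu) f -> forall e, 0 < e ->
  exists2 r : R, 0 < r & forall z', Im z' <= 0 -> Re `|z' - z| < r ->
    hnorm (L2 mu) (wick_op z' f - wick_op z f) < e.
Proof.
move=> z0 fM e e0; apply: contrapT => no.
have bad k : exists z', [/\ Im z' <= 0, cmod (z' - z) <= k.+1%:R^-1 &
    e <= hnorm (L2 mu) (wick_op z' f - wick_op z f)].
  apply: contrapT => h; apply: no; exists k.+1%:R^-1; first by rewrite invr_gt0 ltr0n.
  move=> z' z'0; rewrite Re_norm => zz; rewrite ltNge; apply/negP => ez.
  by apply: h; exists z'; split => //; exact: ltW.
have [zs zsP] := choice bad.
have [||||_ _ cv] := L2_dominated (m := mu) (fs := fun k => wick_op (zs k) f) (f := wick_op z f) (g := fun p => cmod (f p)).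
- by move=> k; case: (zsP k) => zk _ _; case: (wick_op_hdom zk fM).
- by case: (wick_op_hdom z0 fM).
- have := L2_sqmod fM; congr (integrable _ _ _); apply/funext => p; by rewrite /= sqr_cmod.
- apply: aeW => p; split => [k|].
    case: (zsP k) => zk _ _; rewrite /wick_op cmodM -[leRHS]mul1r.
    by rewrite ler_wpM2r ?cmod_ge0 // wick_op_bound.
  have cv0 : (k.+1%:R^-1 * (3 * `|p 0 0| * cmod (f p))) @[k --> \oo] --> (0 : R).
    by apply: (cvg0M (x := fun k => k.+1%:R^-1)); [exact: cvg_harmonic|exact: cvg_cst].
  apply: cvg0_le cv0 => k; rewrite cmod_ge0 /= /wick_op -mulrBl cmodM.
  have [zk zzk _] := zsP k.
  rewrite mulrA; apply: ler_wpM2r; first exact: cmod_ge0.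
  apply: le_trans (wick_lipschitz (normr_ge0 _) zk z0) _.
  by rewrite [leRHS]mulrC ler_wpM2l // mulr_ge0.
have : e = 0.
  apply: (cst_cvg0 (ltW e0) _ cv) => k.
  by case: (zsP k).
by move=> e00; move: e0; rewrite e00 ltxx.
Qed.

Lemma wick_op_derivative z f : Im z < 0 -> hdom (L2 mu) f -> exists2 D, hdom (L2 mu) D &
  forall e, 0 < e -> exists2 r : R, 0 < r & forall z', z' != z -> Re `|z' - z| < r ->
    hnorm (L2 mu) ((z' - z)^-1 *: (wick_op z' f - wick_op z f) - D) < e.
Proof.
move=> z0 fM; pose s := - Im z / 2; have s0 : 0 < s by rewrite divr_gt0 // oppr_gt0.
pose D : Rd -> C^o := fun p => ((0 -i* `|p 0 0|) * wick `|p 0 0| z) * f p.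
have me : measurable_fun setT (fun p : Rd => `|p 0 0|).
  by apply: measurableT_comp => //; exact: measurable_energy.
have mI : cmeasurable (fun p : Rd => 0 -i* `|p 0 0| : C).
  by split => /=; [exact: measurable_cst|exact: measurable_funN].
have cI (a : R) : 0 <= a -> cmod (0 -i* a) = a.
  by move=> a0; rewrite /cmod /= expr0n add0r sqrrN sqrtr_sqr ger0_norm.
exists D.
  apply: (L2_bounded_mul (M := (2 * s)^-1) fM); first by apply: cmeasurableM => //; exact: cmeasurable_wick.
  apply: aeW => p; rewrite cmodM cI // cmod_wick.
  rewrite (_ : Im z * `|p 0 0| = - (2 * s * `|p 0 0|)); last by rewrite /s; field.
  by apply: id_expRN_le => //; rewrite mulr_gt0.
move=> e e0; pose K := 20 / s ^+ 2; have K0 : 0 < K by rewrite divr_gt0 // exprn_gt0.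
have N0 : 0 < K * (hnorm (L2 mu) f + 1) by rewrite mulr_gt0 // ltr_wpDl // hnorm_ge0.
exists (Num.min s (e / (K * (hnorm (L2 mu) f + 1)))).
  by rewrite lt_min s0 divr_gt0.
move=> z' zz'; rewrite Re_norm lt_min => /andP[zs ze]; set d := z' - z.
have d0 : d != 0 by rewrite subr_eq0.
have cd0 : 0 < cmod d by rewrite lt_neqAle cmod_ge0 andbT eq_sym; apply: contra_neq d0; exact: cmod_eq0.
pose Q (p : Rd) : C := d^-1 * wick `|p 0 0| z * (wick `|p 0 0| d - 1 - (0 -i* `|p 0 0|) * d).
have -> : d^-1 *: (wick_op z' f - wick_op z f) - D = (fun p => Q p * f p).
  apply/funext => p; rewrite /Q.
  have -> : (d^-1 *: (wick_op z' f - wick_op z f) - D) p = d^-1 * (wick_op z' f p - wick_op z f p) - D p by [].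
  have -> : z' = z + d by rewrite addrC subrK.
  by rewrite /D /wick_op wickD; field.
apply: (@le_lt_trans _ _ (K * cmod d * hnorm (L2 mu) f)).
  apply: L2_bounded_norm => //.
  - apply: cmeasurableM; first by apply: cmeasurableM; [exact: cmeasurable_cst|exact: cmeasurable_wick].
    apply: cmeasurableB; first by apply: cmeasurableB; [exact: cmeasurable_wick|exact: cmeasurable_cst].
    by apply: cmeasurableM => //; exact: cmeasurable_cst.
  - by rewrite mulr_ge0 ?cmod_ge0 // ltW.
  - apply: aeW => p; rewrite /Q; set a := `|p 0 0|; have a0 : 0 <= a by exact: normr_ge0.
    rewrite cmodM [cmod (d^-1 * _)]cmodM cmodV cmod_wick.
    apply: le_trans (ler_wpM2l _ (wick_taylor d a0)) _; first by rewrite mulr_ge0 ?invr_ge0 ?expR_ge0 ?cmod_ge0.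
    have -> : (cmod d)^-1 * expR (Im z * a) * (5 * (cmod d * a) ^+ 2 * expR (cmod d * a)) =
        5 * cmod d * (a ^+ 2 * (expR (Im z * a) * expR (cmod d * a))).
      by set u := expR _; set v := expR _; field; rewrite gt_eqF.
    have -> : K * cmod d = 5 * cmod d * (4 / s ^+ 2) by rewrite /K; field; rewrite gt_eqF.
    rewrite ler_wpM2l //; first by rewrite mulr_ge0 ?cmod_ge0.
    apply: le_trans (sqr_expRN_le s0 a0); rewrite ler_wpM2l ?sqr_ge0 // -expRD ler_expR.
    rewrite -mulrDl -mulNr ler_wpM2r //; move: (ltW zs); rewrite -/d /s; set u := cmod d => h; lra.
have : cmod d * (K * (hnorm (L2 mu) f + 1)) < e by rewrite -ltr_pdivlMr.
have := mulr_gt0 K0 cd0; rewrite -/d; set u := hnorm _ _; set w := cmod d => Kw h.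
apply: le_lt_trans h; have -> : w * (K * (u + 1)) = K * w * u + K * w by ring.
by rewrite lerDl ltW.
Qed.

Lemma natural_analytic_continuation : analytic_continuation (L2 mu)
  (fun t => natural_rep (pt t 0, 1%:M)) (@decay_op R n).
Proof.
exists wick_op; split.
- move=> z z0; split.
    split => [f|a f g fM gM]; first exact: wick_op_hdom.
    rewrite (_ : wick_op z _ = a *: wick_op z f + wick_op z g); first exact: (heq_refl MP).
    by apply/funext => p; rewrite /wick_op mulrDr; congr (_ + _); rewrite mulrCA.
  exists 1 => f fM; apply: L2_bounded_norm => //; first exact: cmeasurable_wick.
  by apply: aeW => p; exact: wick_op_bound.
- exact: wick_op_real.
- exact: wick_op_decay.
- exact: wick_op_continuous.
- exact: wick_op_derivative.
Qed.

End continuation.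

(** * Generators of motions *)

Section one_parameter_groups.
Variable R : realType.

Lemma one_param0 (G : group) (c : R -> G) : one_param c -> c 0 = gone G.
Proof.
move=> [_ cG cM]; have [h [_ hc _]] := gmulV (cG 0).
by rewrite -[LHS]gmul1g -hc -gmulA -cM addr0.
Qed.

Lemma antiderivative (f : R -> R) : continuous f ->
  exists F : R -> R, forall x : R, -2 < x < 2 -> is_derive x (1 : R) F (f x).
Proof.
move=> cf; exists (fun x => \int[@lebesgue_measure R]_(t in `[-2, x]) f t) => x /andP[x1 x2].
have fi : (@lebesgue_measure R).-integrable `[-2, 2] (EFin \o f).
  by apply: continuous_compact_integrable; [exact: segment_compact|exact: continuous_subspaceT].
have [dF F'x] := continuous_FTC1_closed x2 fi x1 (cf x).
rewrite derive1E in F'x; exact: (DeriveDef dF F'x).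
Qed.

Lemma cvg_bigprod (I : Type) (s : seq I) (F : I -> nat -> R) (l : I -> R) :
  (forall i, F i k @[k --> \oo] --> l i) ->
  (\prod_(i <- s) F i k) @[k --> \oo] --> \prod_(i <- s) l i.
Proof.
move=> h; elim: s => [|i s IH].
  by rewrite big_nil; under eq_fun do rewrite big_nil; exact: cvg_cst.
by rewrite big_cons; under eq_fun do rewrite big_cons; exact: cvgM.
Qed.

Lemma cvg_det m (A : nat -> 'M[R]_m) (L : 'M[R]_m) :
  (forall i j, A k i j @[k --> \oo] --> L i j) -> \det (A k) @[k --> \oo] --> \det L.
Proof.
move=> h; rewrite /determinant; apply: (@cvg_finsum _ _ \oo _) => s.
by apply: cvgM; [exact: cvg_cst|exact: cvg_bigprod].
Qed.

(** A continuous one-parameter group of matrices is differentiable at 0: if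
    [F] is an antiderivative of [B], then [B t *m (F e - F 0) = F (t + e) - F t],
    and [F e - F 0] is invertible for small [e] because
    [(F e - F 0) / e] tends to the identity. *)
Lemma matrix_one_param_derivative m (B : R -> 'M[R]_m) :
  (forall i j, continuous (fun t => B t i j)) ->
  (forall s t, B (s + t) = B s *m B t) -> B 0 = 1%:M ->
  exists M : 'M[R]_m, forall i j, (fun h => h^-1 * (B h i j - B 0 i j)) @ 0^' --> M i j.
Proof.
move=> cB BD B0.
have [F FP] : exists F : R -> 'M[R]_m, forall i j (x : R), -2 < x < 2 ->
    is_derive x (1 : R) (fun x => F x i j) (B x i j).
  have h (ij : 'I_m * 'I_m) := antiderivative (cB ij.1 ij.2).
  have [G GP] := choice h; exists (fun x => \matrix_(i, j) G (i, j) x) => i j x hx.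
  by under eq_fun do rewrite mxE; exact: (GP (i, j)).
have key t e : -2^-1 < t < 2^-1 -> 0 < e < 2^-1 -> B t *m (F e - F 0) = F (t + e) - F t.
  move=> /andP[t1 t2] /andP[e0 e1]; apply/matrixP => i j.
  pose g s := F (t + s) i j - \sum_k B t i k * F s k j.
  have dg (s : R) : -2^-1 < s < 2^-1 -> is_derive s (1 : R) g 0.
    move=> /andP[s1 s2]; rewrite /g.
    have d1 : is_derive s (1 : R) (fun s => F (t + s) i j) (B (t + s) i j).
      have h := FP i j (t + s); have {}h : is_derive (t + s) (1 : R) (fun x => F x i j) (B (t + s) i j).
        by apply: h; apply/andP; split; lra.
      have -> : B (t + s) i j = B (t + s) i j * 1 by rewrite mulr1.
      apply: (@is_derive1_comp _ (fun x => F x i j) (fun s => t + s)).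
      apply/(is_deriveP (V := R^o)); apply: cvg_near_cst; near=> r.
      rewrite [r *: _]mulr1 addrCA addrK mulVf //; near: r; exact: nbhs_dnbhs_neq.
    have d2 k : is_derive s (1 : R) (fun s => B t i k * F s k j) (B t i k * B s k j).
      have h : is_derive s (1 : R) (fun x => F x k j) (B s k j) by apply: FP; apply/andP; split; lra.
      exact: is_deriveZ.
    have d3 : is_derive s (1 : R) (fun s => \sum_k B t i k * F s k j) (\sum_k B t i k * B s k j).
      elim: (index_enum _) => [|k l IH].
        by rewrite big_nil; under eq_fun do rewrite big_nil; exact: is_derive_cst.
      by rewrite big_cons; under eq_fun do rewrite big_cons; exact: is_deriveD.
    have z : B (t + s) i j - \sum_k B t i k * B s k j = 0 by rewrite BD mxE subrr.
    by rewrite -[X in is_derive _ _ _ X]z; exact: is_deriveB.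
  have dg' (s : R) : 0 <= s <= e -> is_derive s (1 : R) g 0.
    by move=> /andP[s0 se]; apply: dg; apply/andP; split; lra.
  have gI s : s \in `]0, e[%R -> is_derive s (1 : R) g 0.
    by rewrite in_itv /= => /andP[s0 se]; apply: dg'; rewrite !ltW.
  have [|s _] := @MVT_segment R g (fun=> 0) 0 e (ltW e0) gI.
    apply: derivable_within_continuous => s; rewrite in_itv /= => /dg'[].
    by [].
  rewrite mul0r /g addr0 => /subr0_eq E.
    rewrite !mxE; under eq_bigr do rewrite !mxE mulrBr.
    rewrite sumrB; move: E; set u := \sum_k _; set v := \sum_k _.
    set a := F _ _ _; set b := F _ _ _ => E; lra.
have [e [e0 e1 eu]] : exists e, [/\ 0 < e, e < 2^-1 & F e - F 0 \in unitmx].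
  pose A k : 'M[R]_m := (k.+1%:R^-1)^-1 *: (F k.+1%:R^-1 - F 0).
  have cA i j : A k i j @[k --> \oo] --> (1%:M : 'M[R]_m) i j.
    rewrite -B0; have z : -2 < (0 : R) < 2 by apply/andP; split; lra.
    have /(is_deriveP (V := R^o)) h := FP i j 0 z.
    have := cvg_comp _ _ (@cvg_harmonic_dnbhs R) h.
    rewrite (_ : _ \o _ = (fun k => A k i j)) //.
    by apply/funext => k; rewrite /A /= !mxE [_ *: 1]mulr1 addr0.
  have := cvg_det cA; rewrite det1 => /cvgrPdist_lt/(_ 1 ltr01)[N _ HN].
  pose k := maxn N 2; have k1 : 0 < k.+1%:R^-1 :> R by rewrite invr_gt0 ltr0n.
  exists k.+1%:R^-1; split => //.
    by rewrite ltf_pV2 ?posrE ?ltr0n // ltr_nat ltnS leq_max leqnn orbT.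
  rewrite unitmxE unitfE; apply/eqP => d0.
  have := HN k (leq_maxl _ _); rewrite /= /A detZ d0 mulr0 subr0 normr1.
  by rewrite ltxx.
exists ((B e - B 0) *m invmx (F e - F 0)) => i j; set K := invmx _.
have BE t : -2^-1 < t < 2^-1 -> B t = (F (t + e) - F t) *m K.
  by move=> ht; rewrite -key ?e0 // mulmxK.
have eI : -2 < e < 2 by apply/andP; split; lra.
have zI : -2 < (0 : R) < 2 by apply/andP; split; lra.
have cv : (fun h : R => \sum_k (h^-1 * (F (h *: (1 : R^o) + e) i k - F e i k) -
    h^-1 * (F (h *: (1 : R^o) + 0) i k - F 0 i k)) * K k j) @ 0^' --> ((B e - B 0) *m K) i j.
  rewrite mxE; apply: (@cvg_finsum R _ (0^') _) => k.
  apply: cvgM; last exact: cvg_cst.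
  rewrite !mxE; apply: cvgB.
    by have /(is_deriveP (V := R^o)) h := FP i k e eI; exact: h.
  by have /(is_deriveP (V := R^o)) h := FP i k 0 zI; exact: h.
apply: cvg_trans cv; apply: near_eq_cvg; near=> h.
have hI : -2^-1 < h < 2^-1.
  by rewrite -ltr_norml; near: h; apply: dnbhs0_lt; rewrite invr_gt0.
have z2 : -2^-1 < (0 : R) < 2^-1 by apply/andP; split; lra.
rewrite (BE _ hI) (BE _ z2) add0r !mxE -sumrB mulr_sumr; apply: eq_bigr => k _.
by rewrite !mxE [h *: 1]mulr1 addr0 -!mulrBr -mulrBl mulrA; congr (_ * _ * _); ring.
Unshelve. all: by end_near. Qed.

(** The derivative at 0 of a curve through the neutral element. *)
Definition velocity d (c : R -> motions R d) (b : 'cV[R]_d) (M : 'M[R]_d) : Prop :=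
  (forall i, (fun h => h^-1 * (c h).1 i 0) @ 0^' --> b i 0) /\
  (forall i j, (fun h => h^-1 * ((c h).2 i j - (i == j)%:R)) @ 0^' --> M i j).

(** Motions are affine maps, that is, block triangular matrices. *)
Lemma motion_one_param_derivative d (c : R -> motions R d) : one_param c ->
  exists (b : 'cV[R]_d) (M : 'M[R]_d), velocity c b M.
Proof.
move=> cP; have c0 := one_param0 cP; have [cc _ cM] := cP.
pose B t : 'M[R]_(1 + d) := block_mx 1%:M 0 (c t).1 (c t).2.
have [|s t||M MP] := @matrix_one_param_derivative _ B.
- move=> i j t; have cc1 : (c s).1 @[s --> t] --> (c t).1.
    exact: (cvg_comp c fst (cc t) (@cvg_fst _ _ (nbhs (c t).1) (nbhs (c t).2) _)).
  have cc2 : (c s).2 @[s --> t] --> (c t).2.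
    exact: (cvg_comp c snd (cc t) (@cvg_snd _ _ (nbhs (c t).1) (nbhs (c t).2) _)).
  rewrite /B; have [k ->|k ->] := split_ordP i; have [l ->|l ->] := split_ordP j.
  + by rewrite /continuous_at /= block_mxEul; under eq_fun do rewrite block_mxEul; exact: cvg_cst.
  + by rewrite /continuous_at /= block_mxEur; under eq_fun do rewrite block_mxEur; exact: cvg_cst.
  + rewrite /continuous_at /= block_mxEdl; under eq_fun do rewrite block_mxEdl.
    exact: (cvg_comp (fun s => (c s).1) (fun x : 'cV[R]_d => x k l) cc1 (@coord_continuous _ _ _ k l _)).
  + rewrite /continuous_at /= block_mxEdr; under eq_fun do rewrite block_mxEdr.
    exact: (cvg_comp (fun s => (c s).2) (fun x : 'M[R]_d => x k l) cc2 (@coord_continuous _ _ _ k l _)).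
- by rewrite /B cM /= mulmx_block !mul1mx !mul0mx !mulmx0 !addr0 mulmx1 add0r.
- by rewrite /B c0 /= -scalar_mx_block.
exists (\col_i M (rshift 1 i) (lshift d 0)), (\matrix_(i, j) M (rshift 1 i) (rshift 1 j)); split => [i|i j].
  rewrite mxE; have := MP (rshift 1 i) (lshift d 0); rewrite /B.
  by under eq_fun do rewrite !block_mxEdl c0 /= [X in _ - X]mxE subr0.
rewrite mxE; have := MP (rshift 1 i) (rshift 1 j); rewrite /B.
by under eq_fun do rewrite !block_mxEdr c0 /= [X in _ - X]mxE.
Qed.

End one_parameter_groups.

Section cmod_limits.
Variable R : realType.
Local Notation C := R[i].
Implicit Types (z w : nat -> C) (a b : C).

Lemma cmod_cvgD z w a b : cmod (z k - a) @[k --> \oo] --> (0 : R) ->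
  cmod (w k - b) @[k --> \oo] --> (0 : R) -> cmod (z k + w k - (a + b)) @[k --> \oo] --> (0 : R).
Proof.
move=> za wb; apply: cvg0_le (cvg0D za wb) => k; rewrite cmod_ge0 /=.
by rewrite opprD addrACA; exact: cmodD.
Qed.

Lemma cmod_cvgM z w a b : cmod (z k - a) @[k --> \oo] --> (0 : R) ->
  cmod (w k - b) @[k --> \oo] --> (0 : R) -> cmod (z k * w k - a * b) @[k --> \oo] --> (0 : R).
Proof.
move=> za wb.
have cv : (cmod (z k - a) * cmod (w k - b) + (cmod (z k - a) * cmod b + cmod (w k - b) * cmod a))
    @[k --> \oo] --> (0 : R).
  by apply: cvg0D; [exact: (cvg0M za wb)|apply: cvg0D; [apply: (cvg0M za); exact: cvg_cst|apply: (cvg0M wb); exact: cvg_cst]].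
apply: cvg0_le cv => k; rewrite cmod_ge0 /=.
have -> : z k * w k - a * b = (z k - a) * (w k - b) + ((z k - a) * b + (w k - b) * a) by ring.
by rewrite -!cmodM; apply: le_trans (cmodD _ _) _; rewrite lerD2l; exact: cmodD.
Qed.

Lemma cmod_cvg_cst a : cmod ((fun=> a) k - a) @[k --> \oo] --> (0 : R).
Proof. by under eq_fun do rewrite subrr cmod0; exact: cvg_cst. Qed.

(** [z - a] is a null sequence times a convergent one. *)
Lemma cmod_cvg_quotient z (a q : C) (h : nat -> R) : h @ \oo --> (0 : R) -> (forall k, h k != 0) ->
  cmod (((h k)^-1)%:C * (z k - a) - q) @[k --> \oo] --> (0 : R) ->
  cmod (z k - a) @[k --> \oo] --> (0 : R).
Proof.
move=> h0 hn zq; have hc : cmod ((h k)%:C - 0) @[k --> \oo] --> (0 : R).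
  apply: (cvg0_eq (x := fun k => `|h k|)) => [k|]; first by rewrite subr0 cmodR.
  exact/norm_cvg0P.
have := cmod_cvgM hc zq; rewrite mul0r => cv; apply: (cvg0_eq _ cv) => k.
by rewrite subr0 mulrA -rmorphM mulfV // mul1r.
Qed.

End cmod_limits.

Section generators.
Variables (R : realType) (d : nat).
Local Notation Rd := 'cV[R]_d.
Local Notation C := R[i].
Local Notation leb := (leb R d).
Local Notation rep := (@natural_rep R d).

Lemma natural_repM (g h : Rd * 'M[R]_d) f : mot_set g -> mot_set h ->
  rep (mot_mul g h) f = rep g (rep h f).
Proof.
move=> gO hO; have ghO := mot_setM gO hO; apply/funext => p; rewrite /natural_rep.
rewrite (orthogonal_inv ghO) (orthogonal_inv gO) (orthogonal_inv hO) /= trmx_mul mulmxA mulrA -expiD.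
by congr (expi _ * _); rewrite dotDl opprD dot_mulmx.
Qed.

Lemma natural_rep1 f : rep (0, 1%:M) f = f.
Proof. by apply/funext => p; rewrite /natural_rep /= invmx1 mul1mx dot0l oppr0 expi0 mul1r. Qed.

(** In Fourier space, [generator b M] is the derivative of the action of a
    one-parameter group of motions with velocity [(b, M)]. *)
Definition generator (b : Rd) (M : 'M[R]_d) (phi : Rd -> C) : Rd -> C := fun y =>
  \sum_k (- (b k 0)%:C) * cpartial k phi y +
  \sum_j \sum_k (- (M k j)%:C) * cpartial k (fun x => (x j 0)%:C * phi x) y.

Lemma test_generator O b M phi : test_function O phi -> test_function O (generator b M phi).
Proof.
move=> tphi; apply: test_D; first by apply: test_sum => k; apply: test_Z; exact: test_cpartial.
apply: test_sum => j; apply: test_sum => k; apply: test_Z; apply: test_cpartial.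
exact: test_coord.
Qed.

Lemma fourierZ (a : C) f p : cintegrable leb f -> fourier (fun x => a * f x) p = a * fourier f p.
Proof.
move=> fi; rewrite /fourier -cintegralZ; last exact: integrable_kernel.
by apply: eq_cintegral => x; rewrite mulrA.
Qed.

Lemma imag_sum (I : Type) (s : seq I) (x y : I -> R) :
  \sum_(k <- s) (x k)%:C * (0 +i* y k) = 0 +i* \sum_(k <- s) x k * y k.
Proof.
elim: s => [|k s IH]; first by rewrite !big_nil.
rewrite !big_cons IH; apply: complex_eqP; rewrite ?cReD ?cImD ?cReM ?cImM /=.
  by rewrite mulr0 mul0r subr0 addr0.
by rewrite mul0r addr0.
Qed.

Lemma fourier_generator O b M phi p : test_function O phi ->
  fourier (generator b M phi) p = (0 +i* (- dot b p)) * fourier phi p +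
    fourier (fun x => (0 +i* (- dot x (M^T *m p))) * phi x) p.
Proof.
move=> tphi; have ti f : test_function O f -> cintegrable leb f.
  by move=> tf; apply: schwartz_integrable; exact: test_schwartz tf.
have tx j := test_coord j tphi.
have t1 k := test_Z (- (b k 0)%:C) (test_cpartial k tphi).
have t2 j k := test_Z (- (M k j)%:C) (test_cpartial k (tx j)).
have t1s := test_sum (index_enum _) t1.
have t2s j := test_sum (index_enum _) (t2 j).
have t3 := test_sum (index_enum _) t2s.
have -> : fourier (generator b M phi) p =
    fourier (fun y => 1 * (\sum_k (- (b k 0)%:C) * cpartial k phi y) + \sum_j \sum_k (- (M k j)%:C) * cpartial k (fun x => (x j 0)%:C * phi x) y) p.
  by apply: eq_cintegral => y; rewrite mul1r.
rewrite (fourier_linear 1 p (ti _ t1s) (ti _ t3)) mul1r; congr (_ + _).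
  rewrite fourier_sum => [|k]; last exact: ti.
  rewrite (_ : (0 +i* (- dot b p)) = \sum_k (- (b k 0)%:C) * (0 +i* p k 0)).
    rewrite mulr_suml; apply: eq_bigr => k _; rewrite fourierZ; last by apply: ti; exact: test_cpartial.
    by rewrite fourier_cpartial ?mulrA //; exact: test_schwartz tphi.
  under eq_bigr do rewrite -rmorphN; rewrite imag_sum /dot -sumrN; congr (0 +i* _).
  by apply: eq_bigr => k _; rewrite mulNr.
rewrite fourier_sum => [|j]; last exact: ti.
pose v := M^T *m p.
transitivity (\sum_j (0 +i* (- v j 0)) * fourier (fun x => (x j 0)%:C * phi x) p).
  apply: eq_bigr => j _; rewrite fourier_sum => [|k]; last exact: ti.
  rewrite (_ : (0 +i* (- v j 0)) = \sum_k (- (M k j)%:C) * (0 +i* p k 0)).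
    rewrite mulr_suml; apply: eq_bigr => k _; rewrite fourierZ; last by apply: ti; exact: test_cpartial.
    by rewrite fourier_cpartial ?mulrA //; exact: test_schwartz (tx j).
  under eq_bigr do rewrite -rmorphN; rewrite imag_sum /v mxE -sumrN; congr (0 +i* _).
  by apply: eq_bigr => k _; rewrite mulNr mxE.
rewrite (_ : fourier _ p = fourier (fun x => \sum_j (0 +i* (- v j 0)) * ((x j 0)%:C * phi x)) p).
  rewrite fourier_sum => [|j]; last by apply: cintegrableZ; exact: ti.
  by apply: eq_bigr => j _; rewrite fourierZ //; exact: ti.
apply: eq_cintegral => x; congr (_ * _); under eq_bigr do rewrite mulrA.
rewrite -mulr_suml; congr (_ * _); rewrite /dot -/v.
under [RHS]eq_bigr do rewrite mulrC; rewrite imag_sum -sumrN; congr (0 +i* _).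
by apply: eq_bigr => k _; rewrite mulrN.
Qed.

Section along_a_group.
Variable c : R -> motions R d.
Hypothesis cP : one_param c.
Variables (b : Rd) (M : 'M[R]_d).
Hypothesis cv : velocity c b M.
Variables (O : set Rd) (phi : Rd -> C).
Hypothesis tphi : test_function O phi.

Let sphi : schwartz phi. Proof. exact: test_schwartz tphi. Qed.

Let cO t : mot_set (c t). Proof. by case: cP => _ + _; apply. Qed.

Let cD s t : c (s + t) = mot_mul (c s) (c t). Proof. by case: cP => _ _ ->. Qed.

Let c0 : c 0 = (0, 1%:M). Proof. exact: one_param0 cP. Qed.

Lemma natural_quotient p (h : nat -> R) : h @ \oo --> (0 : R) -> (forall k, h k != 0) ->
  cmod (((h k)^-1)%:C * (rep (c (h k)) (fourier phi) p - fourier phi p) -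
    fourier (generator b M phi) p) @[k --> \oo] --> (0 : R).
Proof.
move=> h0 hn; have sq (F : R -> R) (l : R) : F @ 0^' --> l -> F (h k) @[k --> \oo] --> l.
  by move=> /cvgr_dnbhsP; apply.
pose q k : Rd := (c (h k)).2^T *m p.
have qv i : ((q k i 0 - p i 0) / h k) @[k --> \oo] --> (M^T *m p) i 0.
  have cvs : (\sum_j ((h k)^-1 * ((c (h k)).2 j i - (j == i)%:R)) * p j 0) @[k --> \oo] --> (M^T *m p) i 0.
    rewrite mxE; apply: (@cvg_finsum _ _ \oo _) => j; rewrite mxE.
    have cv1 := sq _ _ (cv.2 j i).
    by apply: (cvgM cv1); exact: cvg_cst.
  rewrite (_ : (fun k => _) = (fun k => \sum_j ((h k)^-1 * ((c (h k)).2 j i - (j == i)%:R)) * p j 0)) //.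
  apply/funext => k; rewrite /q mxE -[p i 0]mul1r.
  rewrite (_ : 1 * p i 0 = \sum_j (j == i)%:R * p j 0).
    rewrite -sumrB mulr_suml; apply: eq_bigr => j _; rewrite mxE; ring.
  rewrite (bigD1 i) //= eqxx big1 ?addr0 // => j /negbTE ->.
  by rewrite mul0r.
have f1 := fourier_quotient sphi h0 hn qv.
have f2 := cmod_cvg_quotient h0 hn f1.
have e1 : cmod (((h k)^-1)%:C * (expi (- dot (c (h k)).1 p) - expi 0) - (0 +i* (- dot b p)) * expi 0) @[k --> \oo] --> (0 : R).
  apply: expi_quotient => //.
  have cvs : (- \sum_i ((h k)^-1 * (c (h k)).1 i 0) * p i 0) @[k --> \oo] --> - dot b p.
    apply: cvgN; apply: (@cvg_finsum _ _ \oo _) => i.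
    have cv1 := sq _ _ (cv.1 i).
    by apply: (cvgM cv1); exact: cvg_cst.
  rewrite (_ : (fun k => _) = (fun k => (- \sum_i ((h k)^-1 * (c (h k)).1 i 0) * p i 0))) //.
  apply/funext => k; rewrite subr0 /dot mulNr mulr_suml; congr (- _); apply: eq_bigr => i _; ring.
have := cmod_cvgD (cmod_cvgM e1 f2) f1; rewrite (fourier_generator b M p tphi) expi0 mulr1.
move=> cv'; apply: (cvg0_eq _ cv') => k; congr (cmod (_ - _)).
rewrite /natural_rep (orthogonal_inv (cO _)) -/(q k); ring.
Qed.

Let orbit_quotient p (s : R) (h : nat -> R) : h @ \oo --> (0 : R) -> (forall k, h k != 0) ->
  cmod (((h k)^-1)%:C * (rep (c (h k + s)) (fourier phi) p - rep (c s) (fourier phi) p) -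
    rep (c s) (fourier (generator b M phi)) p) @[k --> \oo] --> (0 : R).
Proof.
move=> h0 hn; have := natural_quotient (invmx (c s).2 *m p) h0 hn => cv'.
apply: (cvg0_eq _ cv') => k; rewrite [h k + s]addrC cD natural_repM //.
rewrite [rep (c s) (rep _ _) p]/natural_rep [rep (c s) (fourier phi) p]/natural_rep.
rewrite [rep (c s) (fourier _) p]/natural_rep -mulrBr mulrCA -mulrBr cmodM cmod_expi.
by rewrite mul1r.
Qed.

Lemma japanese_natural (g : Rd * 'M[R]_d) (p : Rd) : mot_set g -> japanese (invmx g.2 *m p) = japanese p.
Proof.
move=> gO; rewrite (orthogonal_inv gO) /japanese dot_orthogonal //; exact: orthogonalC.
Qed.

(** The mean value theorem along the group: the derivative at time [s] is the
    image under [c s] of a fixed rapidly decreasing function, and [c s] preserves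
    [japanese]. *)
Lemma natural_rep_increment (N : nat) : exists K : R, forall h p,
  cmod (rep (c h) (fourier phi) p - fourier phi p) <= `|h| * (K * (japanese p ^+ N)^-1).
Proof.
have sg := test_schwartz (test_generator b M tphi).
have [K K0 HK] := fourier_rapid N sg; exists (2 * K) => h p.
pose u s := rep (c s) (fourier phi) p; pose du s := rep (c s) (fourier (generator b M phi)) p.
have dub s : cmod (du s) <= K * (japanese p ^+ N)^-1.
  by rewrite /du /natural_rep cmodM cmod_expi mul1r -(japanese_natural p (cO s)); exact: HK.
have dRe s : is_derive s (1 : R) (fun s => Re (u s)) (Re (du s)).
  apply/(is_deriveP (V := R^o)); apply/cvgr_dnbhsP => t [tn t0].
  have := cmod_cvg_Re (orbit_quotient p s t0 tn).
  rewrite (_ : (fun k => Re _) = (fun k => (t k)^-1 * (Re (u (t k *: (1 : R^o) + s)) - Re (u s)))) //.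
  by apply/funext => k; rewrite [t k *: _]mulr1 -cReB cReM /= mul0r subr0.
have dIm s : is_derive s (1 : R) (fun s => Im (u s)) (Im (du s)).
  apply/(is_deriveP (V := R^o)); apply/cvgr_dnbhsP => t [tn t0].
  have := cmod_cvg_Im (orbit_quotient p s t0 tn).
  rewrite (_ : (fun k => Im _) = (fun k => (t k)^-1 * (Im (u (t k *: (1 : R^o) + s)) - Im (u s)))) //.
  by apply/funext => k; rewrite [t k *: _]mulr1 -cImB cImM /= mul0r addr0.
have -> : rep (c h) (fourier phi) p - fourier phi p = u h - u 0 by rewrite /u c0 natural_rep1.
have inc (f df : R -> R) (B : R) : (forall s, is_derive s (1 : R) f (df s)) -> (forall s, `|df s| <= B) ->
    `|f h - f 0| <= `|h| * B.
  move=> fd fB; have [s _] := @line_MVT R R^o f 1 0 h (fun z => let: DeriveDef a _ := fd z in a).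
  rewrite !addr0 [h *: _]mulr1 => ->; rewrite normrM ler_wpM2l //.
  by have [_ ->] := fd ((s * h) *: (1 : R^o)); exact: fB.
apply: le_trans (cmod_le_ReIm _) _; rewrite cReB cImB.
have i1 := inc _ _ _ dRe (fun s => le_trans (Re_le_cmod _) (dub s)).
have i2 := inc _ _ _ dIm (fun s => le_trans (Im_le_cmod _) (dub s)).
apply: le_trans (lerD i1 i2) _; rewrite -mulrA.
by rewrite [2 * _]mulr_natl mulr2n mulrDr.
Qed.

End along_a_group.
End generators.

(** * The representation of the motion group *)

Section motion_representation.
Variables (R : realType) (n : nat) (rho : {measure set R -> \bar R}).
Hypothesis nu_tempered : tempered_measure (nu n rho).
Local Notation Rd := 'cV[R]_n.+1.
Local Notation C := R[i].
Local Notation nu := (nu n rho).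
Local Notation G := (motions R n.+1).
Local Notation rep := (@natural_rep R n.+1).
Local Notation nm := (hnorm (L2 nu)).

Let NP := L2_prehilbert nu.

Lemma japanese_sqr_integrable : exists N : nat,
  nu.-integrable setT (EFin \o (fun p : Rd => (japanese p ^+ N)^-1 ^+ 2)).
Proof.
have [N iN] := nu_tempered; exists N.
apply: (le_integrable measurableT _ _ iN).
  apply/measurable_EFinP; apply: measurable_funX; exact: measurable_japaneseVX.
move=> p _ /=; rewrite lee_fin; have j0 := japaneseVX_ge0 p N.
rewrite !ger0_norm ?exprn_ge0 // expr2 ler_piMr // invf_le1 ?exprn_ege1 ?japanese_ge1 //.
by rewrite exprn_gt0 // japanese_gt0.
Qed.

Lemma rep_hdom (g : Rd * 'M[R]_n.+1) f : mot_set g -> hdom (L2 nu) f -> hdom (L2 nu) (rep g f).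
Proof. by move=> gO; exact: (natural_rep_hdom (nu_motion rho gO)). Qed.

Lemma rep_norm (g : Rd * 'M[R]_n.+1) f : mot_set g -> hdom (L2 nu) f -> nm (rep g f) = nm f.
Proof. by move=> gO; exact: (natural_rep_norm (nu_motion rho gO)). Qed.

Lemma fourier_test_L2 O phi : test_function O phi -> hdom (L2 nu) (fourier phi).
Proof. by move=> tphi; apply: fourier_L2 => //; exact: test_schwartz tphi. Qed.

Lemma natural_rep_derivative (c : R -> G) (b : Rd) (M : 'M[R]_n.+1) O phi : one_param c ->
  velocity c b M ->
  test_function O phi ->
  nm ((h^-1)%:C *: (rep (c h) (fourier phi) - fourier phi) - fourier (generator b M phi))
    @[h --> 0^'] --> (0 : R).
Proof.
move=> cP cv tphi; have cO t : mot_set (c t) by case: cP => _ + _; apply.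
have [N iN] := japanese_sqr_integrable.
have [K HK] := natural_rep_increment cP cv tphi N.
have fL := fourier_test_L2 tphi.
have gL := fourier_test_L2 (test_generator b M tphi).
apply/cvgr_dnbhsP => h [hn h0].
have rL k := rep_hdom (cO (h k)) fL.
have qL k : hdom (L2 nu) (((h k)^-1)%:C *: (rep (c (h k)) (fourier phi) - fourier phi)).
  by have := hdomZ NP ((h k)^-1)%:C (hdomB NP (rL k) fL).
have [||||_ _ //] := L2_dominated (m := nu)
  (fs := fun k => ((h k)^-1)%:C *: (rep (c (h k)) (fourier phi) - fourier phi) : Rd -> C^o)
  (f := fourier (generator b M phi)) (g := fun p => K * (japanese p ^+ N)^-1).
- by move=> k; case: (qL k).
- by case: gL.
- rewrite (_ : EFin \o _ = EFin \o (fun p : Rd => K ^+ 2 * (japanese p ^+ N)^-1 ^+ 2)).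
    exact: integrable_scale.
  by apply/funext => p /=; rewrite exprMn.
- apply: aeW => p; split => [k|]; last by have := natural_quotient cP cv tphi p h0 hn; exact.
  rewrite (_ : (_ *: _) p = ((h k)^-1)%:C * (rep (c (h k)) (fourier phi) p - fourier phi p)) //.
  by rewrite cmodM cmodR normfV ler_pdivrMl ?normr_gt0.
Qed.

(** The increment is at most a constant times [e * japanese p], and it also decays
    rapidly; the product of the two bounds is integrable for [nu]. *)
Lemma natural_rep_modulus phi : schwartz phi -> exists2 K : R, 0 <= K &
  forall (g g' : Rd * 'M[R]_n.+1) (e : R), mot_set g -> mot_set g' -> 0 <= e ->
    (forall i, `|g'.1 i 0 - g.1 i 0| <= e) -> (forall i j, `|g'.2 i j - g.2 i j| <= e) ->
    nm (rep g' (fourier phi) - rep g (fourier phi)) ^+ 2 <= e * K.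
Proof.
move=> sphi; have [N iN] := nu_tempered.
have [K1 K10 HK1] := fourier_rapid N.+1 sphi; have [K0 K00 HK0] := fourier_rapid 0 sphi.
have [L L0 HL] := fourier_lipschitz sphi.
pose D : R := n.+1%:R; pose C1 := 2 * D * K0 + L * D ^+ 2.
have D0 : 0 <= D by rewrite ler0n.
have C10 : 0 <= C1 by rewrite addr_ge0 // !mulr_ge0 ?exprn_ge0.
pose I := Rintegral nu setT (fun p => (japanese p ^+ N)^-1).
have I0 : 0 <= I by apply: Rintegral_ge0 => p _; exact: japaneseVX_ge0.
exists (C1 * (2 * K1) * I); first by rewrite !mulr_ge0.
move=> g g' e gO gO' e0 g1 g2.
have fL := fourier_L2 nu_tempered sphi; have rL := rep_hdom gO fL; have rL' := rep_hdom gO' fL.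
have dL := hdomB NP rL' rL.
have j0 (p : Rd) : 0 < japanese p := japanese_gt0 p.
have psum (p : Rd) (a : 'I_n.+1 -> R) : (forall i, `|a i| <= e) -> `|\sum_i a i * p i 0| <= e * (D * japanese p).
  move=> ae; apply: le_trans (ler_norm_sum _ _ _) _.
  apply: (@le_trans _ _ (\sum_(i < n.+1) e * japanese p)).
    by apply: ler_sum => i _; rewrite normrM; apply: ler_pM => //; exact: coord_le_japanese.
  by rewrite sumr_const card_ord -mulr_natl; rewrite -/D mulrCA.
have B1 (p : Rd) : cmod (rep g' (fourier phi) p - rep g (fourier phi) p) <= e * C1 * japanese p.
  rewrite /natural_rep (orthogonal_inv gO) (orthogonal_inv gO').
  set x := expi _; set y := expi _; set u := fourier phi _; set v := fourier phi _.
  have -> : x * u - y * v = (x - y) * u + y * (u - v) by ring.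
  apply: le_trans (cmodD _ _) _; rewrite !cmodM cmod_expi mul1r.
  have h1 : cmod (x - y) <= 2 * (e * (D * japanese p)).
    apply: le_trans (cmod_expiB _ _) _; rewrite ler_wpM2l // -opprD normrN -dotNl -dotDl.
    by apply: psum => i; rewrite !mxE.
  have h2 : cmod u <= K0 by apply: le_trans (HK0 _) _; rewrite expr0 invr1 mulr1.
  have h3 : cmod (u - v) <= L * (D * (e * (D * japanese p))).
    apply: le_trans (HL _ _) _; rewrite ler_wpM2l //.
    apply: (@le_trans _ _ (\sum_(i < n.+1) e * (D * japanese p))).
      apply: ler_sum => i _; rewrite !mxE -sumrB.
      rewrite (_ : \sum_j _ = \sum_j (g'.2 j i - g.2 j i) * p j 0); last first.
        by apply: eq_bigr => j _; rewrite !mxE mulrBl.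
      exact: psum.
    by rewrite sumr_const card_ord -mulr_natl.
  apply: (@le_trans _ _ (2 * (e * (D * japanese p)) * K0 + L * (D * (e * (D * japanese p))))).
    by apply: lerD => //; apply: ler_pM => //; exact: cmod_ge0.
  apply: eqR_le; rewrite /C1; ring.
have B2 (p : Rd) : cmod (rep g' (fourier phi) p - rep g (fourier phi) p) <= 2 * K1 * (japanese p ^+ N.+1)^-1.
  have hb (a : Rd * 'M[R]_n.+1) : mot_set a -> cmod (rep a (fourier phi) p) <= K1 * (japanese p ^+ N.+1)^-1.
    by move=> aO; rewrite /natural_rep cmodM cmod_expi mul1r -(japanese_natural p aO); exact: HK1.
  apply: le_trans (cmodB _ _) _; apply: le_trans (lerD (hb _ gO') (hb _ gO)) _.
  by rewrite -mulrA [2 * _]mulr_natl mulr2n.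
rewrite mulrA -[leRHS]mulrC.
have -> : e * (C1 * (2 * K1)) = e * C1 * (2 * K1) by rewrite mulrA.
rewrite mulrC -RintegralZl //.
apply: L2_norm_le => //.
- exact: integrable_scale.
- by move=> p; rewrite !mulr_ge0 // japaneseVX_ge0.
- apply: aeW => p; rewrite -sqr_cmod expr2.
  apply: le_trans (ler_pM (cmod_ge0 _) (cmod_ge0 _) (B1 p) (B2 p)) _.
  apply: eqR_le.
  by rewrite exprS; have := j0 p; have := exprn_gt0 N (j0 p) => a1 a2; field; rewrite !gt_eqF.
Qed.

Lemma near_motion (g : G) (e : R) : 0 < e -> nbhs g [set g' : Rd * 'M[R]_n.+1 |
  (forall i, `|g'.1 i 0 - g.1 i 0| <= e) /\ (forall i j, `|g'.2 i j - g.2 i j| <= e)].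
Proof.
move=> e0; have : nbhs g (ball (g : Rd * 'M[R]_n.+1) e) by exact: nbhsx_ballx.
apply: filterS => g' [[_ h1] [_ h2]]; split => [i|i j].
  by have := h1 i 0; rewrite /ball /= distrC => /ltW.
by have := h2 i j; rewrite /ball /= distrC => /ltW.
Qed.

Lemma fourier_approx f : hdom (L2 nu) f -> forall e, 0 < e ->
  exists2 phi, test_function setT phi & nm (f - fourier phi) < e.
Proof.
move=> fL e e0; have := fourier_tests_dense nu_tempered fL.
rewrite closed_span_limit //; last 2 first.
- exact: fourier_images_linear.
- by move=> _ [phi tphi <-]; exact: fourier_test_L2 tphi.
by move=> [_ /(_ e e0)[_ [phi tphi <-] h]]; exists phi.
Qed.

Lemma natural_rep_continuous f (g : G) : hdom (L2 nu) f -> mot_set g -> forall e, 0 < e ->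
  \forall g' \near g, mot_set g' -> nm (rep g' f - rep g f) < e.
Proof.
move=> fL gO e e0; have e3 : 0 < e / 3 by rewrite divr_gt0.
have [phi tphi fphi] := fourier_approx fL e3; have sphi := test_schwartz tphi.
have pL := fourier_L2 nu_tempered sphi; have [K K0 HK] := natural_rep_modulus sphi.
pose r := (e / 3) ^+ 2 / (K + 1); have K1 : 0 < K + 1 by rewrite ltr_wpDl.
have r0 : 0 < r by rewrite divr_gt0 // exprn_gt0.
apply: filterS (near_motion g r0) => g' [h1 h2] gO'.
have hb a : mot_set a -> nm (rep a f - rep a (fourier phi)) < e / 3.
  by move=> aO; rewrite -natural_repB (rep_norm aO (hdomB NP fL pL)).
have rf a : mot_set a -> hdom (L2 nu) (rep a f) by move=> aO; exact: rep_hdom.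
have rp a : mot_set a -> hdom (L2 nu) (rep a (fourier phi)) by move=> aO; exact: rep_hdom.
have h3 : nm (rep g' (fourier phi) - rep g (fourier phi)) < e / 3.
  rewrite -(ltr_sqr (x := nm _)) ?nnegrE ?hnorm_ge0 ?(ltW e3) //.
  apply: le_lt_trans (HK g g' r gO gO' (ltW r0) h1 h2) _.
  by rewrite /r mulrAC ltr_pdivrMr // ltr_pM2l ?exprn_gt0 // ltrDl.
have [d1 d2 d3 d4] : [/\ hdom (L2 nu) (rep g' f), hdom (L2 nu) (rep g f), hdom (L2 nu) (rep g' (fourier phi)) & hdom (L2 nu) (rep g (fourier phi))].
  by split; [exact: rf|exact: rf|exact: rp|exact: rp].
apply: le_lt_trans (hnorm_tri NP d1 d3 d2) _.
have h4 := hnorm_tri NP d3 d4 d2; have h5 := hb _ gO'; have h6 := hb _ gO.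
have h7 : nm (rep g (fourier phi) - rep g f) < e / 3 by rewrite (hnormBC NP d4 d2).
apply: le_lt_trans (lerD (lexx _) h4) _.
have -> : e = e / 3 + (e / 3 + e / 3) by field.
exact: (ltrD h5 (ltrD h3 h7)).
Qed.

Lemma natural_rep_lie (c : R -> G) (b : Rd) (M : 'M[R]_n.+1) O phi (g : G) : one_param c ->
  velocity c b M ->
  test_function O phi -> mot_set g ->
  lie_derivative (L2 nu) c (fun g => rep g (fourier phi)) g (rep g (fourier (generator b M phi))).
Proof.
move=> cP cv tphi gO; have cO t : mot_set (c t) by case: cP => _ + _; apply.
have cv' := natural_rep_derivative cP cv tphi.
have pL := fourier_test_L2 tphi; have gL := fourier_test_L2 (test_generator b M tphi).
rewrite /lie_derivative; apply: cvg_trans cv'; apply: near_eq_cvg; near=> h.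
rewrite (natural_repM _ gO (cO h)); have rL := rep_hdom (cO h) pL.
have dL := hdomB NP (hdomZ NP (h^-1)%:C (hdomB NP rL pL)) gL.
rewrite -(rep_norm gO dL); congr (nm _); apply/funext => p.
by rewrite /natural_rep mulrBr; congr (_ - _); rewrite -mulrBr mulrCA.
Unshelve. all: by end_near. Qed.

(** Differentiation replaces [phi] by another test function, which makes the
    induction on the order work. *)
Lemma natural_rep_Ck k O phi : test_function O phi ->
  Ck (G := G) (L2 nu) k (fun g => rep g (fourier phi)).
Proof.
elim: k phi => [|k IH] phi tphi; have pL := fourier_test_L2 tphi.
  by split => [g gO|g gO e e0|//]; [exact: (rep_hdom gO pL)|exact: natural_rep_continuous].
split => [g gO|g gO e e0|c cP].
- exact: (rep_hdom gO pL).
- exact: natural_rep_continuous.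
have [b [M cv]] := motion_one_param_derivative cP.
exists (fun g => rep g (fourier (generator b M phi))) => [g gO|].
  exact: (natural_rep_lie cP cv tphi gO).
by apply: IH; exact: test_generator.
Qed.

Lemma fourier_smooth_vec O phi : test_function O phi ->
  smooth_vec (G := G) (L2 nu) rep (fourier phi).
Proof.
move=> tphi; split; first exact: fourier_test_L2 tphi.
by move=> k; exact: natural_rep_Ck tphi.
Qed.

Lemma fourier_drep (c : R -> G) O phi : one_param c -> test_function O phi ->
  exists2 psi, test_function O psi & drep (G := G) (L2 nu) rep c (fourier phi) (fourier psi).
Proof.
move=> cP tphi; have [b [M cv]] := motion_one_param_derivative cP.
exists (generator b M phi); first exact: test_generator.
split; first exact: fourier_test_L2 (test_generator b M tphi).
have := natural_rep_lie cP cv tphi (@mot_set1 R n.+1).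
by rewrite natural_rep1.
Qed.

Lemma natural_unitary_rep : unitary_rep (G := G) (L2 nu) rep.
Proof.
split.
- move=> g gO; have gN := nu_motion rho gO; split.
  + split => [f|a f f' fL fL']; first exact: natural_rep_hdom.
    by rewrite natural_rep_linear; exact: (heq_refl NP).
  + by move=> f f' fL fL'; exact: natural_rep_form.
  + move=> f fL; have [h [hO _ gh]] := gmulV (gO : gset (g : G)).
    exists (rep h f); first exact: rep_hdom.
    have -> : rep g (rep h f) = f by rewrite -natural_repM //; move: gh => /= ->; rewrite natural_rep1.
    exact: (heq_refl NP).
- by move=> f fL; rewrite natural_rep1; exact: (heq_refl NP).
- by move=> g h f gO hO fL; rewrite natural_repM //; exact: (heq_refl NP).
- by move=> f fL g gO e e0; exact: natural_rep_continuous.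
Qed.

End motion_representation.

(** * Reflection positive representations *)

Section reflections.
Variables (R : realType) (n : nat).
Local Notation Rd := 'cV[R]_n.+1.
Local Notation J := (refl_mx R n).

Lemma refl_tr : J^T = J. Proof. by rewrite /refl_mx tr_diag_mx. Qed.

Lemma refl_mxK : J *m J = 1%:M. Proof. by rewrite -{1}refl_tr; exact: refl_orthogonal. Qed.

Lemma reflK (x : Rd) : refl (refl x) = x.
Proof. by rewrite /refl mulmxA refl_mxK mul1mx. Qed.

Lemma reflD (x y : Rd) : refl (x + y) = refl x + refl y.
Proof. by rewrite /refl mulmxDr. Qed.

Lemma refl_fixed (x : Rd) : refl x = x <-> x 0 0 = 0.
Proof.
split => [/(congr1 (fun y : Rd => y 0 0))|x0].
  by rewrite energy_refl => h; move: h; set a := x 0 0 => h; lra.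
by rewrite reflE x0 oppr0 -[in RHS](pt_vecpart x); congr pt; rewrite -x0.
Qed.

Lemma continuous_refl : continuous (@refl R n).
Proof. by move=> x; have := @continuous_affine R _ _ J 0 x; rewrite /refl /continuous_at addr0; under eq_fun do rewrite addr0. Qed.

Lemma mot_tau_set (g : motions R n.+1) : mot_set g -> mot_set (mot_tau g).
Proof.
rewrite /mot_set /orthogonal_mx /= => gO; rewrite !trmx_mul refl_tr !mulmxA.
by rewrite -(mulmxA _ J J) refl_mxK mulmx1 -(mulmxA _ g.2^T) gO mulmx1 refl_mxK.
Qed.

Lemma mot_tau_involution : involution_on (G := motions R n.+1) (@mot_tau R n).
Proof.
split; first exact: mot_tau_set.
- move=> g h _ _; rewrite /= /mot_mul /mot_tau /=; congr pair.
    by rewrite reflD; congr (_ + _); rewrite /refl !mulmxA -(mulmxA _ J J) refl_mxK mulmx1.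
  by rewrite !mulmxA -(mulmxA _ J J) refl_mxK mulmx1.
- by move=> g _; case: g => x A; rewrite /mot_tau /= reflK !mulmxA refl_mxK mul1mx -mulmxA refl_mxK mulmx1.
- move=> g.
  have h1 := cvg_comp fst (@refl R n) (@cvg_fst _ _ (nbhs g.1) (nbhs g.2) (@nbhs_filter _ _)) (@continuous_refl g.1).
  suff h2 : (fun A : 'M[R]_n.+1 => J *m A *m J) @ g.2 --> J *m g.2 *m J.
    have h3 := cvg_comp snd _ (@cvg_snd _ _ (nbhs g.1) (nbhs g.2) (@nbhs_filter _ _)) h2.
    exact: (cvg_pair h1 h3).
  apply: (@cvg_mx _ _ (nbhs g.2) (nbhs_filter g.2)) => i j.
  rewrite /refl_mx mul_mx_diag mul_diag_mx !mxE.
  under eq_fun do rewrite mul_mx_diag mul_diag_mx !mxE.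
  apply: cvgM; last exact: cvg_cst.
  by apply: cvgM; [exact: cvg_cst|exact: coord_continuous].
Qed.

Lemma mot_H_inv (g : Rd * 'M[R]_n.+1) : mot_H g ->
  exists h, [/\ mot_H h, mot_mul h g = (0, 1%:M) & mot_mul g h = (0, 1%:M)].
Proof.
case: g => x A gH; have := mot_H_set gH; rewrite /mot_set /orthogonal_mx /= => AO.
have [x0 [k kO AE]] := gH; have AO' : A *m A^T = 1%:M by exact: mulmx1C.
have AE' : A = spatial_mx k := AE.
exists (- (A^T *m x), A^T); split.
- split => /=; first by rewrite AE' spatial_tr mxE energy_spatial x0 oppr0.
  by exists k^T; [exact: orthogonalC|rewrite AE' spatial_tr].
- by rewrite /mot_mul /= AO addNr.
- by rewrite /mot_mul /= mulmxN mulmxA AO' mul1mx addrN.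
Qed.

Lemma spatial_mxM (k l : 'M[R]_n) : spatial_mx k *m spatial_mx l = spatial_mx (k *m l).
Proof.
have := @mulmx_block R 1 n 1 n 1 n 1%:M 0 0 k 1%:M 0 0 l.
by rewrite !mulmx0 !mul0mx !addr0 !add0r mul1mx; exact.
Qed.

Lemma mot_HM (g h : Rd * 'M[R]_n.+1) : mot_H g -> mot_H h -> mot_H (mot_mul g h).
Proof.
move=> [g0 [k kO gE]] [h0 [l lO hE]]; split => /=.
  have {}gE : g.2 = spatial_mx k := gE.
  by rewrite mxE g0 gE energy_spatial h0 addr0.
exists (k *m l); first by rewrite /orthogonal_mx /= trmx_mul mulmxA -(mulmxA l^T) kO mulmx1.
by rewrite gE hE; exact: spatial_mxM.
Qed.

Lemma mx_ext m (A B : 'M[R]_m) : (forall x : 'cV[R]_m, A *m x = B *m x) -> A = B.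
Proof.
move=> h; apply/matrixP => i j; have := congr1 (fun y : 'cV[R]_m => y i 0) (h (delta_mx j 0)).
by rewrite /= -!colE !mxE.
Qed.

Lemma refl_spatial (k : 'M[R]_n) : J *m spatial_mx k *m J = spatial_mx k.
Proof.
apply: mx_ext => x; rewrite -!mulmxA -/(refl x) -/(refl _).
by rewrite !reflE energy_spatial vecpart_spatial energy_pt vecpart_pt opprK -spatial_mulmx pt_vecpart.
Qed.

Lemma refl_mxE (A : 'M[R]_n.+1) i j : (J *m A *m J) i j =
  (if i == 0 then -1 else 1) * A i j * (if j == 0 then -1 else 1).
Proof. by rewrite /refl_mx mul_mx_diag mul_diag_mx !mxE. Qed.

(** An orthogonal matrix commuting with the reflection is block diagonal,
    with upper corner [1] or [- 1]; the sign selects an open subgroup. *)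
Lemma mot_H_fixed : @mot_H R n = [set g : Rd * 'M[R]_n.+1 | 0 < g.2 0 0] `&`
  [set g : Rd * 'M[R]_n.+1 | mot_set g /\ mot_tau g = g].
Proof.
apply/seteqP; split => [g gH|[x A] [/= A0 [gO [xE AE]]]].
  have [g0 [k kO gE]] := gH; have {}gE : g.2 = spatial_mx k := gE; split => /=.
    have := energy_spatial k (delta_mx 0 0); rewrite -gE -colE !mxE eqxx => ->.
    by rewrite ltr01.
  split; first exact: mot_H_set.
  case: g g0 gE {gH} => x A /= x0 AE; rewrite /mot_tau /= AE refl_spatial; congr pair.
  exact/refl_fixed.
split; first exact/refl_fixed.
have off i j : (i == 0) != (j == 0) -> A i j = 0.
  move=> ij; have := congr1 (fun B : 'M[R]_n.+1 => B i j) AE; rewrite refl_mxE.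
  by move: ij; case: (i == 0) => /=; case: (j == 0) => //= _; set a := A i j => h; lra.
pose k : 'M[R]_n := \matrix_(i, j) A (rshift 1 i) (rshift 1 j).
pose B : 'M[R]_(1 + n) := A.
have BE : B = block_mx (A 0 0)%:M 0 0 k.
  apply/matrixP => i j; have [a ->|a ->] := split_ordP i; have [b ->|b ->] := split_ordP j.
  - by rewrite block_mxEul !ord1 mxE eqxx; congr (A _ _); exact/val_inj.
  - by rewrite block_mxEur mxE; apply: off; rewrite !ord1.
  - by rewrite block_mxEdl mxE; apply: off; rewrite !ord1.
  - by rewrite block_mxEdr mxE.
have : B^T *m B = 1%:M by exact: gO.
rewrite BE tr_block_mx mulmx_block !trmx0 !mulmx0 !mul0mx !addr0 !add0r tr_scalar_mx.
rewrite (@scalar_mx_block R 1 n 1) => /eq_block_mx[h1 _ _ h2].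
have a1 : A 0 0 = 1.
  have := congr1 (fun B : 'M[R]_1 => B 0 0) h1; rewrite -scalar_mxM !mxE /= => h.
  by move: h A0; set a := A 0 0 => h a0; nra.
exists k => //; rewrite -a1; exact: BE.
Qed.

Lemma mot_H_open : open_fixed_subgroup (G := motions R n.+1) (@mot_tau R n) (@mot_H R n).
Proof.
split.
- exists [set g : motions R n.+1 | 0 < g.2 0 0]; last exact: mot_H_fixed.
  apply: (@open_comp _ _ (fun g : motions R n.+1 => g.2 0 0) [set y | 0 < y]); last exact: open_gt.
  move=> g _; apply: (cvg_comp snd (fun A : 'M[R]_n.+1 => A 0 0) (@cvg_snd _ _ (nbhs g.1) (nbhs g.2) (@nbhs_filter _ _))).
  exact: coord_continuous.
- rewrite mot_H_fixed; split => /=; first by rewrite mxE eqxx ltr01.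
  split; first exact: mot_set1.
  by rewrite /mot_tau /= /refl mulmx0 mulmx1 refl_mxK.
- move=> g h gH hH; split; first exact: mot_HM.
  move=> g' _ gg'; have [g'' [gH'' _ gg'']] := mot_H_inv gH.
  suff -> : g' = g'' by [].
  have : mot_mul (mot_mul g' g) g'' = g'' by move: gg' => /= ->; rewrite mot_mul1g.
  by rewrite -mot_mulA gg'' mot_mulg1.
Qed.

Lemma refl_involution : involution_on (G := translations R n.+1) (@refl R n).
Proof. by split => //; [move=> g h _ _; exact: reflD|move=> g _; exact: reflK|exact: continuous_refl]. Qed.

Lemma space_translations_open :
  open_fixed_subgroup (G := translations R n.+1) (@refl R n) (@space_translations R n).
Proof.
split.
- exists setT; first exact: openT.
  by rewrite setTI; apply/seteqP; split => [x x0|x [_ /refl_fixed]] //=; split => //; exact/refl_fixed.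
- by rewrite /space_translations /= mxE.
- move=> g h g0 h0; split; first by rewrite /space_translations /= mxE g0 h0 addr0.
  move=> g' _ /= /(congr1 (fun y : Rd => y 0 0)); rewrite /space_translations /= !mxE.
  by move: g0; rewrite /space_translations /= => ->; rewrite addr0.
Qed.

End reflections.

Section reflection_positive_representations.
Variables (R : realType) (n : nat) (rho : {measure set R -> \bar R}).
Hypothesis nu_tempered : tempered_measure (nu n rho).
Local Notation Rd := 'cV[R]_n.+1.
Local Notation C := R[i].
Local Notation nu := (nu n rho).
Local Notation E := (E_space n rho).
Local Notation half := (@half_space R n).
Local Notation rep := (@natural_rep R n.+1).

Let EP : prehilbert E := L2_prehilbert (zeta n rho).
Let NP := L2_prehilbert nu.

Lemma theta_nu_involution : unitary_involution (L2 nu) (@theta_nu R n).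
Proof.
have tK f : theta_nu (theta_nu f) = f by apply/funext => p; rewrite /theta_nu reflK.
split; last by move=> f fL; rewrite tK; exact: (heq_refl NP).
split.
- split => [f|a f g fL gL]; first exact: theta_nu_hdom.
  exact: (heq_refl NP).
- move=> f g fL gL; have tf := theta_nu_hdom fL; have tg := theta_nu_hdom gL.
  rewrite -(pullback_form tf tg) -(pullback_form fL gL) -!theta_pullback.
  exact: (theta_form (pullback_L2 fL) (pullback_L2 gL)).
- move=> f fL; exists (theta_nu f); first exact: theta_nu_hdom.
  by rewrite tK; exact: (heq_refl NP).
Qed.

Lemma F_plus_nu_closed : closed_subspace (L2 nu) (F_plus_nu rho).
Proof.
have [_ [F0 Flin] Fcl] := @F_plus_closed R n rho.
split; first by move=> f [].
  split; first by split; [exact: hdom0 NP|exact: F0].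
  move=> a f g [fL fF] [gL gF]; split; first by case: NP => -[_ +] _ _ _; apply.
  exact: Flin.
move=> f fL happ; split => //; apply: Fcl; first exact: pullback_L2.
move=> e e0; have [h [hL Fh] gh] := happ e e0; exists (pullback h) => //.
by have dL := hdomB NP fL hL; rewrite pullbackB pullback_norm.
Qed.

Lemma F_plus_nu_invariant : invariant_under (G := motions R n.+1) (L2 nu) rep (@mot_H R n) (F_plus_nu rho).
Proof.
have inv g f : mot_H g -> F_plus_nu rho f -> F_plus_nu rho (rep g f).
  move=> gH fF; split; last exact: F_plus_natural.
  by case: fF => fL _; apply: rep_hdom => //; exact: mot_H_set.
move=> g gH; split => [f|f fF]; first exact: inv.
have [h [hH _ gh]] := mot_H_inv gH; exists (rep h f); first exact: inv.
rewrite -natural_repM; [|exact: mot_H_set..].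
by rewrite gh natural_rep1; exact: (heq_refl NP).
Qed.

Lemma F_zero_nu_invariant : invariant_under (G := motions R n.+1) (L2 nu) rep (@mot_H R n) (F_zero_nu rho).
Proof.
have inv g f : mot_H g -> F_zero_nu rho f -> F_zero_nu rho (rep g f).
  move=> gH [fL [fF tf]]; have gO := mot_H_set gH; split; first exact: rep_hdom.
  split; first by apply: F_plus_natural.
  have tL := theta_nu_hdom fL.
  rewrite theta_pullback theta_nu_natural // /heq pullbackB -natural_repB.
  have dL := hdomB NP tL fL.
  rewrite (pullback_norm (rep_hdom gO dL)) (rep_norm gO dL) -(pullback_norm dL).
  by rewrite -pullbackB -theta_pullback.
move=> g gH; split => [f|f fF]; first exact: inv.
have [h [hH _ gh]] := mot_H_inv gH; exists (rep h f); first exact: inv.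
rewrite -natural_repM; [|exact: mot_H_set..].
by rewrite gh natural_rep1; exact: (heq_refl NP).
Qed.

Lemma natural_tau (g : Rd * 'M[R]_n.+1) f : mot_set g ->
  rep (mot_tau g) f = theta_nu (rep g (theta_nu f)).
Proof.
move=> gO; have tO : mot_set (mot_tau g) by exact: (@mot_tau_set R n g).
apply/funext => p; rewrite /theta_nu /natural_rep (orthogonal_inv gO) (orthogonal_inv tO) /=.
rewrite /refl dot_mulmx refl_tr !trmx_mul refl_tr; congr (_ * f _).
by rewrite !mulmxA.
Qed.

Lemma motion_reflection_positive : reflection_positive_rep (G := motions R n.+1)
  (L2 nu) rep (@mot_tau R n) (@mot_H R n) (F_plus_nu rho) (@theta_nu R n).
Proof.
have FN phi : test_function half phi -> F_plus_nu rho (fourier phi).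
  move=> tphi; split; first exact: fourier_test_L2 tphi.
  by rewrite -integrated_repE; exact: F_plus_orbit.
split.
- by split; [exact: mot_tau_involution|exact: mot_H_open].
- by split; [exact: natural_unitary_rep|exact: theta_nu_involution].
- split; first exact: F_plus_nu_closed.
  move=> f [fL fF]; have tL := theta_nu_hdom fL.
  by rewrite -(pullback_form tL fL) -theta_pullback; exact: reflection_positive.
- split; last exact: F_plus_nu_invariant.
  by move=> g f gO fL; rewrite natural_tau //; exact: (heq_refl NP).
- exists [set (fourier phi : Rd -> C^o) | phi in test_function half]; split.
  + exact: fourier_images_linear.
  + by move=> _ [phi tphi <-]; exact: fourier_smooth_vec tphi.
  + split; first by move=> _ [phi tphi <-]; exact: FN.
    move=> f [fL fF] e e0.
    have [phis tphis /cvgrPdist_lt/(_ e e0)[N _ HN]] := F_plus_seq nu_tempered fF.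
    exists (fourier (phis N)); first by exists (phis N).
    have dL := hdomB NP fL (fourier_test_L2 nu_tempered (tphis N)).
    have := HN N (leqnn N); rewrite /= sub0r normrN ger0_norm ?hnorm_ge0 //.
    by rewrite integrated_repE pullbackB pullback_norm.
  + move=> c _ [cP _] [phi tphi <-].
    have [psi tpsi dpsi] := fourier_drep nu_tempered cP tphi.
    by exists (fourier psi) => //; exists psi.
Qed.

End reflection_positive_representations.

Lemma Ck_hdom (R : realType) (G : group) (V : lmodType R[i]) (H : hspace V) k (f : G -> V) g :
  Ck H k f -> gset g -> hdom H (f g).
Proof. by case: k => [|k] [fH _ _]; exact: fH. Qed.

Section translation_representation.
Variables (R : realType) (n : nat) (rho : {measure set R -> \bar R}).
Hypothesis nu_tempered : tempered_measure (nu n rho).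
Local Notation Rd := 'cV[R]_n.+1.
Local Notation X := (R * Rd)%type.
Local Notation C := R[i].
Local Notation nu := (nu n rho).
Local Notation E := (E_space n rho).
Local Notation half := (@half_space R n).
Local Notation orbit phi := (integrated_rep phi (@one_E R n) : X -> C^o).
Local Notation rep := (@natural_rep R n.+1).
Local Notation F := (hrestr E (F_space rho)).
Local Notation T := (translations R n.+1).
Local Notation M := (motions R n.+1).

Let EP : prehilbert E := L2_prehilbert (zeta n rho).
Let NP := L2_prehilbert nu.

Let shift (x : Rd) : M := (x, 1%:M).

Let shiftO x : mot_set (shift x).
Proof. by rewrite /mot_set /orthogonal_mx /= trmx1 mulmx1. Qed.

Lemma rep_shift x (f : Rd -> C^o) : pullback (rep (shift x) f) = rep_E x (pullback f).
Proof. by apply/funext => z; rewrite /pullback /natural_rep /rep_E /= invmx1 mul1mx. Qed.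

Lemma shiftD x y : mot_mul (shift x) (shift y) = shift (x + y).
Proof. by rewrite /mot_mul /shift /= mul1mx mulmx1. Qed.

Lemma continuous_shift : continuous (shift : T -> M).
Proof.
move=> x; have h1 : id @ nbhs (x : Rd) --> (x : Rd) by exact: cvg_id.
have h2 : (fun _ : Rd => 1%:M : 'M[R]_n.+1) @ nbhs (x : Rd) --> (1%:M : 'M[R]_n.+1) by exact: cvg_cst.
exact: (cvg_pair h1 h2).
Qed.

Lemma shift_one_param (c : R -> T) : one_param c -> one_param (fun t => shift (c t)).
Proof.
move=> [cc _ cD]; split => [t|t|s t]; last by rewrite cD /= shiftD.
  exact: (cvg_comp c shift (cc t) (@continuous_shift (c t))).
exact: shiftO.
Qed.

(** On F the translations are the restriction of the action of the motions on
    [L^2(nu)], transported by the isometry [pullback]. *)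
Lemma lie_derivative_shift (c : R -> T) (H : M -> Rd -> C^o) (x : Rd) w : one_param c ->
  (forall g, mot_set g -> hdom (L2 nu) (H g)) -> hdom (L2 nu) w ->
  lie_derivative (L2 nu) (fun t => shift (c t)) H (shift x) w ->
  lie_derivative F c (fun x : T => pullback (H (shift x))) x (pullback w).
Proof.
move=> cP HL wL; rewrite /lie_derivative => cv.
apply: cvg_trans cv; apply: near_eq_cvg; near=> h.
rewrite /= shiftD; have xL := HL _ (shiftO (x + c h)); have yL := HL _ (shiftO x).
have dL := hdomB NP (hdomZ NP (h^-1)%:C (hdomB NP xL yL)) wL.
by rewrite -(pullback_norm dL).
Unshelve. all: by end_near. Qed.

Lemma Ck_shift k (H : M -> Rd -> C^o) : Ck (L2 nu) k H ->
  Ck F k (fun x : T => pullback (H (shift x))).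
Proof.
have step H' : (forall g, gset (g : M) -> hdom (L2 nu) (H' g)) ->
    (forall g, gset (g : M) -> forall e, 0 < e -> \forall g' \near g, gset (g' : M) -> hnorm (L2 nu) (H' g' - H' g) < e) ->
    (forall x, gset (x : T) -> hdom F (pullback (H' (shift x)))) /\
    (forall x, gset (x : T) -> forall e, 0 < e -> \forall x' \near x, gset (x' : T) ->
      hnorm F (pullback (H' (shift x')) - pullback (H' (shift x))) < e).
  move=> HL Hc; split => [x _|x _ e e0]; first exact: (pullback_F nu_tempered (HL _ (shiftO x))).
  have near : nbhs x (fun x' => mot_set (shift x') -> hnorm (L2 nu) (H' (shift x') - H' (shift x)) < e).
    exact: (@continuous_shift x _ (Hc _ (shiftO x) e e0)).
  apply: filterS near => x' hx' _; have {}hx' := hx' (shiftO x').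
  have dL := hdomB NP (HL _ (shiftO x')) (HL _ (shiftO x)).
  by rewrite pullbackB; have := pullback_norm dL; rewrite /hnorm => ->.
elim: k H => [|k IH] H /= [HL Hc Hd]; have [h1 h2] := step H HL Hc; split => // c cP.
have [H' H'd H'k] := Hd _ (shift_one_param cP).
exists (fun x => pullback (H' (shift x))); last exact: IH.
move=> x _; apply: lie_derivative_shift => //.
  exact: (Ck_hdom H'k (shiftO x : gset (shift x : M))).
exact: (H'd _ (shiftO x)).
Qed.

Lemma shift_orbit f : (fun x : T => pullback (rep (shift x) f)) = (fun x => rep_E x (pullback f)).
Proof. by apply/funext => x; exact: rep_shift. Qed.

Lemma orbit_smooth_vec O phi : test_function O phi ->
  smooth_vec (G := T) F (@rep_E R n) (orbit phi).
Proof.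
move=> tphi; split.
  rewrite integrated_repE; apply: pullback_F => //; exact: fourier_test_L2 tphi.
move=> k; have [_ /(_ k)/Ck_shift] := fourier_smooth_vec nu_tempered tphi.
by rewrite integrated_repE shift_orbit.
Qed.

Lemma orbit_drep (c : R -> T) O phi : one_param c -> test_function O phi ->
  exists2 psi, test_function O psi & drep (G := T) F (@rep_E R n) c (orbit phi) (orbit psi).
Proof.
move=> cP tphi; have [psi tpsi [psiL d]] := fourier_drep nu_tempered (shift_one_param cP) tphi.
exists psi => //; split.
  rewrite integrated_repE; apply: pullback_F => //; exact: fourier_test_L2 tpsi.
rewrite !integrated_repE.
have := @lie_derivative_shift c (fun g => rep g (fourier phi)) 0 (fourier psi) cP
  (fun g gO => rep_hdom gO (fourier_test_L2 nu_tempered tphi)) psiL d.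
by rewrite shift_orbit.
Qed.

Lemma F_space_rep a (v : X -> C^o) : F_space rho v -> F_space rho (rep_E a v).
Proof.
move=> /(F_spaceP nu_tempered)[vE [f fL vf]]; apply/(F_spaceP nu_tempered).
split; first exact: rep_E_hdom; exists (rep (shift a) f); first exact: rep_hdom.
have dE := hdomB EP vE (pullback_L2 fL).
by rewrite rep_shift /heq -rep_EB rep_E_norm.
Qed.

Lemma F_space_theta (v : X -> C^o) : F_space rho v -> F_space rho (theta v).
Proof.
move=> /(F_spaceP nu_tempered)[vE [f fL vf]]; apply/(F_spaceP nu_tempered).
split; first exact: theta_E; exists (theta_nu f); first exact: theta_nu_hdom.
by rewrite -theta_pullback /heq theta_normB //; exact: pullback_L2.
Qed.

Lemma F_plus_F (v : X -> C^o) : F_plus rho v -> F_space rho v.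
Proof.
apply: closed_span_min; first exact: F_space_closed.
move=> _ [phi tphi <-]; rewrite integrated_repE; apply: pullback_F => //.
exact: fourier_test_L2 tphi.
Qed.

Lemma F_hdom v : hdom F v -> hdom E v. Proof. by case. Qed.

Lemma rep_E_continuous v (x : T) : F_space rho v -> forall e, 0 < e ->
  \forall x' \near x, gset (x' : T) -> hnorm F (rep_E x' v - rep_E x v) < e.
Proof.
move=> /(F_spaceP nu_tempered)[vE [f fL vf]] e e0.
have near : nbhs x (fun x' => mot_set (shift x') -> hnorm (L2 nu) (rep (shift x') f - rep (shift x) f) < e).
  exact: (@continuous_shift x _ (natural_rep_continuous nu_tempered fL (shiftO x) e0)).
apply: filterS near => x' hx' _; have {}hx' := hx' (shiftO x').
have [r1 r2] := (rep_hdom (rho := rho) (shiftO x') fL, rep_hdom (rho := rho) (shiftO x) fL).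
have dL := hdomB NP r1 r2; have pE := pullback_L2 fL.
have heqE a : heq E (rep_E a v) (rep_E a (pullback f)).
  by have dE := hdomB EP vE pE; rewrite /heq -rep_EB rep_E_norm.
have q1 := rep_E_hdom x' vE; have q2 := rep_E_hdom x vE.
have q3 := rep_E_hdom x' pE; have q4 := rep_E_hdom x pE.
have -> : hnorm F (rep_E x' v - rep_E x v) = hnorm E (rep_E x' v - rep_E x v) by [].
rewrite (heq_distance EP q1 q2 q3 q4 (heqE x') (heqE x)) -!rep_shift pullbackB.
by rewrite (pullback_norm dL).
Qed.

Lemma translation_reflection_positive : reflection_positive_rep (G := T)
  F (@rep_E R n) (@refl R n) (@space_translations R n) (F_plus rho) (@theta R n).
Proof.
have refE v : heq F v v by rewrite /heq subrr; exact: (hnorm0 EP).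
split.
- by split; [exact: refl_involution|exact: space_translations_open].
- split.
    split.
    + move=> g _; split.
      * split => [v|a u v _ _]; first exact: F_space_rep.
        by rewrite rep_E_linear; exact: refE.
      * by move=> u v /F_hdom uE /F_hdom vE; exact: rep_E_form.
      * move=> v vF; exists (rep_E (- g) v); first exact: F_space_rep.
        by rewrite -rep_ED addrN rep_E0; exact: refE.
    + by move=> v vF; rewrite rep_E0; exact: refE.
    + by move=> g h v _ _ _; rewrite /= rep_ED; exact: refE.
    + by move=> v vF g _ e e0; exact: rep_E_continuous.
  split.
    split.
    + split => [v|a u v _ _]; first exact: F_space_theta.
      exact: refE.
    + by move=> u v /F_hdom uE /F_hdom vE; exact: theta_form.
    + by move=> v vF; exists (theta v); [exact: F_space_theta|rewrite thetaK; exact: refE].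
  by move=> v vF; rewrite thetaK; exact: refE.
- split; last by move=> v; exact: reflection_positive.
  have [_ Flin Fcl] := @F_plus_closed R n rho.
  by split => // [v|v /F_hdom vE]; [exact: F_plus_F|exact: Fcl].
- split.
    move=> g v _ _; rewrite (_ : rep_E (refl g) v = theta (rep_E g (theta v))); first exact: refE.
    apply/funext => -[t p]; rewrite /rep_E /theta /= opprK; congr (expi (- _) * _).
    by rewrite !dot_split /proj_p0 /= !energy_pt !vecpart_pt vecpart_refl energy_refl mulrN mulNr.
  move=> g g0; have Fp (a : Rd) : a 0 0 = 0 -> forall v, F_plus rho v -> F_plus rho (rep_E a v).
    by move=> a0 v; apply: F_plus_translate; rewrite // a0.
  split => [|v vF]; first exact: Fp.
  exists (rep_E (- g) v); first by apply: Fp => //; rewrite mxE g0 oppr0.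
  by rewrite -rep_ED addrN rep_E0; exact: refE.
- exists [set orbit phi | phi in test_function half]; split.
  + exact: orbits_linear.
  + by move=> _ [phi tphi <-]; exact: orbit_smooth_vec tphi.
  + split; first by move=> _ [phi tphi <-]; exact: F_plus_orbit.
    move=> v vF e e0.
    have [phis tphis /cvgrPdist_lt/(_ e e0)[N _ HN]] := F_plus_seq nu_tempered vF.
    exists (orbit (phis N)); first by exists (phis N).
    by have := HN N (leqnn N); rewrite /= sub0r normrN ger0_norm ?hnorm_ge0.
  + move=> c _ [cP _] [phi tphi <-]; have [psi tpsi dpsi] := orbit_drep cP tphi.
    by exists (orbit psi) => //; exists psi.
Qed.

End translation_representation.

Lemma cvg0_dnbhs_eq (R : realType) (x z : R -> R) : (forall h, x h = z h) ->
  x @ (0 : R)^' --> (0 : R) -> z @ (0 : R)^' --> (0 : R).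
Proof. by move=> xz; rewrite (_ : z = x) //; apply/funext => h. Qed.

(** * The distribution vector *)

Section smooth_functions.
Variables (R : realType) (G : group) (V : lmodType R[i]) (H : hspace V).
Hypothesis HP : prehilbert H.

Lemma lie_derivative_heq (c : R -> G) (F F' : G -> V) g w w' : one_param c -> gset g ->
  (forall g, gset g -> hdom H (F g)) -> (forall g, gset g -> hdom H (F' g)) ->
  hdom H w -> hdom H w' -> (forall g, gset g -> heq H (F g) (F' g)) -> heq H w w' ->
  lie_derivative H c F g w -> lie_derivative H c F' g w'.
Proof.
move=> [_ cG _] gG FH FH' wH wH' FF ww; rewrite /lie_derivative => cv.
apply: cvg_trans cv; apply: near_eq_cvg; near=> h; have gh := gsetM gG (cG h).
have h1 := FH _ gh; have h2 := FH _ gG; have h3 := FH' _ gh; have h4 := FH' _ gG.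
have d1 := hdomB HP h1 h2; have d2 := hdomB HP h3 h4.
apply: (heq_distance HP) => //; try exact: (hdomZ HP).
by apply: (heqZ HP) => //; exact: (heqB HP h1 h2 h3 h4 (FF _ gh) (FF _ gG)).
Unshelve. all: by end_near. Qed.

Lemma Ck_heq k (F F' : G -> V) : (forall g, gset g -> hdom H (F' g)) ->
  (forall g, gset g -> heq H (F g) (F' g)) -> Ck H k F -> Ck H k F'.
Proof.
move=> FH' FF Fk; have FH g := Ck_hdom Fk (g := g).
have cont : (forall g, gset g -> forall e, 0 < e ->
        \forall g' \near g, gset g' -> hnorm H (F g' - F g) < e) ->
    (forall g, gset g -> forall e, 0 < e ->
        \forall g' \near g, gset g' -> hnorm H (F' g' - F' g) < e).
  move=> Fc g gG e e0; apply: filterS (Fc g gG e e0) => g' h gG'.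
  have := h gG'; congr (_ < _).
  exact: (heq_distance HP (FH _ gG') (FH _ gG) (FH' _ gG') (FH' _ gG) (FF _ gG') (FF _ gG)).
case: k Fk => [|k] [_ Fc Fd]; split => //; try exact: cont.
move=> c cP; have [D DF Dk] := Fd c cP; exists D => // g gG.
have DH := Ck_hdom Dk gG.
exact: (lie_derivative_heq cP gG FH FH' DH DH FF (heq_refl HP _) (DF g gG)).
Qed.

Lemma hnorm_big_sum (I : Type) (s : seq I) (f : I -> V) : (forall i, hdom H (f i)) ->
  hdom H (\sum_(i <- s) f i) /\ hnorm H (\sum_(i <- s) f i) <= \sum_(i <- s) hnorm H (f i).
Proof.
move=> fH; elim: s => [|i s [IH1 IH2]].
  by rewrite !big_nil (hnorm0 HP); split => //; exact: hdom0 HP.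
rewrite !big_cons; split; first exact: (hdomD HP).
by apply: le_trans (hnormD HP (fH i) IH1) _; rewrite lerD2l.
Qed.

End smooth_functions.

Section distribution_vector.
Variables (R : realType) (n : nat) (rho : {measure set R -> \bar R}).
Hypothesis nu_tempered : tempered_measure (nu n rho).
Local Notation Rd := 'cV[R]_n.+1.
Local Notation X := (R * Rd)%type.
Local Notation C := R[i].
Local Notation zeta := (zeta n rho).
Local Notation E := (E_space n rho).
Local Notation T := (translations R n.+1).
Local Notation axisT i := (@axis R n i : R -> T).
Local Notation smooth := (smooth_vec (G := T) E (@rep_E R n)).

Let EP : prehilbert E := L2_prehilbert zeta.

Lemma axis_one_param (i : 'I_n.+1) : one_param (axisT i).
Proof.
split => [t|//|s t]; last exact: scalerDl.
apply: (@cvg_mx _ _ (nbhs t) (nbhs_filter t)) => j k; rewrite /axis mxE.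
by under eq_fun do rewrite mxE; apply: cvgM; [exact: cvg_id|exact: cvg_cst].
Qed.

(** The derivative of the translations in the direction of the [i]-th axis *)
Definition momentum (i : 'I_n.+1) (f : X -> C^o) : X -> C^o :=
  fun z => (0 +i* (- proj_p0 z i 0)) * f z.

Lemma cmeasurable_momentum i f : cmeasurable f -> cmeasurable (momentum i f).
Proof.
move=> mf; apply: cmeasurableM => //; split => /=; first exact: measurable_cst.
by apply: measurable_funN; exact: measurableT_comp (@measurable_coord R n.+1 i) (@measurable_proj R n).
Qed.

(** A limit in norm of difference quotients agrees with their pointwise
    limit, which by Fatou is square integrable. *)
Lemma lie_derivative_momentum i f w : hdom E f -> hdom E w ->
  lie_derivative E (axisT i) (fun g : T => rep_E g f) 0 w ->
  hdom E (momentum i f) /\ heq E w (momentum i f).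
Proof.
move=> fE wE lie; pose t k : R := k.+1%:R^-1.
have t0 : t @ \oo --> (0 : R) by exact: cvg_harmonic.
have tn k : t k != 0 by rewrite invr_eq0 pnatr_eq0.
pose fs k : X -> C^o := ((t k)^-1)%:C *: (rep_E (@axis R n i (t k)) f - f) - w.
have fsE k : hdom E (fs k).
  by have := hdomB EP (hdomZ EP ((t k)^-1)%:C (hdomB EP (rep_E_hdom (@axis R n i (t k)) fE) fE)) wE.
have fs0 : hnorm E (fs k) @[k --> \oo] --> (0 : R).
  have := cvg_comp t _ (@cvg_harmonic_dnbhs R) lie; apply: cvg0_eq => k.
  by rewrite /= add0r rep_E0.
have mw : cmeasurable (fun z => momentum i f z - w z).
  by apply: cmeasurableB; [apply: cmeasurable_momentum; case: fE|case: wE].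
have pw z : cmod (fs k z - (momentum i f z - w z)) @[k --> \oo] --> (0 : R).
  have ak : ((- dot (@axis R n i (t k)) (proj_p0 z) - 0) / t k) @[k --> \oo] --> - proj_p0 z i 0.
    rewrite (_ : (fun k => _) = (fun=> - proj_p0 z i 0)); first exact: cvg_cst.
    by apply/funext => k; rewrite dot_axis subr0 -mulrN mulrC mulKf.
  have := cmod_cvgM (expi_quotient t0 tn ak) (@cmod_cvg_cst R (f z)).
  apply: cvg0_eq => k; rewrite expi0 mulr1; congr cmod.
  have -> : fs k z = ((t k)^-1)%:C * (rep_E (@axis R n i (t k)) f z - f z) - w z by [].
  rewrite /rep_E /momentum; set a := expi _; set b := f z; set c := w z; set q := _ +i* _; ring.
have key e : 0 < e -> hdom E (momentum i f - w) /\ hnorm E (momentum i f - w) <= e.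
  move=> e0; move/cvgrPdist_lt: fs0 => /(_ e e0)[N _ HN].
  apply: (@L2_fatou _ _ _ zeta (fun k => fs (k + N)%N)).
  - by move=> k.
  - exact: mw.
  - move=> k; have := HN (k + N)%N (leq_addl _ _).
    by rewrite /= sub0r normrN ger0_norm ?hnorm_ge0 //; exact: ltW.
  - apply: aeW => z; have := pw z.
    by rewrite -(@cvg_shiftn N _ (fun k => cmod (fs k z - (momentum i f z - w z)))).
have [dE _] := key 1 ltr01.
have mE : hdom E (momentum i f) by have := hdomD EP dE wE; rewrite subrK.
split => //; apply: (heq_sym EP mE wE); apply: small_eq0; first exact: hnorm_ge0.
by move=> e /key[].
Qed.

Lemma rep_momentum i g f : rep_E g (momentum i f) = momentum i (rep_E g f).
Proof. by apply/funext => z; rewrite /rep_E /momentum mulrCA. Qed.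

Lemma smooth_momentum i f : smooth f -> smooth (momentum i f) /\
  drep (G := T) E (@rep_E R n) (axisT i) f (momentum i f).
Proof.
move=> [fE fC].
have key (D : T -> X -> C^o) : (forall g, hdom E (D g)) ->
    (forall g, gset (g : T) -> lie_derivative E (axisT i) (fun g : T => rep_E g f) g (D g)) ->
    forall g, hdom E (rep_E g (momentum i f)) /\ heq E (D g) (rep_E g (momentum i f)).
  move=> DE DL g; rewrite rep_momentum; apply: lie_derivative_momentum => //.
    exact: rep_E_hdom.
  have := DL g Logic.I; rewrite /lie_derivative; apply: cvg0_dnbhs_eq => h.
  by rewrite /= add0r rep_E0 -rep_ED [g + _]addrC.
have dk k : exists2 D : T -> X -> C^o, (forall g, gset (g : T) ->
    lie_derivative E (axisT i) (fun g : T => rep_E g f) g (D g)) & Ck E k D.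
  by have [_ _] := fC k.+1; apply; exact: axis_one_param.
have mE : hdom E (momentum i f).
  have [D DL Dk] := dk 0%N; have [] := key D (fun g => Ck_hdom Dk (Logic.I : gset (g : T))) DL 0.
  by rewrite rep_E0.
split.
  split => // k; have [D DL Dk] := dk k.
  have h := key D (fun g => Ck_hdom Dk (Logic.I : gset (g : T))) DL.
  by apply: (Ck_heq EP _ _ Dk) => g _; case: (h g).
split => //; have [D DL Dk] := dk 0%N.
have DE g : hdom E (D g) := Ck_hdom Dk (Logic.I : gset (g : T)).
have [_ heqD] := key D DE DL 0; rewrite rep_E0 in heqD.
have fg g : gset (g : T) -> hdom E (rep_E g f) by move=> _; exact: rep_E_hdom.
apply: (lie_derivative_heq EP (axis_one_param i) _ fg fg (DE 0) mE _ heqD (DL 0 _)) => //.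
by move=> g _; exact: (heq_refl EP).
Qed.

(** The words of directions whose momenta multiply [f] by [p_i^(2 M)], up to sign;
    word 0 is empty. Together these factors dominate [japanese p ^+ M], up to a
    constant. *)
Definition word (M j : nat) : seq (R -> T) :=
  if j is j'.+1 then nseq (2 * M) (axisT (inord j')) else [::].

Definition word_vector (M j : nat) (f : X -> C^o) : X -> C^o :=
  if j is j'.+1 then iter (2 * M) (momentum (inord j')) f else f.

Lemma smooth_word M j f : smooth f -> smooth (word_vector M j f) /\
  drep_word (G := T) E (@rep_E R n) (word M j) f (word_vector M j f).
Proof.
move=> fS; case: j => [//|j] /=; elim: (2 * M)%N => [//|m [IH1 IH2]] /=.
have [h1 h2] := smooth_momentum (inord j) IH1; split => //.
by exists (iter m (momentum (inord j)) f).
Qed.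

Lemma cmod_word M j f z : cmod (word_vector M j f z) =
  (if j is j'.+1 then (proj_p0 z (inord j') 0 ^+ 2) ^+ M else 1) * cmod (f z).
Proof.
case: j => [|j] /=; first by rewrite mul1r.
rewrite -exprM -[_ ^+ (2 * M)]ger0_norm ?exprn_even_ge0 ?oddM // normrX.
elim: (2 * M)%N => [|m IH] /=; first by rewrite expr0 mul1r.
rewrite {1}/momentum cmodM IH mulrA exprS; congr (_ * _ * _).
by rewrite /cmod /= expr0n add0r sqrrN sqrtr_sqr.
Qed.

Definition decay_weight (M : nat) : X -> C^o := fun z => ((japanese (proj_p0 z) ^+ M)^-1)%:C.

Lemma cmod_le_words M f z : cmod (f z) <=
  n.+2%:R ^+ M * ((japanese (proj_p0 z) ^+ M)^-1 * \sum_(j < n.+2) cmod (word_vector M j f z)).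
Proof.
set p := proj_p0 z; have j0 := japanese_gt0 p; set D : R := n.+2%:R.
have term (j : 'I_n.+2) : cmod (word_vector M j f z) <= \sum_(j < n.+2) cmod (word_vector M j f z).
  by rewrite (bigD1 j) //= lerDl sumr_ge0 // => k _; exact: cmod_ge0.
have main (j : 'I_n.+2) : japanese p ^+ M * cmod (f z) <= D ^+ M * cmod (word_vector M j f z) ->
    cmod (f z) <= D ^+ M * ((japanese p ^+ M)^-1 * \sum_(j < n.+2) cmod (word_vector M j f z)).
  move=> h; rewrite mulrCA -ler_pdivrMl ?invr_gt0 ?exprn_gt0 // invrK.
  by apply: le_trans h _; rewrite ler_wpM2l ?exprn_ge0 // ler0n.
have [h|[i h]] := japanese_le_some_coord p.
  apply: (main ord0); rewrite cmod_word /= mul1r ler_wpM2r ?cmod_ge0 //.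
  by apply: lerXn2r => //; rewrite nnegrE ?ltW // ler0n.
have ilt : (i.+1 < n.+2)%N by rewrite ltnS.
apply: (main (Ordinal ilt)); rewrite cmod_word /= inord_val mulrA ler_wpM2r ?cmod_ge0 //.
rewrite -exprMn; apply: lerXn2r; rewrite ?nnegrE ?(ltW j0) //.
by rewrite mulr_ge0 ?sqr_ge0 ?ler0n.
Qed.

(** Write [f] as [japanese^(-M)], square integrable for large [M], times
    [japanese^M f], which is controlled by the norms of [f] and of
    [p_i^(2 M) f], and apply the Cauchy-Schwarz inequality. *)
Lemma smooth_vector_bound : exists M : nat, exists2 K : R, 0 <= K & forall f, smooth f ->
  cintegrable zeta (fun z => @one_E R n z * conjc (f z)) /\
  cmod (functional_of rho (@one_E R n) f) <= K * \sum_(j < n.+2) hnorm E (word_vector M j f).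
Proof.
have [M iM] := japanese_sqr_integrable nu_tempered; exists M.
have kE : hdom E (decay_weight M).
  apply: (@pullback_L2 R n rho (fun p => ((japanese p ^+ M)^-1)%:C)).
  apply: (hdom_L2_le _ iM); first by apply: cmeasurable_real; exact: measurable_japaneseVX.
  by apply: aeW => p; rewrite -sqr_cmod cmodR real_normK ?num_real.
exists (n.+2%:R ^+ M * hnorm E (decay_weight M)); first by rewrite mulr_ge0 ?hnorm_ge0 ?exprn_ge0 ?ler0n.
move=> f fS; have [fE _] := fS.
pose g (j : 'I_n.+2) : X -> C^o := fun z => (cmod (word_vector M j f z))%:C.
have wE (j : 'I_n.+2) : hdom E (word_vector M j f) by case: (smooth_word M j fS) => -[].
have gE j : hdom E (g j).
  apply: (hdom_L2_le _ (L2_sqmod (wE j))).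
    by apply: cmeasurable_real; apply: measurable_cmod; case: (wE j).
  by apply: aeW => z; rewrite -!sqr_cmod cmodR ger0_norm // cmod_ge0.
have gn j : hnorm E (g j) = hnorm E (word_vector M j f).
  by apply: (L2_norm_eq (gE j) (wE j)); apply: aeW => z; rewrite cmodR ger0_norm // cmod_ge0.
have [sE sn] := hnorm_big_sum EP (index_enum _) gE.
set S := \sum_j _ in sE sn.
have SE z : S z = (\sum_(j < n.+2) cmod (word_vector M j f z))%:C.
  by rewrite /S fct_sumE /= rmorph_sum.
pose h z : R := (japanese (proj_p0 z) ^+ M)^-1 * \sum_(j < n.+2) cmod (word_vector M j f z).
have hE z : decay_weight M z * conjc (S z) = (h z)%:C.
  by rewrite SE /decay_weight /h rmorphM; congr (_ * _); apply: complex_eqP; rewrite /= ?oppr0.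
have hi : zeta.-integrable setT (EFin \o h).
  have [ir _] := L2_mul_integrable kE sE; congr (integrable _ _ _): ir.
  by apply/funext => z; rewrite /= hE.
have hv : Rintegral zeta setT h <= hnorm E (decay_weight M) * \sum_(j < n.+2) hnorm E (word_vector M j f).
  have -> : Rintegral zeta setT h = complex.Re (hform E (decay_weight M) S).
    by rewrite /hform /=; congr (fine _); apply: eq_integral => z _; rewrite hE.
  apply: le_trans (ler_norm _) _; apply: le_trans (Re_le_cmod _) _.
  apply: le_trans (hcauchy_schwarz EP kE sE) _; rewrite ler_wpM2l ?hnorm_ge0 //.
  by apply: le_trans sn _; apply: eqR_le; apply: eq_bigr => j _.
have bound z : cmod (@one_E R n z * conjc (f z)) <= n.+2%:R ^+ M * h z.
  by rewrite /one_E mul1r cmodJ; exact: cmod_le_words.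
have mf : cmeasurable (fun z => @one_E R n z * conjc (f z)).
  by apply: cmeasurableM; [exact: cmeasurable_cst|apply: cmeasurableJ; case: fE].
have fi := cintegrable_le mf (integrable_scale (n.+2%:R ^+ M) hi) bound.
split => //; apply: le_trans (cmod_cintegral fi) _; rewrite -mulrA.
apply: (@le_trans _ _ (Rintegral zeta setT (fun z => n.+2%:R ^+ M * h z))).
  apply: le_Rintegral => //; first exact: cintegrable_cmod.
  exact: integrable_scale.
by rewrite RintegralZl // ler_wpM2l // exprn_ge0 // ler0n.
Qed.

Lemma smooth_integrable f : smooth f -> cintegrable zeta (fun z => @one_E R n z * conjc (f z)).
Proof. by have [M [K _ HK]] := smooth_vector_bound; case/HK. Qed.

Lemma one_distribution_vector :
  distribution_vector (G := T) E (@rep_E R n) (functional_of rho (@one_E R n)).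
Proof.
split.
  move=> a u v uS vS; rewrite /functional_of.
  have ui := smooth_integrable uS; have vi := smooth_integrable vS.
  rewrite -cintegralZ // -cintegralD //; last exact: cintegrableZ.
  apply: eq_cintegral => z; rewrite /one_E !mul1r.
  have -> : (a *: u + v) z = a * u z + v z by [].
  by rewrite rmorphD rmorphM.
have [M [K K0 HK]] := smooth_vector_bound.
move=> e e0; exists n.+2, (word M); split.
  move=> j i; case: j => [//|j] /=; rewrite size_nseq => im.
  by rewrite nth_nseq im; exact: axis_one_param.
have K1 : 0 < K + 1 by rewrite ltr_wpDl.
exists (e / ((K + 1) * n.+2%:R)); first by rewrite divr_gt0 // mulr_gt0.
move=> v vS hw; rewrite Re_norm; have [_ hb] := HK v vS.
apply: le_lt_trans hb _; set r := e / _ in hw.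
have r0 : 0 < r by rewrite divr_gt0 // mulr_gt0.
have sr : \sum_(j < n.+2) hnorm E (word_vector M j v) <= n.+2%:R * r.
  apply: (@le_trans _ _ (\sum_(j < n.+2) r)); last by rewrite sumr_const card_ord mulr_natl.
  by apply: ler_sum => j _; apply: ltW; apply: (hw j) => //; case: (smooth_word M j vS).
apply: le_lt_trans (ler_wpM2l K0 sr) _.
have -> : e = (K + 1) * (n.+2%:R * r) by rewrite /r; field; rewrite !gt_eqF ?ltr0n.
have : 0 < n.+2%:R * r by rewrite mulr_gt0 // ltr0n.
by set w := n.+2%:R * r => w0; lra.
Qed.

Lemma one_theta_invariant f : smooth f ->
  functional_of rho (@one_E R n) (theta f) = functional_of rho (@one_E R n) f.
Proof.
move=> [[mf _] _]; rewrite /functional_of.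
rewrite -[RHS](cintegral_preserving (@measurable_time_refl R n) (@zeta_time_refl R n rho)) //.
by apply: cmeasurableM; [exact: cmeasurable_cst|exact: cmeasurableJ].
Qed.

End distribution_vector.

(** * The Fourier transform of the spectral measure *)

Section spectral_distribution.
Variables (R : realType) (n : nat) (rho : {measure set R -> \bar R}).
Hypothesis nu_tempered : tempered_measure (nu n rho).
Local Notation Rd := 'cV[R]_n.+1.
Local Notation X := (R * Rd)%type.
Local Notation C := R[i].
Local Notation nu := (nu n rho).
Local Notation E := (E_space n rho).
Local Notation orbit phi := (integrated_rep phi (@one_E R n) : X -> C^o).

Let NP := L2_prehilbert nu.
Let MP := L2_prehilbert (mu n rho).

Lemma fourier_measure_tempered : tempered_distribution (fourier_measure nu).
Proof.
split.
  move=> a f g sf sg; have fi := fourier_integrable nu_tempered sf.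
  have gi := fourier_integrable nu_tempered sg.
  rewrite /fourier_measure -cintegralZ // -cintegralD //; last exact: cintegrableZ.
  by apply: eq_cintegral => p; apply: fourier_linear; exact: schwartz_integrable.
have [M iM] := nu_tempered; have [K K0 HK] := fourier_decay R n.+1 M.
pose I := Rintegral nu setT (fun p => (japanese p ^+ M)^-1).
have I0 : 0 <= I.
  by apply: Rintegral_ge0 => p _; exact: japaneseVX_ge0.
have KI : 0 < K * I + 1 by rewrite ltr_wpDl // mulr_ge0.
move=> e e0; exists (maxn (2 * M) n.+1); exists (e / (K * I + 1)); first by rewrite divr_gt0.
set r := e / _ => f sf hf; rewrite Re_norm; have r0 : 0 < r by rewrite divr_gt0.
have fd p : cmod (fourier f p) <= K * r * (japanese p ^+ M)^-1.
  apply: HK => // s x sw.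
  have ss : (size s <= maxn (2 * M) n.+1)%N.
    move: sw; rewrite /axis_words inE => /orP[/eqP ->//|/mapP[i _ ->]].
    by rewrite size_nseq leq_maxl.
  have [h1 h2] := hf s x ss.
  have jl : japanese x ^+ n.+1 <= japanese x ^+ (maxn (2 * M) n.+1).
    by rewrite ler_weXn2l ?japanese_ge1 // leq_maxr.
  by split; [apply: le_trans (ltW h1)|apply: le_trans (ltW h2)]; rewrite ler_wpM2r.
have fi := fourier_integrable nu_tempered sf.
apply: le_lt_trans (cmod_cintegral fi) _.
apply: (@le_lt_trans _ _ (K * r * I)).
  rewrite /I -RintegralZl //; apply: le_Rintegral => //; first exact: cintegrable_cmod.
  exact: integrable_scale.
have -> : e = r * (K * I + 1) by rewrite /r divfK // gt_eqF.
by rewrite mulrDr mulr1 [r * _]mulrA [r * K]mulrC ltrDl.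
Qed.

Lemma fourier_measure_functional phi : schwartz phi ->
  fourier_measure nu phi = conjc (functional_of rho (@one_E R n) (orbit phi)).
Proof.
move=> sphi; have mf := measurable_fourier sphi; have fi := fourier_integrable nu_tempered sphi.
rewrite /fourier_measure /functional_of -[LHS](cintegral_preserving (@measurable_proj R n) (@nu_proj R n rho)) //.
have oi := cintegrable_preserving (@measurable_proj R n) (@nu_proj R n rho) fi.
rewrite integrated_repE -cintegralJ; last by apply: cintegrableZ; exact: cintegrableJ.
by apply: eq_cintegral => z; rewrite /one_E mul1r conjcK.
Qed.

Lemma test_conj_inv (O O' : set Rd) phi : (forall x, O x -> O' (- x)) ->
  test_function O phi -> test_function O' (conj_inv phi).
Proof.
move=> OO' tphi.
have [[sr si] [K [cK KO K0]]] : test_function O' (fun x => phi ((- 1%:M) *m x + 0)).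
  apply: (test_affine (B := - 1%:M) _ _ tphi); first by rewrite mulNmx mul1mx opprK.
  by move=> x Ox; rewrite subr0 mulNmx mul1mx; exact: OO'.
have E x : (- 1%:M) *m x + 0 = - x :> Rd by rewrite addr0 mulNmx mul1mx.
have sE : (fun x : Rd => phi ((- 1%:M) *m x + 0)) = (fun x => phi (- x)) by apply/funext => x; rewrite E.
split; last by exists K; split => // x /K0; rewrite E /conj_inv => ->; rewrite conjc0.
have rE : (fun x => Re (conj_inv phi x)) = (fun x => Re (phi ((- 1%:M) *m x + 0))).
  by apply/funext => x; rewrite /conj_inv cReJ E.
split; first by rewrite rE.
have := smooth_scale (-1) si.
by rewrite (_ : (fun x => _) = (fun x => Im (conj_inv phi x))) //; apply/funext => x; rewrite /conj_inv cImJ E mulN1r.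
Qed.

Lemma fourier_refl phi (p : Rd) : schwartz phi -> fourier (fun x => phi (refl x)) p = fourier phi (refl p).
Proof.
by move=> sphi; apply: fourier_orthogonal; [exact: refl_orthogonal|apply: smooth_cmeasurable; case: sphi].
Qed.

Lemma fourier_measure_orthogonal (g : 'M[R]_n.+1) f : g^T *m g = 1%:M -> schwartz f ->
  fourier_measure nu (fun x => f (g *m x)) = fourier_measure nu f.
Proof.
move=> gO sf; rewrite /fourier_measure.
rewrite -[RHS](cintegral_preserving (measurable_cV_mulmx g) (fun A => nu_orthogonal rho gO)); last exact: measurable_fourier.
by apply: eq_cintegral => p; apply: fourier_orthogonal => //; apply: smooth_cmeasurable; case: sf.
Qed.

(** By the convolution theorem, both positivity conditions become statements on
    the Fourier transform: it is square integrable for [nu], and reflection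
    positive in the sense of the orbit vectors. *)
Lemma fourier_measure_reflection_positive :
  reflection_positive_distribution (fourier_measure nu).
Proof.
split.
- move=> f tf; have sf := test_schwartz tf.
  have sc : schwartz (conj_inv f) by apply: test_schwartz (test_conj_inv (O' := setT) _ tf).
  have fL := fourier_L2 nu_tempered sf.
  have -> : fourier_measure nu (convolution (conj_inv f) f) = hform (L2 nu) (fourier f) (fourier f).
    apply: eq_cintegral => p; rewrite fourier_convolution // mulrC fourier_conj_inv //.
    exact: schwartz_integrable.
  exact: (hform_ge0 NP fL).
- by move=> f sf; apply: fourier_measure_orthogonal => //; exact: refl_orthogonal.
- move=> f tf; have sf := test_schwartz tf.
  have tc : test_function setT (conj_inv f) by exact: (test_conj_inv (O' := setT) _ tf).
  have sc := test_schwartz tc.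
  have sr : schwartz (fun x => conj_inv f (refl x)).
    apply: (@test_schwartz _ _ setT).
    rewrite (_ : (fun x => _) = (fun x => conj_inv f (refl_mx R n *m x + 0))).
      exact: (test_affine (refl_mxK R n) _ tc).
    by apply/funext => x; rewrite addr0.
  have fL := fourier_L2 nu_tempered sf; have tL := theta_nu_hdom fL.
  have -> : fourier_measure nu (convolution (fun x => conj_inv f (refl x)) f) =
      hform (L2 nu) (fourier f) (theta_nu (fourier f)).
    apply: eq_cintegral => p; rewrite fourier_convolution // mulrC fourier_refl //.
    by rewrite fourier_conj_inv //; exact: schwartz_integrable.
  rewrite (hform_conj NP tL fL) -(pullback_form tL fL) -theta_pullback -integrated_repE.
  have lL := laplace_L2 nu_tempered tf.
  rewrite (reflected_form nu_tempered tf tf) -(hform_conj MP lL lL).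
  exact: (hform_ge0 MP lL).
Qed.

End spectral_distribution.

Theorem theorem5p16 (R : realType) (n : nat)
    (rho : {measure set R -> \bar R})
    (rho_supp : rho [set m | m < 0] = 0%E)
    (rho_zero : n = 0%N -> rho [set 0] = 0%E)
    (mu_lorentz : lorentz_invariant (mu n rho))
    (mu_radon : radon (mu n rho))
    (mu_zero : mu n rho [set 0] = 0%E)
    (nu_tempered : tempered_measure (nu n rho)) :
  (* 1 is a reflection positive distribution vector *)
  [/\ forall f, smooth_vec (G := translations R n.+1) (E_space n rho) (@rep_E R n) f ->
        cintegrable (zeta n rho) (fun z => one_E z * conjc (f z)),
      distribution_vector (G := translations R n.+1) (E_space n rho) (@rep_E R n)
        (functional_of rho (@one_E R n)),
      forall f, smooth_vec (G := translations R n.+1) (E_space n rho) (@rep_E R n) f ->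
        functional_of rho (@one_E R n) (theta f) =
        functional_of rho (@one_E R n) f,
      forall phi, test_function setT phi ->
        hdom (E_space n rho) (integrated_rep phi (@one_E R n)) &
      forall v, F_plus rho v -> 0 <= hform (E_space n rho) (theta v) v] /\
  (* the reflection positive representation of R^d on F *)
  reflection_positive_rep (G := translations R n.+1)
    (hrestr (E_space n rho) (F_space rho)) (@rep_E R n) (@refl R n)
    (@space_translations R n) (F_plus rho) (@theta R n) /\
  (* the corresponding distribution *)
  [/\ forall phi, schwartz phi -> cintegrable (nu n rho) (fourier phi),
      tempered_distribution (fourier_measure (nu n rho)),
      forall phi, test_function setT phi ->
        fourier_measure (nu n rho) phi =
        conjc (functional_of rho (@one_E R n) (integrated_rep phi (@one_E R n))),
      reflection_positive_distribution (fourier_measure (nu n rho)) &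
      rotation_invariant (fourier_measure (nu n rho))] /\
  (* the reflection positive representation of Mot(R^d) on F = L^2(R^d, nu) *)
  [/\ forall v, F_space rho v <->
        hdom (E_space n rho) v /\
        exists2 f, hdom (L2 (nu n rho)) f & heq (E_space n rho) v (pullback f),
      reflection_positive_rep (G := motions R n.+1)
        (L2 (nu n rho)) (@natural_rep R n.+1) (@mot_tau R n)
        (@mot_H R n) (F_plus_nu rho) (@theta_nu R n),
      invariant_under (G := motions R n.+1)
        (L2 (nu n rho)) (@natural_rep R n.+1) (@mot_H R n) (F_plus_nu rho) &
      invariant_under (G := motions R n.+1)
        (L2 (nu n rho)) (@natural_rep R n.+1) (@mot_H R n) (F_zero_nu rho)] /\
  (* the identification of the completion of F_+ with L^2(V_+, mu) *)
  exists U : (nat -> (R * 'cV[R]_n.+1 -> R[i]^o)) -> 'cV[R]_n.+1 -> R[i]^o,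
  [/\ unitary (F_hat n rho) (L2 (mu n rho)) U,
      forall g f, mot_H g -> F_plus_nu rho f ->
        heq (L2 (mu n rho))
          (U (q_map (pullback (natural_rep g f))))
          (natural_rep g (U (q_map (pullback f)))),
      forall t v, 0 < t -> hdom (F_hat n rho) v ->
        hdom (F_hat n rho) (hat_op (rep_E (pt t 0)) v) /\
        heq (L2 (mu n rho))
          (U (hat_op (rep_E (pt t 0)) v)) (decay_op t (U v)) &
      analytic_continuation (L2 (mu n rho))
        (fun t => natural_rep (pt t 0, 1%:M)) (@decay_op R n)].
Proof.
split; [split|split; [|split; [split|split; [split|]]]].
- by move=> f; exact: smooth_integrable.
- exact: one_distribution_vector.
- by move=> f; exact: one_theta_invariant.
- by move=> phi tphi; apply: orbit_E => //; exact: test_schwartz tphi.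
- by move=> v; exact: reflection_positive.
- exact: translation_reflection_positive.
- by move=> phi; exact: fourier_integrable.
- exact: fourier_measure_tempered.
- by move=> phi tphi; apply: fourier_measure_functional => //; exact: test_schwartz tphi.
- exact: fourier_measure_reflection_positive.
- by move=> g f gO sf; exact: fourier_measure_orthogonal.
- by move=> v; exact: F_spaceP.
- exact: motion_reflection_positive.
- exact: F_plus_nu_invariant.
- exact: F_zero_nu_invariant.
exists (identification rho); split.
- exact: identification_unitary.
- by move=> g f; exact: identification_natural.
- move=> t v t0 vF; split; last exact: identification_decay.
  by apply: hat_translate => //; rewrite energy_pt ltW.
- exact: natural_analytic_continuation.
Qed.
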